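(* Let $A>0$. On a suitable probability space, for each $N\ge1$ there is a decomposition $$\log\zeta_{N,\mathrm{rand}}(1/2+ix)=\mathcal{G}_N(x)+\mathcal{E}_N(x),\qquad x\in[-A,A],$$ where $\mathcal{G}_N$ is a Gaussian process on $[-A,A]$ which can be written as $$\mathcal{G}_N(x)=\sum_{k=1}^N\frac{1}{\sqrt{2p_k}}\,p_k^{-ix}\,(W_k^{(1)}+iW_k^{(2)}),$$ with $(W_k^{(j)})_{k\ge1,\,j\in\{1,2\}}$ i.i.d. standard (real) Gaussians not depending on $N$. The function $\mathcal{E}_N$ is smooth and, as $N\to\infty$, it almost surely converges uniformly to a random smooth function $\mathcal{E}\in C^\infty[-A,A]$. Moreover, the maximal error and its derivatives have finite exponential moments: $$\mathbb{E}\exp\Big(\lambda\sup_{N\ge1}\|\mathcal{E}_N\|_{C^\ell[-A,A]}\Big)<\infty\quad\text{for all }\lambda>0\text{ and all integers }\ell\ge0.$$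
   Context: $p_k$ is the $k$-th prime, $\theta_1,\theta_2,\dots$ are i.i.d. uniform on $[0,1]$, and $\zeta_{N,\mathrm{rand}}(s)=\prod_{k=1}^N(1-p_k^{-s}e^{2\pi i\theta_k})^{-1}$. The logarithm is $\log\zeta_{N,\mathrm{rand}}(1/2+ix)=\sum_{k=1}^N\sum_{j=1}^\infty\frac1j e^{2\pi ij\theta_k}p_k^{-j(1/2+ix)}$. $\|f\|_{C^\ell[-A,A]}=\sum_{j=0}^\ell\|f^{(j)}\|_{L^\infty[-A,A]}$. ''Suitable probability space'' means that the sequences $(\theta_k)$ and $(W_k^{(j)})$ are defined jointly (coupled) on one probability space. *)

(* Defs.v *)
From HB Require Import structures.
From mathcomp Require Import all_boot all_order all_algebra.
From mathcomp Require Import all_classical all_reals all_analysis.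
From mathcomp Require Import measurable_realfun.
From mathcomp Require Import complex.

Set Implicit Arguments.
Unset Strict Implicit.
Unset Printing Implicit Defensive.

Import Order.TTheory GRing.Theory Num.Theory.
Import numFieldNormedType.Exports.

Local Open Scope classical_set_scope.
Local Open Scope ring_scope.
Local Open Scope complex_scope.

Local Notation Re := complex.Re.
Local Notation Im := complex.Im.

(* Sequences indexed by k >= 1 are indexed here from 0: [nth_prime k] is
   p_(k+1), with [nth_prime 0 = 2], and similarly for theta and W. *)

Lemma exists_next_prime (m : nat) : exists p, prime p && (m < p)%N.
Proof. by have [p mp pp] := prime_above m; exists p; rewrite pp mp. Qed.

Definition next_prime (m : nat) : nat := ex_minn (exists_next_prime m).

Definition nth_prime (k : nat) : nat := iter k next_prime 2%N.

(* mathcomp.analysis has no topology on R[i]; limits and derivatives of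
   complex-valued sequences and functions of a real variable are taken on real
   and imaginary parts. *)

Definition cexp (R : realType) (z : R[i]) : R[i] :=
  (expR (Re z) * cos (Im z)) +i* (expR (Re z) * sin (Im z)).

Definition npowc (R : realType) (n : nat) (s : R[i]) : R[i] :=
  cexp (s * (ln n%:R)%:C).

Definition cseries (R : realType) (u : nat -> R[i]) : R[i] :=
  limn (series (fun n => Re (u n))) +i* limn (series (fun n => Im (u n))).

(* log zeta_{N,rand}(1/2 + i x) as a function of t = (theta_k)_k; the inner sum
   over j >= 1 is indexed by j.+1. *)
Definition log_zeta_rand (R : realType) (t : nat -> R) (N : nat) (x : R)
    : R[i] :=
  \sum_(k < N) cseries (fun j =>
    (j.+1)%:R^-1 * cexp (0 +i* (2 * pi * (j.+1)%:R * t k))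
    * npowc (nth_prime k) (- ((j.+1)%:R * (2^-1 +i* x)))).

Definition gauss_sum (R : realType) (W : nat * 'I_2 -> R) (N : nat) (x : R)
    : R[i] :=
  \sum_(k < N) ((Num.sqrt (2 * (nth_prime k)%:R))^-1)%:C
    * npowc (nth_prime k) (0 +i* (- x))
    * (W (val k, ord0) +i* W (val k, ord_max)).

(* Derivatives relative to a set S (one-sided at the endpoints of a segment). *)

Definition diff_quot (R : realType) (f : R -> R) (x y : R) : R :=
  (f y - f x) / (y - x).

Definition derive_within (R : realType) (S : set R) (f : R -> R) (x : R) : R :=
  lim (diff_quot f x @ within S x^').

Definition derive_within_n (R : realType) (S : set R) (n : nat) (f : R -> R)
    : R -> R := iter n (derive_within S) f.

Definition smooth_within (R : realType) (S : set R) (f : R -> R) : Prop :=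
  forall (n : nat) (x : R), S x ->
    cvg (diff_quot (derive_within_n S n f) x @ within S x^').

Definition cderive_within_n (R : realType) (S : set R) (n : nat)
    (f : R -> R[i]) (x : R) : R[i] :=
  derive_within_n S n (fun y => Re (f y)) x
  +i* derive_within_n S n (fun y => Im (f y)) x.

Definition csmooth_within (R : realType) (S : set R) (f : R -> R[i]) : Prop :=
  smooth_within S (fun y => Re (f y)) /\ smooth_within S (fun y => Im (f y)).

Definition cuniform_cvg (R : realType) (S : set R) (f : nat -> R -> R[i])
    (g : R -> R[i]) : Prop :=
  {uniform S, (fun N x => Re (f N x)) @ \oo --> (fun x => Re (g x))} /\
  {uniform S, (fun N x => Im (f N x)) @ \oo --> (fun x => Im (g x))}.

Definition Linfty_norm (R : realType) (S : set R) (f : R -> R[i]) : \bar R :=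
  'N[@lebesgue_measure R]_+oo[(fun x => (Normc.normc (f x))%:E) \_ S]%E.

Definition C_norm (R : realType) (S : set R) (l : nat) (f : R -> R[i])
    : \bar R :=
  (\sum_(j < l.+1) Linfty_norm S (cderive_within_n S j f))%E.

Definition mutually_independent (d : measure_display) (T : measurableType d)
    (R : realType) (P : probability T R) (I : choiceType)
    (X : I -> {RV P >-> R}) : Prop :=
  forall (s : seq I) (B : I -> set R), uniq s ->
    (forall i, i \in s -> measurable (B i)) ->
    (P (\bigcap_(i in [set` s]) (X i @^-1` B i))
     = \prod_(i <- s) P (X i @^-1` B i))%E.

Definition has_law (d : measure_display) (T : measurableType d)
    (R : realType) (P : probability T R) (X : {RV P >-> R})
    (mu : set R -> \bar R) : Prop :=
  forall B : set R, measurable B -> distribution P X B = mu B.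

Definition iid (d : measure_display) (T : measurableType d)
    (R : realType) (P : probability T R) (I : choiceType)
    (X : I -> {RV P >-> R}) (mu : set R -> \bar R) : Prop :=
  mutually_independent X /\ forall i, has_law (X i) mu.

(* [normal_prob m 0] is not the point mass at m in the library, hence the
   separate degenerate case. *)
Definition gaussian_rv (d : measure_display) (T : measurableType d)
    (R : realType) (P : probability T R) (X : {RV P >-> R}) : Prop :=
  exists m s : R,
    0 <= s /\ has_law X (if s == 0 then \d_m else normal_prob m s).

(* Complex-valued Gaussian process: real and imaginary parts are jointly
   Gaussian, i.e. all finite real linear combinations are Gaussian. *)
Definition gaussian_process (d : measure_display) (T : measurableType d)
    (R : realType) (P : probability T R) (S : set R) (G : T -> R -> R[i])
    : Prop :=
  forall (n : nat) (x a b : 'I_n -> R), (forall i, S (x i)) ->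
    exists2 X : {RV P >-> R},
      (forall w, X w = \sum_(i < n)
         (a i * Re (G w (x i)) + b i * Im (G w (x i)))) &
      gaussian_rv X.

Definition random_smooth (d : measure_display) (T : measurableType d)
    (R : realType) (S : set R) (F : T -> R -> R[i]) : Prop :=
  (forall w, csmooth_within S (F w)) /\
  (forall x, S x -> measurable_fun [set: T] (fun w => Re (F w x)) /\
                    measurable_fun [set: T] (fun w => Im (F w x))).

(* Main.v *)
Require Import Defs.
From HB Require Import structures.
From mathcomp Require Import all_boot all_order all_algebra.
From mathcomp Require Import all_classical all_reals all_analysis.
From mathcomp Require Import measurable_realfun.
From mathcomp Require Import complex.
From mathcomp Require Import ring lra zify.
Import Order.TTheory GRing.Theory Num.Theory.
Import numFieldNormedType.Exports.
Local Open Scope classical_set_scope.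
Local Open Scope ring_scope.

Set Implicit Arguments.
Unset Strict Implicit.
Unset Printing Implicit Defensive.

(* The probability space is [0, 1] with the uniform law: splitting the binary
   digits of w into two halves gives a measure preserving map onto the square,
   so that independence becomes Fubini's theorem.

   The primes are cut into blocks [J^128, (J+1)^128).  In a block of n primes put
   S = sum_k e^(2 pi i theta_k) and u = |S|^2 / n.  Lindeberg's exchange argument
   shows that u is nearly exponential.  Adding a small logistic noise makes its
   distribution function F continuous, so v = - ln (1 - F (u + noise)) is exactly
   exponential and close to u.  By rotation invariance sqrt v S / |S| is then an
   exact complex Gaussian g close to S / sqrt n, and successive rotations against
   fresh Gaussians split sqrt n g into the n i.i.d. complex Gaussians of the block.

   On a block p^(-1/2-ix) and its x-derivatives hardly vary, so Abel summation
   bounds the error of the J-th block by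
   xi_J = max (0, tau_J M_J - 1) + beta_J B_J, where B_J is the difference of the
   total sums over the block and M_J the largest partial sum.  The terms j >= 3 of the
   logarithm are absolutely summable.  Hence |E_N^(l)| <= C_l (1 + Xi) with
   Xi = sum_J xi_J.  The xi_J are independent and
   E exp (lambda xi_J) <= 1 + K / J^(9/8), so Xi has all exponential moments; where
   Xi is finite the E_N converge uniformly with all their derivatives. *)

(** * Uniform sources and digit splitting *)

(** Pairing primes one at a time fails: it leaves independent errors of variance proportional to
    1/p, and the sum of 1/p diverges. Blocks must be long enough for the central limit theorem to
    bring the total sums together, and short enough on the logarithmic scale for p^(-1/2-ix) to vary
    by a factor 1 + O(1/J) only. Near J^128 a block has at most about J^127 primes and p^(-1/2) is
    about J^-64; the coupling rate n^(-1/64) is poor, but on a full-sized block it is worth J^-2,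
    and sqrt n times weight times rate is summable over J. This product grows with n, so only upper
    bounds on block sizes are needed, and those hold for any set of integers. Inside a block the W_k
    need not resemble the individual angles: only the totals must agree, and partial sums enter with
    the extra factor 1/J. Rotation invariance reduces the planar coupling to one of a real variable,
    where the distribution function is available. The exponent 9/8 leaves a margin J^(1/8), spent on
    the powers of log p produced by derivatives and on the tails of M_J. *)

Section uniform_source.
Context {R : realType}.
Local Notation mu := (@lebesgue_measure R).
Local Notation mR := (measurableTypeR R).

(* Locked so that simplification does not expose the uniform density. *)
Definition U01 : probability mR R := locked (@uniform_prob R 0 1 ltr01 : probability mR R).

Lemma U01_uniform (A : set R) : U01 A = @uniform_prob R 0 1 ltr01 A.
Proof. by rewrite /U01 -lock. Qed.

(** Rays are stable under intersection, generate the Borel sets and exhaust the line with finite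
    mass, so laws need only be compared on rays. *)
Lemma measure_eq_rays (m1 m2 : {measure set mR -> \bar R}) :
  (forall x : R, m1 `]-oo, x[%classic = m2 `]-oo, x[%classic) ->
  (forall x : R, m1 `]-oo, x[%classic < +oo)%E ->
  forall A : set R, measurable A -> m1 A = m2 A.
Proof.
move=> m12 m1oo A mA.
apply: (@measure_unique _ R mR (@RGenInftyO.G R) (fun n => `]-oo, n%:R[%classic)) => //.
- exact: RGenInftyO.measurableE.
- move=> _ _ [x ->] [y ->]; exists (Order.min x y).
  by apply/seteqP; split => z /=; rewrite !in_itv/= lt_min; [case=> -> ->|move/andP].
- by move=> i; exists i%:R.
- apply/seteqP; split => // x _.
  exists (Num.bound x) => //=; rewrite in_itv/=.
  exact: unstable.ltr_bound.
- by move=> _ [x ->].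
Qed.

Lemma U01E (A : set R) : measurable A -> U01 A = mu (A `&` `[0, 1]%classic).
Proof.
move=> mA; rewrite U01_uniform /uniform_prob integral_uniform_pdf.
rewrite (eq_integral (fun=> 1%E)).
  by rewrite integral_cst ?mul1e//; exact: measurableI.
by move=> x; rewrite inE/= => -[_]; rewrite in_itv/= /uniform_pdf => ->; rewrite subr0 invr1.
Qed.

Lemma U01_itv (c d : R) : 0 <= c -> c <= d -> d <= 1 -> U01 `[c, d[%classic = (d - c)%:E.
Proof.
move=> c0 cd d1; rewrite U01E// (_ : _ `&` _ = `[c, d[%classic).
  rewrite lebesgue_measure_itv/= lte_fin.
  case: (ltrP c d) => [_|dc]; rewrite ?EFinB//.
  have -> : d = c by apply/le_anti/andP.
  by rewrite -EFinB subrr.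
apply/seteqP; split => x /=; rewrite !in_itv/=; first by case.
by move=> /andP[cx xd]; rewrite cx xd; split => //; apply/andP; split; lra.
Qed.

Lemma U01_ray (x : R) : 0 <= x <= 1 -> U01 `]-oo, x[%classic = x%:E.
Proof.
move=> /andP[x0 x1]; have <- : (x - 0)%:E = x%:E by rewrite subr0.
rewrite -(U01_itv (lexx 0) x0 x1) !U01E//; congr (mu _).
apply/seteqP; split => y /=; rewrite !in_itv/=; first by move=> [-> /andP[-> ->]].
by move=> [/andP[-> ->]].
Qed.

Lemma U01_rayE (x : R) : U01 `]-oo, x[%classic = (Num.max 0 (Num.min x 1))%:E.
Proof.
have [x0|x0] := leP x 0.
  rewrite (_ : Num.max _ _ = 0); last first.
    by apply/max_idPl; rewrite ge_min x0.
  rewrite U01E// (_ : _ `&` _ = set0) ?measure0//.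
  apply/seteqP; split => y //=; rewrite !in_itv/= => -[yx /andP[y0 _]].
  by have := lt_le_trans yx x0; rewrite ltNge y0.
have [x1|x1] := leP x 1; rewrite ?(max_idPr (ltW x0)) ?(max_idPr ler01)//.
  by rewrite U01_ray// ltW.
apply/eqP; rewrite eq_le probability_le1//= -(@U01_ray 1) ?lexx ?ler01//.
apply: le_measure; rewrite ?inE//.
by move=> y /=; rewrite !in_itv/= => /lt_trans; apply.
Qed.

(** Each base-4 digit of [N] packs two binary digits; the higher ones form [even_digits], the lower
    ones [odd_digits]. In base 4 both halves advance by one binary digit per step. *)
Fixpoint even_digits (m N : nat) : nat :=
  if m is m'.+1 then ((even_digits m' (N %/ 4)).*2 + odd N./2)%N else 0%N.
Fixpoint odd_digits (m N : nat) : nat :=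
  if m is m'.+1 then ((odd_digits m' (N %/ 4)).*2 + odd N)%N else 0%N.
Fixpoint interleave (m a b : nat) : nat :=
  if m is m'.+1 then (4 * interleave m' a./2 b./2 + (odd a).*2 + odd b)%N else 0%N.

Lemma interleave_digits m N : (N < 4 ^ m)%N ->
  interleave m (even_digits m N) (odd_digits m N) = N.
Proof.
elim: m N => [|m IH] N; first by rewrite expn0; case: N.
rewrite expnS => N4 /=.
have N4' : (N %/ 4 < 4 ^ m)%N by rewrite ltn_divLR// mulnC.
have hb (x : nat) (b : bool) : (x.*2 + b)./2 = x by case: b; lia.
have ob (x : nat) (b : bool) : odd (x.*2 + b) = b by case: b; lia.
rewrite !hb !ob IH//; lia.
Qed.

(** Pairs of [m]-digit binary numbers correspond bijectively to [m]-digit base-4 numbers; this is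
    what makes the mass of a set of digit pairs a matter of counting. *)
Lemma digits_interleave m a b : (a < 2 ^ m)%N -> (b < 2 ^ m)%N ->
  [/\ even_digits m (interleave m a b) = a,
      odd_digits m (interleave m a b) = b & (interleave m a b < 4 ^ m)%N].
Proof.
elim: m a b => [|m IH] a b; first by rewrite !expn0; case: a => //; case: b.
rewrite !expnS => a2 b2 /=.
have [e o l] := IH a./2 b./2 ltac:(lia) ltac:(lia).
set I := interleave m _ _ in e o l *.
have -> : ((4 * I + (odd a).*2 + odd b) %/ 4 = I)%N.
  by case: (odd a); case: (odd b) => /=; lia.
split; rewrite ?e ?o; last lia.
  have -> : odd (4 * I + (odd a).*2 + odd b)./2 = odd a.
    by case: (odd a); case: (odd b) => /=; lia.
  lia.
have -> : odd (4 * I + (odd a).*2 + odd b) = odd b.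
  by case: (odd a); case: (odd b) => /=; lia.
lia.
Qed.

Definition quat (m : nat) (w : R) : nat := Num.truncn (4 ^+ m * w).

Lemma quatS m w : 0 <= w -> (quat m.+1 w %/ 4)%N = quat m w.
Proof.
move=> w0; rewrite /quat exprS -mulrA; set x := _ * w.
have x0 : 0 <= x by rewrite mulr_ge0// exprn_ge0.
apply/esym/eqP; rewrite truncn_eq//.
have := @truncn_itv _ (4 * x) ltac:(lra); set N := Num.trunc _.
have h : (N.+1 <= (N %/ 4).+1 * 4)%N by lia.
have h' : ((N %/ 4) * 4 <= N)%N by lia.
move: h h'; rewrite -!(ler_nat R) !natrM => h h' /andP[h1 h2].
by apply/andP; split; lra.
Qed.

Lemma quat_lt m w : 0 <= w < 1 -> (quat m w < 4 ^ m)%N.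
Proof.
move=> /andP[w0 w1]; rewrite /quat truncn_lt_nat ?mulr_ge0 ?exprn_ge0//.
by rewrite natrX -[ltRHS]mulr1 ltr_pM2l// exprn_gt0.
Qed.

Definition lft_digits m w := even_digits m (quat m w).
Definition rgt_digits m w := odd_digits m (quat m w).

Lemma even_digits_lt m N : (even_digits m N < 2 ^ m)%N.
Proof. by elim: m N => //= m IH N; rewrite expnS; have := IH (N %/ 4)%N; case: odd => /=; lia. Qed.
Lemma odd_digits_lt m N : (odd_digits m N < 2 ^ m)%N.
Proof. by elim: m N => //= m IH N; rewrite expnS; have := IH (N %/ 4)%N; case: odd => /=; lia. Qed.

Lemma lft_digitsS m w : 0 <= w ->
  ((lft_digits m w).*2 <= lft_digits m.+1 w <= (lft_digits m w).*2.+1)%N.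
Proof. by move=> w0; rewrite /lft_digits/= quatS//; case: odd => /=; lia. Qed.
Lemma rgt_digitsS m w : 0 <= w ->
  ((rgt_digits m w).*2 <= rgt_digits m.+1 w <= (rgt_digits m w).*2.+1)%N.
Proof. by move=> w0; rewrite /rgt_digits/= quatS//; case: odd => /=; lia. Qed.

(** Points outside [0, 1) have no expansion of the expected length; they are sent to 0, which
    concerns a null set of the uniform law. *)
Definition clip01 (w : R) : R := if 0 <= w < 1 then w else 0.

Lemma clip01_ge0 w : 0 <= clip01 w < 1.
Proof. by rewrite /clip01; case: ifP => // _; rewrite lexx ltr01. Qed.

Definition bin_lim (d : nat -> R -> nat) (w : R) : R :=
  limn (fun m => (d m (clip01 w))%:R / 2 ^+ m : R).

(** Appending a digit doubles [d] and adds 0 or 1, so the truncations d/2^m increase while (d+1)/2^m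
    decrease; the limit is squeezed between them at every level. *)
Lemma bin_limP (d : nat -> R -> nat) :
  (forall m w, 0 <= w -> ((d m w).*2 <= d m.+1 w <= (d m w).*2.+1)%N) ->
  (forall m w, (d m w < 2 ^ m)%N) ->
  forall w, ((fun m => (d m (clip01 w))%:R / 2 ^+ m : R) @ \oo --> bin_lim d w) /\
   forall m, (d m (clip01 w))%:R / 2 ^+ m <= bin_lim d w <= (d m (clip01 w)).+1%:R / 2 ^+ m.
Proof.
move=> dS dlt w; have /andP[w0 _] := clip01_ge0 w; set v := clip01 w in w0 *.
set u := fun m => (d m v)%:R / 2 ^+ m : R.
have p2 m : 0 < 2 ^+ m :> R by rewrite exprn_gt0.
have uS m : u m <= u m.+1.
  rewrite /u ler_pdivrMr// mulrAC exprS ler_pdivlMr ?mulr_gt0//.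
  rewrite mulrA ler_pM2r// mulrC -natrM ler_nat; have := dS m v w0; lia.
pose U m : R := (d m v).+1%:R / 2 ^+ m.
have US m : U m.+1 <= U m.
  rewrite /U ler_pdivrMr ?mulr_gt0// mulrAC ler_pdivlMr// exprS mulrA ler_pM2r//.
  rewrite -natrM ler_nat; have := dS m v w0; lia.
have und : nondecreasing_seq u by apply/nondecreasing_seqP.
have Uni : nonincreasing_seq U by apply/nonincreasing_seqP.
have uU m n : u m <= U n.
  apply: (@le_trans _ _ (u (maxn m n))); first exact/und/leq_maxl.
  apply: (@le_trans _ _ (U (maxn m n))); last exact/Uni/leq_maxr.
  by rewrite /u /U ler_pM2r ?invr_gt0// ler_nat.
have cu : cvgn u.
  by apply: nondecreasing_is_cvgn => //; exists (U 0%N) => _ [m _ <-]; exact: uU.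
split; first exact: cu.
move=> m; apply/andP; split; first exact: nondecreasing_cvgn_le.
by apply: limr_le => //; near=> k; exact: uU.
Unshelve. all: by end_near. Qed.

Definition lft : R -> R := bin_lim lft_digits.
Definition rgt : R -> R := bin_lim rgt_digits.

Lemma lftP w m : (lft_digits m (clip01 w))%:R / 2 ^+ m <= lft w <= (lft_digits m (clip01 w)).+1%:R / 2 ^+ m.
Proof. by have [_ ->] := bin_limP lft_digitsS (fun m w => even_digits_lt m _) w. Qed.
Lemma rgtP w m : (rgt_digits m (clip01 w))%:R / 2 ^+ m <= rgt w <= (rgt_digits m (clip01 w)).+1%:R / 2 ^+ m.
Proof. by have [_ ->] := bin_limP rgt_digitsS (fun m w => odd_digits_lt m _) w. Qed.

Lemma measurable_clip01 : measurable_fun [set: mR] (clip01 : mR -> mR).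
Proof.
rewrite /clip01; apply: measurable_fun_if => //.
  by apply: measurable_and; [exact: measurable_fun_ler|exact: measurable_fun_ltr].
Qed.

Lemma measurable_nat_seq (g : nat -> R) (N : R -> nat) :
  (forall n, measurable (N @^-1` [set n])) -> measurable_fun [set: mR] (fun w : mR => g (N w) : mR).
Proof.
move=> mN _ B mB; rewrite setTI (_ : _ @^-1` _ = \bigcup_(n in [set n | B (g n)]) (N @^-1` [set n])).
  by apply: bigcup_measurable => n _; exact: mN.
apply/seteqP; split => w /=; first by move=> h; exists (N w).
by move=> [n /= h e]; rewrite e.
Qed.

Lemma measurable_quat m (g : nat -> R) : measurable_fun [set: mR] (fun w : mR => g (quat m (clip01 w)) : mR).
Proof.
apply: measurable_nat_seq => n.
rewrite (_ : _ @^-1` _ = (fun w => 4 ^+ m * clip01 w) @^-1` `[n%:R, n.+1%:R[%classic).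
  rewrite -[X in measurable X]setTI; apply: (_ : measurable_fun _ _) => //.
  by apply: measurable_funM => //; exact: measurable_clip01.
apply/seteqP; split => w /=; rewrite in_itv/= /quat.
  by move=> <-; rewrite truncn_itv// mulr_ge0 ?exprn_ge0//; case/andP: (clip01_ge0 w).
by move=> /truncn_def.
Qed.

Lemma measurable_lft : measurable_fun [set: mR] (lft : mR -> mR).
Proof.
apply: (@measurable_fun_cvg _ _ _ _ (fun m w => (lft_digits m (clip01 w))%:R / 2 ^+ m)).
  by move=> m; exact: (@measurable_quat m (fun N => (even_digits m N)%:R / 2 ^+ m)).
by move=> w _; have [] := bin_limP lft_digitsS (fun m w => even_digits_lt m _) w.
Qed.
Lemma measurable_rgt : measurable_fun [set: mR] (rgt : mR -> mR).
Proof.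
apply: (@measurable_fun_cvg _ _ _ _ (fun m w => (rgt_digits m (clip01 w))%:R / 2 ^+ m)).
  by move=> m; exact: (@measurable_quat m (fun N => (odd_digits m N)%:R / 2 ^+ m)).
by move=> w _; have [] := bin_limP rgt_digitsS (fun m w => odd_digits_lt m _) w.
Qed.

Lemma U01_quat m N : (N < 4 ^ m)%N ->
  U01 ((quat m \o clip01) @^-1` [set N] `&` `[0, 1[%classic) = (4 ^- m)%:E.
Proof.
move=> N4; have p4 : 0 < 4 ^+ m :> R by rewrite exprn_gt0.
have N4' : N.+1%:R <= 4 ^+ m :> R by rewrite -natrX ler_nat.
rewrite (_ : _ `&` _ = `[N%:R / 4 ^+ m, N.+1%:R / 4 ^+ m[%classic).
  rewrite U01_itv ?divr_ge0// ?ler_pM2r ?invr_gt0 ?ler_nat//.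
    by rewrite -natr1 mulrDl mul1r addrAC subrr add0r.
  by rewrite ler_pdivrMr// mul1r.
apply/seteqP; split => w /=; rewrite !in_itv/=.
  move=> [+ w01]; rewrite /clip01 w01 /quat => h; case/andP: w01 => w0 w1.
  have := @truncn_itv _ (4 ^+ m * w) ltac:(by rewrite mulr_ge0// ltW); rewrite h.
  by rewrite ler_pdivrMr// ltr_pdivlMr// (mulrC w).
rewrite ler_pdivrMr// ltr_pdivlMr// => /andP[h1 h2].
have w0 : 0 <= w by rewrite -(pmulr_lge0 _ p4); apply: le_trans h1.
have w1 : w < 1 by rewrite -(ltr_pM2r p4) mul1r; apply: lt_le_trans h2 _.
rewrite /clip01 w0 w1/= /quat; split => //.
by apply: truncn_def; rewrite mulrC h1.
Qed.

Let dl m w := lft_digits m (clip01 w).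
Let dr m w := rgt_digits m (clip01 w).
Let Q m N : set R := (quat m \o clip01) @^-1` [set N] `&` `[0, 1[%classic.

Let mQ m N : measurable (Q m N).
Proof.
apply: measurableI => //.
have := @measurable_quat m (fun n => n%:R) measurableT [set N%:R] (measurable_set1 _).
rewrite setTI; congr measurable; apply/seteqP; split => w /= => [/eqP|->//].
by rewrite eqr_nat => /eqP.
Qed.

(** In the square with coordinates ([lft], [rgt]) cut at level [m], these are a cell, the beginning
    of a line of cells and a corner rectangle. Each cell is a single interval of length 4^-m of the
    source, so masses are obtained by counting cells. *)
Let cell m (a b : nat) : set R := [set w | dl m w = a /\ dr m w = b] `&` `[0, 1[%classic.
Let row m (a b : nat) : set R := [set w | dl m w = a /\ (dr m w < b)%N] `&` `[0, 1[%classic.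
Let box m (a b : nat) : set R := [set w | (dl m w < a)%N /\ (dr m w < b)%N] `&` `[0, 1[%classic.

Let cellE m a b : (a < 2 ^ m)%N -> (b < 2 ^ m)%N -> cell m a b = Q m (interleave m a b).
Proof.
move=> a2 b2; have [e o l] := digits_interleave a2 b2.
apply/seteqP; split => w [/= h w01]; split => //=.
  case: h => <- <-; rewrite interleave_digits//.
  exact/quat_lt/clip01_ge0.
by rewrite /dl /dr /lft_digits /rgt_digits h e o.
Qed.

Let row_measure m a b : (a < 2 ^ m)%N -> (b <= 2 ^ m)%N ->
  measurable (row m a b) /\ U01 (row m a b) = (b%:R * 4 ^- m)%:E.
Proof.
move=> a2; elim: b => [|b IH] b2.
  rewrite (_ : row _ _ _ = set0) ?measure0 ?mul0r//.
  by apply/seteqP; split => // w [[]].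
have [mr Pr] := IH (ltnW b2).
have -> : row m a b.+1 = row m a b `|` cell m a b.
  apply/seteqP; split => w; rewrite /row /cell /=.
    move=> [[-> ]]; rewrite ltnS leq_eqVlt => /orP[/eqP ->|->] h; [right|left]; by split.
  by move=> [[[-> h] ?]|[[-> ->] ?]]; split => //; split => //; rewrite ltnS ltnW.
have mc : measurable (cell m a b) by rewrite cellE//; exact: mQ.
split; first exact: measurableU.
have dis : row m a b `&` cell m a b = set0.
  by apply/seteqP; split => // w [[[_ h] _] [[_ e] _]]; move: h; rewrite e ltnn.
rewrite measureU//= Pr cellE//.
have -> := U01_quat (N := interleave m a b); last by have [] := digits_interleave a2 b2.
by rewrite -EFinD -[in RHS]addn1 natrD mulrDl mul1r.
Qed.

Let box_measure m a b : (a <= 2 ^ m)%N -> (b <= 2 ^ m)%N ->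
  measurable (box m a b) /\ U01 (box m a b) = (a%:R * b%:R * 4 ^- m)%:E.
Proof.
elim: a => [|a IH] a2 b2.
  rewrite (_ : box _ _ _ = set0) ?measure0 ?mul0r//.
  by apply/seteqP; split => // w [[]].
have [mr Pr] := IH (ltnW a2) b2.
have -> : box m a.+1 b = box m a b `|` row m a b.
  apply/seteqP; split => w; rewrite /box /row /=.
    by move=> [[]]; rewrite ltnS leq_eqVlt => /orP[/eqP ->|->] h; [right|left]; split.
  by move=> [[[h h'] ?]|[[-> h] ?]]; split => //; split => //; rewrite ltnS ltnW.
have [mc Pc] := row_measure a2 b2.
split; first exact: measurableU.
have dis : box m a b `&` row m a b = set0.
  by apply/seteqP; split => // w [[[h _] _] [[e _] _]]; move: h; rewrite e ltnn.
rewrite measureU//= Pr Pc.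
by rewrite -EFinD -[in RHS]addn1 natrD !mulrDl mul1r.
Qed.

Lemma U01_01 : U01 `[0, 1[%classic = 1%E.
Proof. by rewrite U01_itv ?ler01// subr0. Qed.

Lemma U01_I01 (A : set R) : measurable A -> U01 (A `&` `[0, 1[%classic) = U01 A.
Proof.
move=> mA; apply/eqP; rewrite eq_le; apply/andP; split.
  by apply: le_measure; rewrite ?inE//; exact: measurableI.
have h : U01 (~` `[0, 1[%classic) = 0%E.
  by rewrite probability_setC//= U01_01 subee.
rewrite -[leRHS]addr0 -[X in (_ + X)%E]h.
rewrite -measureU//=; [|exact: measurableI|exact: measurableC|].
  apply: le_measure; rewrite ?inE//.
    by apply: measurableU; [exact: measurableI|exact: measurableC].
  by move=> w Aw; have [w01|w01] := pselect (`[0, 1[%classic w); [left|right].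
by rewrite -setIA setICr setI0.
Qed.

Lemma eq_of_dist_pow2 (p q : R) : (forall m, `|p - q| <= 8 * 2 ^- m) -> p = q.
Proof.
move=> h; apply/eqP; rewrite -subr_eq0 -normr_le0 -[leRHS]/(0 : R).
have : (fun m => 8 * 2 ^- m : R) @ \oo --> (0 : R).
  rewrite -(mulr0 8); apply: cvgM; first exact: cvg_cst.
  under eq_fun do rewrite -exprVn.
  by apply: cvg_expr; rewrite gtr0_norm; lra.
move=> c; rewrite -(cvg_lim _ c)//; apply: limr_ge; first by apply/cvg_ex; exists 0.
by near=> m.
Unshelve. all: by end_near. Qed.

(** Number of dyadic columns that surely lie below [x], and number that surely covers what lies
    below [x]. The predecessor in [inner] secures a strict inequality: the column of index d reaches
    up to (d+1)/2^m, which must stay below [x]. *)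
Let inner (x : R) m : nat := (minn (2 ^ m) (Num.truncn (2 ^+ m * x))).-1.
Let outer (x : R) m : nat := minn (2 ^ m) (Num.truncn (2 ^+ m * x)).+1.
Let clip (x : R) : R := Num.max 0 (Num.min x 1).

Let inner_bound x m : (inner x m <= 2 ^ m)%N /\ clip x - 2 * 2 ^- m <= (inner x m)%:R * 2 ^- m.
Proof.
have p2 : 0 < 2 ^+ m :> R by rewrite exprn_gt0.
split; first by rewrite /inner; lia.
rewrite ler_pdivlMr// mulrBl mulfVK ?gt_eqF//.
have h : clip x * 2 ^+ m <= (minn (2 ^ m) (Num.truncn (2 ^+ m * x)))%:R + 1.
  have [x0|x0] := leP x 0.
    rewrite /clip (_ : Num.max _ _ = 0) ?mul0r ?addr_ge0//.
    by apply/max_idPl; rewrite ge_min x0.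
  have := @truncn_itv _ (2 ^+ m * x) ltac:(by rewrite mulr_ge0 ?ltW).
  set N := Num.trunc _ => /andP[_ h1].
  have c1 : clip x <= 1 by rewrite /clip ge_max ler01 ge_min lexx orbT.
  have cx : clip x <= x by rewrite /clip ge_max (ltW x0) ge_min lexx.
  rewrite /minn; case: ifP => _.
    by rewrite natrX ler_wpDr// ler_piMl// ltW.
  by rewrite natr1; apply: le_trans (ltW h1); rewrite mulrC ler_pM2l.
apply: le_trans (lerB h (lexx _)) _; rewrite /inner.
by case: (minn _ _) => [|k] /=; rewrite -?natr1; lra.
Qed.

Let outer_bound x m : (outer x m <= 2 ^ m)%N /\ (outer x m)%:R * 2 ^- m <= clip x + 2 ^- m.
Proof.
have p2 : 0 < 2 ^+ m :> R by rewrite exprn_gt0.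
split; first by rewrite /outer; lia.
rewrite ler_pdivrMr// mulrDl mulVf ?gt_eqF//.
have c0 : 0 <= clip x by rewrite /clip le_max lexx.
have [x0|x0] := ltP x 0.
  rewrite /outer (_ : Num.trunc _ = 0%N).
    apply: (@le_trans _ _ 1); first by rewrite (ler_nat _ _ 1); lia.
    by rewrite lerDr mulr_ge0// ltW.
  by apply/truncn0Pn; rewrite -ltNge (@lt_trans _ _ 0)// pmulr_rlt0.
have := @truncn_itv _ (2 ^+ m * x) ltac:(by rewrite mulr_ge0// ltW).
set N := Num.trunc _ => /andP[h0 h1].
rewrite /outer -/N; have [x1|x1] := leP x 1.
  rewrite /clip (min_idPl x1) (max_idPr x0) mulrC.
  apply: (@le_trans _ _ N.+1%:R); last by rewrite -natr1; lra.
  by rewrite ler_nat; lia.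
rewrite /clip (min_idPr (ltW x1)) (max_idPr ler01) mul1r.
apply: (@le_trans _ _ (2 ^ m)%:R); first by rewrite ler_nat; lia.
by rewrite natrX; lra.
Qed.

Let digit_inner (d : nat -> R -> nat) (l : R -> R) x m w : 
  l w <= (d m w).+1%:R / 2 ^+ m -> (d m w < inner x m)%N -> l w < x.
Proof.
move=> h; rewrite /inner => dm; apply: le_lt_trans h _.
have p2 : 0 < 2 ^+ m :> R by rewrite exprn_gt0.
have x0 : 0 <= 2 ^+ m * x.
  rewrite leNgt; apply/negP => x0; move: dm.
  rewrite (_ : Num.trunc _ = 0%N) ?minn0//.
  by apply/truncn0Pn; rewrite -ltNge (lt_trans x0).
have := truncn_itv x0; set N := Num.trunc _ in dm * => /andP[h0 _].
rewrite ltr_pdivrMr// mulrC; apply: lt_le_trans h0.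
by rewrite ltr_nat; lia.
Qed.

Let digit_outer (d : nat -> R -> nat) (l : R -> R) x m w : (d m w < 2 ^ m)%N ->
  (d m w)%:R / 2 ^+ m <= l w -> l w < x -> (d m w < outer x m)%N.
Proof.
move=> d2 h lx; rewrite /outer ltn_min d2/=.
have p2 : 0 < 2 ^+ m :> R by rewrite exprn_gt0.
rewrite ltnS truncn_ge_nat; last first.
  rewrite mulr_ge0 ?ltW//; apply: le_lt_trans lx; apply: le_trans h; exact: divr_ge0.
by rewrite mulrC -ler_pdivrMr// (le_trans h)// ltW.
Qed.

(** The preimage of a quadrant lies between two boxes of cells whose masses differ from the expected
    product by a multiple of 2^-m, for every m. *)
Lemma split_ray (x y : R) :
  U01 (lft @^-1` `]-oo, x[%classic `&` rgt @^-1` `]-oo, y[%classic) =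
  (U01 `]-oo, x[%classic * U01 `]-oo, y[%classic)%E.
Proof.
have ml : measurable (lft @^-1` `]-oo, x[%classic).
  by rewrite -[X in measurable X]setTI; exact: measurable_lft.
have mr : measurable (rgt @^-1` `]-oo, y[%classic).
  by rewrite -[X in measurable X]setTI; exact: measurable_rgt.
have mI := measurableI _ _ ml mr.
rewrite !U01_rayE -EFinM -/(clip x) -/(clip y).
set A := _ `&` _ in mI *.
rewrite -U01_I01// -[LHS]fineK ?fin_num_measure//; last exact: measurableI.
congr EFin; apply: eq_of_dist_pow2 => m.
have p2 : 0 < 2 ^+ m :> R by rewrite exprn_gt0.
have [ix ix'] := inner_bound x m; have [iy iy'] := inner_bound y m.
have [ox ox'] := outer_bound x m; have [oy oy'] := outer_bound y m.
have [mi Pi] := box_measure ix iy; have [mo Po] := box_measure ox oy.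
pose I01 : set R := `[0, 1[%classic.
have h1 : (U01 (box m (inner x m) (inner y m)) <= U01 (A `&` I01))%E.
  apply: le_measure; rewrite ?inE//; first by apply: measurableI => //; exact: measurable_itv.
  move=> w [[/= d1 d2] w01]; split => //; split => /=; rewrite in_itv/=.
    apply: digit_inner d1; by have /andP[] := lftP w m.
  apply: digit_inner d2; by have /andP[] := rgtP w m.
have h2 : (U01 (A `&` I01) <= U01 (box m (outer x m) (outer y m)))%E.
  apply: le_measure; rewrite ?inE//; first by apply: measurableI => //; exact: measurable_itv.
  move=> w [[/= +  + w01]]; rewrite !in_itv/= => lx ry; split => //; split => /=.
    apply: digit_outer lx; first exact: even_digits_lt.
    by have /andP[] := lftP w m.
  apply: digit_outer ry; first exact: odd_digits_lt.
  by have /andP[] := rgtP w m.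
have mAI : measurable (A `&` I01) by apply: measurableI => //; exact: measurable_itv.
have fE : U01 (A `&` I01) = (fine (U01 (A `&` I01)))%:E by rewrite fineK ?fin_num_measure.
move: h1 h2; rewrite Pi Po fE !lee_fin -/I01; set p := fine _ => h1 h2.
have e4 : 4 ^- m = 2 ^- m * 2 ^- m :> R.
  by rewrite -invfM -exprMn; congr (_ ^- m); rewrite -natrM.
rewrite e4 mulrACA in h1; rewrite e4 mulrACA in h2.
have c01 z : 0 <= clip z <= 1 by rewrite /clip le_max lexx/= ge_max ler01 ge_min lexx orbT.
have := c01 x; have := c01 y.
have i0 z : 0 <= (inner z m)%:R * 2 ^- m :> R by rewrite divr_ge0.
have o0 z : 0 <= (outer z m)%:R * 2 ^- m :> R by rewrite divr_ge0.
have := i0 x; have := i0 y; have := o0 x; have := o0 y.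
have d0 : 0 < 2 ^- m :> R by rewrite invr_gt0.
have d1 : 2 ^- m <= 1 :> R by rewrite invf_le1// exprn_ege1// ler1n.
have a1 : (inner x m)%:R * 2 ^- m <= 1 :> R.
  by rewrite ler_pdivrMr// mul1r -natrX ler_nat.
move: h1 h2 ix' iy' ox' oy' d0 d1 a1.
set a := (inner x m)%:R * _; set b := (inner y m)%:R * _.
set a' := (outer x m)%:R * _; set b' := (outer y m)%:R * _.
set d := _ ^- m; set u := clip x; set v := clip y.
clearbody a b a' b' d u v p.
move=> h1 h2 ix' iy' ox' oy' d0 d1 a1 b'0 a'0 b0 a0 /andP[v0 v1] /andP[u0 u1].
rewrite ler_norml; apply/andP; split.
  have : (u - 2 * d) * v <= a * v by rewrite ler_wpM2r.
  have : a * (v - 2 * d) <= a * b by rewrite ler_wpM2l.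
  by rewrite /=; nra.
have : a' * b' <= (u + d) * b' by rewrite ler_wpM2r.
have : (u + d) * b' <= (u + d) * (v + d) by rewrite ler_wpM2l//; lra.
by rewrite /=; nra.
Qed.

End uniform_source.

(** Identities of laws are used throughout as identities of integrals of nonnegative functions; this
    is the passage from sets to functions. *)
Lemma law_integral d1 d2 (T1 : measurableType d1) (T2 : measurableType d2) (R : realType)
    (m1 : {measure set T1 -> \bar R}) (m2 : {measure set T2 -> \bar R}) (h : T1 -> T2)
    (f : T2 -> \bar R) : measurable_fun setT h ->
  (forall A, measurable A -> m1 (h @^-1` A) = m2 A) ->
  measurable_fun setT f -> (forall z, 0 <= f z)%E ->
  (\int[m1]_w f (h w) = \int[m2]_z f z)%E.
Proof.
move=> mh m12 mf f0.
rewrite -[LHS](@ge0_integral_pushforward _ _ _ _ _ _ mh m1 setT f)//.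
by apply: eq_measure_integral => A mA _; exact: m12.
Qed.

(** * Independence of the two halves of the digits *)

Section splitting.
Context {R : realType}.
Local Notation mR := (measurableTypeR R).
Local Notation U01 := (@U01 R).

(** One factor at a time: when the second event is a ray both sides are measures in the first event
    and agree on rays; then the roles are exchanged. *)
Lemma split_measure (A B : set R) : measurable A -> measurable B ->
  U01 (lft @^-1` A `&` rgt @^-1` B) = (U01 A * U01 B)%E.
Proof.
have ml (C : set R) : measurable C -> measurable (lft @^-1` C).
  by move=> mC; rewrite -[X in measurable X]setTI; exact: measurable_lft.
have mr (C : set R) : measurable C -> measurable (rgt @^-1` C).
  by move=> mC; rewrite -[X in measurable X]setTI; exact: measurable_rgt.
have hray (y : R) (C : set R) : measurable C ->
    U01 (lft @^-1` C `&` rgt @^-1` `]-oo, y[%classic) = (U01 C * U01 `]-oo, y[%classic)%E.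
  move=> mC; pose D := rgt @^-1` `]-oo, y[%classic : set R.
  have mD : measurable D by exact: mr.
  have f0 : 0 <= fine (U01 `]-oo, y[%classic) by exact/fine_ge0/measure_ge0.
  transitivity ((fine (U01 `]-oo, y[%classic))%:E * U01 C)%E; last by rewrite fineK ?fin_num_measure// muleC.
  (* As measures in [C]: the uniform law restricted to the event on the right half and pushed
     forward by the left half, against a multiple of the uniform law. *)
  apply: (@measure_eq_rays R (pushforward (mrestr U01 mD) (lft : mR -> mR)) (mscale (NngNum f0) U01)) => //.
  - exact: measurable_lft.
  - move=> m x; transitivity ((fine (U01 `]-oo, y[%classic))%:E * U01 `]-oo, x[%classic)%E => //.
    by rewrite fineK ?fin_num_measure// muleC -split_ray.
  - by move=> m x; apply: le_lt_trans (ltry 1); apply: probability_le1; apply: measurableI => //; exact: ml.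
move=> mA mB; pose D := lft @^-1` A.
have mD : measurable D by exact: ml.
have f0 : 0 <= fine (U01 A) by exact/fine_ge0/measure_ge0.
transitivity ((fine (U01 A))%:E * U01 B)%E; last by rewrite fineK ?fin_num_measure.
rewrite setIC.
apply: (@measure_eq_rays R (pushforward (mrestr U01 mD) (rgt : mR -> mR)) (mscale (NngNum f0) U01)) => //.
- exact: measurable_rgt.
- move=> m x; transitivity ((fine (U01 A))%:E * U01 `]-oo, x[%classic)%E => //.
  by rewrite fineK ?fin_num_measure// -hray// setIC.
- by move=> m x; apply: le_lt_trans (ltry 1); apply: probability_le1; apply: measurableI => //; exact: mr.
Qed.

Lemma measurable_split : measurable_fun [set: mR] (fun w : mR => (lft w, rgt w) : (mR * mR)%type).
Proof. by apply: measurable_fun_pair; [exact: measurable_lft|exact: measurable_rgt]. Qed.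

(** Independence in its working form: the image of the uniform law under both halves is the product
    measure, hence an iterated integral by Tonelli. *)
Lemma split_integral (f : mR * mR -> \bar R) : measurable_fun setT f ->
  (forall z, 0 <= f z)%E ->
  (\int[U01]_w f (lft w, rgt w) = \int[U01]_x \int[U01]_y f (x, y))%E.
Proof.
move=> mf f0; rewrite (law_integral (m2 := (U01 \x U01)%E) measurable_split)//.
  by rewrite -fubini_tonelli1.
move=> A mA; have := @product_measure_unique _ _ _ _ R U01 U01 (pushforward U01 (fun w : mR => (lft w, rgt w) : (mR * mR)%type)).
by move=> /(_ measurable_split) h; apply/esym/h => // B C mB mC; exact: split_measure.
Qed.

Lemma integral_cst_prob (d : measure_display) (T : measurableType d) (P : probability T R) (c : \bar R) :
  (\int[P]_x c = c)%E.
Proof. by have := integral_cst P measurableT c; rewrite /= => ->; rewrite probability_setT mule1. Qed.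

Lemma lft_integral (f : mR -> \bar R) : measurable_fun setT f ->
  (forall z, 0 <= f z)%E -> (\int[U01]_w f (lft w) = \int[U01]_x f x)%E.
Proof.
move=> mf f0; have /= -> := (@split_integral (f \o fst)) => //.
  by apply: eq_integral => x _ /=; rewrite integral_cst_prob.
exact: measurableT_comp.
Qed.

Lemma rgt_integral (f : mR -> \bar R) : measurable_fun setT f ->
  (forall z, 0 <= f z)%E -> (\int[U01]_w f (rgt w) = \int[U01]_x f x)%E.
Proof.
move=> mf f0; have /= -> := (@split_integral (f \o snd)) => //.
  by rewrite integral_cst_prob.
exact: measurableT_comp.
Qed.

End splitting.

(** * Exponential and Gaussian laws *)

Section density.
Context {R : realType}.
Local Notation mu := (@lebesgue_measure R).
Local Notation mR := (measurableTypeR R).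
Variables (g : R -> R) (mg : measurable_fun [set: mR] g) (g0 : forall x, 0 <= g x).

(** The two proofs are arguments so that the measure structure, which rests on them, can be attached
    to the term [dens mg g0]. *)
Definition dens (_ : measurable_fun [set: mR] g) (_ : forall x, 0 <= g x) : set mR -> \bar R :=
  fun A => (\int[mu]_(x in A) (g x)%:E)%E.
Local Notation nu := (dens mg g0).

Let dens0 : nu set0 = 0%E. Proof. by rewrite /dens integral_set0. Qed.
Let dens_ge0 A : (0 <= nu A)%E.
Proof. by apply: integral_ge0 => x _; rewrite lee_fin. Qed.
Let dens_sigma_additive : semi_sigma_additive nu.
Proof.
move=> /= F mF tF mUF; rewrite /dens; apply: cvg_toP.
  apply: ereal_nondecreasing_is_cvgn => m n mn.
  apply: lee_sum_nneg_natr => // k _ _.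
  by apply: integral_ge0 => /= x Fkx; rewrite lee_fin.
rewrite ge0_integral_bigcup//=.
- by apply: measurable_funTS; exact/measurable_EFinP.
- by move=> x _; rewrite lee_fin.
Qed.
HB.instance Definition _ := isMeasure.Build _ _ _ nu dens0 dens_ge0 dens_sigma_additive.

Import HBNNSimple.

Let dens_indic E : measurable E ->
  (\int[nu]_x (\1_E x)%:E = \int[mu]_x ((\1_E x)%:E * (g x)%:E))%E.
Proof.
move=> mE; rewrite integral_indic//= setIT /dens integral_mkcond; apply: eq_integral => x _.
by rewrite patchE indicE; case: ifP => _; rewrite ?mul1e ?mul0e.
Qed.

Let dens_nnsfun (f : {nnsfun mR >-> R}) :
  (\int[nu]_x (f x)%:E = \int[mu]_x ((f x)%:E * (g x)%:E))%E.
Proof.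
under [LHS]eq_integral do rewrite fimfunE -fsumEFin//.
rewrite [LHS]ge0_integral_fsum//; last 2 first.
  - by move=> r; exact/measurable_EFinP/measurableT_comp.
  - by move=> n x _; rewrite EFinM nnfun_muleindic_ge0.
under [RHS]eq_integral.
  move=> x xD; rewrite fimfunE -fsumEFin// muleC ge0_mule_fsumr; last first.
    by move=> r; rewrite EFinM nnfun_muleindic_ge0.
  over.
rewrite [RHS]ge0_integral_fsum//; last 2 first.
  - move=> r; apply: emeasurable_funM; first exact/measurable_EFinP.
    by apply/measurable_EFinP; exact/measurableT_comp.
  - move=> n x _; rewrite EFinM mule_ge0//; first by rewrite lee_fin.
    by rewrite nnfun_muleindic_ge0.
apply: eq_fsbigr => r _.
have [r0|r0] := leP 0 r; last first.
  rewrite preimage_nnfun0//= indic0.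
  by under eq_integral do rewrite mulr0; under [RHS]eq_integral do rewrite mulr0 mule0; rewrite !integral0.
under [LHS]eq_integral do rewrite EFinM.
under [RHS]eq_integral do rewrite EFinM muleC -muleA.
rewrite [LHS]ge0_integralZl ?lee_fin//; last exact/measurable_EFinP.
rewrite [RHS]ge0_integralZl ?lee_fin//; first by rewrite dens_indic.
- apply: emeasurable_funM; last exact/measurable_EFinP.
  by apply/measurable_EFinP.
- by move=> x _; rewrite mule_ge0// lee_fin.
Qed.

Lemma dens_integral (f : mR -> \bar R) : measurable_fun setT f -> (forall x, 0 <= f x)%E ->
  (\int[nu]_x f x = \int[mu]_x (f x * (g x)%:E))%E.
Proof.
move=> mf f0; pose f_ := nnsfun_approx measurableT mf.
transitivity (limn (fun n => \int[nu]_x (f_ n x)%:E))%E.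
  rewrite -monotone_convergence//=.
  - apply: eq_integral => ? /[!inE] xD; apply/esym/cvg_lim => //=.
    exact: cvg_nnsfun_approx.
  - by move=> n; exact/measurable_EFinP/measurable_funTS.
  - by move=> n ? _; rewrite lee_fin.
  - by move=> ? _ ? ? mn; rewrite lee_fin; exact/lefP/nd_nnsfun_approx.
transitivity (limn (fun n => \int[mu]_x ((f_ n x)%:E * (g x)%:E)))%E.
  by congr (limn _); apply/funext => n; exact: dens_nnsfun.
rewrite -monotone_convergence//=.
- apply: eq_integral => x _; apply/cvg_lim => //.
  by apply: cvgeZr => //; exact: cvg_nnsfun_approx.
- by move=> n; apply: emeasurable_funM; exact/measurable_EFinP.
- by move=> n x _; rewrite mule_ge0// lee_fin.
- move=> x _ m n mn; rewrite lee_wpmul2r ?lee_fin//; exact/lefP/nd_nnsfun_approx.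
Qed.

End density.

Section measurable_functions.
Context {R : realType}.
Local Notation mR := (measurableTypeR R).

Lemma measurable_inv : measurable_fun [set: mR] (fun x : R => x^-1 : mR).
Proof.
have -> : [set: mR] = [set 0] `|` ~` [set 0 : R] by rewrite setUv.
apply/measurable_funU => //; first exact: measurableC.
split; first exact: measurable_fun_set1.
apply: open_continuous_measurable_fun.
  by apply: closed_openC; exact: closed_eq.
by move=> x; rewrite inE/= => /eqP x0; exact: inv_continuous.
Qed.

Lemma measurable_sqrt : measurable_fun [set: mR] (fun x : R => Num.sqrt x : mR).
Proof. by apply: nondecreasing_measurable => // x y xy; exact: ler_wsqrtr. Qed.

Lemma measurable_cos : measurable_fun [set: mR] (@cos R : mR -> mR).
Proof. by apply: continuous_measurable_fun; exact: continuous_cos. Qed.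

Lemma measurable_sin : measurable_fun [set: mR] (@sin R : mR -> mR).
Proof. by apply: continuous_measurable_fun; exact: continuous_sin. Qed.

Lemma measurable_tan : measurable_fun [set: mR] (@tan R : mR -> mR).
Proof.
apply: measurable_funM; first exact: measurable_sin.
exact: (measurableT_comp measurable_inv measurable_cos).
Qed.

End measurable_functions.

(** * Changes of variables and the Box-Muller formula *)

Section substitutions.
Context {R : realType}.
Local Notation mu := (@lebesgue_measure R).
Local Notation mR := (measurableTypeR R).
Local Notation U01 := (@U01 R).

(** The variant for right rays, because the densities below are integrated over tails by the
    fundamental theorem of calculus. *)
Lemma measure_eq_right_rays (m1 m2 : {measure set mR -> \bar R}) :
  (forall x : R, m1 `[x, +oo[%classic = m2 `[x, +oo[%classic) ->
  (forall x : R, m1 `[x, +oo[%classic < +oo)%E ->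
  forall A : set R, measurable A -> m1 A = m2 A.
Proof.
move=> m12 m1oo A mA.
apply: (@measure_unique _ R mR (@RGenCInfty.G R) (fun n => `[- n%:R, +oo[%classic)) => //.
- exact: RGenCInfty.measurableE.
- move=> _ _ [x ->] [y ->]; exists (Order.max x y).
  by apply/seteqP; split => z /=; rewrite !in_itv/= !andbT ge_max; [case=> -> ->|move/andP].
- by move=> i; exists (- i%:R).
- apply/seteqP; split => // x _.
  exists (Num.bound x) => //=; rewrite in_itv/= andbT lerNl ltW//.
  exact: unstable.ltrNbound.
- by move=> _ [x ->].
Qed.

(** The image of Lebesgue measure under the scaling, renormalised, gives half-open intervals their
    length; uniqueness of Lebesgue measure does the rest. *)
Lemma lebesgue_scale (x : R) (f : mR -> \bar R) : x != 0 ->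
  measurable_fun setT f -> (forall y, 0 <= f y)%E ->
  (\int[mu]_y f y = `|x|%:E * \int[mu]_t f (x * t)%R)%E.
Proof.
move=> x0 mf f0.
have mx : measurable_fun [set: mR] (fun t : mR => x * t : mR) by exact: mulrl_measurable.
pose r := NngNum (normr_ge0 x).
have hA (A : set R) : measurable A -> mscale r mu ((fun t : mR => x * t : mR) @^-1` A) = mu A.
  move=> mA; apply/esym.
  apply: (@lebesgue_measure_unique _ (pushforward (mscale r mu) (fun t : mR => x * t : mR))) => //.
  move=> _ [[a b]] _ <-; transitivity (`|x|%:E * mu ((fun t => (x * t)%R) @^-1` `]a, b]))%E => //.
  have [xgt|xlt|] := ltgtP 0 x; last by move=> e; rewrite -e eqxx in x0.
    have -> : (fun t => x * t) @^-1` `]a, b] = `]a / x, b / x]%classic.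
      by apply/seteqP; split => t /=; rewrite !in_itv/= ltr_pdivrMr// ler_pdivlMr// (mulrC x).
    rewrite !lebesgue_measure_itv/= !lte_fin ltr_pM2r ?invr_gt0//.
    case: ifP => _; rewrite ?mule0// -!EFinB -EFinM gtr0_norm//; congr EFin; by field.
  have -> : (fun t => x * t) @^-1` `]a, b] = `[b / x, a / x[%classic.
    by apply/seteqP; split => t /=; rewrite !in_itv/= ltr_ndivlMr// ler_ndivrMr// (mulrC x) andbC.
  rewrite !lebesgue_measure_itv/= !lte_fin ltr_nM2r ?invr_lt0//.
  case: ifP => _; rewrite ?mule0// -!EFinB -EFinM ltr0_norm//; congr EFin; by field.
rewrite -(law_integral mx hA)// ge0_integral_mscale//.
exact: measurableT_comp mf mx.
Qed.

Lemma derivable_continuous (f : R -> R) : (forall x, derivable f x 1) -> continuous f.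
Proof. by move=> df x; apply: differentiable_continuous; apply/derivable1_diffP. Qed.

Lemma ge0_FTC_tail (f F : R -> R) (a l : R) : (forall x : R, is_derive x 1 F (f x)) ->
  (forall x, a <= x -> 0 <= f x) -> continuous f -> F x @[x --> +oo] --> l ->
  (\int[mu]_(s in `[a, +oo[) (f s)%:E = (l - F a)%:E)%E.
Proof.
move=> dF f0 cf Fl.
have cF : continuous F by apply: derivable_continuous => x; have [] := dF x.
rewrite (@ge0_continuous_FTC2y _ _ F _ l)//.
- exact: continuous_subspaceT.
- by apply: cvg_at_right_filter; exact: cF.
- by move=> y _; rewrite derive1E; have [_ ->] := dF y.
Qed.

Lemma is_derive_expRN (c x : R) : is_derive x 1 (fun s => - expR (- (c * s))) (c * expR (- (c * x))).
Proof.
apply: is_derive_eq.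
by rewrite /GRing.scale/=; ring.
Qed.

Lemma expRN_cvg (c : R) : 0 < c -> expR (- (c * s)) @[s --> +oo%R] --> (0:R).
Proof.
move=> c0; apply: (@cvg_comp _ _ _ (fun s => c * s) (fun z => expR (- z)) _ (pinfty_nbhs R)); last exact: cvgr_expR.
exact: gt0_cvgMry.
Qed.

Lemma expRN_tail (c x : R) : 0 < c ->
  (\int[mu]_(s in `[x, +oo[) (c * expR (- (c * s)))%:E = (expR (- (c * x)))%:E)%E.
Proof.
move=> c0; apply: etrans (@ge0_FTC_tail _ (fun s => - expR (- (c * s))) _ 0 _ _ _ _) _; last by rewrite sub0r opprK.
- by move=> y; exact: is_derive_expRN.
- by move=> y _; rewrite mulr_ge0 ?expR_ge0// ltW.
- by apply: derivable_continuous => y; exact: ex_derive.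
- by rewrite -oppr0; apply: cvgN; exact: expRN_cvg.
Qed.

Lemma gauss_radial_tail (c x : R) : 0 < c -> 0 <= x ->
  (\int[mu]_(s in `[x, +oo[) (2 * c * s * expR (- (c * s ^+ 2)))%:E = (expR (- (c * x ^+ 2)))%:E)%E.
Proof.
move=> c0 x0; apply: etrans (@ge0_FTC_tail _ (fun s => - expR (- (c * s ^+ 2))) _ 0 _ _ _ _) _; last by rewrite sub0r opprK.
- by move=> y; apply: (@is_derive_eq); rewrite /GRing.scale/=; ring.
- by move=> y xy; rewrite !mulr_ge0 ?expR_ge0// ?(ltW c0)// (le_trans x0).
- by apply: derivable_continuous => y; exact: ex_derive.
- rewrite -oppr0; apply: cvgN.
  apply: (@cvg_comp _ _ _ (fun s => s ^+ 2) (fun z => expR (- (c * z))) _ (pinfty_nbhs R)); last exact: expRN_cvg.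
  apply/cvgryPge => B; near=> y; apply: (@le_trans _ _ y); first by near: y; apply: nbhs_pinfty_ge; rewrite num_real.
  have : 1 <= y by near: y; apply: nbhs_pinfty_ge; rewrite num_real.
  by move=> y1; rewrite expr2 ler_peMl// (le_trans ler01).
Unshelve. all: by end_near. Qed.

Lemma cauchy_tail (x : R) :
  (\int[mu]_(s in `[x, +oo[) (pi^-1 * (1 + s ^+ 2)^-1)%:E = (2^-1 - atan x / pi)%:E)%E.
Proof.
apply: etrans (@ge0_FTC_tail _ (fun s => pi^-1 * atan s) _ 2^-1 _ _ _ _) _; last by rewrite [pi^-1 * _]mulrC.
- by move=> y xy; rewrite !mulr_ge0 ?invr_ge0 ?pi_ge0// addr_ge0// sqr_ge0.
- move=> y; apply: cvgM; first exact: cvg_cst.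
  apply: cvgV; first by rewrite gt_eqF// ltr_pwDl// sqr_ge0.
  by apply: cvgD; [exact: cvg_cst|exact: exprn_continuous].
- have -> : 2^-1 = pi^-1 * (pi / 2) :> R by rewrite mulKf// gt_eqF// pi_gt0.
  by apply: cvgM; [exact: cvg_cst|exact: cvgy_atan].
Qed.

(** Quantile function of the exponential law of mean 1. *)
Definition expo (u : R) : R := - ln (1 - u).

Lemma measurable_expo : measurable_fun [set: mR] (expo : mR -> mR).
Proof.
apply: measurableT_comp => //; apply: (measurableT_comp (@measurable_ln R)).
exact: measurable_funB.
Qed.

(** Quantile formulas are valid for 0 < u < 1 only, as at u = 1 the logarithm takes a default value;
    the complement of the open interval is null. *)
Lemma U01_ae (A B : set R) : measurable A -> measurable B ->
  (forall u, 0 < u < 1 -> A u <-> B u) -> U01 A = U01 B.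
Proof.
have m01 : measurable (`]0, 1[%classic : set R) by [].
have h1 : U01 `]0, 1[%classic = 1%E.
  rewrite U01E// (_ : _ `&` _ = `]0, 1[%classic) ?lebesgue_measure_itv/= ?lte_fin ?ltr01 ?sube0//.
  apply/seteqP; split => u /=; rewrite !in_itv/=; first by case.
  by move=> /andP[h h']; rewrite h h' (ltW h) (ltW h').
have h0 (C : set R) : measurable C -> U01 C = U01 (C `&` `]0, 1[%classic).
  move=> mC; apply/eqP; rewrite eq_le; apply/andP; split; last first.
    by apply: le_measure; rewrite ?inE//; exact: measurableI.
  have hc : U01 (~` `]0, 1[%classic) = 0%E by rewrite probability_setC// h1 subee.
  rewrite -[leRHS]adde0 -[X in (_ + X)%E]hc -measureU//=; [|exact: measurableI|exact: measurableC|].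
    apply: le_measure; rewrite ?inE//.
      by apply: measurableU; [exact: measurableI|exact: measurableC].
    by move=> u Cu; have [w01|w01] := pselect (`]0, 1[%classic u); [left|right].
  by rewrite -setIA setICr setI0.
move=> mA mB AB; rewrite (h0 A)// (h0 B)//; congr (U01 _).
apply/seteqP; split => u /= [h]; rewrite in_itv/= => u01; split => //; exact/(AB _ u01).
Qed.

Lemma U01_tail (A : set R) (c : R) : measurable A -> 0 <= c <= 1 ->
  (forall u, 0 < u < 1 -> A u <-> c <= u) -> U01 A = (1 - c)%:E.
Proof.
move=> mA /andP[c0 c1] Ac; rewrite -(U01_itv c0 c1 (lexx 1)); apply: U01_ae => //.
move=> u u01; rewrite Ac//= in_itv/=; case/andP: u01 => _ ->; rewrite andbT.
by split.
Qed.

Lemma expo_gt0 u : 0 < u < 1 -> 0 < expo u.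
Proof. by move=> u01; rewrite /expo oppr_gt0 ln_lt0//; lra. Qed.

Lemma expo_ge (u x : R) : 0 < u < 1 -> (x <= expo u) = (1 - expR (- x) <= u).
Proof.
move=> u01; rewrite /expo lerNr -[ln _ <= _]ler_expR lnK; last by rewrite posrE; lra.
by apply/idP/idP; lra.
Qed.

Lemma integral_ge_dens (g : R -> R) (f : R -> \bar R) :
  (\int[mu]_x (f x * (g x * (0 <= x)%R%:R)%:E) = \int[mu]_(x in `[0%R, +oo[) (f x * (g x)%:E))%E.
Proof.
rewrite [RHS]integral_mkcond; apply: eq_integral => s _.
rewrite patchE; case: ifPn; rewrite ?in_setE ?notin_setE/= in_itv/= andbT => h.
  by rewrite h mulr1.
by move/negP/negbTE : h => ->; rewrite mulr0 mule0.
Qed.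

Lemma measurable_halfline (g : R -> R) : measurable_fun [set: mR] g ->
  measurable_fun [set: mR] (fun s : R => g s * (0 <= s)%R%:R).
Proof.
move=> mg; apply: measurable_funM => //.
have -> : (fun s : R => (0 <= s)%R%:R : R) = \1_(`[0, +oo[%classic : set R).
  apply/funext => s; rewrite indicE; congr ((nat_of_bool _)%:R).
  by apply/idP/idP; rewrite in_setE/= in_itv/= andbT.
exact: measurable_indic.
Qed.

(** Inverse transform sampling: [c] is the distribution function of the density [g] on the half line
    and [h] the corresponding quantile function. *)
Lemma tail_law (g : R -> R) (h : R -> R) (c : R -> R)
    (mg : measurable_fun [set: mR] g) (g0 : forall x, 0 <= x -> 0 <= g x) :
  measurable_fun [set: mR] (h : mR -> mR) ->
  (forall x, 0 <= x -> 0 <= c x <= 1) ->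
  (forall x u, 0 <= x -> 0 < u < 1 -> (x <= h u) = (c x <= u)) ->
  (forall u, 0 < u < 1 -> 0 <= h u) -> c 0 = 0 ->
  (forall x : R, (0 <= x)%R -> \int[mu]_(s in `[x, +oo[) (g s)%:E = (1 - c x)%:E)%E ->
  forall f : mR -> \bar R, measurable_fun setT f -> (forall x, 0 <= f x)%E ->
  (\int[U01]_u f (h u) = \int[mu]_(s in `[0%R, +oo[) (f s * (g s)%:E))%E.
Proof.
move=> mh c01 hc h0 c00 gc f mf f0.
have mg' := measurable_halfline mg.
have g0' (s : R) : 0 <= g s * (0 <= s)%R%:R.
  by case: (leP 0 s) => s0; rewrite ?mulr0// mulr1 g0.
rewrite (law_integral (m2 := dens mg' g0') mh)//.
  by rewrite dens_integral// integral_ge_dens.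
move=> A mA; apply: (@measure_eq_right_rays (pushforward U01 (h : mR -> mR)) (dens mg' g0')) => //.
  move=> x; rewrite /pushforward /=.
  have mhx (y : R) : measurable (h @^-1` `[y, +oo[%classic).
    by rewrite -[X in measurable X]setTI; exact: mh.
  (* A ray starting at a negative x carries the whole mass, hence the maximum with 0. *)
  have dE : (dens mg' g0' `[x, +oo[%classic = (1 - c (Num.max 0 x))%:E)%E.
    rewrite -gc ?le_max ?lexx// /dens integral_mkcond [RHS]integral_mkcond; apply: eq_integral => s _.
    rewrite !patchE !mem_setE !in_itv/= !andbT ge_max.
    by case: (leP x s) => xs; case: (leP 0 s) => s0 //=; rewrite ?mulr1 ?mulr0.
  rewrite dE; apply: U01_tail => //.
    by apply: c01; rewrite le_max lexx.
  move=> u u01; rewrite /= in_itv/= andbT -hc ?le_max ?lexx// ge_max h0//.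
by move=> x; apply: le_lt_trans (ltry 1); apply: probability_le1; rewrite -[X in measurable X]setTI; exact: mh.
Qed.

Lemma expo_integral (f : mR -> \bar R) : measurable_fun setT f -> (forall x, 0 <= f x)%E ->
  (\int[U01]_u f (expo u) = \int[mu]_(s in `[0%R, +oo[) (f s * (expR (- s))%:E))%E.
Proof.
apply: (@tail_law (fun s => expR (- s)) expo (fun x => 1 - expR (- x))).
- by apply: measurableT_comp => //.
- by move=> x _; exact: expR_ge0.
- exact: measurable_expo.
- move=> x x0; have := expR_ge0 (- x); have : expR (- x) <= 1 by rewrite -expR0 ler_expR oppr_le0.
  by move=> h1 h2; apply/andP; split; lra.
- by move=> x u x0 u01; rewrite expo_ge.
- by move=> u u01; rewrite ltW// expo_gt0.
- by rewrite oppr0 expR0 subrr.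
- move=> x x0; have := @expRN_tail 1 x ltr01; under eq_integral do rewrite !mul1r.
  by move=> ->; rewrite mul1r; congr EFin; ring.
Qed.

(** The Rayleigh law: if s has this density then c s^2 is exponential, so its quantile function is
    the square root of [expo u / c]. *)
Lemma radial_integral (c : R) (f : mR -> \bar R) : 0 < c -> measurable_fun setT f -> (forall x, 0 <= f x)%E ->
  (\int[mu]_(s in `[0%R, +oo[) (f s * (2 * c * s * expR (- (c * s ^+ 2)))%:E)
   = \int[U01]_u f (Num.sqrt (expo u / c)))%E.
Proof.
move=> c0 mf f0; apply/esym.
apply: (@tail_law (fun s => 2 * c * s * expR (- (c * s ^+ 2))) (fun u => Num.sqrt (expo u / c)) (fun x => 1 - expR (- (c * x ^+ 2)))) => //.
- apply: measurable_funM; first exact: measurable_funM.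
  by apply: measurableT_comp => //; apply: measurableT_comp => //; apply: measurable_funM.
- by move=> x x0; rewrite !mulr_ge0 ?expR_ge0// ltW.
- apply: (measurableT_comp measurable_sqrt); apply: measurable_funM => //; exact: measurable_expo.
- move=> x x0; have := expR_ge0 (- (c * x ^+ 2)); have : expR (- (c * x ^+ 2)) <= 1.
    by rewrite -expR0 ler_expR oppr_le0 mulr_ge0 ?sqr_ge0// ltW.
  by move=> h1 h2; apply/andP; split; lra.
- move=> x u x0 u01; rewrite -expo_ge// (mulrC c) -ler_pdivlMr//.
  rewrite -[in LHS](ger0_norm x0) -sqrtr_sqr ler_sqrt// divr_ge0 ?(ltW c0)// ltW// expo_gt0// u01.
- by rewrite expr0n/= mulr0 oppr0 expR0 subrr.
- move=> x x0; rewrite gauss_radial_tail//; congr EFin; ring.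
Qed.

Lemma cauchy_integral (f : mR -> \bar R) : measurable_fun setT f -> (forall x, 0 <= f x)%E ->
  (\int[mu]_t (f t * (pi^-1 * (1 + t ^+ 2)^-1)%:E)
   = \int[U01]_u f (tan (pi * (u - 2^-1))))%E.
Proof.
move=> mf f0.
have mg : measurable_fun [set: mR] (fun t : R => pi^-1 * (1 + t ^+ 2)^-1).
  apply: measurable_funM => //; apply: (measurableT_comp measurable_inv).
  by apply: measurable_funD.
have g0 (t : R) : 0 <= pi^-1 * (1 + t ^+ 2)^-1.
  by rewrite mulr_ge0 ?invr_ge0 ?pi_ge0// addr_ge0// sqr_ge0.
have mh : measurable_fun [set: mR] (fun u : R => tan (pi * (u - 2^-1)) : mR).
  apply: (measurableT_comp measurable_tan); apply: measurable_funM => //; exact: measurable_funB.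
apply/esym; rewrite (law_integral (m2 := dens mg g0) mh)//; first by rewrite dens_integral.
move=> A mA; apply: (@measure_eq_right_rays (pushforward U01 (fun u : R => tan (pi * (u - 2^-1)) : mR)) (dens mg g0)) => //.
  move=> x; rewrite /pushforward /= /dens cauchy_tail.
  have -> : 2^-1 - atan x / pi = 1 - (2^-1 + atan x / pi) by lra.
  have ax1 := atan_gtNpi2 x; have ax2 := atan_ltpi2 x; have pi0 := pi_gt0 R.
  apply: U01_tail.
  - by rewrite -[X in measurable X]setTI; exact: mh.
  - have : - 2^-1 < atan x / pi by rewrite ltr_pdivlMr//; lra.
    have : atan x / pi < 2^-1 by rewrite ltr_pdivrMr//; lra.
    by move=> ? ?; apply/andP; split; lra.
  - move=> u /andP[u0 u1]; rewrite /= in_itv/= andbT -lerBrDl ler_pdivrMr// (mulrC _ pi).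
    set a := pi * _; rewrite !leNgt -[in X in ~~ (_ < X)](atanK x).
    have -> : (tan a < tan (atan x)) = (a < atan x).
      rewrite ltr_tan// in_itv/=; last by rewrite ax1 ax2.
      rewrite /a; apply/andP; split; nra.
    by split.
by move=> x; apply: le_lt_trans (ltry 1); apply: probability_le1; rewrite -[X in measurable X]setTI; exact: mh.
Qed.

Lemma measurable_rad (c : R) : measurable_fun [set: mR] (fun u : R => Num.sqrt (expo u / c) : mR).
Proof.
by apply: (measurableT_comp measurable_sqrt); apply: measurable_funM => //; exact: measurable_expo.
Qed.

(** The line is folded at 0: each half contributes one Rayleigh integral, hence the two signs. *)
Lemma lebesgue_pm_radial (c : R) (f : mR -> \bar R) : 0 < c -> measurable_fun setT f -> (forall x, 0 <= f x)%E ->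
  (\int[mu]_x (f x * (`|x| * expR (- (c * x ^+ 2)))%:E)
   = (2 * c)^-1%:E * \int[U01]_u (f (Num.sqrt (expo u / c)) + f (- Num.sqrt (expo u / c))%R))%E.
Proof.
move=> c0 mf f0.
have mfN : measurable_fun setT (fun x : mR => f (- x)%R) by exact: measurableT_comp.
have mw : measurable_fun [set: mR] (fun x : R => `|x| * expR (- (c * x ^+ 2))).
  apply: measurable_funM; first exact: normr_measurable.
  by apply: measurableT_comp => //; apply: measurableT_comp => //; exact: measurable_funM.
have mF : measurable_fun setT (fun x : mR => f x * (`|x| * expR (- (c * x ^+ 2)))%:E)%E.
  by apply: emeasurable_funM => //; exact/measurable_EFinP.
have F0 (x : mR) : (0 <= f x * (`|x| * expR (- (c * x ^+ 2)))%:E)%E.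
  by rewrite mule_ge0// lee_fin mulr_ge0 ?expR_ge0.
have half g : measurable_fun setT g -> (forall x, 0 <= g x)%E ->
    (\int[mu]_(x in `[0%R, +oo[) (g x * (`|x| * expR (- (c * x ^+ 2)))%:E)
     = (2 * c)^-1%:E * \int[U01]_u g (Num.sqrt (expo u / c)))%E.
  move=> mg g0.
  rewrite -radial_integral// -ge0_integralZl//.
  - apply: eq_integral => x; rewrite in_setE/= in_itv/= andbT => x0.
    rewrite muleCA -EFinM ger0_norm//; congr (_ * _%:E)%E; field; exact: lt0r_neq0.
  - apply: emeasurable_funM; first exact: measurable_funTS.
    apply/measurable_EFinP/measurable_funTS; apply: measurable_funM; first exact: measurable_funM.
    by apply: measurableT_comp => //; apply: measurableT_comp => //; exact: measurable_funM.
  - move=> x; rewrite /= in_itv/= andbT => x0.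
    by rewrite mule_ge0// lee_fin !mulr_ge0 ?expR_ge0// ltW.
  - by rewrite lee_fin invr_ge0 mulr_ge0// ltW.
rewrite ge0_integralD//; [|exact: (measurableT_comp mf (measurable_rad c))|exact: (measurableT_comp mfN (measurable_rad c))].
rewrite ge0_muleDr; [|exact: integral_ge0|exact: integral_ge0].
rewrite -half// -(half (fun x => f (- x)%R))//.
have -> : [set: mR] = `]-oo, 0%R[%classic `|` `[0%R, +oo[%classic.
  by apply/seteqP; split => x //= _; rewrite !in_itv/= andbT; case: (ltP x 0); [left|right].
rewrite ge0_integral_setU//=; last 2 first.
  by apply: measurable_funTS.
  apply/disj_setPS => x /=; rewrite !in_itv/= andbT => -[x0]; by rewrite leNgt x0.
rewrite addeC; congr (_ + _)%E.
rewrite integral_itv_bndo_bndc; last exact: measurable_funTS.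
pose H (x : R) : \bar R := (f (- x)%R * (`|x| * expR (- (c * x ^+ 2)))%:E)%E.
have mH : measurable_fun [set: mR] H by apply: emeasurable_funM; [exact: mfN|exact/measurable_EFinP].
have H0 (x : R) : (0 <= H x)%E by rewrite mule_ge0// lee_fin mulr_ge0 ?expR_ge0.
rewrite [RHS](@ge0_integration_by_substitution0 R H mH H0).
by apply: eq_integral => x _; rewrite /H opprK normrN sqrrN.
Qed.

Lemma U01_integral_oo (f : mR -> \bar R) : measurable_fun setT f -> (forall x, 0 <= f x)%E ->
  (\int[U01]_u f u = \int[mu]_(u in `]0%R, 1%R[) f u)%E.
Proof.
move=> mf f0; rewrite (eq_measure_integral (uniform_prob ltr01)); last first.
  by move=> A _ _; exact: U01_uniform.
rewrite integral_uniform// subr0 invr1 mul1e integral_itv_bndoo//; exact: measurable_funTS.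
Qed.

Lemma eq_U01_integral (f g : mR -> \bar R) : measurable_fun setT f -> (forall x, 0 <= f x)%E ->
  measurable_fun setT g -> (forall x, 0 <= g x)%E -> (forall u : R, (0 < u < 1)%R -> f u = g u) ->
  (\int[U01]_u f u = \int[U01]_u g u)%E.
Proof.
move=> mf f0 mg g0 fg; rewrite !U01_integral_oo//; apply: eq_integral => u.
by rewrite in_setE/= in_itv/=; exact: fg.
Qed.

(** [h] represents [k] modulo 1 inside the unit interval: for a periodic [f] the two are
    interchangeable, and [h] preserves the uniform law. Shifts and the doubling of an angle are the
    instances. *)
Lemma periodic_integral (f : mR -> \bar R) (h k : R -> R) : measurable_fun setT f -> (forall x, 0 <= f x)%E ->
  measurable_fun [set: mR] (h : mR -> mR) -> measurable_fun [set: mR] (k : mR -> mR) ->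
  (forall u, 0 < u < 1 -> f (k u) = f (h u)) -> (forall u, 0 < u < 1 -> 0 <= h u <= 1) ->
  (forall x, 0 < x <= 1 -> U01 (h @^-1` `]-oo, x[%classic) = x%:E) ->
  (\int[U01]_u f (k u) = \int[U01]_u f u)%E.
Proof.
move=> mf f0 mh mk kh h01 hx.
have mp x : measurable (h @^-1` `]-oo, x[%classic).
  by rewrite -[X in measurable X]setTI; exact: mh.
rewrite (@eq_U01_integral _ (fun u => f (h u)))//; do ?exact: measurableT_comp.
apply: (@law_integral _ _ _ _ R U01 U01 h f mh _ mf f0) => A mA.
apply: (@measure_eq_rays R (pushforward U01 (h : mR -> mR)) U01) => // x.
  rewrite /pushforward -[RHS]/(U01 `]-oo, x[%classic) -[LHS]/(U01 (h @^-1` `]-oo, x[%classic)).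
  have [x0|x0] := leP x 0.
    rewrite U01_rayE (_ : Num.max _ _ = 0); last by apply/max_idPl; rewrite ge_min x0.
    rewrite -[RHS](@measure0 _ _ _ U01); apply: U01_ae => // u /h01/andP[hu _]; split => //=.
    by rewrite in_itv/= => hx'; have := le_lt_trans hu (lt_le_trans hx' x0); rewrite ltxx.
  have [x1|x1] := leP x 1.
    by rewrite hx ?x0// U01_ray// x1 ltW.
  rewrite U01_rayE (min_idPr (ltW x1)) (max_idPr ler01).
  apply/le_anti; rewrite probability_le1; last exact: mp.
  rewrite andTb; apply: (@le_trans _ _ (U01 (h @^-1` `]-oo, 1[%classic))).
    by rewrite hx ?ltr01 ?lexx.
  apply: le_measure; rewrite ?inE; [exact: mp|exact: mp|].
  by move=> u /=; rewrite !in_itv/= => /lt_trans; apply.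
by apply: le_lt_trans (ltry 1); apply: probability_le1; exact: mp.
Qed.

Lemma U01_Icc (c d : R) : 0 <= c -> c <= d -> d <= 1 -> U01 (~` `[c, d[%classic) = (1 - (d - c))%:E.
Proof. by move=> c0 cd d1; rewrite probability_setC// U01_itv. Qed.

Lemma shift_integral1 (f : mR -> \bar R) (t : R) : measurable_fun setT f -> (forall x, 0 <= f x)%E ->
  (forall u : R, f (u + 1)%R = f u) -> 0 <= t < 1 -> (\int[U01]_u f (u + t)%R = \int[U01]_u f u)%E.
Proof.
move=> mf f0 f1 /andP[t0 t1].
pose h (u : R) : R := if u < 1 - t then u + t else u + t - 1.
have mh : measurable_fun [set: mR] (h : mR -> mR).
  rewrite /h; apply: measurable_fun_if => //.
  + exact: measurable_fun_ltr.
  + by apply: measurable_funTS; exact: measurable_funD.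
  + by apply: measurable_funTS; apply: measurable_funB => //; exact: measurable_funD.
apply: (@periodic_integral f h (fun u => u + t)) => //.
- exact: measurable_funD.
- by move=> u u01; rewrite /h; case: ifP => // _; rewrite -[in RHS]f1 subrK.
- by move=> u /andP[u0 u1]; rewrite /h; case: ltP => h'; apply/andP; split; lra.
- move=> x /andP[x0 x1].
  have mhx : measurable (h @^-1` `]-oo, x[%classic).
    by rewrite -[X in measurable X]setTI; exact: mh.
  have [tx|xt] := leP x t.
    have <- : (1 - t + x - (1 - t))%:E = x%:E by congr EFin; ring.
    rewrite -U01_itv; [|lra|lra|lra]; apply: U01_ae => // u /andP[u0 u1].
    rewrite /h/= !in_itv/=; case: (ltP u (1 - t)) => h'.
      by split=> [?|/andP[? ?]]; [exfalso; lra|lra].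
    by split=> [?|/andP[? ?]]; [apply/andP; split; lra|lra].
  have <- : (1 - ((1 - t) - (x - t)))%:E = x%:E by congr EFin; ring.
  rewrite -U01_Icc; [|lra|lra|lra]; apply: U01_ae => //; first exact: measurableC.
  move=> u /andP[u0 u1]; rewrite /h/= !in_itv/=; case: (ltP u (1 - t)) => h'; split => [?|/negP].
- by rewrite andbT; apply/negP; rewrite -ltNge; lra.
- by rewrite andbT -ltNge => ?; lra.
- by rewrite andbF.
- by move=> _; lra.
Qed.

Lemma double_integral (f : mR -> \bar R) : measurable_fun setT f -> (forall x, 0 <= f x)%E ->
  (forall u : R, f (u + 1)%R = f u) -> (\int[U01]_u f (2 * u)%R = \int[U01]_u f u)%E.
Proof.
move=> mf f0 f1.
pose h (u : R) : R := if u < 2^-1 then 2 * u else 2 * u - 1.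
have mh : measurable_fun [set: mR] (h : mR -> mR).
  rewrite /h; apply: measurable_fun_if => //.
  + exact: measurable_fun_ltr.
  + by apply: measurable_funTS; apply: measurable_funB => //; exact: mulrl_measurable.
apply: (@periodic_integral f h (fun u => 2 * u)) => //.
- exact: mulrl_measurable.
- by move=> u u01; rewrite /h; case: ifP => // _; rewrite -[in RHS]f1 subrK.
- by move=> u /andP[u0 u1]; rewrite /h; case: ltP => h'; apply/andP; split; lra.
- move=> x /andP[x0 x1].
  have mhx : measurable (h @^-1` `]-oo, x[%classic).
    by rewrite -[X in measurable X]setTI; exact: mh.
  have -> : U01 (h @^-1` `]-oo, x[%classic) = U01 (`[0, x / 2[ `|` `[2^-1, 2^-1 + x / 2[).
    apply: U01_ae => //; first exact: measurableU.
    move=> u /andP[u0 u1]; rewrite /h/= !in_itv/=; case: (ltP u 2^-1) => h'.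
      by split => [?|[/andP[? ?]|/andP[? ?]]]; [left; apply/andP; split; lra|lra|lra].
    by split => [?|[/andP[? ?]|/andP[? ?]]]; [right; apply/andP; split; lra|lra|lra].
  rewrite measureU//=; last first.
    by apply/seteqP; split => // u; rewrite /= !in_itv/= => -[/andP[? ?] /andP[? ?]]; lra.
  rewrite -[X in (X + _)%E = _]/(U01 `[0, x / 2[%classic) -[X in (_ + X)%E = _]/(U01 `[2^-1, 2^-1 + x / 2[%classic).
  rewrite !U01_itv; [|lra..].
  by rewrite -EFinD; congr EFin; field.
Qed.

Lemma periodic_int (T : Type) (f : R -> T) (n : int) (x : R) : (forall u : R, f (u + 1)%R = f u) ->
  f (x + n%:~R) = f x.
Proof.
move=> f1.
have hn (k : nat) (y : R) : f (y + k%:R) = f y.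
  elim: k y => [|k IH] y; first by rewrite addr0.
  by rewrite -addn1 natrD addrA f1 IH.
case: n => k; first exact: hn.
by rewrite NegzE mulrNz -(hn k.+1 (x - _)) subrK.
Qed.

Lemma shift_integral (f : mR -> \bar R) (t : R) : measurable_fun setT f -> (forall x, 0 <= f x)%E ->
  (forall u : R, f (u + 1)%R = f u) -> (\int[U01]_u f (u + t)%R = \int[U01]_u f u)%E.
Proof.
move=> mf f0 f1; rewrite -(@shift_integral1 f (t - (Num.floor t)%:~R))//; last first.
  by have := floor_itv t; rewrite intrD => /andP[? ?]; apply/andP; split; lra.
apply: eq_integral => u _.
by rewrite -[in LHS](subrK (Num.floor t)%:~R t) addrA (periodic_int _ _ f1).
Qed.

Definition phi (x : R) : R := (Num.sqrt (pi *+ 2))^-1 * expR (- (x ^+ 2 / 2)).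

Lemma phiE x : normal_pdf 0 1 x = phi x.
Proof.
rewrite normal_pdfE ?oner_eq0// /normal_peak /normal_fun /phi expr1n mul1r subr0.
by rewrite mulNr.
Qed.

Lemma phi_ge0 x : 0 <= phi x.
Proof. by rewrite mulr_ge0 ?invr_ge0 ?sqrtr_ge0 ?expR_ge0. Qed.

Lemma measurable_phi : measurable_fun [set: mR] (phi : mR -> mR).
Proof.
apply: measurable_funM => //; apply: measurableT_comp => //; apply: measurableT_comp => //.
by apply: measurable_funM.
Qed.

Definition gam : probability mR R := locked (normal_prob 0 1 : probability mR R).

Lemma gamE (A : set R) : gam A = normal_prob 0 1 A.
Proof. by rewrite /gam -lock. Qed.

Lemma gam_integral (f : mR -> \bar R) : measurable_fun setT f -> (forall x, 0 <= f x)%E ->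
  (\int[gam]_x f x = \int[mu]_x (f x * (phi x)%:E))%E.
Proof.
move=> mf f0; rewrite -(dens_integral measurable_phi phi_ge0)//.
apply: eq_measure_integral => A mA _; transitivity (normal_prob 0 1 A); first exact: gamE.
rewrite /normal_prob /dens.
by apply: eq_integral => x _; rewrite phiE.
Qed.

Lemma phi_phi (x t : R) : phi x * phi (x * t) * `|x| = (pi *+ 2)^-1 * (`|x| * expR (- ((1 + t ^+ 2) / 2 * x ^+ 2))).
Proof.
rewrite /phi mulrACA -expRD -invfM -expr2 sqr_sqrtr; last by rewrite mulrn_wge0 ?pi_ge0.
rewrite (_ : - (x ^+ 2 / 2) - _ = - ((1 + t ^+ 2) / 2 * x ^+ 2)); last by field.
by rewrite -[LHS]mulrA (mulrC (expR _)).
Qed.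

(** Quantile function of |x| for a Gaussian pair (x, y) given its slope t = y/x: the conditional
    density is proportional to |x| exp(-(1 + t^2) x^2 / 2). *)
Definition rad (t u : R) : R := Num.sqrt (expo u / ((1 + t ^+ 2) / 2)).

Lemma measurable_rad2 : measurable_fun [set: mR * mR] (fun z : mR * mR => rad z.1 z.2 : mR).
Proof.
apply: (measurableT_comp measurable_sqrt); apply: measurable_funM.
  exact: (measurableT_comp measurable_expo).
apply: (measurableT_comp measurable_inv); apply: measurable_funM => //.
by apply: measurable_funD => //; apply: measurable_funX.
Qed.

Lemma gam_scale (F : mR -> \bar R) (x : R) : x != 0 -> measurable_fun setT F -> (forall z, 0 <= F z)%E ->
  ((\int[gam]_y F y) * (phi x)%:E = \int[mu]_t (F (x * t)%R * (phi x * phi (x * t) * `|x|)%:E))%E.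
Proof.
move=> x0 mF F0.
have mFp : measurable_fun setT (fun y : mR => (F y * (phi y)%:E)%E).
  by apply: emeasurable_funM => //; apply/measurable_EFinP; exact: measurable_phi.
have Fp0 (y : mR) : (0 <= F y * (phi y)%:E)%E by rewrite mule_ge0// lee_fin phi_ge0.
rewrite gam_integral// (lebesgue_scale x0)//.
have mx : measurable_fun [set: mR] (fun t : mR => x * t : mR) by exact: mulrl_measurable.
have mG : measurable_fun setT (fun t : mR => (F (x * t)%R * (phi (x * t))%:E)%E).
  exact: (measurableT_comp mFp mx).
have G0 (t : mR) : (0 <= F (x * t)%R * (phi (x * t))%:E)%E by rewrite mule_ge0// lee_fin phi_ge0.
rewrite muleC muleA -EFinM -ge0_integralZl//; last by rewrite lee_fin mulr_ge0 ?phi_ge0.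
apply: eq_integral => t _; rewrite muleCA -EFinM; congr (_ * _%:E)%E; ring.
Qed.

(** The substitution y = x t uses the slope in place of the polar angle, so that a scaling of each
    line replaces a two-dimensional change of variables. The slope is Cauchy distributed; given it,
    |x| is Rayleigh and the sign of x is symmetric. *)
Lemma box_muller_radial (F : mR * mR -> \bar R) : measurable_fun setT F -> (forall z, 0 <= F z)%E ->
  (\int[gam]_x \int[gam]_y F (x, y) = 
   \int[mu]_t ((\int[U01]_u (F (rad t u, rad t u * t)%R + F (- rad t u, - rad t u * t)%R))
     * (2^-1 * (pi^-1 * (1 + t ^+ 2)^-1))%R%:E))%E.
Proof.
move=> mF F0.
pose w (x t : R) : R := phi x * phi (x * t) * `|x|.
have w0 x t : 0 <= w x t by rewrite !mulr_ge0 ?phi_ge0.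
pose K (z : mR * mR) : \bar R := (F (z.1, z.1 * z.2)%R * (w z.1 z.2)%:E)%E.
have K0 z : (0 <= K z)%E by rewrite mule_ge0// lee_fin w0.
have mK : measurable_fun setT K.
  have m12 : measurable_fun [set: mR * mR] (fun z : mR * mR => (z.1 * z.2 : mR)).
    exact: measurable_funM.
  apply: emeasurable_funM.
    by apply: (measurableT_comp mF); apply: measurable_fun_pair.
  apply/measurable_EFinP; apply: measurable_funM; last exact: measurableT_comp.
  by apply: measurable_funM; [exact: (measurableT_comp measurable_phi)|exact: (measurableT_comp measurable_phi)].
have mFx (x : R) : measurable_fun [set: mR] (fun y : mR => F (x, y)) by exact: measurable_fun_pair2.
have mF1 : measurable_fun [set: mR] (fun x : mR => (\int[gam]_y F (x, y))%E).
  exact: (@measurable_fun_fubini_tonelli_F _ _ _ _ R gam F mF F0).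
transitivity (\int[mu]_x ((\int[gam]_y F (x, y)) * (phi x)%:E))%E.
  rewrite gam_integral//; last by move=> x; exact: integral_ge0.
transitivity (\int[mu]_x \int[mu]_t K (x, t))%E.
  (* At x = 0 the substitution degenerates; this point is discarded on both sides. *)
  rewrite -[LHS](@integral_setD1 R _ 0 setT)//; last 2 first.
  - exact: measurableD.
  - apply: measurable_funTS; apply: emeasurable_funM; last by apply/measurable_EFinP; exact: measurable_phi.
    exact: mF1.
  rewrite -[RHS](@integral_setD1 R _ 0 setT)//; last 2 first.
  - exact: measurableD.
  - by apply: measurable_funTS; exact: (measurable_fun_fubini_tonelli_F K).
  apply: eq_integral => x; rewrite in_setE => -[_ /eqP x0].
  by rewrite gam_scale.
rewrite fubini_tonelli//; apply: eq_integral => t _; rewrite /K/=.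
have c0 : 0 < (1 + t ^+ 2) / 2 by rewrite divr_gt0// ltr_pwDl// sqr_ge0.
under eq_integral do rewrite /w phi_phi (mulrC (_ *+ 2)^-1) EFinM muleA.
have mFt : measurable_fun [set: mR] (fun x : mR => F (x, x * t)%R).
  apply: (measurableT_comp mF); apply: measurable_fun_pair => //; exact: mulrr_measurable.
rewrite ge0_integralZr//; last 3 first.
- apply: emeasurable_funM => //; apply/measurable_EFinP; apply: measurable_funM; first exact: normr_measurable.
  by apply: measurableT_comp => //; apply: measurableT_comp => //; exact: measurable_funM.
- by move=> x _; rewrite mule_ge0// lee_fin mulr_ge0 ?expR_ge0.
- by rewrite lee_fin invr_ge0 mulrn_wge0// pi_ge0.
rewrite lebesgue_pm_radial// muleC muleA -EFinM muleC; congr (_ * _%:E)%E.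
have p0 : pi != 0 :> R by rewrite gt_eqF// pi_gt0.
have t0 : 1 + t ^+ 2 != 0 by rewrite gt_eqF// ltr_pwDl// sqr_ge0.
rewrite -mulr_natl; move: (1 + t ^+ 2) (pi : R) p0 t0 => T p p0 t0.
by field; rewrite ?p0 ?t0.
Qed.

(** Angles are measured in turns: the uniform law on [0, 1] is the uniform angle and the period is
    1. *)
Definition ecos (v : R) : R := cos (2 * pi * v).
Definition esin (v : R) : R := sin (2 * pi * v).

Lemma measurable_ecos : measurable_fun [set: mR] (ecos : mR -> mR).
Proof. by apply: (measurableT_comp measurable_cos); exact: mulrl_measurable. Qed.
Lemma measurable_esin : measurable_fun [set: mR] (esin : mR -> mR).
Proof. by apply: (measurableT_comp measurable_sin); exact: mulrl_measurable. Qed.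

Lemma ecos1 v : ecos (v + 1) = ecos v.
Proof. by rewrite /ecos mulrDr mulr1 (mulr_natl pi 2) cosD cos2pi sin2pi mulr1 mulr0 subr0. Qed.
Lemma esin1 v : esin (v + 1) = esin v.
Proof. by rewrite /esin mulrDr mulr1 (mulr_natl pi 2) sinD cos2pi sin2pi mulr1 mulr0 addr0. Qed.
Lemma ecos2Desin2 v : ecos v ^+ 2 + esin v ^+ 2 = 1.
Proof. exact: cos2Dsin2. Qed.

Lemma ecosD u v : ecos (u + v) = ecos u * ecos v - esin u * esin v.
Proof. by rewrite /ecos /esin mulrDr cosD. Qed.
Lemma esinD u v : esin (u + v) = esin u * ecos v + ecos u * esin v.
Proof. by rewrite /ecos /esin mulrDr sinD. Qed.
Lemma ecosN u : ecos (- u) = ecos u. Proof. by rewrite /ecos mulrN cosN. Qed.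
Lemma esinN u : esin (- u) = - esin u. Proof. by rewrite /esin mulrN sinN. Qed.
Lemma ecos14 : ecos (4^-1) = 0 /\ esin (4^-1) = 1.
Proof. by rewrite /ecos /esin (_ : 2 * pi * 4^-1 = pi / 2) ?cos_pihalf ?sin_pihalf//; field. Qed.
Lemma ecos12 : ecos (2^-1) = -1 /\ esin (2^-1) = 0.
Proof. by rewrite /ecos /esin (_ : 2 * pi * 2^-1 = pi) ?cospi ?sinpi//; field. Qed.

Lemma unit_angle (a b : R) : a ^+ 2 + b ^+ 2 = 1 -> exists v, a = ecos v /\ b = esin v.
Proof.
move=> ab; have a1 : -1 <= a <= 1 by apply/andP; split; nra.
have p0 := pi_gt0 R.
have e (s : R) : s ^+ 2 = 1 -> 2 * pi * (s * acos a / (2 * pi)) = s * acos a.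
  by move=> _; rewrite mulrC divfK// mulf_neq0 ?pnatr_eq0 ?gt_eqF.
have [b0|b0] := leP 0 b.
  exists (1 * acos a / (2 * pi)); rewrite /ecos /esin e ?expr1n// mul1r acosK//; split => //.
  by rewrite sin_acos// -ab addrC addKr sqrtr_sqr ger0_norm.
exists (-1 * acos a / (2 * pi)); rewrite /ecos /esin e ?sqrrN ?expr1n// mulN1r cosN sinN acosK//; split => //.
by rewrite sin_acos// -ab addrC addKr sqrtr_sqr ltr0_norm// opprK.
Qed.

Lemma rad_tan (a u : R) : 0 < cos a -> 0 <= expo u -> rad (tan a) u = Num.sqrt (2 * expo u) * cos a.
Proof.
move=> ca u0; rewrite /rad.
have -> : 1 + tan a ^+ 2 = (cos a ^+ 2)^-1 by rewrite -cos2_tan2 ?gt_eqF// exprVn.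
have -> : expo u / ((cos a ^+ 2)^-1 / 2) = (2 * expo u) * cos a ^+ 2.
  by field; rewrite gt_eqF.
by rewrite sqrtrM ?mulr_ge0// sqrtr_sqr gtr0_norm.
Qed.

Lemma measurable_polar : measurable_fun [set: mR * mR]
  (fun z : mR * mR => (Num.sqrt (2 * expo z.1) * ecos z.2, Num.sqrt (2 * expo z.1) * esin z.2) : (mR * mR)%type).
Proof.
have mr : measurable_fun [set: mR * mR] (fun z : mR * mR => Num.sqrt (2 * expo z.1) : mR).
  apply: (measurableT_comp measurable_sqrt); apply: measurable_funM => //.
  exact: (measurableT_comp measurable_expo).
apply: measurable_fun_pair; apply: measurable_funM => //.
  exact: (measurableT_comp measurable_ecos).
exact: (measurableT_comp measurable_esin).
Qed.

Definition polar_int (F : mR * mR -> \bar R) (v : R) : \bar R :=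
  (\int[U01]_u F (Num.sqrt (2 * expo u) * ecos v, Num.sqrt (2 * expo u) * esin v)%R)%E.

Lemma polar_int1 F v : polar_int F (v + 1) = polar_int F v.
Proof. by rewrite /polar_int ecos1 esin1. Qed.

Lemma polar_int_ge0 F v : (forall z, 0 <= F z)%E -> (0 <= polar_int F v)%E.
Proof. by move=> F0; exact: integral_ge0. Qed.

Lemma measurable_polar_int F : measurable_fun setT F -> (forall z, 0 <= F z)%E ->
  measurable_fun [set: mR] (polar_int F : mR -> \bar R).
Proof.
move=> mF F0.
exact: (measurable_fun_fubini_tonelli_G (fun z : mR * mR => F (Num.sqrt (2 * expo z.1) * ecos z.2, Num.sqrt (2 * expo z.1) * esin z.2))) (measurableT_comp mF measurable_polar) _.
Qed.

(** The Cauchy slope is the tangent of a uniform angle in a half-turn, and the sign of x supplies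
    the opposite half-turn. *)
Lemma box_muller (F : mR * mR -> \bar R) : measurable_fun setT F -> (forall z, 0 <= F z)%E ->
  (\int[gam]_x \int[gam]_y F (x, y) = \int[U01]_v polar_int F v)%E.
Proof.
move=> mF F0; have p0 := pi_gt0 R.
have mP := measurable_polar_int mF F0.
have P0 v := polar_int_ge0 v F0.
(* For v uniform, v/2 - 1/4 runs through the half-turn where the cosine is positive and v/2 + 1/4
   through the opposite one. A unit shift of v exchanges the summands, so [k] has period 1 and v may
   be doubled. *)
pose k (v : mR) : \bar R := (polar_int F (v / 2 - 4^-1)%R + polar_int F (v / 2 + 4^-1)%R)%E.
have mk : measurable_fun setT k.
  apply: emeasurable_funD; apply: (measurableT_comp mP).
    by apply: measurable_funB => //; apply: measurable_funM.
  by apply: measurable_funD => //; apply: measurable_funM.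
have k0 v : (0 <= k v)%E by rewrite adde_ge0.
have k1 (v : R) : k (v + 1) = k v.
  rewrite /k (_ : (v + 1) / 2 - 4^-1 = v / 2 + 4^-1); last by field.
  by rewrite (_ : (v + 1) / 2 + 4^-1 = v / 2 - 4^-1 + 1) ?polar_int1 1?addeC//; field.
have hk : (\int[U01]_v k v = 2%:E * \int[U01]_v polar_int F v)%E.
  rewrite -(double_integral mk k0 k1) /k.
  have e (v : R) : 2 * v / 2 = v by field.
  under eq_integral do rewrite e.
  rewrite ge0_integralD//; last 2 first.
  - by apply: (measurableT_comp mP); exact: measurable_funB.
  - by apply: (measurableT_comp mP); exact: measurable_funD.
  rewrite (shift_integral (- 4^-1) mP P0 (polar_int1 F)) (shift_integral (4^-1) mP P0 (polar_int1 F)).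
  by rewrite -mule2n mule_natl.
rewrite box_muller_radial//.
pose L (t : mR) : \bar R := (\int[U01]_u (F (rad t u, rad t u * t)%R + F (- rad t u, - rad t u * t)%R))%E.
have mL : measurable_fun setT L.
  pose J (z : mR * mR) : \bar R := (F (rad z.1 z.2, rad z.1 z.2 * z.1)%R + F (- rad z.1 z.2, - rad z.1 z.2 * z.1)%R)%E.
  apply: (@measurable_fun_fubini_tonelli_F _ _ _ _ R U01 J); last by move=> z; rewrite adde_ge0.
  have mN : measurable_fun [set: mR * mR] (fun z : mR * mR => - rad z.1 z.2 : mR).
    exact: (measurableT_comp _ measurable_rad2).
  apply: emeasurable_funD; apply: (measurableT_comp mF); apply: measurable_fun_pair => //; try exact: measurable_rad2.
    by apply: measurable_funM => //; exact: measurable_rad2.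
  exact: measurable_funM.
have L0 t : (0 <= L t)%E by apply: integral_ge0 => u _; rewrite adde_ge0.
transitivity (2^-1%:E * \int[mu]_t (L t * (pi^-1 * (1 + t ^+ 2)^-1)%:E))%E.
  have mLc : measurable_fun [set: mR] (fun t : mR => (L t * (pi^-1 * (1 + t ^+ 2)^-1)%:E)%E).
    apply: emeasurable_funM => //; apply/measurable_EFinP; apply: measurable_funM => //.
    by apply: (measurableT_comp measurable_inv); exact: measurable_funD.
  have Lc0 (t : mR) : (0 <= L t * (pi^-1 * (1 + t ^+ 2)^-1)%:E)%E.
    by rewrite mule_ge0// lee_fin mulr_ge0 ?invr_ge0 ?(ltW p0)// addr_ge0 ?sqr_ge0.
  rewrite -[RHS]ge0_integralZl//.
  by apply: eq_integral => t _; rewrite EFinM muleCA.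
rewrite cauchy_integral//.
transitivity (2^-1%:E * \int[U01]_v k v)%E; last first.
  by rewrite hk muleA -EFinM mulVf ?mul1e// pnatr_eq0.
congr (_ * _)%E; apply: eq_U01_integral => //.
  apply: (measurableT_comp mL); apply: (measurableT_comp measurable_tan).
  by apply: measurable_funM => //; exact: measurable_funB.
move=> v /andP[v0 v1]; rewrite /L /k /polar_int.
have mp (w : R) : measurable_fun [set: mR] (fun u : mR => F (Num.sqrt (2 * expo u) * ecos w, Num.sqrt (2 * expo u) * esin w)).
  exact: (measurable_fun_pair1 (f := fun z : mR * mR => F (Num.sqrt (2 * expo z.1) * ecos z.2, Num.sqrt (2 * expo z.1) * esin z.2)) w (measurableT_comp mF measurable_polar)).
rewrite -ge0_integralD//.
set a := pi * (v - 2^-1).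
have ca : 0 < cos a by apply: cos_gt0_pihalf; rewrite /a; apply/andP; split; nra.
have e1 : ecos (v / 2 - 4^-1) = cos a /\ esin (v / 2 - 4^-1) = sin a.
  by rewrite /ecos /esin (_ : 2 * pi * (v / 2 - 4^-1) = a)// /a; field.
have e2 : ecos (v / 2 + 4^-1) = - cos a /\ esin (v / 2 + 4^-1) = - sin a.
  rewrite (_ : v / 2 + 4^-1 = v / 2 - 4^-1 + 2^-1); last by field.
  case: e1 => e1a e1b; case: ecos12 => e3 e4.
  by rewrite ecosD (esinD (v / 2 - 4^-1)) e3 e4 e1a e1b; split; ring.
have st : sin a = cos a * tan a by rewrite /tan mulrC divfK ?gt_eqF.
apply: eq_U01_integral.
- apply: emeasurable_funD; apply: (measurableT_comp mF).
    apply: measurable_fun_pair; first exact: measurable_rad.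
    by apply: measurable_funM => //; exact: measurable_rad.
  apply: measurable_fun_pair; first by apply: (measurableT_comp _ (measurable_rad _)).
  by apply: measurable_funM => //; apply: (measurableT_comp _ (measurable_rad _)).
- by move=> u; rewrite adde_ge0.
- exact: emeasurable_funD.
- by move=> u; rewrite adde_ge0.
move=> u u01; rewrite rad_tan//; last exact/ltW/expo_gt0.
case: e1 => -> ->; case: e2 => -> ->; rewrite st; set q := Num.sqrt _.
by congr (F (_, _) + F (_, _))%E; ring.
Qed.

(** In polar form a rotation is a shift of the uniform angle. *)
Lemma rotation_integral (F : mR * mR -> \bar R) (a b : R) : a ^+ 2 + b ^+ 2 = 1 ->
  measurable_fun setT F -> (forall z, 0 <= F z)%E ->
  (\int[gam]_x \int[gam]_y F (a * x + b * y, - b * x + a * y)%R = \int[gam]_x \int[gam]_y F (x, y))%E.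
Proof.
move=> ab mF F0; have [v [-> ->]] := unit_angle ab.
pose H (z : mR * mR) : \bar R := F (ecos v * z.1 + esin v * z.2, - esin v * z.1 + ecos v * z.2).
have mH : measurable_fun setT H.
  by apply: (measurableT_comp mF); apply: measurable_fun_pair; apply: measurable_funD; apply: measurable_funM.
have H0 z : (0 <= H z)%E by exact: F0.
have P0 x := polar_int_ge0 x F0.
rewrite (box_muller mF F0); transitivity (\int[U01]_v polar_int H v)%E; first exact: (box_muller mH H0).
rewrite -[RHS](shift_integral (- v) (measurable_polar_int mF F0) P0 (polar_int1 F)).
apply: eq_integral => w _; apply: eq_integral => u _.
rewrite /H/= ecosD esinD ecosN esinN; congr (F (_, _)); ring.
Qed.

End substitutions.

(** * Independent families and rotations of Gaussians *)

Section independence.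
Context {R : realType}.
Local Notation mu := (@lebesgue_measure R).
Local Notation mR := (measurableTypeR R).
Local Notation U01 := (@U01 R).
Local Notation gam := (@gam R).

(** An i.i.d. sequence of uniforms drawn from a single one: read the left half, continue on the
    right half. After [m] draws, [iter m rgt w] is the unread remainder. *)
Definition useq (i : nat) (w : R) : R := lft (iter i rgt w).

Lemma measurable_comp1 d (T : measurableType d) (h : R -> R) (f : T -> R) :
  measurable_fun [set: mR] (h : mR -> mR) -> measurable_fun [set: T] (f : T -> mR) ->
  measurable_fun [set: T] (fun t => h (f t) : mR).
Proof. by move=> mh mf; exact: (measurableT_comp mh mf). Qed.

Lemma measurable_iter_rgt d (T : measurableType d) i (f : T -> R) : measurable_fun [set: T] (f : T -> mR) ->
  measurable_fun [set: T] (fun t => iter i rgt (f t) : mR).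
Proof.
by move=> mf; elim: i => [|i IH] //=; exact: (measurable_comp1 measurable_rgt IH).
Qed.

Lemma measurable_useq d (T : measurableType d) i (f : T -> R) : measurable_fun [set: T] (f : T -> mR) ->
  measurable_fun [set: T] (fun t => useq i (f t) : mR).
Proof. by move=> mf; exact: (measurable_comp1 measurable_lft (measurable_iter_rgt i mf)). Qed.

Lemma iter_rgt_integral i (f : mR -> \bar R) : measurable_fun setT f -> (forall z, 0 <= f z)%E ->
  (\int[U01]_w f (iter i rgt w) = \int[U01]_x f x)%E.
Proof.
move=> mf f0; elim: i => [|i IH] //; rewrite -[RHS]IH.
under eq_integral do rewrite iterSr.
rewrite (rgt_integral (f := fun w => f (iter i rgt w)))//.
by apply: (measurableT_comp mf); exact: measurable_iter_rgt.
Qed.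

Lemma useq_integral i (f : mR -> \bar R) : measurable_fun setT f -> (forall z, 0 <= f z)%E ->
  (\int[U01]_w f (useq i w) = \int[U01]_x f x)%E.
Proof.
move=> mf f0; rewrite -(lft_integral mf f0).
by rewrite -[RHS](iter_rgt_integral i)//; exact: (measurableT_comp mf measurable_lft).
Qed.

(** A recursive product that exposes its last factor, to match the recursions of [wsplit] and
    [gfun]. *)
Fixpoint eprod (m : nat) (q : nat -> \bar R) : \bar R :=
  if m is m'.+1 then (q m' * eprod m' q)%E else 1%E.

Lemma eprod_ge0 m q : (forall k, 0 <= q k)%E -> (0 <= eprod m q)%E.
Proof. by move=> q0; elim: m => //= m IH; rewrite mule_ge0. Qed.

Lemma eq_eprod m q q' : (forall k, (k < m)%N -> q k = q' k) -> eprod m q = eprod m q'.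
Proof.
elim: m => //= m IH h; rewrite h// IH// => k km; exact/h/ltnW.
Qed.

Lemma eprodE m q : eprod m q = (\prod_(k < m) q k)%E.
Proof. by elim: m => [|m IH] /=; rewrite ?big_ord0// big_ord_recr/= muleC IH. Qed.

Lemma eprod_recl m q : eprod m.+1 q = (q 0%N * eprod m (fun k => q k.+1))%E.
Proof. by rewrite !eprodE big_ord_recl. Qed.

Lemma measurable_eprod d (T : measurableType d) m (q : nat -> T -> \bar R) :
  (forall k, measurable_fun setT (q k)) -> measurable_fun setT (fun t => eprod m (q ^~ t)).
Proof.
by move=> mq; elim: m => [|m IH] //=; apply: emeasurable_funM.
Qed.

(** The unread remainder is carried along as a further independent uniform; this lets the induction
    peel off the first draw. *)
Lemma useq_prod m (f : nat -> mR -> \bar R) (g : mR -> \bar R) :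
  (forall k, measurable_fun setT (f k)) -> (forall k z, 0 <= f k z)%E ->
  measurable_fun setT g -> (forall z, 0 <= g z)%E ->
  (\int[U01]_w (eprod m (fun k => f k (useq k w)) * g (iter m rgt w)) =
   eprod m (fun k => \int[U01]_x f k x) * \int[U01]_x g x)%E.
Proof.
elim: m f => [|m IH] f mf f0 mg g0.
  by rewrite /= mul1e; apply: eq_integral => w _; rewrite mul1e.
pose H (y : mR) : \bar R := (eprod m (fun k => f k.+1 (useq k y)) * g (iter m rgt y))%E.
have H0 y : (0 <= H y)%E by rewrite mule_ge0// eprod_ge0.
have mH : measurable_fun setT H.
  apply: emeasurable_funM; last by apply: (measurableT_comp mg); exact: measurable_iter_rgt.
  by apply: measurable_eprod => k; apply: (measurableT_comp (mf _)); exact: measurable_useq.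
transitivity (\int[U01]_w (f 0%N (lft w) * H (rgt w)))%E.
  by apply: eq_integral => w _; rewrite eprod_recl /H iterSr muleA; congr (_ * _ * _)%E; apply: eq_eprod => k _; rewrite /useq iterSr.
rewrite (split_integral (f := fun z : mR * mR => (f 0%N z.1 * H z.2)%E))//; last 2 first.
- by apply: emeasurable_funM; exact: measurableT_comp.
- by move=> z; rewrite mule_ge0.
under eq_integral => x _ /= do rewrite ge0_integralZl//.
rewrite ge0_integralZr//; last exact: integral_ge0.
rewrite eprod_recl -muleA; congr (_ * _)%E; exact: (IH (fun k => f k.+1)).
Qed.

Lemma useq_prod1 m (f : nat -> mR -> \bar R) :
  (forall k, measurable_fun setT (f k)) -> (forall k z, 0 <= f k z)%E ->
  (\int[U01]_w eprod m (fun k => f k (useq k w)) = eprod m (fun k => \int[U01]_x f k x))%E.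
Proof.
move=> mf f0; have := @useq_prod m f (cst 1%E) mf f0 (measurable_cst _) (fun=> lee01).
rewrite integral_cst_prob mule1 => <-; apply: eq_integral => w _; by rewrite mule1.
Qed.

(** A standard Gaussian made from one uniform by the Box-Muller formula. *)
Definition gz (w : R) : R := Num.sqrt (2 * expo (lft w)) * ecos (rgt w).

Lemma measurable_gz : measurable_fun [set: mR] (gz : mR -> mR).
Proof.
exact: (measurableT_comp (measurable_fst) (measurableT_comp measurable_polar measurable_split)).
Qed.

Lemma gz_integral (f : mR -> \bar R) : measurable_fun setT f -> (forall z, 0 <= f z)%E ->
  (\int[U01]_w f (gz w) = \int[gam]_x f x)%E.
Proof.
move=> mf f0; have mF : measurable_fun [set: mR * mR] (fun z : mR * mR => f z.1) by exact: measurableT_comp.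
transitivity (\int[gam]_x \int[gam]_y (f x))%E; last first.
  by apply: eq_integral => x _; rewrite integral_cst_prob.
rewrite [RHS](box_muller mF)// /polar_int/=.
rewrite -(fubini_tonelli (fun z : mR * mR => f (Num.sqrt (2 * expo z.1) * ecos z.2)))//; last first.
  exact: (measurableT_comp mF measurable_polar).
rewrite /gz (split_integral (f := fun z : mR * mR => f (Num.sqrt (2 * expo z.1) * ecos z.2)))//.
exact: (measurableT_comp mF measurable_polar).
Qed.

(* Each step rotates the pair (g, fresh Gaussian) by the angle of cosine [1 / sqrt m]: one
   coordinate becomes the last summand, the other one carries the remaining sum. *)
Fixpoint wsplit (m : nat) (g w : R) (k : nat) : R :=
  if m is m'.+1 then
    let a := (Num.sqrt m'.+1%:R)^-1 in let b := Num.sqrt m'%:R * a in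
    if k == m' then a * g - b * gz (lft w) else wsplit m' (b * g + a * gz (lft w)) (rgt w) k
  else 0.

Lemma wsplit_rot m (a := (Num.sqrt m.+1%:R)^-1 : R) (b := Num.sqrt m%:R * a) :
  a ^+ 2 + (- b) ^+ 2 = 1.
Proof.
rewrite sqrrN /b exprMn /a exprVn !sqr_sqrtr// -[X in X + _]mul1r -mulrDl -natr1 addrC mulfV//.
Qed.

(** Holds for every [w], not only in law: the fresh Gaussian of each rotation cancels, because its
    share of the carried coordinate is multiplied by sqrt m when that coordinate is split in
    turn. *)
Lemma wsplit_sum m g w : \sum_(k < m) wsplit m g w k = Num.sqrt m%:R * g.
Proof.
elim: m g w => [|m IH] g w; first by rewrite big_ord0 sqrtr0 mul0r.
rewrite big_ord_recr /= eqxx.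
have s0 : Num.sqrt m.+1%:R != 0 :> R by rewrite sqrtr_eq0 -ltNge ltr0n.
under eq_bigr => k _ do rewrite (ltn_eqF (ltn_ord k)).
rewrite IH; set h := gz _; set s := Num.sqrt m.+1%:R.
have sm : Num.sqrt m%:R ^+ 2 = m%:R :> R by rewrite sqr_sqrtr.
have ss : s ^+ 2 = m%:R + 1 :> R by rewrite sqr_sqrtr// natr1.
set q := Num.sqrt m%:R in sm *.
have -> : q * (q / s * g + s^-1 * h) + (s^-1 * g - q / s * h) = (q ^+ 2 + 1) / s * g by field.
by rewrite sm -ss expr2 mulfK.
Qed.

Lemma measurable_wsplit d (T : measurableType d) m (g w : T -> R) k : 
  measurable_fun [set: T] (g : T -> mR) -> measurable_fun [set: T] (w : T -> mR) ->
  measurable_fun [set: T] (fun t => wsplit m (g t) (w t) k : mR).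
Proof.
elim: m g w => [|m IH] g w mg mw //=.
have mh : measurable_fun [set: T] (fun t => gz (lft (w t)) : mR).
  exact: (measurable_comp1 measurable_gz (measurable_comp1 measurable_lft mw)).
case: (k == m); first by apply: measurable_funB; exact: measurable_funM.
apply: IH; first by apply: measurable_funD; exact: measurable_funM.
exact: (measurable_comp1 measurable_rgt mw).
Qed.

(** For i.i.d. standard Gaussians X_k, the expectation of the product of the p_k(X_k) times f(s +
    sum c_k X_k), as an iterated integral. *)
Fixpoint gfun (m : nat) (c : nat -> R) (p : nat -> mR -> \bar R) (f : mR -> \bar R) (s : mR) : \bar R :=
  if m is m'.+1 then (\int[gam]_x (p m' x * gfun m' c p f (s + c m' * x)%R))%E else f s.

(** By rotation invariance the last summand and the carried coordinate are again independent
    standard Gaussians, and the induction continues with the carried one. The weights [p] give the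
    joint law of the summands, the function [f] the law of their linear combinations. *)
Lemma wsplit_law m (c : nat -> R) (p : nat -> mR -> \bar R) (f : mR -> \bar R) s :
  (forall k, measurable_fun setT (p k)) -> measurable_fun setT f ->
  (forall k z, 0 <= p k z)%E -> (forall z, 0 <= f z)%E ->
  (\int[gam]_g \int[U01]_w (eprod m (fun k => p k (wsplit m g w k)) *
      f (s + \sum_(k < m) c k * wsplit m g w k)%R) = gfun m c p f s)%E.
Proof.
move=> mp + p0; elim: m f s => [|m IH] f s mf f0.
  under eq_integral do under eq_integral do rewrite /= mul1e big_ord0 addr0.
  by under eq_integral do rewrite integral_cst_prob; rewrite integral_cst_prob.
pose a : R := (Num.sqrt m.+1%:R)^-1; pose b : R := Num.sqrt m%:R * a.
pose Q (y w s' : R) : \bar R := (eprod m (fun k => p k (wsplit m y w k)) *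
      f (s' + \sum_(k < m) c k * wsplit m y w k)%R)%E.
have Q0 y w s' : (0 <= Q y w s')%E by rewrite mule_ge0// eprod_ge0.
have mQ d (T : measurableType d) (y w s' : T -> R) : measurable_fun [set: T] (y : T -> mR) ->
    measurable_fun [set: T] (w : T -> mR) -> measurable_fun [set: T] (s' : T -> mR) ->
    measurable_fun [set: T] (fun t => Q (y t) (w t) (s' t)).
  move=> my mw ms; apply: emeasurable_funM.
    by apply: measurable_eprod => k; apply: (measurableT_comp (mp k)); exact: measurable_wsplit.
  apply: (measurableT_comp mf); apply: measurable_funD => //.
  by apply: measurable_sum => k; apply: measurable_funM => //; exact: measurable_wsplit.
pose Phi (z : mR * mR) : \bar R := (p m z.1 * \int[U01]_w Q z.2 w (s + c m * z.1)%R)%E.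
have mPhi : measurable_fun setT Phi.
  apply: emeasurable_funM; first exact: measurableT_comp.
  apply: (measurable_fun_fubini_tonelli_F (fun z : (mR * mR) * mR => Q z.1.2 z.2 (s + c m * z.1.1))) => //.
  apply: mQ => //; first exact: measurableT_comp.
  by apply: measurable_funD => //; apply: measurable_funM => //; exact: measurableT_comp.
have Phi0 z : (0 <= Phi z)%E by rewrite mule_ge0//; exact: integral_ge0.
transitivity (\int[gam]_g \int[gam]_h Phi (a * g + (- b) * h, - (- b) * g + a * h)%R)%E; last first.
  rewrite (rotation_integral (wsplit_rot m) mPhi Phi0); apply: eq_integral => x _.
  rewrite /Phi/= ge0_integralZl//.
  - by congr (_ * _)%E; exact: IH.
  - apply: (measurable_fun_fubini_tonelli_F (fun z : mR * mR => Q z.1 z.2 (s + c m * x))) => //.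
    exact: mQ.
  - by move=> y _; exact: integral_ge0.
apply: eq_integral => g _.
have mPg : measurable_fun [set: mR] (fun h : mR => Phi (a * g + - b * h, - - b * g + a * h)).
  apply: (measurableT_comp mPhi); apply: measurable_fun_pair; apply: measurable_funD => //;
  exact: measurable_funM.
rewrite -(gz_integral mPg)//.
pose K (z : mR * mR) : \bar R := (p m (a * g + - b * gz z.1)%R *
  Q (- - b * g + a * gz z.1)%R z.2 (s + c m * (a * g + - b * gz z.1))%R)%E.
have mgz1 : measurable_fun [set: mR * mR] (fun z : mR * mR => gz z.1 : mR).
  exact: (measurable_comp1 measurable_gz).
have mK : measurable_fun setT K.
  have m1 : measurable_fun [set: mR * mR] (fun z : mR * mR => a * g + - b * gz z.1 : mR).
    by apply: measurable_funD => //; exact: measurable_funM.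
  apply: emeasurable_funM; first exact: (measurableT_comp (mp m)).
  apply: mQ => //.
    by apply: measurable_funD => //; exact: measurable_funM.
  by apply: measurable_funD => //; exact: measurable_funM.
transitivity (\int[U01]_w K (lft w, rgt w))%E.
  apply: eq_integral => w _; rewrite /K/= eqxx -/a -/b -muleA opprK mulNr; congr (_ * _)%E.
  rewrite /Q; congr (_ * f _)%E.
    by apply: eq_eprod => k km; rewrite ltn_eqF.
  rewrite big_ord_recr/= eqxx -/a -/b (addrC (\sum_(_ < _) _)) addrA; congr (_ + _).
  by apply: eq_bigr => k _; rewrite ltn_eqF.
rewrite split_integral//; last by move=> z; rewrite mule_ge0.
apply: eq_integral => x _; rewrite /K /Phi/= ge0_integralZl//.
by apply: mQ => //; exact: measurable_id.
Qed.

(** A rotation taking the first axis to the direction (a, b) leaves a single Gaussian; for a = b = 0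
    there is no direction and the claim is immediate. *)
Lemma gam_comb (f : mR -> \bar R) (a b s : R) : measurable_fun setT f -> (forall z, 0 <= f z)%E ->
  (\int[gam]_x \int[gam]_y f (s + a * x + b * y)%R = \int[gam]_x f (s + Num.sqrt (a ^+ 2 + b ^+ 2) * x)%R)%E.
Proof.
move=> mf f0; set r := Num.sqrt _.
have rr : r ^+ 2 = a ^+ 2 + b ^+ 2 by rewrite sqr_sqrtr// addr_ge0 ?sqr_ge0.
have [r0|r0] := eqVneq r 0.
  have [a0 b0] : a = 0 /\ b = 0.
    have : a ^+ 2 + b ^+ 2 = 0 by rewrite -rr r0 expr0n.
    move=> /eqP; rewrite paddr_eq0 ?sqr_ge0// !sqrf_eq0 => /andP[/eqP -> /eqP ->]; by [].
  rewrite r0 a0 b0; under eq_integral do under eq_integral do rewrite !mul0r !addr0.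
  under eq_integral do rewrite integral_cst_prob.
  by under [RHS]eq_integral do rewrite mul0r addr0.
pose F (z : mR * mR) : \bar R := f (s + r * z.1).
have mF : measurable_fun setT F.
  by apply: (measurableT_comp mf); apply: measurable_funD => //; exact: measurable_funM.
have ab : (a / r) ^+ 2 + (b / r) ^+ 2 = 1.
  by rewrite !exprMn exprVn -mulrDl -rr mulfV// sqrf_eq0.
have := rotation_integral ab mF (fun z => f0 _); rewrite /F/= => h.
transitivity (\int[gam]_x \int[gam]_y f (s + r * (a / r * x + b / r * y))%R)%E.
  by apply: eq_integral => x _; apply: eq_integral => y _; congr f; field.
by rewrite h; apply: eq_integral => x _; rewrite integral_cst_prob.
Qed.

Lemma gfun1 m (c : nat -> R) (f : mR -> \bar R) s : measurable_fun setT f -> (forall z, 0 <= f z)%E ->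
  (gfun m c (fun _ => cst 1) f s = \int[gam]_x f (s + Num.sqrt (\sum_(k < m) c k ^+ 2) * x)%R)%E.
Proof.
move=> mf f0; elim: m s => [|m IH] s /=.
  by under [RHS]eq_integral do rewrite big_ord0 sqrtr0 mul0r addr0; rewrite integral_cst_prob.
under eq_integral do rewrite mul1e IH.
rewrite big_ord_recr/=; set v := \sum_(_ < _) _.
have v0 : 0 <= v by apply: sumr_ge0 => k _; exact: sqr_ge0.
by rewrite gam_comb// sqr_sqrtr// addrC.
Qed.

(** The law N(0, v) expressed through test functions, a form that covers the degenerate case v =
    0. *)
Definition isN (X : R -> R) (v : R) : Prop :=
  forall f : mR -> \bar R, measurable_fun setT f -> (forall z, 0 <= f z)%E ->
  (\int[U01]_w f (X w) = \int[gam]_x f (Num.sqrt v * x)%R)%E.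

Lemma isN_add (X Y : R -> R) a b : measurable_fun [set: mR] (X : mR -> mR) -> measurable_fun [set: mR] (Y : mR -> mR) ->
  0 <= a -> 0 <= b -> isN X a -> isN Y b -> isN (fun w => X (lft w) + Y (rgt w)) (a + b).
Proof.
move=> mX mY a0 b0 NX NY f mf f0.
have mXY : measurable_fun [set: mR * mR] (fun z : mR * mR => f (X z.1 + Y z.2)).
  apply: (measurableT_comp mf); apply: measurable_funD; [exact: (measurableT_comp mX)|exact: (measurableT_comp mY)].
rewrite (split_integral (f := fun z => f (X z.1 + Y z.2)))//=.
transitivity (\int[U01]_x \int[gam]_y f (X x + Num.sqrt b * y)%R)%E.
  apply: eq_integral => x _; rewrite -(NY (fun y => f (X x + y)%R))//.
  by apply: (measurableT_comp mf); exact: measurable_funD.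
rewrite (NX (fun x => \int[gam]_y f (x + Num.sqrt b * y)%R)%E).
- under eq_integral do under eq_integral do rewrite -[X in (X + _)%R]add0r.
  by rewrite gam_comb// !sqr_sqrtr//; under eq_integral do rewrite add0r.
- apply: (measurable_fun_fubini_tonelli_F (fun z : mR * mR => f (z.1 + Num.sqrt b * z.2))) => //.
  by apply: (measurableT_comp mf); apply: measurable_funD => //; exact: measurable_funM.
- by move=> x; exact: integral_ge0.
Qed.

Lemma gam_mgf (t : R) : (\int[gam]_x (expR (t * x))%:E = (expR (t ^+ 2 / 2))%:E)%E.
Proof.
rewrite gam_integral//; last first.
  by apply/measurable_EFinP; apply: measurableT_comp => //; exact: measurable_funM.
transitivity (\int[mu]_x ((expR (t ^+ 2 / 2))%:E * (normal_pdf t 1 x)%:E))%E.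
  apply: eq_integral => x _; rewrite -!EFinM normal_pdfE ?oner_eq0// /normal_peak /normal_fun /phi expr1n mul1r.
  congr EFin; rewrite mulrCA [RHS]mulrCA -!expRD; congr (_ * expR _).
  by rewrite -[1 *+ 2]/(2 : R); field.
rewrite ge0_integralZl// ?lee_fin ?expR_ge0//.
- by rewrite integral_normal_pdf mule1.
- by apply/measurable_EFinP; exact: measurable_normal_pdf.
- by move=> x _; rewrite lee_fin normal_pdf_ge0.
Qed.

Lemma gam_law (s : R) (B : set R) : 0 < s -> measurable B ->
  (\int[gam]_x (\1_B (s * x))%:E = normal_prob 0 s B)%E.
Proof.
move=> s0 mB.
have mi : measurable_fun [set: mR] (fun x : mR => (\1_B (s * x))%:E : \bar R).
  by apply/measurable_EFinP; apply: (measurableT_comp (measurable_indic mB)); exact: measurable_funM.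
have mpdf : measurable_fun [set: mR] (fun y : mR => (normal_pdf 0 s y)%:E).
  by apply/measurable_EFinP; exact: measurable_normal_pdf.
have pdf0 y : (0 <= (normal_pdf 0 s y)%:E)%E by rewrite lee_fin normal_pdf_ge0.
pose h (y : mR) : \bar R := ((\1_B y)%:E * (normal_pdf 0 s y)%:E)%E.
have mh : measurable_fun setT h.
  by apply: emeasurable_funM => //; apply/measurable_EFinP; exact: measurable_indic.
have h0 y : (0 <= h y)%E by rewrite mule_ge0// lee_fin.
rewrite gam_integral// /normal_prob [RHS]integral_mkcond.
transitivity (\int[mu]_y h y)%E; last first.
  apply: eq_integral => y _; rewrite patchE /h indicE; case: ifP => _; by rewrite ?mul1e ?mul0e.
rewrite [RHS](lebesgue_scale (lt0r_neq0 s0))// -ge0_integralZl//; last first.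
  by apply: (measurableT_comp mh); exact: mulrl_measurable.
apply: eq_integral => x _; rewrite /h muleCA -EFinM gtr0_norm// normal_pdfE ?gt_eqF//.
rewrite -!EFinM; congr EFin; congr (_ * _); rewrite /normal_peak /normal_fun /phi subr0 -[s ^+ 2 * pi *+ 2]mulrnAr.
have -> : Num.sqrt (s ^+ 2 * (pi *+ 2)) = s * Num.sqrt (pi *+ 2).
  by rewrite sqrtrM ?sqr_ge0// sqrtr_sqr gtr0_norm.
rewrite invfM !mulrA mulfV ?gt_eqF// mul1r.
by congr (_ * expR _); rewrite -[_ *+ 2]mulr_natl; field; rewrite gt_eqF.
Qed.

End independence.

(** * Lindeberg's exchange *)

Section translation_operators.
Context {R : realType}.
Local Notation mR := (measurableTypeR R).
Local Notation U01 := (@U01 R).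
Local Notation gam := (@gam R).
Local Notation plane := (mR * mR)%type.

(** Convolution operator: one step of the random walk with increment (a, b), acting on functions.
    Its powers average over sums of independent increments. *)
Definition trans (a b : R -> R) (f : plane -> \bar R) (z : plane) : \bar R :=
  (\int[U01]_w f (z.1 + a w, z.2 + b w)%R)%E.

Definition mp (f : plane -> \bar R) := measurable_fun [set: plane] f.
Definition nn (f : plane -> \bar R) := forall z, (0 <= f z)%E.

Section one_operator.
Variables (a b : R -> R).
Hypotheses (ma : measurable_fun [set: mR] (a : mR -> mR)) (mb : measurable_fun [set: mR] (b : mR -> mR)).

Lemma trans_ge0 f : nn f -> nn (trans a b f).
Proof. by move=> f0 z; exact: integral_ge0. Qed.

Lemma measurable_shiftw (f : plane -> \bar R) (z : plane) : mp f ->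
  measurable_fun [set: mR] (fun w : mR => f (z.1 + a w, z.2 + b w)).
Proof.
by move=> mf; apply: (measurableT_comp mf); apply: measurable_fun_pair; exact: measurable_funD.
Qed.

Lemma measurable_trans2 (f : plane -> \bar R) : mp f ->
  measurable_fun [set: (plane * mR)%type] (fun t : plane * mR => f (t.1.1 + a t.2, t.1.2 + b t.2)).
Proof.
move=> mf; apply: (measurableT_comp mf); apply: measurable_fun_pair; apply: measurable_funD.
- exact: (measurableT_comp measurable_fst measurable_fst).
- exact: (measurable_comp1 ma).
- exact: (measurableT_comp measurable_snd measurable_fst).
- exact: (measurable_comp1 mb).
Qed.

Lemma measurable_trans f : mp f -> nn f -> mp (trans a b f).
Proof.
move=> mf f0.
by apply: (measurable_fun_fubini_tonelli_F (fun t : plane * mR => f (t.1.1 + a t.2, t.1.2 + b t.2))) => //;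
  exact: measurable_trans2.
Qed.

Lemma trans_le f g : mp f -> nn f -> mp g -> (forall z, f z <= g z)%E -> 
  (forall z, trans a b f z <= trans a b g z)%E.
Proof.
move=> mf f0 mg fg z; apply: ge0_le_integral => //; exact: measurable_shiftw.
Qed.

Lemma trans_add f g z : mp f -> nn f -> mp g -> nn g ->
  (trans a b (fun z => f z + g z) z = trans a b f z + trans a b g z)%E.
Proof. by move=> mf f0 mg g0; rewrite /trans ge0_integralD//; exact: measurable_shiftw. Qed.

Lemma trans_scale f z (c : R) : (0 <= c) -> mp f -> nn f ->
  (trans a b (fun z => c%:E * f z) z = c%:E * trans a b f z)%E.
Proof. by move=> c0 mf f0; rewrite /trans ge0_integralZl//; exact: measurable_shiftw. Qed.

Lemma iter_trans_props n f : mp f -> nn f -> mp (iter n (trans a b) f) /\ nn (iter n (trans a b) f).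
Proof.
move=> mf f0; elim: n => [|n [IH1 IH2]] //=.
by split; [exact: measurable_trans|exact: trans_ge0].
Qed.

Lemma trans_sum n f z : mp f -> nn f ->
  (iter n (trans a b) f z = \int[U01]_w f (z.1 + \sum_(i < n) a (useq i w), z.2 + \sum_(i < n) b (useq i w))%R)%E.
Proof.
move=> mf f0; elim: n z => [|n IH] z.
  under eq_integral do rewrite !big_ord0 !addr0.
  by rewrite integral_cst_prob; case: z.
rewrite /= /trans; under eq_integral => w _ do rewrite IH/=.
pose K (t : mR * mR) : \bar R := f (z.1 + a t.1 + \sum_(i < n) a (useq i t.2), z.2 + b t.1 + \sum_(i < n) b (useq i t.2)).
rewrite -[LHS]/(\int[U01]_w \int[U01]_y K (w, y))%E -split_integral; last 2 first.
- apply: (measurableT_comp mf); apply: measurable_fun_pair; apply: measurable_funD.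
  + by apply: measurable_funD => //; exact: (measurable_comp1 ma).
  + by apply: measurable_sum => i; apply: (measurable_comp1 ma); exact: measurable_useq.
  + by apply: measurable_funD => //; exact: (measurable_comp1 mb).
  + by apply: measurable_sum => i; apply: (measurable_comp1 mb); exact: measurable_useq.
- by move=> z0; exact: f0.
apply: eq_integral => w _; rewrite /K/= !big_ord_recl/= !addrA.
by congr (f (_ + _, _ + _)); apply: eq_bigr => i _; rewrite /useq -iterSr.
Qed.

End one_operator.

Section two_operators.
Variables (a b a' b' : R -> R).
Hypotheses (ma : measurable_fun [set: mR] (a : mR -> mR)) (mb : measurable_fun [set: mR] (b : mR -> mR)).
Hypotheses (ma' : measurable_fun [set: mR] (a' : mR -> mR)) (mb' : measurable_fun [set: mR] (b' : mR -> mR)).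
Local Notation S := (trans a b).
Local Notation T := (trans a' b').

Lemma trans_comm f z : mp f -> nn f -> S (T f) z = T (S f) z.
Proof.
move=> mf f0; rewrite /trans/=.
pose K (t : mR * mR) : \bar R := f (z.1 + a t.1 + a' t.2, z.2 + b t.1 + b' t.2).
have mK : measurable_fun [set: (mR * mR)%type] K.
  apply: (measurableT_comp mf); apply: measurable_fun_pair; apply: measurable_funD.
  - by apply: measurable_funD => //; exact: (measurable_comp1 ma).
  - exact: (measurable_comp1 ma').
  - by apply: measurable_funD => //; exact: (measurable_comp1 mb).
  - exact: (measurable_comp1 mb').
apply: etrans (fubini_tonelli _ mK (fun t => f0 _)) _.
by apply: eq_integral => x _; apply: eq_integral => y _; rewrite /K/=; congr (f (_, _)); rewrite addrAC.
Qed.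

Lemma trans_iter_comm n f z : mp f -> nn f -> iter n S (T f) z = T (iter n S f) z.
Proof.
move=> mf f0; elim: n z => [|n IH] z //=.
rewrite -trans_comm; last 2 first.
- by have [] := iter_trans_props ma mb n mf f0.
- by have [] := iter_trans_props ma mb n mf f0.
by rewrite /trans; apply: eq_integral => w _; exact: IH.
Qed.

Lemma iter_trans_le n f g : mp f -> nn f -> mp g -> (forall z, f z <= g z)%E ->
  (forall z, iter n S f z <= iter n S g z)%E.
Proof.
move=> mf f0 mg fg; have g0 : nn g by move=> z; exact: le_trans (f0 z) (fg z).
elim: n => [|n IH] //= z; apply: trans_le => //.
- by have [] := iter_trans_props ma mb n mf f0.
- by have [] := iter_trans_props ma mb n mf f0.
- by have [] := iter_trans_props ma mb n mg g0.
Qed.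

Lemma iter_trans_add n f g : mp f -> nn f -> mp g -> nn g ->
  (forall z, iter n S (fun z => f z + g z) z = iter n S f z + iter n S g z)%E.
Proof.
move=> mf f0 mg g0; elim: n => [|n IH] //= z.
have [? ?] := iter_trans_props ma mb n mf f0.
have [? ?] := iter_trans_props ma mb n mg g0.
by rewrite -trans_add//; apply: eq_integral => w _; exact: IH.
Qed.

(* Lindeberg: [S^n - T^n] telescopes into [n] terms containing one factor
   [S - T]; since all operators commute it can be applied first. *)
Lemma lindeberg n (f : plane -> \bar R) (psi : nat -> plane -> \bar R) :
  mp f -> nn f -> (forall k, mp (psi k)) -> (forall k, nn (psi k)) ->
  (forall k z, psi k z <= psi k.+1 z)%E ->
  (forall z, S f z <= T f z + psi 0%N z)%E ->
  (forall k z, S (psi k) z <= psi k.+1 z)%E -> (forall k z, T (psi k) z <= psi k.+1 z)%E ->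
  (forall z, iter n S f z <= iter n T f z + n%:R%:E * psi n z)%E.
Proof.
move=> mf f0 mpsi psi0 psiS fST Sp Tp.
have Snpsi k z : (iter k S (psi 0%N) z <= psi k z)%E.
  elim: k z => [|k IH] z //=; apply: le_trans (Sp k z).
  apply: trans_le => //; by have [] := iter_trans_props ma mb k (mpsi 0%N) (psi0 0%N).
elim: n => [|n IH] z; first by rewrite /= mul0e adde0.
have [mSn Sn0] := iter_trans_props ma mb n mf f0.
have [mTn Tn0] := iter_trans_props ma' mb' n mf f0.
have mTf : mp (T f) by exact: measurable_trans.
have Tf0 : nn (T f) by exact: trans_ge0.
rewrite iterSr; apply: (@le_trans _ _ (iter n S (fun z => T f z + psi 0%N z)%E z)).
  apply: iter_trans_le => //.
  - exact: measurable_trans.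
  - exact: trans_ge0.
  - exact: (emeasurable_funD mTf (mpsi 0%N)).
rewrite iter_trans_add// trans_iter_comm//.
have mnpsi : mp (fun z => n%:R%:E * psi n z)%E.
  by apply: (emeasurable_funM (measurable_cst _)); exact: mpsi.
have h : (T (iter n S f) z <= T (iter n T f) z + n%:R%:E * psi n.+1 z)%E.
  apply: (@le_trans _ _ (T (fun z => iter n T f z + n%:R%:E * psi n z)%E z)).
    by apply: trans_le => //; exact: (emeasurable_funD mTn mnpsi).
  have nnpsi : nn (fun z => n%:R%:E * psi n z)%E by move=> y; apply: mule_ge0; rewrite ?lee_fin//; exact: psi0.
  rewrite trans_add//.
  by rewrite leeD2l// trans_scale// lee_wpmul2l.
apply: le_trans (leeD h (le_trans (Snpsi n z) (psiS n z))) _.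
rewrite -addeA leeD2l// -[in leRHS]natr1 EFinD ge0_muleDl// ?mul1e//.
Qed.

End two_operators.

End translation_operators.

(** * The logistic function as a smoothed step *)

Section logistic.
Context {R : realType}.
Local Notation mR := (measurableTypeR R).

Lemma mvt_le (f f' : R -> R) (B x y : R) : (forall z : R, is_derive z 1 f (f' z)) ->
  (forall z, `|z - x| <= `|y - x| -> `|f' z| <= B) -> `|f y - f x| <= B * `|y - x|.
Proof.
move=> df fB; have cf : continuous f by apply: derivable_continuous => z; have [] := df z.
have [xy|yx] := leP x y.
  have [c cxy ->] := MVT_segment xy (fun z _ => df z) (continuous_subspaceT cf).
  rewrite normrM ler_wpM2r// fB//.
  by move: cxy; rewrite in_itv/= => /andP[c1 c2]; rewrite !ger0_norm ?subr_ge0// lerB.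
have [c cxy e] := MVT_segment (ltW yx) (fun z _ => df z) (continuous_subspaceT cf).
rewrite distrC e normrM (distrC y x) ler_wpM2r// fB//.
move: cxy; rewrite in_itv/= => /andP[c1 c2].
by rewrite distrC (distrC y) !ger0_norm ?subr_ge0// ?lerB// ltW.
Qed.

(** Distribution function of the logistic law. Its derivatives are polynomials in [logi] itself, so
    global bounds on them are elementary; and it will serve both as test function and as law of the
    noise. *)
Definition logi (x : R) : R := (1 + expR (- x))^-1.
Let logi' x := logi x * (1 - logi x).
Let logi'' x := logi x * (1 - logi x) * (1 - 2 * logi x).

Lemma logi_denom (x : R) : 0 < 1 + expR (- x).
Proof. by rewrite addr_gt0 ?expR_gt0. Qed.

Lemma logi_gt0 x : 0 < logi x. Proof. by rewrite invr_gt0 logi_denom. Qed.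

Lemma logi_lt1 x : logi x < 1.
Proof. by rewrite invf_lt1 ?logi_denom// ltrDl expR_gt0. Qed.

Lemma is_derive_logi (x : R) : is_derive x 1 logi (logi x * (1 - logi x)).
Proof.
have d0 : 1 + expR (- x) != 0 by rewrite gt_eqF// logi_denom.
have := @is_deriveV R (fun y : R => 1 + expR (- y)) x _ 1 d0 (ltac:(apply: is_derive_eq)) => dV.
have {dV} := dV _ erefl; move/is_derive_eq; apply; rewrite /GRing.scale/= /logi; by field; rewrite d0.
Qed.

Let dlogi1 (x : R) : is_derive x 1 logi' (logi'' x).
Proof.
have := is_derive_logi x => ?.
by apply: is_derive_eq; rewrite /GRing.scale/= /logi''; ring.
Qed.

Let dlogi2 (x : R) : is_derive x 1 logi'' (logi x * (1 - logi x) * (1 - 6 * logi x + 6 * logi x ^+ 2)).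
Proof.
have := is_derive_logi x => ?.
by apply: is_derive_eq; rewrite /GRing.scale/=; ring.
Qed.

Lemma continuous_logi : continuous logi.
Proof. by apply: derivable_continuous => x; have [] := is_derive_logi x. Qed.

Lemma measurable_logi : measurable_fun [set: mR] (logi : mR -> mR).
Proof. by apply: continuous_measurable_fun; exact: continuous_logi. Qed.

Lemma logi_lip x y : `|logi y - logi x| <= `|y - x|.
Proof.
rewrite -[leRHS]mul1r; apply: mvt_le (is_derive_logi) _ => z _.
have := logi_gt0 z; have := logi_lt1 z; rewrite ler_norml => ? ?; apply/andP; split; nra.
Qed.

Lemma logi_mono x y : x <= y -> logi x <= logi y.
Proof. by move=> xy; rewrite lef_pV2 ?posrE ?logi_denom// lerD2l ler_expR lerN2. Qed.

(** The third derivative is at most 1 in modulus; the mean value inequality is applied three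
    times. *)
Lemma logi_taylor x y :
  `|logi y - logi x - logi x * (1 - logi x) * (y - x)
    - logi x * (1 - logi x) * (1 - 2 * logi x) / 2 * (y - x) ^+ 2| <= `|y - x| ^+ 3.
Proof.
have e2 z : `|logi'' z - logi'' x| <= `|z - x|.
  rewrite -[leRHS]mul1r; apply: mvt_le dlogi2 _ => w _.
  have := logi_gt0 w; have := logi_lt1 w; move: (logi w) => h h0 h1.
  have k0 : 0 <= h * (1 - h) by nra.
  have k1 : h * (1 - h) <= 1 / 4 by have := sqr_ge0 (h - 2^-1); nra.
  rewrite (_ : 1 - 6 * h + 6 * h ^+ 2 = 1 - 6 * (h * (1 - h))); last by ring.
  move: (h * (1 - h)) k0 k1 => k k0 k1.
  rewrite ler_norml; apply/andP; split; nra.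
have e1 z : `|logi' z - logi' x - logi'' x * (z - x)| <= `|z - x| ^+ 2.
  have d (w : R) : is_derive w 1 (fun w => logi' w - logi'' x * (w - x)) (logi'' w - logi'' x).
    have := dlogi1 w => ?.
    by apply: is_derive_eq; rewrite /GRing.scale/=; ring.
  have := @mvt_le _ _ `|z - x| x z d _; rewrite subrr mulr0 subr0 addrAC expr2; apply.
  by move=> w; apply: le_trans.
have d (w : R) : is_derive w 1 (fun w => logi w - logi' x * (w - x) - logi'' x / 2 * (w - x) ^+ 2)
    (logi' w - logi' x - logi'' x * (w - x)).
  have := is_derive_logi w => ?.
  by apply: is_derive_eq; rewrite /GRing.scale/= -/(logi' w); field.
have := @mvt_le _ _ (`|y - x| ^+ 2) x y d _.
rewrite subrr mulr0 subr0 expr0n/= mulr0 subr0 -exprSr => h.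
rewrite -(_ : logi y - logi' x * (y - x) - logi'' x / 2 * (y - x) ^+ 2 - logi x =
  logi y - logi x - logi' x * (y - x) - logi'' x / 2 * (y - x) ^+ 2); last by ring.
apply: h => w hw; apply: le_trans (e1 w) _.
by rewrite ler_pXn2r ?nnegrE.
Qed.

(** A smooth indicator of q < t at scale [eps]; equally, the probability that q plus [eps] times a
    logistic variable falls below t. *)
Definition fstep (eps t q : R) : R := logi ((t - q) / eps).

Lemma fstep_taylor (eps t x : R) : 0 < eps ->
  exists h1 h2, `|h2| <= eps ^- 2 /\
  forall y, `|fstep eps t y - fstep eps t x - h1 * (y - x) - h2 / 2 * (y - x) ^+ 2| <= eps ^- 3 * `|y - x| ^+ 3.
Proof.
move=> e0; have e0' : eps != 0 by rewrite gt_eqF.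
set l := logi ((t - x) / eps).
exists (- (l * (1 - l)) / eps), (l * (1 - l) * (1 - 2 * l) / eps ^+ 2); split.
  rewrite normrM -[leRHS]mul1r [`|eps ^- 2|]ger0_norm ?invr_ge0 ?exprn_ge0 ?(ltW e0)//.
  rewrite ler_wpM2r ?invr_ge0 ?exprn_ge0 ?(ltW e0)//.
  have := logi_gt0 ((t - x) / eps); have := logi_lt1 ((t - x) / eps); rewrite -/l => l1 l0.
  have k0 : 0 <= l * (1 - l) by nra.
  have k1 : l * (1 - l) <= 1 / 4 by have := sqr_ge0 (l - 2^-1); nra.
  by rewrite ler_norml; apply/andP; split; nra.
move=> z; have := logi_taylor ((t - x) / eps) ((t - z) / eps); rewrite -/l -/(fstep _ _ _).
rewrite -![in X in X -> _]mulrBl (_ : t - z - (t - x) = - (z - x)); last by ring.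
rewrite normrM normrN normfV (gtr0_norm e0) exprMn exprVn [X in _ <= X -> _]mulrC => h.
have conv (a b c d : R) : a <= b -> a = c -> b = d -> c <= d by move=> + <- <-.
by apply: conv h _ _; rewrite -?[fstep eps t x]/l; [congr (`|_|)|]; field.
Qed.

End logistic.

(** * Averages over quarter turns *)

Section four_points.
Context {R : realType}.
Local Notation mR := (measurableTypeR R).
Local Notation U01 := (@U01 R).
Local Notation plane := (mR * mR)%type.

Definition sqn (z : plane) : R := z.1 ^+ 2 + z.2 ^+ 2.

(* the average of [f] over the square with centre [z] and vertices [z + r e^(i(a + k pi/2))],
   [(c, s) = (cos a, sin a)] *)
Definition avg4 (f : R -> R) (q r x0 x1 : R) : R :=
  (f (q + (2 * r * x0 + r ^+ 2)) + f (q + (2 * r * x1 + r ^+ 2))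
   + f (q + (- (2 * r * x0) + r ^+ 2)) + f (q + (- (2 * r * x1) + r ^+ 2))) / 4.

(** Arithmetic-geometric mean inequality: it trades the odd absolute moment for the second and the
    fourth, with a free scale [s] meant to be of the order of |d|. *)
Lemma norm3_le (s d : R) : 0 < s -> `|d| ^+ 3 <= (s * d ^+ 2 + d ^+ 4 / s) / 2.
Proof.
move=> s0; have h := sqr_ge0 (s - `|d|).
have -> : d ^+ 4 / s = `|d| ^+ 4 / s by congr (_ / _); rewrite -normrX ger0_norm// -[4%N]/(2 * 2)%N exprM sqr_ge0.
rewrite -[d ^+ 2]real_normK ?num_real//.
have := normr_ge0 d; move: `|d| h => e h e0.
have sn0 : s != 0 by rewrite gt_eqF.
rewrite -subr_ge0 (_ : _ - _ = e ^+ 2 * (s - e) ^+ 2 / s / 2); last by field.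
apply: divr_ge0 => //; apply: divr_ge0; [apply: mulr_ge0; exact: sqr_ge0|exact: ltW].
Qed.

(** The increments of |z|^2 are 2 r x + r^2 with x running over x0, x1, -x0, -x1, so the odd parts
    cancel: the first order averages to r^2 and the second to 2 r^2 |z|^2 + r^4, whatever the
    direction. *)
Lemma avg4_taylor (f : R -> R) (h1 h2 M s q r x0 x1 Q : R) : 0 < s -> 0 <= M ->
  (forall y, `|f y - f q - h1 * (y - q) - h2 / 2 * (y - q) ^+ 2| <= M * `|y - q| ^+ 3) ->
  x0 ^+ 2 + x1 ^+ 2 = Q ->
  `|avg4 f q r x0 x1 - f q - h1 * r ^+ 2 - h2 / 2 * (2 * r ^+ 2 * Q + r ^+ 4)|
   <= M * (s * (2 * r ^+ 2 * Q + r ^+ 4) + (64 * r ^+ 4 * Q ^+ 2 + 8 * r ^+ 8) / s) / 2.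
Proof.
move=> s0 M0 tf xQ.
have tf' d : `|f (q + d) - f q - h1 * d - h2 / 2 * d ^+ 2| <= M * ((s * d ^+ 2 + d ^+ 4 / s) / 2).
  have := tf (q + d); rewrite (addrC q) addrK => /le_trans; apply.
  by rewrite ler_wpM2l// norm3_le.
set d0 := 2 * r * x0 + r ^+ 2; set d1 := 2 * r * x1 + r ^+ 2.
set d2 := - (2 * r * x0) + r ^+ 2; set d3 := - (2 * r * x1) + r ^+ 2.
have E2 : d0 ^+ 2 + d1 ^+ 2 + d2 ^+ 2 + d3 ^+ 2 = 4 * (2 * r ^+ 2 * Q + r ^+ 4).
  by rewrite -xQ /d0 /d1 /d2 /d3; ring.
have E1 : d0 + d1 + d2 + d3 = 4 * r ^+ 2 by rewrite /d0 /d1 /d2 /d3; ring.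
(* From (a + b)^4 <= 8 (a^4 + b^4) and x0^4 + x1^4 <= Q^2. *)
have E4 : d0 ^+ 4 + d1 ^+ 4 + d2 ^+ 4 + d3 ^+ 4 <= 4 * (64 * r ^+ 4 * Q ^+ 2 + 8 * r ^+ 8).
  have p4 (a b : R) : (a + b) ^+ 4 <= 8 * (a ^+ 4 + b ^+ 4).
    have -> : a ^+ 4 = (a ^+ 2) ^+ 2 by rewrite -exprM.
    have -> : b ^+ 4 = (b ^+ 2) ^+ 2 by rewrite -exprM.
    have -> : (a + b) ^+ 4 = ((a + b) ^+ 2) ^+ 2 by rewrite -exprM.
    have h1' : (a + b) ^+ 2 <= 2 * (a ^+ 2 + b ^+ 2) by have := sqr_ge0 (a - b); nra.
    apply: (@le_trans _ _ ((2 * (a ^+ 2 + b ^+ 2)) ^+ 2)).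
      by rewrite ler_pXn2r ?nnegrE ?sqr_ge0// mulr_ge0// addr_ge0 ?sqr_ge0.
    have := sqr_ge0 (a ^+ 2 - b ^+ 2); nra.
  apply: (@le_trans _ _ (8 * ((2 * r * x0) ^+ 4 + (r ^+ 2) ^+ 4) + 8 * ((2 * r * x1) ^+ 4 + (r ^+ 2) ^+ 4) +
    8 * ((- (2 * r * x0)) ^+ 4 + (r ^+ 2) ^+ 4) + 8 * ((- (2 * r * x1)) ^+ 4 + (r ^+ 2) ^+ 4))).
    by rewrite /d0 /d1 /d2 /d3; do !apply: lerD; exact: p4.
  rewrite -xQ -subr_ge0.
  rewrite (_ : _ - _ = 512 * (r ^+ 2 * (x0 * x1)) ^+ 2); last by ring.
  by apply: mulr_ge0; [exact: ler0n|exact: sqr_ge0].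
have := lerD (lerD (lerD (tf' d0) (tf' d1)) (tf' d2)) (tf' d3).
move/(le_trans (le_trans (ler_normD _ _) (lerD (le_trans (ler_normD _ _) (lerD (ler_normD _ _) (lexx _))) (lexx _)))).
have -> : f (q + d0) - f q - h1 * d0 - h2 / 2 * d0 ^+ 2 +
   (f (q + d1) - f q - h1 * d1 - h2 / 2 * d1 ^+ 2) +
   (f (q + d2) - f q - h1 * d2 - h2 / 2 * d2 ^+ 2) +
   (f (q + d3) - f q - h1 * d3 - h2 / 2 * d3 ^+ 2) =
   4 * (avg4 f q r x0 x1 - f q - h1 * r ^+ 2 - h2 / 2 * (2 * r ^+ 2 * Q + r ^+ 4)).
  transitivity (f (q + d0) + f (q + d1) + f (q + d2) + f (q + d3) - 4 * f q
     - h1 * (d0 + d1 + d2 + d3) - h2 / 2 * (d0 ^+ 2 + d1 ^+ 2 + d2 ^+ 2 + d3 ^+ 2)); first by ring.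
  by rewrite E1 E2 /avg4 -/d0 -/d1 -/d2 -/d3; field.
rewrite normrM [`|4|]ger0_norm// => h.
have : M * (s * (d0 ^+ 2 + d1 ^+ 2 + d2 ^+ 2 + d3 ^+ 2) + (d0 ^+ 4 + d1 ^+ 4 + d2 ^+ 4 + d3 ^+ 4) / s) / 2
   <= M * (s * (4 * (2 * r ^+ 2 * Q + r ^+ 4)) + (4 * (64 * r ^+ 4 * Q ^+ 2 + 8 * r ^+ 8)) / s) / 2.
  rewrite E2 ler_pdivlMr// mulfVK// ler_wpM2l// lerD2l ler_wpM2r// invr_ge0 ltW//.
move=> h'; rewrite -(@ler_pM2l _ 4)//; apply: le_trans h _.
have sn0 : s != 0 by rewrite gt_eqF.
by apply: (le_trans _ (le_trans h' _)); rewrite le_eqVlt; apply/orP; left; apply/eqP; field.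
Qed.

(** For quadratic functions the average is exact; this gives the growth of the error majorants along
    the walk. *)
Lemma avg4_lin (f : R -> R) (k b : R) (q r x0 x1 Q : R) : x0 ^+ 2 + x1 ^+ 2 = Q ->
  avg4 (fun q => q ^+ 2 + k * q + b) q r x0 x1 =
  q ^+ 2 + 2 * q * r ^+ 2 + 2 * r ^+ 2 * Q + r ^+ 4 + k * (q + r ^+ 2) + b.
Proof. by move=> <-; rewrite /avg4; field. Qed.

End four_points.

(** * One step of a rotation-invariant walk *)

Section polar_steps.
Context {R : realType}.
Local Notation mR := (measurableTypeR R).
Local Notation U01 := (@U01 R).
Local Notation plane := (mR * mR)%type.

Lemma ecos_quarter (v : R) : ecos (v + 4^-1) = - esin v :> R.
Proof. by rewrite ecosD ecos14.1 ecos14.2; ring. Qed.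
Lemma esin_quarter (v : R) : esin (v + 4^-1) = ecos v :> R.
Proof. by rewrite esinD ecos14.1 ecos14.2; ring. Qed.
Lemma ecos_half (v : R) : ecos (v + 2^-1) = - ecos v :> R.
Proof. by rewrite ecosD ecos12.1 ecos12.2; ring. Qed.
Lemma esin_half (v : R) : esin (v + 2^-1) = - esin v :> R.
Proof. by rewrite esinD ecos12.1 ecos12.2; ring. Qed.

Section one_radius.
Variable r : R -> R.
Hypothesis mr : measurable_fun [set: mR] (r : mR -> mR).
Hypothesis r2 : (\int[U01]_u (r u ^+ 2)%:E = 1)%E.
Hypothesis er2 : (\int[U01]_u (expR (r u ^+ 2 / 2))%:E <= 2%:E)%E.

Definition pcos (w : R) : R := r (lft w) * ecos (rgt w).
Definition psin (w : R) : R := r (lft w) * esin (rgt w).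

Lemma measurable_pcos : measurable_fun [set: mR] (pcos : mR -> mR).
Proof.
apply: measurable_funM; first exact: (measurable_comp1 mr (measurable_lft)).
exact: (measurable_comp1 measurable_ecos measurable_rgt).
Qed.

Lemma measurable_psin : measurable_fun [set: mR] (psin : mR -> mR).
Proof.
apply: measurable_funM; first exact: (measurable_comp1 mr (measurable_lft)).
exact: (measurable_comp1 measurable_esin measurable_rgt).
Qed.

Lemma trans_polar (f : plane -> \bar R) z : mp f -> nn f ->
  (trans pcos psin f z = \int[U01]_u \int[U01]_v f (z.1 + r u * ecos v, z.2 + r u * esin v)%R)%E.
Proof.
move=> mf f0; rewrite /trans /pcos /psin.
rewrite (@split_integral _ (fun t : mR * mR => f (z.1 + r t.1 * ecos t.2, z.2 + r t.1 * esin t.2)))//.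
apply: (measurableT_comp mf); apply: measurable_fun_pair; apply: measurable_funD => //; apply: measurable_funM.
- exact: (measurable_comp1 mr).
- exact: (measurable_comp1 measurable_ecos).
- exact: (measurable_comp1 mr).
- exact: (measurable_comp1 measurable_esin).
Qed.

(** The integral over a full turn is invariant under quarter shifts; this is how the averages over
    four points enter. *)
Lemma quarter_turns (g : mR -> \bar R) : measurable_fun setT g -> (forall v, 0 <= g v)%E ->
  (forall v, g (v + 1)%R = g v) ->
  (\int[U01]_v g v = \int[U01]_v (4^-1%:E * (g v + g (v + 4^-1)%R + g (v + 2^-1)%R + g (v + 2^-1 + 4^-1)%R)))%E.
Proof.
move=> mg g0 g1.
have ms (t : R) : measurable_fun [set: mR] (fun v : mR => g (v + t)).
  by apply: (measurableT_comp mg); apply: measurable_funD.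
have is_ (t : R) : (\int[U01]_v g (v + t)%R = \int[U01]_v g v)%E by exact: shift_integral.
have ms3 : measurable_fun [set: mR] (fun v : mR => g (v + 2^-1 + 4^-1)).
  by under eq_fun do rewrite -addrA; exact: ms.
have m2 : measurable_fun [set: mR] (fun v : mR => g v + g (v + 4^-1)%R)%E by exact: emeasurable_funD.
have m3 : measurable_fun [set: mR] (fun v : mR => g v + g (v + 4^-1)%R + g (v + 2^-1)%R)%E by exact: emeasurable_funD.
rewrite ge0_integralZl//; last 2 first.
- exact: emeasurable_funD.
- by move=> v _; rewrite !adde_ge0.
rewrite (ge0_integralD U01 measurableT (fun v _ => adde_ge0 (adde_ge0 (g0 _) (g0 _)) (g0 _)) m3 (fun v _ => g0 _) ms3).
rewrite (ge0_integralD U01 measurableT (fun v _ => adde_ge0 (g0 _) (g0 _)) m2 (fun v _ => g0 _) (ms _)).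
rewrite (ge0_integralD U01 measurableT (fun v _ => g0 _) mg (fun v _ => g0 _) (ms _)).
under [X in (_ * (_ + X))%E]eq_integral do rewrite -addrA.
rewrite !is_; have : (0 <= \int[U01]_v g v)%E by exact: integral_ge0.
case: (\int[U01]_v g v)%E => [x| |]//=; last by rewrite !addye// mulry gtr0_sg ?mul1e// invr_gt0.
by move=> _; rewrite -!EFinD -EFinM; congr EFin; field.
Qed.

Let mr2 : measurable_fun [set: mR] (fun u : mR => (r u ^+ 2)%:E).
Proof. by apply/measurable_EFinP; apply: measurable_funX. Qed.

Let me : measurable_fun [set: mR] (fun u : mR => (expR (r u ^+ 2 / 2))%:E).
Proof.
apply/measurable_EFinP; apply: (measurableT_comp (@measurable_expR R)).
by apply: measurable_funM => //; exact: measurable_funX.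
Qed.

Let mZ (c : R) (f : mR -> \bar R) : measurable_fun setT f -> measurable_fun setT (fun u => (c%:E * f u)%E).
Proof. by move=> mf; apply: (emeasurable_funM (measurable_cst _) mf). Qed.

Let Z2 (c : R) : 0 <= c -> (\int[U01]_u (c%:E * (r u ^+ 2)%:E) = c%:E)%E.
Proof.
by move=> c0; rewrite (ge0_integralZl U01 measurableT mr2 (fun u _ => sqr_ge0 (r u)) (_ : (0 <= c%:E)%E))// r2 mule1.
Qed.

Let Ze (c : R) : 0 <= c -> (\int[U01]_u (c%:E * (expR (r u ^+ 2 / 2))%:E) <= (2 * c)%:E)%E.
Proof.
move=> c0; rewrite (ge0_integralZl U01 measurableT me (fun u _ => expR_ge0 _) (_ : (0 <= c%:E)%E))//.
by rewrite mulrC EFinM; apply: lee_wpmul2l; rewrite ?lee_fin.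
Qed.

(** The linear coefficient of a Taylor expansion may be negative. Its negative part [cm] stays on
    the left, so that only nonnegative integrals are added and none is subtracted. *)
Lemma weighted_le (I : mR -> \bar R) (h cp cm K : R) : measurable_fun [set: mR] I ->
  (forall u, 0 <= I u)%E -> 0 <= h -> 0 <= cp -> 0 <= cm -> 0 <= K ->
  (forall u, I u + (cm * r u ^+ 2)%:E <= (h + cp * r u ^+ 2 + K * expR (r u ^+ 2 / 2))%:E)%E ->
  (\int[U01]_u I u + cm%:E <= (h + cp + 2 * K)%:E)%E.
Proof.
move=> mI I0 h0 cp0 cm0 K0 IK.
rewrite -[cm%:E](Z2 cm0) -ge0_integralD//; last 2 first.
- by move=> u _; rewrite -EFinM lee_fin mulr_ge0// sqr_ge0.
- exact: mZ.
apply: (@le_trans _ _ (\int[U01]_u (h%:E + cp%:E * (r u ^+ 2)%:E + K%:E * (expR (r u ^+ 2 / 2))%:E)))%E.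
  apply: ge0_le_integral => //.
  - by move=> u _; apply: adde_ge0 => //; rewrite -EFinM lee_fin mulr_ge0// sqr_ge0.
  - by apply: emeasurable_funD => //; exact: mZ.
  - by apply: emeasurable_funD; [apply: emeasurable_funD => //|]; exact: mZ.
rewrite ge0_integralD//; last 4 first.
- by move=> u _; rewrite -!EFinM -!EFinD lee_fin !addr_ge0// mulr_ge0 ?sqr_ge0 ?expR_ge0.
- by apply: emeasurable_funD => //; exact: mZ.
- by move=> u _; rewrite -!EFinM lee_fin mulr_ge0 ?expR_ge0.
- exact: mZ.
rewrite ge0_integralD//; last 2 first.
- by move=> u _; rewrite -!EFinM lee_fin mulr_ge0 ?sqr_ge0.
- exact: mZ.
by rewrite integral_cst_prob Z2// !EFinD; apply: leeD => //; exact: Ze.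
Qed.

Lemma weighted_ge (I : mR -> \bar R) (h cp cm K : R) : measurable_fun [set: mR] I ->
  (forall u, 0 <= I u)%E -> 0 <= h -> 0 <= cp -> 0 <= cm -> 0 <= K ->
  (forall u, (h + cp * r u ^+ 2)%:E <= I u + (cm * r u ^+ 2 + K * expR (r u ^+ 2 / 2))%:E)%E ->
  ((h + cp)%:E <= \int[U01]_u I u + (cm + 2 * K)%:E)%E.
Proof.
move=> mI I0 h0 cp0 cm0 K0 IK.
apply: (@le_trans _ _ (\int[U01]_u (I u + (cm%:E * (r u ^+ 2)%:E + K%:E * (expR (r u ^+ 2 / 2))%:E))))%E; last first.
  rewrite ge0_integralD//; last 2 first.
  - by move=> u _; rewrite -!EFinM -!EFinD lee_fin addr_ge0// mulr_ge0 ?sqr_ge0 ?expR_ge0.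
  - by apply: emeasurable_funD => //; exact: mZ.
  rewrite ge0_integralD//; last 4 first.
  - by move=> u _; rewrite -!EFinM lee_fin mulr_ge0 ?sqr_ge0.
  - exact: mZ.
  - by move=> u _; rewrite -!EFinM lee_fin mulr_ge0 ?expR_ge0.
  - exact: mZ.
  by rewrite Z2// EFinD !leeD2l//; exact: Ze.
rewrite EFinD -[in leLHS](Z2 cp0) -[h%:E](integral_cst_prob U01) -ge0_integralD//; last 2 first.
- by move=> u _; rewrite -EFinM lee_fin mulr_ge0// sqr_ge0.
- exact: mZ.
apply: ge0_le_integral => //.
- by move=> u _; rewrite -!EFinM -!EFinD lee_fin !addr_ge0// mulr_ge0 ?sqr_ge0.
- by apply: emeasurable_funD => //; exact: mZ.
- by apply: emeasurable_funD => //; apply: emeasurable_funD; exact: mZ.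
- by move=> u _; exact: IK.
Qed.

Section radial.
Variables (g : R -> R) (z : plane).
Hypotheses (mg : measurable_fun [set: mR] (g : mR -> mR)) (g0 : forall q, 0 <= g q).
Let x0 (v : R) : R := z.1 * ecos v + z.2 * esin v.
Let x1 (v : R) : R := z.2 * ecos v - z.1 * esin v.

Lemma radial_coord v : x0 v ^+ 2 + x1 v ^+ 2 = sqn z.
Proof.
transitivity (sqn z * (ecos v ^+ 2 + esin v ^+ 2)); last by rewrite ecos2Desin2 mulr1.
by rewrite /x0 /x1 /sqn; ring.
Qed.

Let f : plane -> \bar R := fun z => (g (sqn z))%:E.

Lemma measurable_sqn_comp : mp f.
Proof.
apply/measurable_EFinP; apply: (measurableT_comp mg).
by apply: measurable_funD; apply: measurable_funX.
Qed.

Let J u v : R := avg4 g (sqn z) (r u) (x0 v) (x1 v).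

Lemma trans_avg4 : trans pcos psin f z = (\int[U01]_u \int[U01]_v (J u v)%:E)%E.
Proof.
have mf := measurable_sqn_comp; have f0 : nn f by move=> y; rewrite lee_fin.
rewrite (trans_polar _ mf f0); apply: eq_integral => u _.
rewrite quarter_turns//; last 2 first.
- apply: (measurableT_comp mf); apply: measurable_fun_pair; apply: measurable_funD => //; apply: measurable_funM => //.
  exact: measurable_ecos.
  exact: measurable_esin.
- by move=> v; rewrite ecos1 esin1.
apply: eq_integral => v _; rewrite /f -!EFinD -EFinM; congr EFin; rewrite /J.
rewrite !ecos_quarter !esin_quarter !ecos_half !esin_half /avg4 mulrC; congr (_ / _).
rewrite /sqn/=; have cs : ecos v ^+ 2 = 1 - esin v ^+ 2 by rewrite -(ecos2Desin2 v) addrK.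
congr (g _ + g _ + g _ + g _); rewrite /x0 /x1; ring: cs.
Qed.

Let J0 u v : 0 <= J u v.
Proof. by rewrite /J /avg4 divr_ge0// !addr_ge0. Qed.

Let mJ : measurable_fun [set: mR * mR] (fun t : mR * mR => (J t.1 t.2)%:E).
Proof.
have mx0 : measurable_fun [set: (mR * mR)%type] (fun t : mR * mR => x0 t.2 : mR).
  apply: measurable_funD; apply: measurable_funM => //.
  exact: (measurable_comp1 measurable_ecos).
  exact: (measurable_comp1 measurable_esin).
have mx1 : measurable_fun [set: (mR * mR)%type] (fun t : mR * mR => x1 t.2 : mR).
  apply: measurable_funB; apply: measurable_funM => //.
  exact: (measurable_comp1 measurable_ecos).
  exact: (measurable_comp1 measurable_esin).
have mrt : measurable_fun [set: (mR * mR)%type] (fun t : mR * mR => r t.1 : mR).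
  exact: (measurable_comp1 mr).
have mh (x : mR * mR -> R) : measurable_fun [set: (mR * mR)%type] (x : mR * mR -> mR) ->
    measurable_fun [set: (mR * mR)%type] (fun t => g (sqn z + (x t + r t.1 ^+ 2)) : mR).
  move=> mx; apply: (measurableT_comp mg); apply: measurable_funD => //.
  by apply: measurable_funD => //; exact: measurable_funX.
have m2 (x : mR * mR -> R) : measurable_fun [set: (mR * mR)%type] (x : mR * mR -> mR) ->
    measurable_fun [set: (mR * mR)%type] (fun t => 2 * r t.1 * x t : mR).
  by move=> mx; apply: measurable_funM => //; apply: measurable_funM.
apply/measurable_EFinP; apply: measurable_funM => //.
apply: measurable_funD; [apply: measurable_funD; [apply: measurable_funD|]|]; apply: mh.
- exact: m2.
- exact: m2.
- by apply: measurableT_comp => //; exact: m2.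
- by apply: measurableT_comp => //; exact: m2.
Qed.

Let mJu u : measurable_fun [set: mR] (fun v : mR => (J u v)%:E).
Proof. exact: (measurable_fun_pair2 u mJ). Qed.

Let mI : measurable_fun [set: mR] (fun u => \int[U01]_v (J u v)%:E)%E.
Proof.
by apply: (measurable_fun_fubini_tonelli_F (fun t : mR * mR => (J t.1 t.2)%:E)) => // t; rewrite lee_fin.
Qed.

Let I0 u : (0 <= \int[U01]_v (J u v)%:E)%E.
Proof. by apply: integral_ge0 => v _; rewrite lee_fin. Qed.

Lemma radial_step (h cp cm K : R) : 0 <= h -> 0 <= cp -> 0 <= cm -> 0 <= K ->
  (forall s x0 x1 : R, x0 ^+ 2 + x1 ^+ 2 = sqn z ->
    avg4 g (sqn z) s x0 x1 + cm * s ^+ 2 <= h + cp * s ^+ 2 + K * expR (s ^+ 2 / 2)) ->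
  (trans pcos psin f z + cm%:E <= (h + cp + 2 * K)%:E)%E.
Proof.
move=> h0 cp0 cm0 K0 H; rewrite trans_avg4; apply: weighted_le => // u.
set A := h + _ + _.
apply: (@le_trans _ _ ((A - cm * r u ^+ 2)%:E + (cm * r u ^+ 2)%:E)%E); last by rewrite -EFinD subrK.
apply: leeD => //; rewrite -[leRHS](integral_cst_prob U01); apply: ge0_le_integral => //.
- by move=> v _; rewrite lee_fin.
- by move=> v _; rewrite lee_fin lerBrDr H// radial_coord.
Qed.

Lemma radial_step_ge (h cp cm K : R) : 0 <= h -> 0 <= cp -> 0 <= cm -> 0 <= K ->
  (forall s x0 x1 : R, x0 ^+ 2 + x1 ^+ 2 = sqn z ->
    h + cp * s ^+ 2 <= avg4 g (sqn z) s x0 x1 + cm * s ^+ 2 + K * expR (s ^+ 2 / 2)) ->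
  ((h + cp)%:E <= trans pcos psin f z + (cm + 2 * K)%:E)%E.
Proof.
move=> h0 cp0 cm0 K0 H; rewrite trans_avg4; apply: weighted_ge => // u.
set A := cm * _ + _.
suff : ((h + cp * r u ^+ 2 - A)%:E <= \int[U01]_v (J u v)%:E)%E.
  by move=> ?; rewrite -leeBlDr//.
(* The lower bound may be negative; its positive part is integrated instead, as the integrand is
   nonnegative. *)
apply: (@le_trans _ _ (Num.max 0 (h + cp * r u ^+ 2 - A))%:E); first by rewrite lee_fin le_max lexx orbT.
rewrite -[leLHS](integral_cst_prob U01); apply: ge0_le_integral => //.
- by move=> v _; rewrite lee_fin le_max lexx.
- move=> v _; rewrite lee_fin ge_max J0/= lerBlDr /A addrA.
  by apply: H; exact: radial_coord.
Qed.

End radial.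
End one_radius.
End polar_steps.

Ltac nonneg := repeat first [assumption | exact: ler01 | exact: ler0n | apply: ltW; assumption | exact: sqr_ge0
  | exact: normr_ge0 | exact: expR_ge0 | apply: sqrtr_ge0 | apply: addr_ge0 | apply: mulr_ge0 | apply: exprn_ge0
  | (rewrite invr_ge0)].

(** * Comparison of the circular walk with the Gaussian walk *)

Section clt.
Context {R : realType}.
Local Notation mR := (measurableTypeR R).
Local Notation U01 := (@U01 R).
Local Notation plane := (mR * mR)%type.

Lemma measurable_abs : measurable_fun [set: mR] (fun x : mR => `|x| : mR).
Proof. by apply: continuous_measurable_fun; exact: norm_continuous. Qed.

(** Single terms of the exponential series in s^2 / 2; 8 is 2^2 2! and 384 is 2^4 4!. *)
Lemma exp_half_bounds (s : R) (E := expR (s ^+ 2 / 2)) :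
  [/\ s ^+ 2 <= 2 * E, s ^+ 4 <= 8 * E & s ^+ 8 <= 384 * E].
Proof.
have h0 : 0 <= s ^+ 2 / 2 by rewrite divr_ge0// sqr_ge0.
have h1 := expR_ge1Dxn 0 h0; have h2 := expR_ge1Dxn 1 h0; have h4 := expR_ge1Dxn 3 h0.
rewrite -/E in h1 h2 h4.
have e4 : s ^+ 4 = (s ^+ 2) ^+ 2 by rewrite -exprM.
have e8 : s ^+ 8 = (s ^+ 2) ^+ 4 by rewrite -exprM.
rewrite e4 e8; move: h1 h2 h4; rewrite !expr_div_n [1`!]factS fact0 !factS fact0 /=.
move: (s ^+ 2) => v; rewrite expr1 => h1 h2 h4.
by split; lra.
Qed.

(** Steps with uniform direction and equal second moments are compared. The exponential moment
    controls the higher ones; 2 is its exact value when r^2 is exponential. *)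
Definition polar_radius (r : R -> R) := [/\ measurable_fun [set: mR] (r : mR -> mR),
  (\int[U01]_u (r u ^+ 2)%:E = 1)%E & (\int[U01]_u (expR (r u ^+ 2 / 2))%:E <= 2%:E)%E].

Lemma polar_radius1 : polar_radius (fun _ => 1).
Proof.
split; first exact: measurable_cst.
  by rewrite expr1n integral_cst_prob.
rewrite integral_cst_prob lee_fin expr1n mul1r.
have := expR_ge1Dx (- 2^-1 : R); rewrite expRN.
have := expR_gt0 (2^-1 : R); move: (expR _) => e e0 h.
by move: h; rewrite -(ler_pM2r e0) mulVf ?gt_eqF//; lra.
Qed.

Lemma expo_sqrt (u : R) : 0 < u < 1 -> Num.sqrt (expo u) ^+ 2 = expo u.
Proof. by move=> u01; rewrite sqr_sqrtr// ltW// expo_gt0. Qed.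

(** With this radius and a uniform angle the step is a complex Gaussian of mean square 1. *)
Lemma polar_radius_expo : polar_radius (fun u => Num.sqrt (expo u)).
Proof.
have mr : measurable_fun [set: mR] (fun u : mR => Num.sqrt (expo u) : mR).
  by apply: (measurableT_comp measurable_sqrt); exact: measurable_expo.
split => //.
  transitivity (\int[U01]_u (`|expo u|)%:E)%E.
    apply: eq_U01_integral.
    - by apply/measurable_EFinP; exact: measurable_funX.
    - by move=> u; rewrite lee_fin sqr_ge0.
    - by apply/measurable_EFinP; apply: measurableT_comp => //; exact: measurable_expo.
    - by move=> u; rewrite lee_fin.
    - by move=> u u01; rewrite expo_sqrt// gtr0_norm// expo_gt0.
  rewrite (@expo_integral _ (fun s => (`|s|)%:E)); last 2 first.
  - by apply/measurable_EFinP; exact: measurable_abs.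
  - by move=> u; rewrite lee_fin.
  transitivity (\int[@lebesgue_measure R]_(s in `[0%R, +oo[) (s * expR (- s))%:E)%E.
    apply: eq_integral => s; rewrite in_setE/= in_itv/= andbT => s0.
    by rewrite ger0_norm// -EFinM.
  apply: etrans (@ge0_FTC_tail R (fun s => s * expR (- s)) (fun s => - ((s + 1) * expR (- s))) 0 0 _ _ _ _) _; last first.
  - by rewrite oppr0 expR0 add0r mulr1 opprK add0r.
  - have h : (s + 1) * expR (- s) @[s --> +oo%R] --> (0:R).
      apply: (@squeeze_cvgr _ _ _ _ (fun=> 0) (fun s => 2 * expR (- (2^-1 * s)))).
      + near=> s; have ? : 0 <= s by near: s; apply: nbhs_pinfty_ge; rewrite num_real.
        apply/andP; split; first by rewrite mulr_ge0 ?expR_ge0// addr_ge0.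
        have -> : expR (- s) = expR (- (2^-1 * s)) * expR (- (2^-1 * s)) by rewrite -expRD; congr expR; field.
        rewrite mulrA ler_wpM2r ?expR_ge0//.
        have := expR_ge1Dx (2^-1 * s); rewrite expRN.
        have := expR_gt0 (2^-1 * s); move: (expR _) => e e0 h.
        rewrite ler_pdivrMr//; lra.
      + exact: cvg_cst.
      + rewrite -[X in _ --> X](mulr0 2); apply: cvgMr; exact: expRN_cvg.
    by rewrite -[X in _ --> X]oppr0; exact: cvgN h.
  - apply: derivable_continuous => y; exact: ex_derive.
  - by move=> s s0; rewrite mulr_ge0// expR_ge0.
  - by move=> s; apply: is_derive_eq; rewrite /GRing.scale/=; ring.
rewrite le_eqVlt; apply/orP; left; apply/eqP.
transitivity (\int[U01]_u (expR (expo u / 2))%:E)%E.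
  have m2 : measurable_fun [set: mR] (fun u : mR => expR (u / 2) : mR).
    by apply: (measurableT_comp (@measurable_expR R)); exact: measurable_funM.
  apply: eq_U01_integral.
  - by apply/measurable_EFinP; apply: (measurable_comp1 m2); exact: measurable_funX.
  - by move=> u; rewrite lee_fin expR_ge0.
  - by apply/measurable_EFinP; apply: (measurable_comp1 m2); exact: measurable_expo.
  - by move=> u; rewrite lee_fin expR_ge0.
  - by move=> u u01; rewrite expo_sqrt.
rewrite (@expo_integral _ (fun s => (expR (s / 2))%:E)); last 2 first.
- apply/measurable_EFinP; apply: (measurableT_comp (@measurable_expR R)); exact: measurable_funM.
- by move=> u; rewrite lee_fin expR_ge0.
transitivity (\int[@lebesgue_measure R]_(s in `[0%R, +oo[) (2%:E * (2^-1 * expR (- (2^-1 * s)))%:E))%E.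
  by apply: eq_integral => s _; rewrite -!EFinM mulrA divff// mul1r -expRD; congr (expR _)%:E; field.
have me : measurable_fun [set: mR] (fun s : mR => (2^-1 * expR (- (2^-1 * s)))%:E).
  apply/measurable_EFinP; apply: measurable_funM => //; apply: (measurableT_comp (@measurable_expR R)).
  by apply: measurableT_comp => //; exact: mulrl_measurable.
rewrite ge0_integralZl//; last exact: measurable_funTS.
by rewrite expRN_tail// mulr0 oppr0 expR0 mule1.
Unshelve. all: by end_near. Qed.

Section comparison.
Variables (r r' : R -> R) (g : R -> R) (n : nat) (M c : R).
Hypotheses (Hr : polar_radius r) (Hr' : polar_radius r') (n0 : (0 < n)%N).
Hypotheses (mg : measurable_fun [set: mR] (g : mR -> mR)) (g0 : forall q, 0 <= g q) (M0 : 0 <= M).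
(** Kept symbolic in the algebra below. The value dominates the constant part 4 + 1536 + 4 of the
    remainder bounds, and the coefficients 2 and 256 of the other parts. *)
Hypothesis c1600 : c = 1600.
Hypothesis tg : forall x, exists h1 h2, `|h2| <= M /\
  forall y, `|g y - g x - h1 * (y - x) - h2 / 2 * (y - x) ^+ 2| <= M * `|y - x| ^+ 3.

Let N : R := n%:R.
Let s := Num.sqrt N.
(** Error of one step, of order N^(-3/2), so that N steps cost N^(-1/2). *)
Let D : R := c * M / (s * N).
Let gn q := g (q / N).

Let N1 : 1 <= N. Proof. by rewrite /N ler1n. Qed.
Let sN : s ^+ 2 = N. Proof. by rewrite sqr_sqrtr// (le_trans ler01). Qed.
Let s1 : 1 <= s. Proof. by rewrite -sqrtr1 ler_sqrt// (lt_le_trans ltr01). Qed.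
Let N0 : 0 < N. Proof. by rewrite (lt_le_trans ltr01). Qed.
Let s0 : 0 < s. Proof. by rewrite (lt_le_trans ltr01). Qed.
Let D0 : 0 <= D.
Proof. rewrite /D c1600; nonneg. Qed.

(** The coefficient [k] of t^2 depends on [q] alone. Both radii have second moment 1, so it
    contributes equally to both walks and only the remainder separates them. *)
Let taylor_gn q : exists k, forall t x0 x1 Q, x0 ^+ 2 + x1 ^+ 2 = Q -> Q = q ->
  `|avg4 gn q t x0 x1 - gn q - k * t ^+ 2| <= D * (1 + q / N + (q / N) ^+ 2) * expR (t ^+ 2 / 2).
Proof.
have N0' : N != 0 by rewrite gt_eqF.
have [h1 [h2 [h2M T]]] := tg (q / N).
(* The second summand is the share 2 t^2 q of the second-order average; its companion t^4 goes into
   the remainder. *)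
exists (h1 / N + h2 / N ^+ 2 * q) => t x0 x1 Q xQ Qq.
have q0 : 0 <= q by rewrite -Qq -xQ addr_ge0 ?sqr_ge0.
have MN : 0 <= M / N ^+ 3 by rewrite divr_ge0// exprn_ge0// (le_trans ler01).
have tn y : `|gn y - gn q - (h1 / N) * (y - q) - (h2 / N ^+ 2) / 2 * (y - q) ^+ 2| <= M / N ^+ 3 * `|y - q| ^+ 3.
  have := T (y / N); rewrite -mulrBl normrM [`|N^-1|]ger0_norm; last by rewrite invr_ge0 (le_trans ler01).
  have conv (u v w x : R) : u <= v -> u = w -> v = x -> w <= x by move=> + <- <-.
  by move=> h; apply: conv h _ _; [congr (`|_|)|]; rewrite /gn; field.
have := avg4_taylor t s0 MN tn xQ; rewrite Qq => h.
have [b1 b2 b4] := exp_half_bounds t; set E := expR _ in b1 b2 b4 *.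
have -> : avg4 gn q t x0 x1 - gn q - (h1 / N + h2 / N ^+ 2 * q) * t ^+ 2 =
  (avg4 gn q t x0 x1 - gn q - h1 / N * t ^+ 2 - h2 / N ^+ 2 / 2 * (2 * t ^+ 2 * q + t ^+ 4)) + h2 / N ^+ 2 / 2 * t ^+ 4.
  by field.
apply: le_trans (ler_normD _ _) _.
have h3 : `|h2 / N ^+ 2 / 2 * t ^+ 4| <= M / N ^+ 2 / 2 * t ^+ 4.
  have p0 : 0 <= N ^- 2 / 2 * t ^+ 4 by rewrite (exprM t 2 2); nonneg.
  by rewrite -!mulrA normrM ler_pM// mulrA ger0_norm.
apply: le_trans (lerD h h3) _.
have E0 : 0 < E := expR_gt0 _.
set p := q / N; have p0 : 0 <= p by rewrite divr_ge0// (le_trans ler01).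
have qp : q = p * N by rewrite /p divfK.
have e8 : t ^+ 8 = (t ^+ 4) ^+ 2 by rewrite -exprM.
have t20 := sqr_ge0 t.
have t40 : 0 <= t ^+ 4 by rewrite (exprM t 2 2) sqr_ge0.
move: (t ^+ 2) (t ^+ 4) (t ^+ 8) t20 t40 b1 b2 b4 {h h3 tn T e8} => v v2 v4 v0 v20 b1 b2 b4.
have sn0 : s != 0 by rewrite gt_eqF.
rewrite [leLHS](_ : _ = M / (s * N) * (p * v + v2 / (2 * N) + 32 * v2 * p ^+ 2 + 4 * v4 / N ^+ 2 + s * v2 / (2 * N))); last first.
  by rewrite qp -sN; field.
rewrite [leRHS](_ : _ = M / (s * N) * (c * (1 + p + p ^+ 2) * E)); last by rewrite /D; ring.
rewrite ler_wpM2l//; first by rewrite divr_ge0// mulr_ge0 ?(ltW s0)// (le_trans ler01).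
have i1 : v2 / (2 * N) <= 4 * E.
  rewrite ler_pdivrMr; last by rewrite mulr_gt0// (lt_le_trans ltr01).
  by have := ler_peMr (ltW E0) N1; lra.
have i2 : 4 * v4 / N ^+ 2 <= 1536 * E.
  rewrite ler_pdivrMr; last by rewrite exprn_gt0// (lt_le_trans ltr01).
  by have := ler_peMr (ltW E0) (exprn_ege1 2 N1); lra.
have i3 : s * v2 / (2 * N) <= 4 * E.
  rewrite ler_pdivrMr; last by rewrite mulr_gt0// (lt_le_trans ltr01).
  have sleN : s <= N by rewrite -sN expr2 ler_peMl// ltW.
  by have := ler_pM (ltW s0) v20 sleN b2; lra.
have i4 : p * v <= p * (2 * E) by rewrite ler_wpM2l.
have i5 : 32 * v2 * p ^+ 2 <= 32 * (8 * E) * p ^+ 2 by rewrite ler_wpM2r ?sqr_ge0// ler_wpM2l.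
have i6 : 0 <= p ^+ 2 * E by rewrite mulr_ge0 ?sqr_ge0// ltW.
have i7 : 0 <= p * E by rewrite mulr_ge0// ltW.
rewrite c1600; lra.
Qed.

(** Bound for the one-step error averaged over [k] further steps, that is, for the growth of the
    moments of |z|^2; the term 18 k^2 absorbs the bound 16 on the fourth moment of a radius and the
    cross terms. *)
Let psi (k : nat) (z : plane) : \bar R :=
  (4 * D * (1 + (sqn z + k%:R) / N + (sqn z ^+ 2 + 4 * k%:R * sqn z + 18 * k%:R ^+ 2) / N ^+ 2))%:E.

Let f : plane -> \bar R := fun z => (gn (sqn z))%:E.
Let S := trans (pcos r) (psin r).
Let T := trans (pcos r') (psin r').

Let mgn : measurable_fun [set: mR] (gn : mR -> mR).
Proof. by apply: (measurableT_comp mg); exact: measurable_funM. Qed.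

Let sqn0 (z : plane) : 0 <= sqn z. Proof. by rewrite addr_ge0// sqr_ge0. Qed.

Let step z : (S f z <= T f z + psi 0 z)%E.
Proof.
have [mr r2 er2] := Hr; have [mr' r2' er2'] := Hr'.
have [k kP] := taylor_gn (sqn z); set K := D * _ in kP.
have K0 : 0 <= K.
  have ? := sqn0 z; rewrite /K; nonneg.
(* The coefficient of t^2 is split into its positive and negative parts, one for each side of the
   inequalities. *)
pose kp := Num.max k 0; pose km := Num.max (- k) 0.
have kpm : k = kp - km by rewrite /kp /km; have [h|/ltW h] := leP k 0; [rewrite max_l ?sub0r ?opprK// oppr_ge0|rewrite max_r ?subr0// oppr_le0].
have kp0 : 0 <= kp by rewrite le_max lexx orbT.
have km0 : 0 <= km by rewrite le_max lexx orbT.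
have gn0 q : 0 <= gn q by exact: g0.
have h1 := @radial_step _ r mr r2 er2 gn z mgn gn0 (gn (sqn z)) kp km K (gn0 _) kp0 km0 K0.
have h2 := @radial_step_ge _ r' mr' r2' er2' gn z mgn gn0 (gn (sqn z)) kp km K (gn0 _) kp0 km0 K0.
have {}h1 := h1 (fun t x0 x1 e => ltac:(have := kP t x0 x1 _ e erefl; rewrite kpm ler_norml => /andP[? ?]; lra)).
have {}h2 := h2 (fun t x0 x1 e => ltac:(have := kP t x0 x1 _ e erefl; rewrite kpm ler_norml => /andP[? ?]; lra)).
rewrite -/S -/T in h1 h2.
have -> : psi 0 z = (4 * K)%:E.
  by rewrite /psi /K; congr EFin; rewrite !mulr0 mul0r addr0 expr0n/= mulr0 addr0 expr_div_n; ring.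
rewrite -(@leeD2rE _ km%:E)//; apply: le_trans h1 _.
apply: (@le_trans _ _ ((T f z + (km + 2 * K)%:E) + (2 * K)%:E)%E).
  by rewrite EFinD leeD2r.
by rewrite -!(addeA (T f z)); apply: leeD2l; rewrite -!EFinD lee_fin; lra.
Qed.

Let psi_step (rr : R -> R) : polar_radius rr -> forall k z, (trans (pcos rr) (psin rr) (psi k) z <= psi k.+1 z)%E.
Proof.
move=> [mr r2 er2] k z.
have N0' : N != 0 by rewrite gt_eqF.
(* [psi k] as a function of q = |z|^2, with absolute values to make it nonnegative on the whole
   line. *)
pose pk (q : R) : R := 4 * D / N ^+ 2 * (`|q| ^+ 2 + (N + 4 * k%:R) * `|q| + (N ^+ 2 + k%:R * N + 18 * k%:R ^+ 2)).
have pk0 q : 0 <= pk q.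
  rewrite /pk; nonneg.
have mpk : measurable_fun [set: mR] (pk : mR -> mR).
  apply: measurable_funM => //; apply: measurable_funD => //; apply: measurable_funD.
    by apply: measurable_funX; exact: measurable_abs.
  by apply: measurable_funM => //; exact: measurable_abs.
have -> : psi k = (fun z => (pk (sqn z))%:E).
  apply/funext => y; rewrite /psi /pk ger0_norm//; congr EFin; by field.
have := @radial_step _ rr mr r2 er2 pk z mpk pk0 (pk (sqn z)) (4 * D / N ^+ 2 * (4 * sqn z + N + 4 * k%:R)) 0 (4 * D / N ^+ 2 * 8).
have D2 : 0 <= 4 * D / N ^+ 2 by rewrite divr_ge0 ?sqr_ge0// mulr_ge0.
have q0 := sqn0 z.
rewrite adde0 => h; apply: le_trans (h _ _ _ _ _) _ => //.
- by rewrite mulr_ge0// !addr_ge0 ?mulr_ge0// ltW.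
- by rewrite mulr_ge0.
- move=> t x0 x1 xQ; rewrite mul0r addr0.
  have t2 := sqr_ge0 t.
  have pos x : x ^+ 2 <= sqn z -> 0 <= sqn z + (2 * t * x + t ^+ 2).
    move=> xz; have := sqr_ge0 (t + x); nra.
  have p0 := pos x0; have p1 := pos x1; have p2 := pos (- x0); have p3 := pos (- x1).
  have x02 := sqr_ge0 x0; have x12 := sqr_ge0 x1.
  have [_ b2 _] := exp_half_bounds t.
  rewrite /avg4 /pk (ger0_norm q0) !ger0_norm; last 4 first.
  + by rewrite -mulrN; apply: p3; rewrite sqrrN; lra.
  + by rewrite -mulrN; apply: p2; rewrite sqrrN; lra.
  + by apply: p1; lra.
  + by apply: p0; lra.
  rewrite -!mulrDr -mulrA -(mulrA (4 * D / N ^+ 2)) -(mulrA (4 * D / N ^+ 2)) -!mulrDr ler_wpM2l//.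
  have := @avg4_lin R (fun=> 0) (N + 4 * k%:R) (N ^+ 2 + k%:R * N + 18 * k%:R ^+ 2) (sqn z) t x0 x1 _ xQ.
  rewrite /avg4 => ->; lra.
rewrite lee_fin /pk (ger0_norm q0) /= -[k.+1%:R]natr1.
rewrite [leRHS](_ : _ = 4 * D / N ^+ 2 * (sqn z ^+ 2 + (N + 4 * (k%:R + 1)) * sqn z + (N ^+ 2 + (k%:R + 1) * N + 18 * (k%:R + 1) ^+ 2))); last by field.
rewrite (mulrCA 2) -!mulrDr ler_wpM2l//.
have : 0 <= (k%:R : R) by []. nra.
Qed.

(** At the origin [psi n] is 4 D (1 + 1 + 18) = 80 D, and n D = c M / sqrt n. *)
Lemma clt_compare : (iter n S f (0%R, 0%R) <= iter n T f (0%R, 0%R) + (80 * c * M / s)%:E)%E.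
Proof.
have [mr _ _] := Hr; have [mr' _ _] := Hr'.
have mf : mp f by exact: measurable_sqn_comp.
have psi0 k : nn (psi k).
  move=> z; have ? := sqn0 z; rewrite lee_fin; nonneg.
have := @lindeberg R (pcos r) (psin r) (pcos r') (psin r') (measurable_pcos mr) (measurable_psin mr)
  (measurable_pcos mr') (measurable_psin mr') n f psi mf (fun z => g0 _) _ psi0 _ step (psi_step Hr) (psi_step Hr') (0, 0).
have mpsi k : mp (psi k).
  have ms : measurable_fun [set: plane] (@sqn R : plane -> mR).
    by apply: measurable_funD; apply: measurable_funX.
  apply/measurable_EFinP; apply: measurable_funM => //; apply: measurable_funD.
    by apply: measurable_funD => //; apply: measurable_funM => //; exact: measurable_funD.
  apply: measurable_funM => //; apply: measurable_funD => //; apply: measurable_funD.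
    exact: measurable_funX.
  exact: measurable_funM.
have psiS k z : (psi k z <= psi k.+1 z)%E.
  have q0 := sqn0 z; rewrite lee_fin; apply: ler_wpM2l; first by apply: mulr_ge0.
  have kk : k%:R <= k.+1%:R :> R by rewrite ler_nat.
  apply: lerD; first by rewrite lerD2l ler_wpM2r ?lerD2l// invr_ge0 ltW.
  rewrite ler_wpM2r ?invr_ge0 ?sqr_ge0// lerD//.
    by rewrite lerD2l ler_wpM2r// ler_wpM2l.
  by rewrite ler_wpM2l// ler_pXn2r ?nnegrE.
move=> /(_ mpsi psiS) /le_trans; apply; rewrite leeD2l// -EFinM lee_fin.
rewrite /sqn/= !expr0n/= addr0 !mulr0 !add0r !expr0n/= !add0r -/N.
have N0' : N != 0 by rewrite gt_eqF.
have s0' : s != 0 by rewrite gt_eqF// (lt_le_trans ltr01).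
rewrite le_eqVlt; apply/orP; left; apply/eqP; rewrite /D; field.
by rewrite N0' s0'.
Qed.

End comparison.
End clt.

(** * Coupling on a block *)

Section smoothed_cdf.
Context {R : realType}.
Local Notation mR := (measurableTypeR R).
Local Notation U01 := (@U01 R).

(** Quantile function of the logistic law: [logit V] is logistic when V is uniform. *)
Definition logit (V : R) : R := ln (V / (1 - V)).

Lemma logit_lt (V x : R) : 0 < V < 1 -> (logit V < x) = (V < logi x).
Proof.
move=> /andP[V0 V1]; have W0 : 0 < 1 - V by rewrite subr_gt0.
have q0 : 0 < V / (1 - V) by exact: divr_gt0.
rewrite /logit -[LHS]ltr_expR lnK ?posrE// ltr_pdivrMr// /logi -[in RHS]div1r ltr_pdivlMr ?logi_denom//.
rewrite expRN; have := expR_gt0 x; move: (expR x) => e e0.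
rewrite -[RHS](ltr_pM2l e0) (_ : e * (V * (1 + e^-1)) = e * V + V); last first.
  by have e0' : e != 0 by [rewrite gt_eqF]; field.
by apply/idP/idP; lra.
Qed.

Lemma logitK (V : R) : 0 < V < 1 -> logi (logit V) = V.
Proof.
move=> /andP[V0 V1]; have W0 : 0 < 1 - V by rewrite subr_gt0.
have q0 : 0 < V / (1 - V) by exact: divr_gt0.
rewrite /logi /logit expRN lnK ?posrE// invf_div.
by have v0 : V != 0 by [rewrite gt_eqF]; field; rewrite v0 addrC subrK oner_eq0.
Qed.

Lemma measurable_logit : measurable_fun [set: mR] (logit : mR -> mR).
Proof.
apply: (measurableT_comp (@measurable_ln R)); apply: measurable_funM => //.
by apply: (measurableT_comp measurable_inv); exact: measurable_funB.
Qed.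

Lemma fstep_gt0 eps t q : 0 < fstep eps t q :> R. Proof. exact: logi_gt0. Qed.
Lemma fstep_lt1 eps t q : fstep eps t q < 1 :> R. Proof. exact: logi_lt1. Qed.
Lemma measurable_fstep eps t : measurable_fun [set: mR] (fstep eps t : mR -> mR).
Proof. by apply: (measurable_comp1 measurable_logi); apply: measurable_funM => //; exact: measurable_funB. Qed.

Section one_variable.
Variables (X : R -> R) (Q eps : R).
Hypotheses (mX : measurable_fun [set: mR] (X : mR -> mR)) (X0Q : forall w, 0 <= X w <= Q) (eps0 : 0 < eps).

(** Distribution function of X plus [eps] times an independent logistic noise, with the noise
    integrated out first; in this form it inherits the Lipschitz constant 1/eps of the smoothed
    step. *)
Definition scdf (t : R) : R := fine (\int[U01]_w (fstep eps t (X w))%:E).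

Let mf t : measurable_fun [set: mR] (fun w : mR => (fstep eps t (X w))%:E).
Proof. by apply/measurable_EFinP; apply: (measurable_comp1 (measurable_fstep _ _)). Qed.

Lemma scdfE t : (\int[U01]_w (fstep eps t (X w))%:E = (scdf t)%:E)%E.
Proof.
have i0 : (0 <= \int[U01]_w (fstep eps t (X w))%:E)%E.
  by apply: integral_ge0 => w _; rewrite lee_fin ltW// fstep_gt0.
have i1 : (\int[U01]_w (fstep eps t (X w))%:E <= 1)%E.
  rewrite -[leRHS](integral_cst_prob U01); apply: ge0_le_integral => //.
    by move=> w _; rewrite lee_fin ltW// fstep_gt0.
  by move=> w _; rewrite lee_fin ltW// fstep_lt1.
by rewrite /scdf fineK// ge0_fin_numE// (le_lt_trans i1) ?ltry.
Qed.

Lemma scdf_le (t c : R) : (forall q, 0 <= q <= Q -> fstep eps t q <= c) -> scdf t <= c.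
Proof.
move=> h; rewrite -lee_fin -scdfE -[leRHS](integral_cst_prob U01); apply: ge0_le_integral => //.
  by move=> w _; rewrite lee_fin ltW// fstep_gt0.
by move=> w _; rewrite lee_fin h.
Qed.

Lemma scdf_ge (t c : R) : 0 <= c -> (forall q, 0 <= q <= Q -> c <= fstep eps t q) -> c <= scdf t.
Proof.
move=> c0 h; rewrite -lee_fin -scdfE -[leLHS](integral_cst_prob U01); apply: ge0_le_integral => //.
by move=> w _; rewrite lee_fin h.
Qed.

Lemma scdf_mono t t' : t <= t' -> scdf t <= scdf t'.
Proof.
move=> tt'; rewrite -lee_fin -(scdfE t) -(scdfE t'); apply: ge0_le_integral => //.
  by move=> w _; rewrite lee_fin ltW// fstep_gt0.
by move=> w _; rewrite lee_fin logi_mono// ler_wpM2r ?invr_ge0 ?(ltW eps0)// lerB.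
Qed.

Lemma scdf_lip1 t t' : scdf t <= scdf t' + `|t - t'| / eps.
Proof.
have h0 : 0 <= `|t - t'| / eps by rewrite divr_ge0// ltW.
rewrite -lee_fin EFinD -!scdfE -[X in (_ <= _ + X)%E](integral_cst_prob U01) -ge0_integralD//; last first.
  by move=> w _; rewrite lee_fin ltW// fstep_gt0.
apply: ge0_le_integral => //.
- by move=> w _; rewrite lee_fin ltW// fstep_gt0.
- exact: emeasurable_funD.
move=> w _; rewrite -EFinD lee_fin.
have := logi_lip ((t' - X w) / eps) ((t - X w) / eps).
rewrite -mulrBl (_ : t - X w - (t' - X w) = t - t'); last by ring.
rewrite normrM [`|eps^-1|]gtr0_norm ?invr_gt0// => h.
by rewrite -lerBlDl; apply: le_trans h; exact: ler_norm.
Qed.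

Lemma scdf_lip t t' : `|scdf t - scdf t'| <= `|t - t'| / eps.
Proof.
have := scdf_lip1 t t'; have := scdf_lip1 t' t; rewrite (distrC t') => h1 h2.
by move: (scdf t) (scdf t') h1 h2 => u v h1 h2; rewrite ler_norml lerNl opprB !lerBlDl h1 h2.
Qed.

Lemma continuous_scdf : continuous scdf.
Proof.
move=> t; apply/cvgrPdist_le => e e0; near=> s.
apply: le_trans (scdf_lip _ _) _.
rewrite ler_pdivrMr//; near: s.
have e1 : 0 < e * eps by rewrite mulr_gt0.
by exists (e * eps) => // y /ltW.
Unshelve. all: by end_near. Qed.

Lemma measurable_scdf : measurable_fun [set: mR] (scdf : mR -> mR).
Proof. by apply: continuous_measurable_fun; exact: continuous_scdf. Qed.

(** X is bounded, so the logistic quantile shifted by the two ends of the range of X brackets the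
    level x; the intermediate value theorem concludes. *)
Lemma scdf_surj (x : R) : 0 < x < 1 -> exists t, scdf t = x.
Proof.
move=> x01; have Q0 : 0 <= Q by have /andP[/le_trans] := X0Q 0; apply.
set a := eps * logit x.
have ae : a / eps = logit x by rewrite /a mulrC mulKf// gt_eqF.
have ha : scdf a <= x.
  apply: scdf_le => q /andP[q0 _]; rewrite -[leRHS](logitK x01) -ae; apply: logi_mono.
  by rewrite ler_wpM2r ?invr_ge0 ?(ltW eps0)// gerBl.
have hb : x <= scdf (Q + a).
  apply: scdf_ge => [|q /andP[_ qQ]]; first by case/andP: x01 => /ltW.
  rewrite -[leLHS](logitK x01) -ae; apply: logi_mono.
  by rewrite ler_wpM2r ?invr_ge0 ?(ltW eps0)//; lra.
have ab : a <= Q + a by rewrite lerDr.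
have [||c _ <-] := @IVT R scdf a (Q + a) x ab; last by exists c.
- exact/continuous_subspaceT/continuous_scdf.
- by move: (scdf a) (scdf (Q + a)) ha hb => u v ha hb; rewrite ge_min ha le_max hb orbT.
Qed.

Let h (w : R) : R := X (lft w) + eps * logit (rgt w).

Let mh : measurable_fun [set: mR] (h : mR -> mR).
Proof.
apply: measurable_funD; first exact: (measurable_comp1 mX measurable_lft).
by apply: measurable_funM => //; exact: (measurable_comp1 measurable_logit measurable_rgt).
Qed.

Let mpre d (T : measurableType d) (k : T -> R) (A : set R) : measurable_fun [set: T] (k : T -> mR) ->
  measurable A -> measurable (k @^-1` A).
Proof. by move=> mk mA; rewrite -[X in measurable X]setTI; exact: mk. Qed.

Lemma scdf_prob t : U01 (h @^-1` `]-oo, t[%classic) = (scdf t)%:E.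
Proof.
pose B := `]-oo, t[%classic : set R.
have mB : measurable B by exact: measurable_itv.
rewrite -scdfE -[X in U01 X]setIT -integral_indic//; last exact: mpre.
have mi : measurable_fun [set: mR * mR] (fun z : mR * mR => (\1_B (X z.1 + eps * logit z.2))%:E : \bar R).
  apply/measurable_EFinP; apply: (measurableT_comp (measurable_indic mB)); apply: measurable_funD.
    exact: (measurable_comp1 mX).
  by apply: measurable_funM => //; exact: (measurable_comp1 measurable_logit).
rewrite (split_integral (f := fun z => (\1_B (X z.1 + eps * logit z.2))%:E))//.
apply: eq_integral => w _ /=.
have mk : measurable_fun [set: mR] (fun V : mR => X w + eps * logit V : mR).
  by apply: measurable_funD => //; apply: measurable_funM => //; exact: measurable_logit.
rewrite (integral_indic U01 measurableT (mpre mk mB)) ?setIT.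
rewrite -(@U01_ray R (fstep eps t (X w))) ?(ltW (fstep_gt0 _ _ _)) ?(ltW (fstep_lt1 _ _ _))//.
apply: U01_ae => //; first exact: (mpre mk mB).
move=> V V01; rewrite /B /= !in_itv/= /fstep -logit_lt// ltr_pdivlMr// mulrC.
by split; lra.
Qed.

(** A continuous distribution function evaluated at its own variable is uniform. The mass is
    compared with attained levels y on either side of x, which are then moved towards x. *)
Let scdf_h_ray x : U01 ((scdf \o h) @^-1` `]-oo, x[%classic) = U01 `]-oo, x[%classic.
Proof.
have msh : measurable_fun [set: mR] (scdf \o h : mR -> mR) by exact: (measurable_comp1 measurable_scdf mh).
have low y : 0 < y < 1 -> y < x -> (y%:E <= U01 ((scdf \o h) @^-1` `]-oo, x[%classic))%E.
  move=> y01 yx; have [t ty] := scdf_surj y01; rewrite -ty -scdf_prob; apply: le_measure; rewrite ?inE//.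
  - exact: mpre.
  - exact: mpre.
  by move=> w /=; rewrite !in_itv/= => /ltW ht; apply: le_lt_trans (scdf_mono ht) _; rewrite ty.
have high y : 0 < y < 1 -> x <= y -> (U01 ((scdf \o h) @^-1` `]-oo, x[%classic) <= y%:E)%E.
  move=> y01 yx; have [t ty] := scdf_surj y01; rewrite -ty -scdf_prob; apply: le_measure; rewrite ?inE//.
  - exact: mpre.
  - exact: mpre.
  move=> w /=; rewrite !in_itv/= => hx; rewrite ltNge; apply/negP => /scdf_mono; rewrite ty => h1.
  by have := lt_le_trans hx (le_trans yx h1); rewrite ltxx.
rewrite U01_rayE; set P := U01 _ in low high *.
have P0 : (0 <= P)%E by exact: measure_ge0.
have P1 : (P <= 1)%E by apply: probability_le1; exact: mpre.
have Pf : P \is a fin_num by rewrite ge0_fin_numE// (le_lt_trans P1) ?ltry.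
move: low high P0 P1; rewrite -(fineK Pf); move: (fine P) => p.
rewrite !lee_fin => low high p0 p1; congr EFin; apply/eqP.
have {}low y : 0 < y < 1 -> y < x -> y <= p by move=> *; rewrite -lee_fin low.
have {}high y : 0 < y < 1 -> x <= y -> p <= y by move=> *; rewrite -lee_fin high.
have [x0|x0] := leP x 0.
  rewrite max_l ?ge_min ?x0// eq_le p0 andbT; apply/ler_addgt0Pr => e e0; rewrite add0r.
  have [e1|e1] := ltP e 1; last exact: le_trans e1.
  by apply: high; rewrite ?e0// (le_trans x0) ?ltW.
rewrite max_r; last by rewrite le_min (ltW x0) ler01.
rewrite eq_le; apply/andP; split.
  rewrite le_min p1 andbT; have [x1|x1] := ltP x 1; last exact: le_trans x1.
  by apply: high; rewrite ?x0.
apply/ler_addgt0Pr => e e0; rewrite -lerBlDr.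
have [x1|x1] := leP (Num.min x 1 - e) 0; first exact: le_trans x1 _.
apply: low.
  by rewrite x1 ltrBlDr (le_lt_trans (_ : _ <= 1)) ?ge_min ?lexx ?orbT// ltrDl.
by rewrite ltrBlDr (le_lt_trans (_ : _ <= x)) ?ge_min ?lexx// ltrDl.
Qed.

Lemma scdf_uniform (f : mR -> \bar R) : measurable_fun setT f -> (forall z, 0 <= f z)%E ->
  (\int[U01]_w \int[U01]_V f (scdf (X w + eps * logit V)%R) = \int[U01]_u f u)%E.
Proof.
move=> mf0 f0; have msh : measurable_fun [set: mR] (scdf \o h : mR -> mR) by exact: (measurable_comp1 measurable_scdf mh).
rewrite -(split_integral (f := fun z => f (scdf (X z.1 + eps * logit z.2)%R)))//; last first.
  apply: (measurableT_comp mf0); apply: (measurable_comp1 measurable_scdf); apply: measurable_funD.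
    exact: (measurable_comp1 mX).
  by apply: measurable_funM => //; exact: (measurable_comp1 measurable_logit).
rewrite -[LHS]/(\int[U01]_w f ((scdf \o h) w))%E; apply: (law_integral msh) => //.
apply: (@measure_eq_rays R (pushforward U01 (scdf \o h : mR -> mR)) U01) => x.
  exact: scdf_h_ray.
by apply: le_lt_trans (probability_le1 _ _) (ltry 1); exact: mpre.
Qed.

End one_variable.
End smoothed_cdf.

(** * An exact Gaussian pair from the sum of a block *)

Section block_gaussian.
Context {R : realType}.
Local Notation mR := (measurableTypeR R).
Local Notation U01 := (@U01 R).
Local Notation gam := (@gam R).
Local Notation plane := (mR * mR)%type.

Definition sumc (n : nat) (t : R) : R := \sum_(i < n) ecos (useq i t).
Definition sums (n : nat) (t : R) : R := \sum_(i < n) esin (useq i t).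
Definition bnorm (n : nat) (t : R) : R := sqn (sumc n t, sums n t) / n%:R.
(** Exactly exponential when q is [bnorm n t] for a uniform t and V is an independent uniform:
    distribution function, then exponential quantile. This is the monotone coupling of the noisy
    |S|^2 / n. *)
Definition bexp (n : nat) (eps : R) (q V : R) : R := expo (scdf (bnorm n) eps (q + eps * logit V)).

(* the direction of [z], or the independent random one [e^(2 i pi U)] if [z = 0]; note [x / 0 = 0] *)
Definition dir1 (z : plane) (U : R) : R := z.1 / Num.sqrt (sqn z) + ecos U * \1_[set 0] (sqn z).
Definition dir2 (z : plane) (U : R) : R := z.2 / Num.sqrt (sqn z) + esin U * \1_[set 0] (sqn z).

(** The squared norm of a standard Gaussian pair is twice an exponential variable, hence the factor
    2. *)
Definition bgauss1 n eps (z : plane) V U : R := Num.sqrt (2 * bexp n eps (sqn z / n%:R) V) * dir1 z U.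
Definition bgauss2 n eps (z : plane) V U : R := Num.sqrt (2 * bexp n eps (sqn z / n%:R) V) * dir2 z U.

Lemma measurable_sumc n : measurable_fun [set: mR] (sumc n : mR -> mR).
Proof. by apply: measurable_sum => i; apply: (measurable_comp1 measurable_ecos); exact: measurable_useq. Qed.
Lemma measurable_sums n : measurable_fun [set: mR] (sums n : mR -> mR).
Proof. by apply: measurable_sum => i; apply: (measurable_comp1 measurable_esin); exact: measurable_useq. Qed.

Lemma measurable_sqn : measurable_fun [set: plane] (@sqn R : plane -> mR).
Proof. by apply: measurable_funD; apply: measurable_funX. Qed.

Lemma measurable_bnorm n : measurable_fun [set: mR] (bnorm n : mR -> mR).
Proof.
apply: measurable_funM => //; apply: measurable_funD; apply: measurable_funX; [exact: measurable_sumc|exact: measurable_sums].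
Qed.

Lemma sqn_ge0 (z : plane) : 0 <= sqn z. Proof. by rewrite addr_ge0// sqr_ge0. Qed.

Lemma sum_le_n n (a : R -> R) (t : R) : (forall v, `|a v| <= 1) -> `|\sum_(i < n) a (useq i t)| <= n%:R.
Proof.
move=> a1; apply: le_trans (ler_norm_sum _ _ _) _.
by rewrite -[leRHS]mulr1 mulr_natl -[in leRHS](card_ord n) -sumr_const; apply: ler_sum.
Qed.

Lemma ecos_le1 (v : R) : `|ecos v| <= 1.
Proof. by have := ecos2Desin2 v; have := sqr_ge0 (esin v) => h1 h2; rewrite ler_norml; apply/andP; split; nra. Qed.
Lemma esin_le1 (v : R) : `|esin v| <= 1.
Proof. by have := ecos2Desin2 v; have := sqr_ge0 (ecos v) => h1 h2; rewrite ler_norml; apply/andP; split; nra. Qed.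

Lemma bnorm_bound n t : 0 <= bnorm n t <= 2 * n%:R.
Proof.
rewrite divr_ge0 ?sqn_ge0//=; have [->|n0] := eqVneq n 0%N; first by rewrite /bnorm invr0 !mulr0.
rewrite ler_pdivrMr ?ltr0n ?lt0n// /sqn/=.
have h (x : R) : `|x| <= n%:R -> x ^+ 2 <= n%:R ^+ 2.
  by move=> h; rewrite -[x ^+ 2]real_normK ?num_real// ler_pXn2r ?nnegrE.
have := h _ (sum_le_n n t ecos_le1); have := h _ (sum_le_n n t esin_le1); rewrite -/(sums n t) -/(sumc n t).
move: (n%:R) (sumc n t) (sums n t) => N x y; lra.
Qed.

Definition rot (a : R) (z : plane) : plane := (z.1 * ecos a - z.2 * esin a, z.1 * esin a + z.2 * ecos a).

Lemma sqn_rot a z : sqn (rot a z) = sqn z.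
Proof.
transitivity (sqn z * (ecos a ^+ 2 + esin a ^+ 2)); last by rewrite ecos2Desin2 mulr1.
by rewrite /sqn /rot/=; ring.
Qed.

Lemma measurable_rot2 : measurable_fun [set: (mR * plane)%type] (fun t : mR * plane => rot t.1 t.2).
Proof.
have m1 : measurable_fun [set: (mR * plane)%type] (fun t : mR * plane => ecos t.1 : mR).
  exact: (measurable_comp1 measurable_ecos).
have m2 : measurable_fun [set: (mR * plane)%type] (fun t : mR * plane => esin t.1 : mR).
  exact: (measurable_comp1 measurable_esin).
have m3 : measurable_fun [set: (mR * plane)%type] (fun t : mR * plane => t.2.1 : mR).
  exact: (measurableT_comp measurable_fst measurable_snd).
have m4 : measurable_fun [set: (mR * plane)%type] (fun t : mR * plane => t.2.2 : mR).
  exact: (measurableT_comp measurable_snd measurable_snd).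
by apply: measurable_fun_pair; [apply: measurable_funB|apply: measurable_funD]; exact: measurable_funM.
Qed.

Lemma measurable_rot a : measurable_fun [set: plane] (rot a).
Proof. exact: (measurable_fun_pair2 a measurable_rot2). Qed.

Let X := trans (@ecos R) (@esin R).

Lemma trans_rot a (f : plane -> \bar R) z : mp f -> nn f -> X (f \o rot a) z = X f (rot a z).
Proof.
move=> mf f0; rewrite /X /trans.
transitivity (\int[U01]_w f ((rot a z).1 + ecos (w + a), (rot a z).2 + esin (w + a))%R)%E.
  by apply: eq_integral => w _; rewrite /rot/= ecosD esinD; congr (f (_, _)); ring.
apply: (@shift_integral R (fun w => f ((rot a z).1 + ecos w, (rot a z).2 + esin w)) a) => //.
  by apply: (measurable_shiftw _ _ _ mf); [exact: measurable_ecos|exact: measurable_esin].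
by move=> u; rewrite ecos1 esin1.
Qed.

Lemma iter_trans_rot n a (f : plane -> \bar R) z : mp f -> nn f ->
  iter n X (f \o rot a) z = iter n X f (rot a z).
Proof.
move=> mf f0; elim: n z => [|n IH] z //=.
have [? ?] := iter_trans_props measurable_ecos measurable_esin n mf f0.
by rewrite -/X -trans_rot// /X /trans; apply: eq_integral => w _; exact: IH.
Qed.

(** Each step of the walk is invariant under rotations in law, its angle being uniform; the operator
    therefore commutes with rotations. *)
Lemma sum_rot_law n a (f : plane -> \bar R) : mp f -> nn f ->
  (\int[U01]_t f (rot a (sumc n t, sums n t)) = \int[U01]_t f (sumc n t, sums n t))%E.
Proof.
move=> mf f0.
have mfr : mp (f \o rot a) by apply: (measurableT_comp mf); exact: measurable_rot.
have e g : mp g -> nn g -> iter n X g (0%R, 0%R) = (\int[U01]_t g (sumc n t, sums n t))%E.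
  move=> mg g0; rewrite (trans_sum measurable_ecos measurable_esin)//=.
  by apply: eq_integral => t _; rewrite !add0r.
rewrite -(e f)// -(e (f \o rot a))// ?iter_trans_rot//; last by move=> z; exact: f0.
by rewrite /rot/= !mul0r subr0 addr0.
Qed.

(** [v] is the argument of [z]. For z = 0 there is none, and the auxiliary uniform takes its
    place. *)
Lemma dir_unit (z : plane) : exists v, forall a U,
  dir1 (rot a z) U = (if sqn z == 0 then ecos U else ecos (v + a)) /\
  dir2 (rot a z) U = (if sqn z == 0 then esin U else esin (v + a)).
Proof.
have [z0|z0] := eqVneq (sqn z) 0.
  exists 0 => a U; rewrite /dir1 /dir2 sqn_rot z0 sqrtr0 invr0 !mulr0 !add0r.
  by rewrite indicE mem_set// !mulr1.
have s0 : Num.sqrt (sqn z) != 0 by rewrite sqrtr_eq0 -ltNge lt_neqAle sqn_ge0 eq_sym z0.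
have ss : Num.sqrt (sqn z) ^+ 2 = sqn z by rewrite sqr_sqrtr// sqn_ge0.
have [|v [v1 v2]] := @unit_angle R (z.1 / Num.sqrt (sqn z)) (z.2 / Num.sqrt (sqn z)).
  by rewrite !expr_div_n ss -mulrDl mulfV.
exists v => a U; rewrite /dir1 /dir2 sqn_rot indicE memNset ?mulr0 ?addr0; last exact/eqP.
by rewrite /rot/= ecosD esinD -v1 -v2; split; field.
Qed.

Section law.
Variables (n : nat) (eps : R).
Hypothesis eps0 : 0 < eps.
Let sc := scdf (bnorm n) eps.

Let measurable_bscdf : measurable_fun [set: mR] (scdf (bnorm n) eps : mR -> mR).
Proof. apply: measurable_scdf => //; exact: measurable_bnorm. Qed.

Lemma measurable_bexp d (T : measurableType d) (q V : T -> R) :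
  measurable_fun [set: T] (q : T -> mR) -> measurable_fun [set: T] (V : T -> mR) ->
  measurable_fun [set: T] (fun t => bexp n eps (q t) (V t) : mR).
Proof.
move=> mq mV; apply: (measurable_comp1 measurable_expo); apply: (measurable_comp1 measurable_bscdf).
by apply: measurable_funD => //; apply: measurable_funM => //; exact: (measurable_comp1 measurable_logit).
Qed.

Lemma measurable_bgauss d (T : measurableType d) (x y V U : T -> R) :
  measurable_fun [set: T] (x : T -> mR) -> measurable_fun [set: T] (y : T -> mR) ->
  measurable_fun [set: T] (V : T -> mR) -> measurable_fun [set: T] (U : T -> mR) ->
  measurable_fun [set: T] (fun t => (bgauss1 n eps (x t, y t) (V t) (U t), bgauss2 n eps (x t, y t) (V t) (U t)) : plane).
Proof.
move=> mx my mV mU.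
have msq : measurable_fun [set: T] (fun t => sqn (x t, y t) : mR).
  exact: (measurableT_comp measurable_sqn (measurable_fun_pair mx my)).
have ms : measurable_fun [set: T] (fun t => Num.sqrt (2 * bexp n eps (sqn (x t, y t) / n%:R) (V t)) : mR).
  apply: (measurable_comp1 measurable_sqrt); apply: measurable_funM => //.
  by apply: measurable_bexp => //; exact: measurable_funM.
have mi : measurable_fun [set: T] (fun t => (Num.sqrt (sqn (x t, y t)))^-1 : mR).
  by apply: (measurable_comp1 measurable_inv); exact: (measurable_comp1 measurable_sqrt).
have m1 : measurable_fun [set: T] (fun t => \1_[set 0] (sqn (x t, y t)) : mR).
  by apply: (measurableT_comp (measurable_indic _)).
apply: measurable_fun_pair; apply: measurable_funM => //; apply: measurable_funD; apply: measurable_funM => //.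
- exact: (measurable_comp1 measurable_ecos).
- exact: (measurable_comp1 measurable_esin).
Qed.

(** A uniform rotation of the sum does not change its law. Integrating over it first makes the
    direction uniform whatever the modulus, while the squared modulus is exponential by
    [scdf_uniform]: what remains is the Box-Muller formula. *)
Lemma bgauss_law (F : plane -> \bar R) : mp F -> nn F ->
  (\int[U01]_t \int[U01]_V \int[U01]_U
     F (bgauss1 n eps (sumc n t, sums n t) V U, bgauss2 n eps (sumc n t, sums n t) V U)
   = \int[gam]_x \int[gam]_y F (x, y))%E.
Proof.
move=> mF F0.
pose H (z : plane) V U : \bar R := F (bgauss1 n eps z V U, bgauss2 n eps z V U).
have H0 z V U : (0 <= H z V U)%E by exact: F0.
have mH : measurable_fun [set: ((plane * mR) * mR)%type] (fun t : plane * mR * mR => H t.1.1 t.1.2 t.2).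
  apply: (measurableT_comp mF).
  have := @measurable_bgauss _ (plane * mR * mR)%type (fun t => t.1.1.1) (fun t => t.1.1.2) (fun t => t.1.2) (fun t => t.2).
  have -> : (fun t : plane * mR * mR => (bgauss1 n eps (t.1.1.1, t.1.1.2) t.1.2 t.2, bgauss2 n eps (t.1.1.1, t.1.1.2) t.1.2 t.2))
     = (fun t => (bgauss1 n eps t.1.1 t.1.2 t.2, bgauss2 n eps t.1.1 t.1.2 t.2)) by apply/funext => -[[[? ?] ?] ?].
  apply => //.
  - by apply: (measurableT_comp measurable_fst); exact: (measurableT_comp measurable_fst measurable_fst).
  - by apply: (measurableT_comp measurable_snd); exact: (measurableT_comp measurable_fst measurable_fst).
  - exact: (measurableT_comp measurable_snd measurable_fst).
  - exact: measurable_snd.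
pose HU (t : plane * mR) : \bar R := (\int[U01]_U H t.1 t.2 U)%E.
have mHU : measurable_fun [set: (plane * mR)%type] HU.
  by apply: (measurable_fun_fubini_tonelli_F (fun t : plane * mR * mR => H t.1.1 t.1.2 t.2)) => // t; exact: H0.
have HU0 t : (0 <= HU t)%E by exact: integral_ge0.
pose K (z : plane) : \bar R := (\int[U01]_V HU (z, V))%E.
have mK : mp K by exact: (measurable_fun_fubini_tonelli_F HU).
have K0 : nn K by move=> z; exact: integral_ge0.
rewrite -[LHS]/(\int[U01]_t K (sumc n t, sums n t))%E.
pose Phi (p : mR) : \bar R := (\int[U01]_a F (Num.sqrt (2 * expo p) * ecos a, Num.sqrt (2 * expo p) * esin a)%R)%E.
have mPhi2 : measurable_fun [set: plane] (fun t : plane => F (Num.sqrt (2 * expo t.1) * ecos t.2, Num.sqrt (2 * expo t.1) * esin t.2)).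
  exact: (measurableT_comp mF measurable_polar).
have mPhi : measurable_fun [set: mR] Phi.
  by apply: (measurable_fun_fubini_tonelli_F (fun t : plane => F (Num.sqrt (2 * expo t.1) * ecos t.2, Num.sqrt (2 * expo t.1) * esin t.2))) => // t; exact: F0.
have Phi0 p : (0 <= Phi p)%E by apply: integral_ge0 => a _; exact: F0.
have mS : measurable_fun [set: mR] (fun t : mR => (sumc n t, sums n t) : plane).
  by apply: measurable_fun_pair; [exact: measurable_sumc|exact: measurable_sums].
(* At fixed [z] the average over rotations depends on |z| only. *)
have rotK z : (\int[U01]_a K (rot a z) = \int[U01]_V Phi (sc (sqn z / n%:R + eps * logit V)%R))%E.
  have mr : measurable_fun [set: plane] (fun t : plane => HU (rot t.1 z, t.2)).
    apply: (measurableT_comp mHU); apply: measurable_fun_pair => //.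
    exact: (measurableT_comp (measurable_fun_pair1 z measurable_rot2)).
  apply: etrans (fubini_tonelli _ mr (fun t => HU0 _)) _.
  apply: eq_integral => V _; rewrite /HU /H/=.
  set p := sc _; set c := Num.sqrt (2 * expo p).
  have e a U : (bgauss1 n eps (rot a z) V U, bgauss2 n eps (rot a z) V U) = (c * dir1 (rot a z) U, c * dir2 (rot a z) U).
    by rewrite /bgauss1 /bgauss2 sqn_rot.
  under eq_integral do under eq_integral do rewrite e.
  have mFc : measurable_fun [set: mR] (fun a : mR => F (c * ecos a, c * esin a)).
    apply: (measurableT_comp mF); apply: measurable_fun_pair; apply: measurable_funM => //.
      exact: measurable_ecos.
    exact: measurable_esin.
  have [z0|z0] := eqVneq (sqn z) 0.
    rewrite (eq_integral (fun=> Phi p)) ?integral_cst_prob// => a _; apply: eq_integral => U _.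
    by have [v /(_ a U)] := dir_unit z; rewrite z0 eqxx => -[-> ->].
  have [v hv] := dir_unit z; rewrite (negbTE z0) in hv.
  transitivity (\int[U01]_a F (c * ecos (a + v), c * esin (a + v))%R)%E.
    apply: eq_integral => a _; rewrite (eq_integral (fun=> F (c * ecos (a + v), c * esin (a + v)))) ?integral_cst_prob// => U _.
    by have [-> ->] := hv a U; rewrite !(addrC a).
  apply: (@shift_integral R (fun a => F (c * ecos a, c * esin a)) v) => //.
  by move=> u; rewrite ecos1 esin1.
have PhiE : (\int[U01]_p Phi p = \int[U01]_p \int[U01]_a F (Num.sqrt (2 * expo p) * ecos a, Num.sqrt (2 * expo p) * esin a)%R)%E by [].
clearbody K Phi.
transitivity (\int[U01]_a \int[U01]_t K (rot a (sumc n t, sums n t)))%E.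
  by under [RHS]eq_integral do rewrite sum_rot_law//; rewrite integral_cst_prob.
have mKr : measurable_fun [set: plane] (fun t : plane => K (rot t.1 (sumc n t.2, sums n t.2))).
  have m2 : measurable_fun [set: plane] (fun t : plane => (t.1, (sumc n t.2, sums n t.2)) : (mR * plane)%type).
    apply: measurable_fun_pair; first exact: measurable_fst.
    exact: (measurableT_comp mS measurable_snd).
  exact: (measurableT_comp mK (measurableT_comp measurable_rot2 m2)).
apply: etrans (fubini_tonelli _ mKr (fun t => K0 _)) _.
transitivity (\int[U01]_t \int[U01]_V Phi (sc (bnorm n t + eps * logit V)%R))%E.
  have rotS t : (\int[U01]_a K (rot a (sumc n t, sums n t)) = \int[U01]_V Phi (sc (bnorm n t + eps * logit V)%R))%E.
    exact: (rotK (sumc n t, sums n t)).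
  transitivity (\int[U01]_t \int[U01]_a K (rot a (sumc n t, sums n t)))%E; first by [].
  by apply: eq_integral => t _; rewrite rotS.
rewrite (scdf_uniform (measurable_bnorm n) (bnorm_bound n) eps0 mPhi Phi0) (box_muller mF F0) PhiE.
exact: (fubini_tonelli _ mPhi2 (fun t => F0 _)).
Qed.

End law.
End block_gaussian.

(** * Central limit estimate for the squared modulus *)

Section block_clt.
Context {R : realType}.
Local Notation mR := (measurableTypeR R).
Local Notation U01 := (@U01 R).
Local Notation gam := (@gam R).
Local Notation plane := (mR * mR)%type.

Lemma eq_iter_trans (a b a' b' : R -> R) n (f : plane -> \bar R) :
  measurable_fun [set: mR] (a : mR -> mR) -> measurable_fun [set: mR] (b : mR -> mR) ->
  (forall f z, mp f -> nn f -> trans a b f z = trans a' b' f z) -> mp f -> nn f ->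
  iter n (trans a b) f = iter n (trans a' b') f.
Proof.
move=> ma mb e mf f0; elim: n => [|n IH] //=.
have [mi i0] := iter_trans_props ma mb n mf f0.
by apply/funext => z; rewrite (e _ z mi i0) IH.
Qed.

Lemma trans_unit_circle (f : plane -> \bar R) z : mp f -> nn f ->
  trans (@ecos R) (@esin R) f z = trans (pcos (fun=> 1)) (psin (fun=> 1)) f z.
Proof.
move=> mf f0; rewrite trans_polar// integral_cst_prob; apply: eq_integral => v _.
by rewrite !mul1r.
Qed.

Let rad2 (u : R) := Num.sqrt (expo u) : R.

Let mrad2 : measurable_fun [set: mR] (rad2 : mR -> mR).
Proof. by have [] := @polar_radius_expo R. Qed.

Let mshift (f : plane -> \bar R) d (T : measurableType d) (x y : T -> R) : mp f ->
  measurable_fun [set: T] (x : T -> mR) -> measurable_fun [set: T] (y : T -> mR) ->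
  measurable_fun [set: T] (fun t => f (x t, y t)).
Proof. by move=> mf mx my; exact: (measurableT_comp mf (measurable_fun_pair mx my)). Qed.

(** Each coordinate of a complex Gaussian of mean square 1 has variance 1/2, hence [b]. *)
Lemma trans_gauss (f : plane -> \bar R) z (b := Num.sqrt 2^-1) : mp f -> nn f ->
  (trans (pcos rad2) (psin rad2) f z = \int[gam]_x \int[gam]_y f (z.1 + b * x, z.2 + b * y)%R)%E.
Proof.
move=> mf f0; rewrite trans_polar//.
have mF : measurable_fun [set: plane] (fun t : plane => f (z.1 + b * t.1, z.2 + b * t.2)).
  by apply: mshift => //; apply: measurable_funD => //; exact: measurable_funM.
rewrite (box_muller mF (fun t => f0 _)).
have mp2 : measurable_fun [set: plane] (fun t : plane => f (z.1 + rad2 t.1 * ecos t.2, z.2 + rad2 t.1 * esin t.2)).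
  apply: (mshift mf); apply: measurable_funD => //; apply: measurable_funM.
  - exact: (measurable_comp1 mrad2).
  - exact: (measurable_comp1 measurable_ecos).
  - exact: (measurable_comp1 mrad2).
  - exact: (measurable_comp1 measurable_esin).
apply: etrans (fubini_tonelli _ mp2 (fun t => f0 _)) _.
apply: eq_integral => v _; apply: eq_integral => u _.
have e : b * Num.sqrt (2 * expo u) = rad2 u by rewrite /b /rad2 -sqrtrM ?invr_ge0// mulKf.
by rewrite /= !mulrA e.
Qed.

Lemma iter_trans_gauss n (f : plane -> \bar R) z (b := Num.sqrt (n%:R / 2)) : mp f -> nn f ->
  (iter n (trans (pcos rad2) (psin rad2)) f z = \int[gam]_x \int[gam]_y f (z.1 + b * x, z.2 + b * y)%R)%E.
Proof.
move=> mf f0; rewrite /b {b}; elim: n z => [|n IH] z.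
  rewrite mul0r sqrtr0; under eq_integral do under eq_integral do rewrite !mul0r !addr0.
  by under eq_integral do rewrite integral_cst_prob; rewrite integral_cst_prob; case: z.
have [mi i0] := iter_trans_props (measurable_pcos mrad2) (measurable_psin mrad2) n mf f0.
rewrite iterS (trans_gauss _ mi i0).
set a := Num.sqrt 2^-1; pose b : R := Num.sqrt (n%:R / 2); set c := Num.sqrt (n.+1%:R / 2).
have abc : Num.sqrt (a ^+ 2 + b ^+ 2) = c.
  by rewrite /a /b !sqr_sqrtr ?divr_ge0 ?invr_ge0// /c -natr1; congr Num.sqrt; field.
have {}IH y : iter n (trans (pcos rad2) (psin rad2)) f y = (\int[gam]_x' \int[gam]_y' f (y.1 + b * x', y.2 + b * y')%R)%E.
  exact: IH.
under eq_integral do under eq_integral do rewrite IH/=.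
transitivity (\int[gam]_x \int[gam]_x' \int[gam]_y \int[gam]_y' f (z.1 + a * x + b * x', z.2 + a * y + b * y')%R)%E.
  apply: eq_integral => x _.
  pose K (t : plane) : \bar R := (\int[gam]_y' f (z.1 + a * x + b * t.2, z.2 + a * t.1 + b * y')%R)%E.
  have mK : measurable_fun [set: plane] K.
    apply: (measurable_fun_fubini_tonelli_F (fun t : plane * mR => f (z.1 + a * x + b * t.1.2, z.2 + a * t.1.1 + b * t.2))) => //.
    apply: (mshift mf).
      apply: measurable_funD => //; apply: measurable_funM => //.
      exact: (measurableT_comp measurable_snd measurable_fst).
    apply: measurable_funD; last exact: measurable_funM.
    apply: measurable_funD => //; apply: measurable_funM => //.
    exact: (measurableT_comp measurable_fst measurable_fst).
  apply: (fubini_tonelli _ mK) => t; exact: integral_ge0.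
have mfx (s : R) : measurable_fun [set: mR] (fun y : mR => f (s, y)).
  by apply: (mshift mf).
transitivity (\int[gam]_x \int[gam]_x' \int[gam]_y f (z.1 + a * x + b * x', z.2 + c * y)%R)%E.
  apply: eq_integral => x _; apply: eq_integral => x' _.
  by rewrite (gam_comb a b z.2 (mfx _))// abc.
have mFy : measurable_fun [set: mR] (fun s : mR => \int[gam]_y f (s, z.2 + c * y)%R)%E.
  apply: (measurable_fun_fubini_tonelli_F (fun t : plane => f (t.1, z.2 + c * t.2))) => //.
  by apply: (mshift mf) => //; apply: measurable_funD => //; exact: measurable_funM.
have Fy0 (s : mR) : (0 <= \int[gam]_y f (s, z.2 + c * y)%R)%E by exact: integral_ge0.
by have := gam_comb a b z.1 mFy Fy0; rewrite abc.
Qed.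

Lemma iter_trans_gauss_radial n (g : R -> R) : (0 < n)%N ->
  measurable_fun [set: mR] (g : mR -> mR) -> (forall q, 0 <= g q) ->
  (iter n (trans (pcos rad2) (psin rad2)) (fun z : plane => (g (sqn z / n%:R))%:E) (0%R, 0%R) =
   \int[U01]_u (g (expo u))%:E)%E.
Proof.
move=> n0 mg g0; set f := fun z : plane => _.
have mf : mp f.
  apply/measurable_EFinP; apply: (measurable_comp1 mg); apply: measurable_funM => //; exact: measurable_sqn.
have f0 : nn f by move=> z; rewrite lee_fin.
rewrite iter_trans_gauss//=; set b := Num.sqrt _.
have mF : measurable_fun [set: plane] (fun t : plane => f (0 + b * t.1, 0 + b * t.2)).
  by apply: mshift => //; apply: measurable_funD => //; exact: measurable_funM.
rewrite (box_muller mF)// -[RHS](integral_cst_prob U01); apply: eq_integral => v _.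
have mb (a : R -> R) : measurable_fun [set: mR] (fun u : mR => 0 + b * (Num.sqrt (2 * expo u) * a v) : mR).
  apply: measurable_funD => //; apply: measurable_funM => //; apply: measurable_funM => //.
  by apply: (measurable_comp1 measurable_sqrt); apply: measurable_funM => //; exact: measurable_expo.
apply: eq_U01_integral => [|u||u|u u01].
- exact: (mshift mf (mb (@ecos R)) (mb (@esin R))).
- exact: f0.
- by apply/measurable_EFinP; apply: (measurable_comp1 mg); exact: measurable_expo.
- by rewrite lee_fin.
rewrite /f; congr (g _)%:E; rewrite /sqn/= !add0r.
have e0 := ltW (expo_gt0 u01).
transitivity (b ^+ 2 * Num.sqrt (2 * expo u) ^+ 2 * (ecos v ^+ 2 + esin v ^+ 2) / n%:R); first by ring.
rewrite ecos2Desin2 mulr1 !sqr_sqrtr ?divr_ge0 ?mulr_ge0//.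
by have n0' : n%:R != 0 :> R by [rewrite pnatr_eq0 -lt0n]; field.
Qed.

(** Lindeberg's comparison with the smoothed step as test function of |z|^2 / n; exchanging the two
    walks gives the opposite inequality. *)
Lemma clt_scdf : exists2 C : R, 0 <= C & forall (n : nat) (eps t : R), (0 < n)%N -> 0 < eps <= 1 ->
  `|scdf (bnorm n) eps t - scdf expo eps t| <= C / (eps ^+ 3 * Num.sqrt n%:R).
Proof.
have [c c1600] : exists c : R, c = 1600 by exists 1600.
exists (80 * c) => [|n eps t n0 /andP[e0 e1]]; first by apply: mulr_ge0; rewrite ?c1600 ler0n.
(* This also bounds the second derivative eps^-2, because eps <= 1. *)
pose M : R := eps ^- 3.
have M0 : 0 <= M by rewrite invr_ge0 exprn_ge0// ltW.
have mg := measurable_fstep eps t.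
have g0 q : 0 <= fstep eps t q by rewrite ltW// fstep_gt0.
have tg x : exists h1 h2, `|h2| <= M /\
  forall y, `|fstep eps t y - fstep eps t x - h1 * (y - x) - h2 / 2 * (y - x) ^+ 2| <= M * `|y - x| ^+ 3.
  have [h1 [h2 [hh H]]] := fstep_taylor t x e0.
  exists h1, h2; split => //; apply: le_trans hh _.
  by rewrite lef_pV2 ?posrE ?exprn_gt0// exprS ler_piMl// exprn_ge0// ltW.
have E1 : iter n (trans (pcos (fun=> 1)) (psin (fun=> 1))) (fun z : plane => (fstep eps t (sqn z / n%:R))%:E) (0%R, 0%R) = (scdf (bnorm n) eps t)%:E.
  have mf : mp (fun z : plane => (fstep eps t (sqn z / n%:R))%:E).
    apply/measurable_EFinP; apply: (measurable_comp1 mg); apply: measurable_funM => //; exact: measurable_sqn.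
  have f0 : nn (fun z : plane => (fstep eps t (sqn z / n%:R))%:E) by move=> z; rewrite lee_fin.
  rewrite -(eq_iter_trans n measurable_ecos measurable_esin trans_unit_circle mf f0).
  rewrite (trans_sum measurable_ecos measurable_esin)// -scdfE; last exact: measurable_bnorm.
  by apply: eq_integral => w _ /=; rewrite !add0r.
have E2 : iter n (trans (pcos rad2) (psin rad2)) (fun z : plane => (fstep eps t (sqn z / n%:R))%:E) (0%R, 0%R) = (scdf expo eps t)%:E.
  rewrite iter_trans_gauss_radial//; apply: scdfE; exact: measurable_expo.
have L1 := clt_compare polar_radius1 polar_radius_expo n0 mg g0 M0 c1600 tg.
have L2 := clt_compare polar_radius_expo polar_radius1 n0 mg g0 M0 c1600 tg.
rewrite E1 E2 -EFinD lee_fin in L1; rewrite E1 E2 -EFinD lee_fin in L2.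
have -> : 80 * c / (eps ^+ 3 * Num.sqrt n%:R) = 80 * c * M / Num.sqrt n%:R by rewrite invfM mulrA.
move: (scdf (bnorm n) eps t) (scdf expo eps t) (_ / Num.sqrt n%:R) L1 L2 => u v w L1 L2.
by rewrite ler_norml lerNl opprB !lerBlDl L1 L2.
Qed.

End block_clt.

(** * Pointwise error of the quantile coupling *)

Section block_error.
Context {R : realType}.
Local Notation mR := (measurableTypeR R).
Local Notation U01 := (@U01 R).
Local Notation gam := (@gam R).
Local Notation plane := (mR * mR)%type.

Definition expo_cdf (s : R) : R := Num.max 0 (1 - expR (- s)).

Lemma expo_cdf_lip (s d : R) : 0 <= d -> expo_cdf s <= expo_cdf (s + d) <= expo_cdf s + d.
Proof.
move=> d0; rewrite /expo_cdf; apply/andP; split.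
  by rewrite ge_max le_max lexx/= le_max lerD2l lerN2 ler_expR lerN2 lerDl d0 orbT.
have m0 : 0 <= Num.max 0 (1 - expR (- s)) by rewrite le_max lexx.
rewrite ge_max addr_ge0//=.
have [s0|s0] := leP 0 s.
  apply: (@le_trans _ _ (1 - expR (- s) + d)); last by rewrite lerD2r le_max lexx orbT.
  have e1 : expR (- s) <= 1 by rewrite -expR0 ler_expR oppr_le0.
  have := expR_ge1Dx (- d); have := expR_gt0 (- s).
  rewrite opprD expRD; move: (expR (- s)) (expR (- d)) e1 => x y x1 x0 y1; nra.
have := expR_ge1Dx (- (s + d)); lra.
Qed.

Lemma expo_prob (s : R) : (\int[U01]_u (\1_(`]-oo, s[%classic) (expo u))%:E = (expo_cdf s)%:E)%E.
Proof.
have mB : measurable (`]-oo, s[%classic : set R) by exact: measurable_itv.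
have mC : measurable (`]-oo, 1 - expR (- s)[%classic : set R) by exact: measurable_itv.
transitivity (\int[U01]_u (\1_(`]-oo, 1 - expR (- s)[%classic) u)%:E)%E.
  apply: eq_U01_integral => [|u||u|u u01].
  - by apply/measurable_EFinP; apply: (measurableT_comp (measurable_indic mB)); exact: measurable_expo.
  - by rewrite lee_fin.
  - by apply/measurable_EFinP; exact: measurable_indic.
  - by rewrite lee_fin.
  congr EFin; rewrite !indicE; congr ((nat_of_bool _)%:R).
  by apply/idP/idP; rewrite !in_setE/= !in_itv/= !ltNge expo_ge.
rewrite (integral_indic U01 measurableT mC) setIT; apply: etrans (U01_rayE _) _.
rewrite /expo_cdf; congr (Num.max 0 _)%:E.
by rewrite min_l// gerBl expR_ge0.
Qed.

(** Both bounds are e^(-y) <= 1/y at y = 1/d. *)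
Lemma logi_tail (d : R) : 0 < d -> 1 - d <= logi d^-1 /\ logi (- d^-1) <= d.
Proof.
move=> d0; have e : expR (- d^-1) <= d.
  rewrite expRN -[leRHS]invrK lef_pV2 ?posrE ?expR_gt0 ?invr_gt0//.
  by apply: le_trans (expR_ge1Dx _); rewrite lerDr.
split.
  rewrite /logi -[leRHS]div1r ler_pdivlMr ?logi_denom//.
  have := expR_gt0 (- d^-1); move: (expR _) e => x xd x0; nra.
rewrite /logi opprK; have := expR_gt0 d^-1; have := e; rewrite expRN.
move: (expR _) => x xd x0; apply: le_trans xd.
by rewrite lef_pV2 ?posrE// ?lerDr// ltr_pwDl// ltW.
Qed.

(** With noise of scale d^2, a displacement by d lies 1/d units out in the logistic tail and has
    probability at most d; shifting the exponential distribution function by d costs d more, its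
    density being at most 1. *)
Lemma scdf_expo_cdf (d t : R) : 0 < d -> `|scdf expo (d ^+ 2) t - expo_cdf t| <= 2 * d.
Proof.
move=> d0; have d20 : 0 < d ^+ 2 by rewrite exprn_gt0.
have [lt1 lt2] := logi_tail d0.
have di : d / d ^+ 2 = d^-1 by rewrite expr2 invfM mulrA mulfV ?mul1r// gt_eqF.
have mB s : measurable (`]-oo, s[%classic : set R) by exact: measurable_itv.
have mi s : measurable_fun [set: mR] (fun u : mR => (\1_(`]-oo, s[%classic) (expo u))%:E : \bar R).
  by apply/measurable_EFinP; apply: (measurableT_comp (measurable_indic (mB s))); exact: measurable_expo.
have mf : measurable_fun [set: mR] (fun u : mR => (fstep (d ^+ 2) t (expo u))%:E).
  by apply/measurable_EFinP; apply: (measurable_comp1 (measurable_fstep _ _)); exact: measurable_expo.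
have f0 (u : mR) : (0 <= (fstep (d ^+ 2) t (expo u))%:E)%E by rewrite lee_fin ltW// fstep_gt0.
have d0' := ltW d0.
have up : scdf expo (d ^+ 2) t <= expo_cdf (t + d) + d.
  rewrite -lee_fin EFinD -scdfE; last exact: measurable_expo.
  rewrite -expo_prob -[X in (_ + X)%E](integral_cst_prob U01) -ge0_integralD//.
  apply: ge0_le_integral => //; first exact: emeasurable_funD.
  move=> u _; rewrite -EFinD lee_fin indicE.
  have [h|h] := boolP (_ \in _); first by rewrite (le_trans (ltW (fstep_lt1 _ _ _)))// lerDl.
  move: h; rewrite notin_setE/= in_itv/= => /negP; rewrite -leNgt add0r => h.
  apply: le_trans lt2; apply: logi_mono; rewrite -di -mulNr ler_wpM2r ?invr_ge0 ?(ltW d20)//; lra.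
have low : expo_cdf (t - d) <= scdf expo (d ^+ 2) t + d.
  rewrite -lee_fin EFinD -scdfE; last exact: measurable_expo.
  rewrite -expo_prob -[X in (_ + X)%E](integral_cst_prob U01) -ge0_integralD//.
  apply: ge0_le_integral => //; first exact: emeasurable_funD.
  move=> u _; rewrite -EFinD lee_fin indicE.
  have [h|h] := boolP (_ \in _); last by rewrite addr_ge0// ltW// fstep_gt0.
  move: h; rewrite in_setE/= in_itv/= => h.
  rewrite -lerBlDr; apply: le_trans lt1 _; apply: logi_mono; rewrite -di ler_wpM2r ?invr_ge0 ?(ltW d20)//; lra.
have /andP[_ a1] := expo_cdf_lip t d0'; have /andP[_ a2] := expo_cdf_lip (t - d) d0'.
rewrite subrK in a2; rewrite ler_norml; apply/andP; split; lra.
Qed.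

(* With [n = rho^-64], the smoothing at scale [eps = rho^8] makes both error terms small. *)
Lemma scdf_bnorm_close : exists2 C : R, 1 <= C & forall (n : nat) (rho t : R), 0 < rho <= 1 ->
  rho ^+ 64 = n%:R^-1 -> `|scdf (bnorm n) (rho ^+ 8) t - expo_cdf t| <= (C * rho ^+ 2) ^+ 2.
Proof.
have [C C0 H] := @clt_scdf R.
exists (C + 2) => [|n rho t /andP[r0 r1] rn]; first by lra.
have n0 : (0 < n)%N.
  rewrite lt0n; apply/eqP => n0; move: rn; rewrite n0 invr0 => /eqP.
  by rewrite expf_eq0/= gt_eqF.
have rk k : 0 < rho ^+ k by exact: exprn_gt0.
have sn : Num.sqrt n%:R = rho ^- 32.
  by rewrite -[n%:R]invrK -rn (exprM rho 32 2) -exprVn sqrtr_sqr gtr0_norm// invr_gt0.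
have e1 : 0 < rho ^+ 8 <= 1 by rewrite rk exprn_ile1// ltW.
have := H n (rho ^+ 8) t n0 e1; rewrite sn -exprM => h1.
have := scdf_expo_cdf t (rk 4); rewrite -exprM => h2.
apply: le_trans (ler_distD (scdf expo (rho ^+ 8) t) _ _) _; apply: le_trans (lerD h1 h2) _.
have -> : C / (rho ^+ (8 * 3) / rho ^+ 32) = C * rho ^+ 8.
  rewrite invf_div -[32%N]/(8 * 3 + 8)%N exprD mulrAC divff ?gt_eqF// mul1r//.
rewrite exprMn -exprM -[(2 * 2)%N]/4%N.
have -> : rho ^+ 8 = rho ^+ 4 * rho ^+ 4 by rewrite -exprD.
have : rho ^+ 4 <= 1 by rewrite exprn_ile1// ltW.
have := rk 4%N; move: (rho ^+ 4) => x x0 x1.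
have : x * x <= x by rewrite ler_piMl// ltW.
move=> xx; nra.
Qed.

Lemma sqrtB_le (a b : R) : 0 <= a -> 0 <= b -> `|Num.sqrt a - Num.sqrt b| <= Num.sqrt `|a - b|.
Proof.
move=> a0 b0.
have h : `|Num.sqrt a - Num.sqrt b| ^+ 2 <= `|a - b|.
  rewrite -{2}(sqr_sqrtr a0) -{2}(sqr_sqrtr b0) subr_sqr normrM expr2 ler_wpM2l//.
  have := sqrtr_ge0 a; have := sqrtr_ge0 b => x0 y0.
  rewrite (@ger0_norm _ (Num.sqrt a + Num.sqrt b)) ?addr_ge0//.
  by rewrite ler_norml; apply/andP; split; lra.
by rewrite -[leLHS]ger0_norm// -sqrtr_sqr ler_wsqrtr.
Qed.

(** Where its argument is at least s/2 the logarithm is Lipschitz with constant 2/s; so, away from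
    the upper tail, an error s^2 of the distribution functions becomes 2 s on the quantiles. *)
Lemma expo_close (q t p s d : R) : 0 <= q -> `|t - q| <= d -> p < 1 -> 0 < s <= 2^-1 ->
  `|p - expo_cdf t| <= s ^+ 2 -> s <= 1 - p -> `|q - expo p| <= d + 2 * s.
Proof.
move=> q0 tq p1 /andP[s0 s1] pt sp.
(* Since q >= 0, replacing a negative t by 0 does not move it away from q. *)
pose tp := Num.max t 0; have tpq : `|q - tp| <= d.
  rewrite distrC /tp; have [t0|t0] := leP t 0; last by [].
  apply: le_trans tq; have h : q <= `|t - q| by rewrite -normrN; apply: le_trans (ler_norm _); lra.
  by rewrite ler_norml; apply/andP; split; lra.
have Ge : expo_cdf t = 1 - expR (- tp).
  rewrite /expo_cdf /tp; have [t0|t0] := leP t 0.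
    rewrite oppr0 expR0 subrr max_l// subr_le0 -[leLHS]expR0 ler_expR; lra.
  by rewrite max_r// subr_ge0 -[leRHS]expR0 ler_expR; lra.
set b := expR (- tp) in Ge.
have b0 : 0 < b by exact: expR_gt0.
have tb : tp = - ln b by rewrite /b expRK opprK.
rewrite -(subrK tp q) -addrA; apply: le_trans (ler_normD _ _) _; apply: lerD => //.
rewrite tb /expo opprK addrC -[X in `|X|]/(ln (1 - p) - ln b).
set a := 1 - p in sp *; have a0 : 0 < a by rewrite /a; lra.
have ab : `|a - b| <= s ^+ 2.
  by rewrite distrC; apply: le_trans pt; rewrite le_eqVlt; apply/orP; left; apply/eqP; congr (`|_|); rewrite Ge /a; ring.
have ss : s ^+ 2 <= s / 2 by rewrite expr2 ler_wpM2l// ltW.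
have bs : s / 2 <= b by move: ab; rewrite ler_norml => /andP[? ?]; lra.
have lnB (x y : R) : 0 < x -> 0 < y -> s / 2 <= y -> ln x - ln y <= `|x - y| / (s / 2).
  move=> x0 y0 ys; rewrite -ln_div ?posrE//.
  apply: (@le_trans _ _ (x / y - 1)).
    have := expR_ge1Dx (ln (x / y)); rewrite lnK ?posrE ?divr_gt0//; lra.
  have -> : x / y - 1 = (x - y) / y by field; rewrite gt_eqF.
  apply: (@le_trans _ _ (`|x - y| / y)); first by rewrite ler_wpM2r ?invr_ge0 ?(ltW y0)// ler_norm.
  by rewrite ler_wpM2l// lef_pV2 ?posrE ?divr_gt0.
have sa : s / 2 <= a by lra.
have e : `|a - b| / (s / 2) <= 2 * s.
  rewrite ler_pdivrMr ?divr_gt0//; apply: le_trans ab _.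
  rewrite expr2; nra.
rewrite ler_norml; apply/andP; split.
  by rewrite lerNl opprB; apply: le_trans e; rewrite distrC; exact: lnB.
by apply: le_trans e; exact: lnB.
Qed.

End block_error.

(** * Exponential moments on a block *)

Section exponential_moments.
Context {R : realType}.
Local Notation mR := (measurableTypeR R).
Local Notation U01 := (@U01 R).
Local Notation gam := (@gam R).

(** For |x| >= 1/2 because |x| <= 2 x^2; below that, e^x <= 1/(1 - x) bounds the left side by 2/(1 -
    x^2). *)
Lemma cosh_le (x : R) : expR x + expR (- x) <= 2 * expR (2 * x ^+ 2).
Proof.
have [h|h] := leP (2^-1) `|x|.
  have x2 : `|x| <= 2 * x ^+ 2.
    by rewrite -[x ^+ 2]real_normK ?num_real// expr2; have := normr_ge0 x; move: `|x| h => y; nra.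
  have e1 : expR x <= expR (2 * x ^+ 2) by rewrite ler_expR (le_trans (ler_norm _)).
  have e2 : expR (- x) <= expR (2 * x ^+ 2) by rewrite ler_expR -[- x]opprK (le_trans _ x2)// opprK -normrN ler_norm.
  lra.
move: h; rewrite ltr_norml => /andP[x1 x2].
have ex : expR x <= (1 - x)^-1.
  rewrite -[x in leLHS]opprK expRN lef_pV2 ?posrE ?expR_gt0//; last by lra.
  exact: expR_ge1Dx.
have ex' : expR (- x) <= (1 + x)^-1.
  rewrite expRN lef_pV2 ?posrE ?expR_gt0//; last by lra.
  exact: expR_ge1Dx.
apply: le_trans (lerD ex ex') _.
have -> : (1 - x)^-1 + (1 + x)^-1 = 2 * (1 - x ^+ 2)^-1.
  field; apply/and3P; split; rewrite gt_eqF//; nra.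
rewrite ler_wpM2l//; apply: le_trans (expR_ge1Dx _).
have y0 := sqr_ge0 x; have y1 : x ^+ 2 <= 4^-1 by nra.
move: (x ^+ 2) y0 y1 => y y0 y1; rewrite -[leLHS]div1r ler_pdivrMr; nra.
Qed.

Definition subgauss (K : R) (a : R -> R) := [/\ measurable_fun [set: mR] (a : mR -> mR) &
  forall t, (\int[U01]_v (expR (t * a v))%:E <= (expR (K * t ^+ 2))%:E)%E].

Lemma measurable_expM d (T : measurableType d) (a : T -> R) (t : R) : measurable_fun [set: T] (a : T -> mR) ->
  measurable_fun [set: T] (fun v => (expR (t * a v))%:E).
Proof. by move=> ma; apply/measurable_EFinP; apply: (measurableT_comp (@measurable_expR R)); exact: measurable_funM. Qed.

(** Averaging over v and its shift by [h], where [a] changes sign, turns the exponential into a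
    hyperbolic cosine. *)
Lemma subgauss_odd (a : R -> R) (h : R) : measurable_fun [set: mR] (a : mR -> mR) ->
  (forall v, a (v + 1) = a v) -> (forall v, a (v + h) = - a v) -> (forall v, `|a v| <= 1) -> subgauss 2 a.
Proof.
move=> ma a1 ah ab; split => // t.
have mE := measurable_expM t ma.
have E0 (v : mR) : (0 <= (expR (t * a v))%:E)%E by rewrite lee_fin expR_ge0.
have sh : (\int[U01]_v (expR (t * a (v + h)))%:E = \int[U01]_v (expR (t * a v))%:E)%E.
  by apply: (shift_integral h mE E0) => u; rewrite a1.
have m2 : measurable_fun [set: mR] (fun v : mR => (expR (t * a (v + h)))%:E).
  by under eq_fun do rewrite ah; apply: (measurable_expM t); exact: measurableT_comp.
have : (\int[U01]_v (expR (t * a v))%:E + \int[U01]_v (expR (t * a (v + h)))%:E <= (2 * expR (2 * t ^+ 2))%:E)%E.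
  rewrite -ge0_integralD//.
  rewrite -[leRHS](integral_cst_prob U01); apply: ge0_le_integral => //.
  - by move=> v _; rewrite -EFinD lee_fin addr_ge0// expR_ge0.
  - exact: emeasurable_funD.
  move=> v _; rewrite -EFinD lee_fin ah mulrN; apply: le_trans (cosh_le _) _.
  rewrite ler_wpM2l// ler_expR ler_wpM2l// exprMn ler_piMr ?sqr_ge0//.
  by rewrite -[a v ^+ 2]real_normK ?num_real// exprn_ile1.
rewrite sh; have : (0 <= \int[U01]_v (expR (t * a v))%:E)%E by exact: integral_ge0.
case: (\int[U01]_v (expR (t * a v))%:E)%E => [x| |]//=.
by rewrite -EFinD !lee_fin => _ h2; lra.
Qed.

Lemma subgauss_ecos : subgauss 2 (@ecos R).
Proof.
apply: (@subgauss_odd _ 2^-1); [exact: measurable_ecos|exact: ecos1|exact: ecos_half|exact: ecos_le1].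
Qed.

Lemma subgauss_esin : subgauss 2 (@esin R).
Proof.
apply: (@subgauss_odd _ 2^-1); [exact: measurable_esin|exact: esin1|exact: esin_half|exact: esin_le1].
Qed.

Lemma subgauss_ecos2 : subgauss 2 (fun v => ecos (2 * v)).
Proof.
apply: (@subgauss_odd _ 4^-1).
- by apply: (measurable_comp1 measurable_ecos); exact: mulrl_measurable.
- by move=> v; rewrite (_ : 2 * (v + 1) = 2 * v + 1 + 1) ?ecos1//; ring.
- by move=> v; rewrite (_ : 2 * (v + 4^-1) = 2 * v + 2^-1) ?ecos_half//; field.
- by move=> v; exact: ecos_le1.
Qed.

Lemma subgauss_esin2 : subgauss 2 (fun v => esin (2 * v)).
Proof.
apply: (@subgauss_odd _ 4^-1).
- by apply: (measurable_comp1 measurable_esin); exact: mulrl_measurable.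
- by move=> v; rewrite (_ : 2 * (v + 1) = 2 * v + 1 + 1) ?esin1//; ring.
- by move=> v; rewrite (_ : 2 * (v + 4^-1) = 2 * v + 2^-1) ?esin_half//; field.
- by move=> v; exact: esin_le1.
Qed.

Lemma eprod_le m (q r : nat -> \bar R) : (forall k, 0 <= q k)%E -> (forall k, q k <= r k)%E -> (eprod m q <= eprod m r)%E.
Proof.
by move=> q0 qr; elim: m => //= m IH; apply: lee_pmul => //; exact: eprod_ge0.
Qed.

Lemma expR_sum_eprod m (f : nat -> R) : (expR (\sum_(i < m) f i))%:E = eprod m (fun i => (expR (f i))%:E).
Proof. by elim: m => [|m IH]; rewrite ?big_ord0 ?expR0// big_ord_recr/= expRD EFinM muleC IH. Qed.

Lemma eprod_cst m (c : R) : eprod m (fun=> c%:E) = (c ^+ m)%:E.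
Proof. by elim: m => //= m ->; rewrite exprS EFinM. Qed.

Lemma sum_mgf (K : R) (a : R -> R) n (t : R) : subgauss K a ->
  (\int[U01]_w (expR (t * \sum_(i < n) a (useq i w)))%:E <= (expR (K * t ^+ 2 * n%:R))%:E)%E.
Proof.
move=> [ma aK].
under eq_integral => w _ do rewrite mulr_sumr (expR_sum_eprod n (fun i => t * a (useq i w))).
rewrite (useq_prod1 n (f := fun _ v => (expR (t * a v))%:E)); last 2 first.
- by move=> _; exact: measurable_expM.
- by move=> _ z; rewrite lee_fin expR_ge0.
apply: (@le_trans _ _ (eprod n (fun=> (expR (K * t ^+ 2))%:E))).
  apply: eprod_le => // _; apply: integral_ge0 => v _; rewrite lee_fin expR_ge0//.
by rewrite eprod_cst -expRM_natr.
Qed.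

Lemma expM_abs (t x : R) : expR (t * `|x|) <= expR (t * x) + expR (- t * x).
Proof.
have [x0|/ltW x0] := leP 0 x; first by rewrite ger0_norm// lerDl expR_ge0.
by rewrite ler0_norm// mulrN -mulNr lerDr expR_ge0.
Qed.

(** Separates two dependent summands in an exponent at the price of doubling them. *)
Lemma expD_le (x y : R) : expR (x + y) <= (expR (2 * x) + expR (2 * y)) / 2.
Proof.
have e (z : R) : expR (2 * z) = expR z * expR z by rewrite -expRD; congr expR; ring.
rewrite expRD !e; by have := sqr_ge0 (expR x - expR y); rewrite expr2; lra.
Qed.

(** The modulus of the sum is at most the sum of the moduli of its coordinates, and each of these is
    subgaussian at scale sqrt n. *)
Lemma bnorm_mgf (m : R) n : 0 <= m -> (0 < n)%N ->
  (\int[U01]_t (expR (m * Num.sqrt (bnorm n t)))%:E <= (2 * expR (8 * m ^+ 2))%:E)%E.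
Proof.
move=> m0 n0; have s0 : 0 < Num.sqrt n%:R :> R by rewrite sqrtr_gt0 ltr0n.
pose tau := 2 * m / Num.sqrt n%:R.
have tn : 2 * tau ^+ 2 * n%:R = 8 * m ^+ 2.
  have n0' : n%:R != 0 :> R by rewrite pnatr_eq0 -lt0n.
  by rewrite /tau expr_div_n sqr_sqrtr//; field.
have mS a : subgauss 2 a -> measurable_fun [set: mR] (fun t : mR => \sum_(i < n) a (useq i t) : mR).
  by move=> [ma _]; apply: measurable_sum => i; apply: (measurable_comp1 ma); exact: measurable_useq.
have mc := mS _ subgauss_ecos; have ms := mS _ subgauss_esin.
have le a (t : R) : subgauss 2 a -> t ^+ 2 = tau ^+ 2 ->
    (\int[U01]_w (expR (t * \sum_(i < n) a (useq i w)))%:E <= (expR (8 * m ^+ 2))%:E)%E.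
  by move=> sa tt; rewrite -tn -tt; exact: sum_mgf.
have e0 (f : mR -> R) w : (0 <= (expR (f w))%:E)%E by rewrite lee_fin expR_ge0.
apply: (@le_trans _ _ (\int[U01]_t (2^-1%:E * ((expR (tau * sumc n t))%:E + (expR (- tau * sumc n t))%:E
    + (expR (tau * sums n t))%:E + (expR (- tau * sums n t))%:E)))%E).
  apply: ge0_le_integral => //.
  - apply: (measurable_expM m); apply: (measurable_comp1 measurable_sqrt); exact: measurable_bnorm.
  - apply: (emeasurable_funM (measurable_cst _)); do 3? apply: emeasurable_funD; exact: measurable_expM.
  move=> t _; rewrite -!EFinD -EFinM lee_fin.
  have h : Num.sqrt (bnorm n t) <= (`|sumc n t| + `|sums n t|) / Num.sqrt n%:R.
    rewrite /bnorm sqrtrM ?sqn_ge0// sqrtrV// ler_wpM2r ?invr_ge0 ?(ltW s0)//.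
    rewrite -[leRHS]ger0_norm ?addr_ge0// -sqrtr_sqr ler_wsqrtr// /sqn/=.
    rewrite -[sumc n t ^+ 2]real_normK ?num_real// -[sums n t ^+ 2]real_normK ?num_real//.
    have := normr_ge0 (sumc n t); have := normr_ge0 (sums n t).
    move: `|sumc n t| `|sums n t| => x y x0 y0; nra.
  apply: (@le_trans _ _ (expR (tau / 2 * `|sumc n t| + tau / 2 * `|sums n t|))).
    rewrite ler_expR; apply: le_trans (ler_wpM2l m0 h) _.
    by rewrite -mulrDr le_eqVlt; apply/orP; left; apply/eqP; rewrite /tau; field; rewrite gt_eqF.
  apply: le_trans (expD_le _ _) _; rewrite mulrC ler_wpM2l//.
  have e2 (z : R) : 2 * (tau / 2 * z) = tau * z by field.
  rewrite !e2.
  by rewrite -[leRHS]addrA; apply: lerD; exact: expM_abs.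
rewrite ge0_integralZl//; last 2 first.
- by do 3? apply: emeasurable_funD; exact: measurable_expM.
- by move=> t _; rewrite !adde_ge0.
rewrite ge0_integralD//; last 3 first.
- by move=> t _; rewrite !adde_ge0.
- by do 2? apply: emeasurable_funD; exact: measurable_expM.
- exact: measurable_expM.
rewrite ge0_integralD//; last 3 first.
- by move=> t _; rewrite !adde_ge0.
- by apply: emeasurable_funD; exact: measurable_expM.
- exact: measurable_expM.
rewrite ge0_integralD//; [|exact: measurable_expM..].
have -> : (2 * expR (8 * m ^+ 2))%:E = (2^-1%:E * ((expR (8 * m ^+ 2))%:E + (expR (8 * m ^+ 2))%:E + (expR (8 * m ^+ 2))%:E + (expR (8 * m ^+ 2))%:E))%E.
  by rewrite -!EFinD -EFinM; congr EFin; field.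
apply: lee_wpmul2l => //; do 3? apply: leeD; [apply: (le _ _ subgauss_ecos)|apply: (le _ _ subgauss_ecos)|apply: (le _ _ subgauss_esin)|apply: (le _ _ subgauss_esin)]; by rewrite ?sqrrN.
Qed.

(** By m x <= m^2 / 2 + x^2 / 2, together with the exponential moment of the squared radius. *)
Lemma expo_mgf (m : R) : (\int[U01]_u (expR (m * Num.sqrt (expo u)))%:E <= (2 * expR (m ^+ 2 / 2))%:E)%E.
Proof.
have [mr _ err_term] := @polar_radius_expo R.
have me : measurable_fun [set: mR] (fun u : mR => (expR (Num.sqrt (expo u) ^+ 2 / 2))%:E).
  apply/measurable_EFinP; apply: (measurableT_comp (@measurable_expR R)).
  by apply: measurable_funM => //; exact: measurable_funX.
apply: (@le_trans _ _ (\int[U01]_u ((expR (m ^+ 2 / 2))%:E * (expR (Num.sqrt (expo u) ^+ 2 / 2))%:E))%E).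
  apply: ge0_le_integral => //.
  - exact: measurable_expM.
  - exact: (emeasurable_funM (measurable_cst _) me).
  move=> u _; rewrite -EFinM lee_fin -expRD ler_expR.
  by have := sqr_ge0 (m - Num.sqrt (expo u)); move: (Num.sqrt _) => x; lra.
rewrite (ge0_integralZl U01 measurableT me (fun u _ => expR_ge0 _) (_ : (0 <= (expR (m ^+ 2 / 2))%:E)%E)); last by rewrite lee_fin expR_ge0.
by rewrite [2 * _]mulrC EFinM; apply: lee_wpmul2l; rewrite ?lee_fin ?expR_ge0.
Qed.

Definition berr (n : nat) (rho t V : R) : R :=
  `|Num.sqrt (bnorm n t) - Num.sqrt (bexp n (rho ^+ 8) (bnorm n t) V)|.

(** Off two bad events, a noise beyond rho^-4 or an exponential variable in the top C rho^2 of its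
    law, the coupling is within 3 C rho. On them x <= rho x^2 / 2 + 1/(2 rho): the square is
    integrable, and bad events of probability O(rho^2) cost only O(rho). *)
Lemma berr_pointwise : exists2 C : R, 1 <= C & forall (n : nat) (rho t V l : R), 0 <= l -> 0 < rho <= 1 ->
  rho ^+ 64 = n%:R^-1 -> C * rho ^+ 2 <= 2^-1 ->
  let q := bnorm n t in let p := scdf (bnorm n) (rho ^+ 8) (q + rho ^+ 8 * logit V) in
  is_true (expR (l * berr n rho t V) <= expR (3 * l * C * rho) +
    (rho / 4 * (expR (4 * l * Num.sqrt q) + expR (4 * l * Num.sqrt (expo p))) +
     (2 * rho)^-1 * (\1_(~` `[logi (- rho ^- 4), logi (rho ^- 4)[%classic) V + \1_(~` `[0, 1 - C * rho ^+ 2[%classic) p))).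
Proof.
have [C C1 H] := @scdf_bnorm_close R; exists C => // n rho t V l l0 r01 rn Cr q p.
have /andP[r0 r1] := r01; have rk k : 0 < rho ^+ k by exact: exprn_gt0.
have C0 : 0 < C by exact: lt_le_trans C1.
have [q0 _] := andP (bnorm_bound n t); rewrite -/q in q0.
set A := \1_ _ V; set B := \1_ _ p; have A0 : 0 <= A by []. have B0 : 0 <= B by [].
set eq := expR (4 * l * Num.sqrt q); set ev := expR (4 * l * Num.sqrt (expo p)).
have eq0 : 0 < eq := expR_gt0 _; have ev0 : 0 < ev := expR_gt0 _.
have X1 : berr n rho t V <= Num.sqrt q + Num.sqrt (expo p).
  rewrite /berr -/q /bexp -/p; have := sqrtr_ge0 q; have := sqrtr_ge0 (expo p).
  by move=> ? ?; rewrite ler_norml; apply/andP; split; lra.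
have e2X : expR (2 * (l * berr n rho t V)) <= (eq + ev) / 2.
  apply: (@le_trans _ _ (expR (2 * l * Num.sqrt q + 2 * l * Num.sqrt (expo p)))).
    by rewrite ler_expR -mulrDr mulrA ler_wpM2l// mulr_ge0.
  apply: le_trans (expD_le _ _) _; rewrite /eq /ev.
  have e (z : R) : 2 * (2 * l * z) = 4 * l * z by ring.
  by rewrite !e.
have rest0 : 0 <= rho / 4 * (eq + ev) by rewrite mulr_ge0// ?divr_ge0 ?addr_ge0 ?ltW.
have rest1 : 0 <= (2 * rho)^-1 * (A + B) by rewrite mulr_ge0 ?invr_ge0 ?mulr_ge0 ?addr_ge0 ?(ltW r0).
have [bad|] := boolP ((V \in ~` `[logi (- rho ^- 4), logi (rho ^- 4)[%classic) || (p \in ~` `[0, 1 - C * rho ^+ 2[%classic)).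
  have AB : 1 <= A + B.
    rewrite /A /B !indicE; case/orP: bad => ->; first by rewrite lerDl.
    by rewrite lerDr.
  apply: (@le_trans _ _ (rho / 4 * (eq + ev) + (2 * rho)^-1)); last first.
    by rewrite -[leLHS]add0r lerD ?expR_ge0// lerD2l ler_peMr// invr_ge0 mulr_ge0// ltW.
  set x := expR (l * _) in e2X *.
  have xx : x ^+ 2 <= (eq + ev) / 2.
    by apply: le_trans e2X; rewrite /x mulr_natl mulr2n expRD expr2.
  have amgm : x <= rho / 2 * x ^+ 2 + (2 * rho)^-1.
    rewrite -subr_ge0 (_ : _ - x = (rho * x - 1) ^+ 2 / (2 * rho)).
      by rewrite divr_ge0 ?sqr_ge0// mulr_ge0// ltW.
    by have r0' : rho != 0 by [rewrite gt_eqF]; field.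
  apply: le_trans amgm _; rewrite lerD2r.
  apply: le_trans (ler_wpM2l _ xx) _; first by rewrite divr_ge0// ltW.
  by rewrite le_eqVlt; apply/orP; left; apply/eqP; field.
rewrite negb_or !in_setC !negbK !mem_setE !in_itv/= => /andP[/andP[Vl Vu] /andP[p0 pu]].
have V01 : 0 < V < 1.
  by rewrite (lt_le_trans (logi_gt0 _) Vl) (lt_trans Vu (logi_lt1 _)).
have lV : `|logit V| <= rho ^- 4.
  rewrite ler_norml [X in _ && X]ltW ?logit_lt// andbT leNgt logit_lt// -leNgt//.
have Crk : 0 < C * rho ^+ 2 by rewrite mulr_gt0.
have p1 : p < 1 by apply: lt_le_trans pu _; rewrite gerBl ltW.
have tq : `|q + rho ^+ 8 * logit V - q| <= rho ^+ 4.
  rewrite addrC addKr normrM ger0_norm ?(ltW (rk _))//.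
  apply: le_trans (ler_wpM2l (ltW (rk _)) lV) _.
  by rewrite -[8%N]/(4 + 4)%N exprD mulfK// gt_eqF.
have close := expo_close q0 tq p1 _ (H n rho _ r01 rn) _.
have Cb : 0 < C * rho ^+ 2 <= 2^-1 by rewrite Crk.
have sp : C * rho ^+ 2 <= 1 - p by rewrite lerBrDr addrC -lerBrDr ltW.
have {}close := close Cb sp; rewrite -/p in close.
have X2 : berr n rho t V <= 3 * C * rho.
  apply: le_trans (sqrtB_le q0 _) _; first by rewrite oppr_ge0 ln_le0// gerBl.
  have h3 : 0 <= 3 * C * rho by rewrite !mulr_ge0// ltW.
  rewrite -[leRHS]ger0_norm// -[leRHS]sqrtr_sqr ler_wsqrtr//; apply: le_trans close _.
  have r42 : rho ^+ 4 <= rho ^+ 2 by rewrite ler_wiXn2l// ltW.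
  rewrite !exprMn; have := rk 2%N; move: (rho ^+ 2) (rho ^+ 4) r42 => x y xy x0.
  have : C * x <= C ^+ 2 * x by rewrite ler_wpM2r ?(ltW x0)// expr2 ler_peMl// ltW.
  have : x <= C * x by rewrite ler_peMl// ltW.
  lra.
apply: (@le_trans _ _ (expR (3 * l * C * rho))).
  by rewrite ler_expR -!mulrA mulrCA ler_wpM2l// !mulrA.
by rewrite lerDl addr_ge0.
Qed.

Lemma expR_le_lin (c x : R) : 0 <= c -> 0 <= x <= 1 -> expR (c * x) <= 1 + c * expR c * x.
Proof.
move=> c0 /andP[x0 x1]; have h := expR_ge1Dx (- (c * x)).
have e : expR (c * x) <= expR c by rewrite ler_expR ler_piMr.
have : expR (c * x) * (1 - c * x) <= 1.
  by rewrite -[leRHS](expRxMexpNx_1 (c * x)) ler_wpM2l ?expR_ge0.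
have : c * x * expR (c * x) <= c * x * expR c by rewrite ler_wpM2l// mulr_ge0.
lra.
Qed.

(** The bad events have probability at most 2 rho^4 and C rho^2; divided by 2 rho these are O(rho),
    and so are the remaining terms of the pointwise bound after subtracting 1. *)
Lemma berr_exp (l : R) : 0 <= l -> exists2 K : R, 0 <= K & forall (n : nat) (rho : R), 0 < rho <= 1 ->
  rho ^+ 64 = n%:R^-1 ->
  (\int[U01]_w (expR (l * berr n rho (lft w) (rgt w)))%:E <= (1 + K * rho)%:E)%E.
Proof.
move=> l0; have [C C1 H] := berr_pointwise; have C0 : 0 < C by exact: lt_le_trans C1.
pose m := 4 * l; have m0 : 0 <= m by rewrite mulr_ge0.
pose Kq := 2 * expR (8 * m ^+ 2); pose Kv := 2 * expR (m ^+ 2 / 2).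
have Kq0 : 0 <= Kq by rewrite mulr_ge0 ?expR_ge0.
have Kv0 : 0 <= Kv by rewrite mulr_ge0 ?expR_ge0.
pose c := 3 * l * C; have c0 : 0 <= c by rewrite !mulr_ge0// ltW.
exists (2 * C * (Kq + Kv) + (c * expR c + (Kq + Kv) + 2 + C)).
  by rewrite !addr_ge0 ?mulr_ge0 ?addr_ge0 ?expR_ge0// ltW.
move=> n rho r01 rn; have /andP[r0 r1] := r01.
have rk k : 0 < rho ^+ k by exact: exprn_gt0.
have n0 : (0 < n)%N.
  by rewrite lt0n; apply/eqP => n0; move: rn; rewrite n0 invr0 => /eqP; rewrite gt_eqF.
pose q (w : R) : R := bnorm n (lft w); pose p (w : R) : R := scdf (bnorm n) (rho ^+ 8) (q w + rho ^+ 8 * logit (rgt w)).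
have mq : measurable_fun [set: mR] (q : mR -> mR) by exact: (measurable_comp1 (measurable_bnorm n) measurable_lft).
have msc : measurable_fun [set: mR] (scdf (bnorm n) (rho ^+ 8) : mR -> mR).
  by apply: measurable_scdf => //; exact: measurable_bnorm.
have mp_ : measurable_fun [set: mR] (p : mR -> mR).
  apply: (measurable_comp1 msc); apply: measurable_funD => //; apply: measurable_funM => //.
  exact: (measurable_comp1 measurable_logit measurable_rgt).
have ms (x : R -> R) : measurable_fun [set: mR] (x : mR -> mR) -> measurable_fun [set: mR] (fun w => Num.sqrt (x w) : mR).
  by move=> mx; exact: (measurable_comp1 measurable_sqrt).
have mb : measurable_fun [set: mR] (fun w => berr n rho (lft w) (rgt w) : mR).
  apply: (measurable_comp1 measurable_abs); apply: measurable_funB; first exact: ms.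
  apply: ms; apply: measurable_bexp => //; exact: measurable_rgt.
have p_law (f : mR -> \bar R) : measurable_fun setT f -> (forall z, 0 <= f z)%E ->
    (\int[U01]_w f (p w) = \int[U01]_u f u)%E.
  move=> mf f0; rewrite -(scdf_uniform (measurable_bnorm n) (bnorm_bound n) (rk 8%N) mf f0).
  apply: (split_integral (f := fun z => f (scdf (bnorm n) (rho ^+ 8) (bnorm n z.1 + rho ^+ 8 * logit z.2)%R))) => //.
  apply: (measurableT_comp mf); apply: (measurable_comp1 msc); apply: measurable_funD.
    exact: (measurable_comp1 (measurable_bnorm n)).
  by apply: measurable_funM => //; exact: (measurable_comp1 measurable_logit).
have e0 (f : mR -> R) w : (0 <= (expR (f w))%:E)%E by rewrite lee_fin expR_ge0.
have mv : measurable_fun [set: mR] (fun w => Num.sqrt (expo (p w)) : mR).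
  by apply: ms; exact: (measurable_comp1 measurable_expo).
have iq : (\int[U01]_w (expR (m * Num.sqrt (q w)))%:E <= Kq%:E)%E.
  rewrite (lft_integral (f := fun t => (expR (m * Num.sqrt (bnorm n t)))%:E))//; last first.
    by apply: measurable_expM; apply: ms; exact: measurable_bnorm.
  exact: bnorm_mgf.
have iv : (\int[U01]_w (expR (m * Num.sqrt (expo (p w))))%:E <= Kv%:E)%E.
  rewrite (p_law (fun u => (expR (m * Num.sqrt (expo u)))%:E))//; last first.
    by apply: measurable_expM; apply: ms; exact: measurable_expo.
  exact: expo_mgf.
have mEq := measurable_expM m (ms _ mq); have mEv := measurable_expM m mv.
pose I (w : R) : \bar R := ((expR (m * Num.sqrt (q w)))%:E + (expR (m * Num.sqrt (expo (p w))))%:E)%E.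
have mI : measurable_fun [set: mR] I by exact: emeasurable_funD.
have I0 w : (0 <= I w)%E by rewrite adde_ge0.
have iI : (\int[U01]_w I w <= (Kq + Kv)%:E)%E.
  by rewrite ge0_integralD// EFinD; exact: leeD.
(* If C rho^2 > 1/2 then 2 C rho >= 1, and any constant bound is already of the form K rho. *)
have [Cr|Cr] := leP (C * rho ^+ 2) (2^-1); last first.
  apply: (@le_trans _ _ (\int[U01]_w I w)%E).
    apply: ge0_le_integral => //; first exact: measurable_expM.
    move=> w _; rewrite /I -EFinD lee_fin.
    apply: (@le_trans _ _ (expR (l * Num.sqrt (q w) + l * Num.sqrt (expo (p w))))).
      rewrite ler_expR -mulrDr ler_wpM2l// /berr -/(q w) /bexp -/(p w).
      have := sqrtr_ge0 (q w); have := sqrtr_ge0 (expo (p w)).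
      by move=> ? ?; rewrite ler_norml; apply/andP; split; lra.
    apply: le_trans (expD_le _ _) _.
    have e (z : R) : 0 <= z -> expR (2 * (l * z)) <= expR (m * z).
      by move=> z0; rewrite ler_expR mulrA ler_wpM2r// /m; lra.
    have := e _ (sqrtr_ge0 (q w)); have := e _ (sqrtr_ge0 (expo (p w))).
    have := expR_ge0 (2 * (l * Num.sqrt (q w))); have := expR_ge0 (2 * (l * Num.sqrt (expo (p w)))); lra.
  apply: le_trans iI _; rewrite lee_fin.
  have r2 : rho ^+ 2 <= rho by rewrite expr2 ler_piMl// ltW.
  have : 1 <= 2 * C * rho by have := ler_wpM2l (ltW C0) r2; lra.
  move=> h; have h1 : Kq + Kv <= (Kq + Kv) * (2 * C * rho) by rewrite ler_peMr// addr_ge0.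
  have h2 : 0 <= (c * expR c + (Kq + Kv) + 2 + C) * rho.
    by rewrite mulr_ge0 ?addr_ge0 ?mulr_ge0 ?expR_ge0// ltW.
  lra.
set A : set R := ~` `[logi (- rho ^- 4), logi (rho ^- 4)[%classic; set B : set R := ~` `[0, 1 - C * rho ^+ 2[%classic.
have mA : measurable A by apply: measurableC; exact: measurable_itv.
have mB : measurable B by apply: measurableC; exact: measurable_itv.
have [lt1 lt2] := logi_tail (rk 4%N).
have iA : (\int[U01]_w (\1_A (rgt w))%:E <= (2 * rho ^+ 4)%:E)%E.
  rewrite (rgt_integral (f := fun v => (\1_A v)%:E))//; last by apply/measurable_EFinP; exact: measurable_indic.
  rewrite (integral_indic U01 measurableT mA) setIT; apply: (@le_trans _ _ (1 - (logi (rho ^- 4) - logi (- rho ^- 4)))%:E).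
    rewrite le_eqVlt; apply/orP; left; apply/eqP; apply: U01_Icc; [exact/ltW/logi_gt0| |exact/ltW/logi_lt1].
    by apply: logi_mono; apply: (@le_trans _ _ 0); rewrite ?oppr_le0 invr_ge0 ltW.
  rewrite lee_fin; lra.
have iB : (\int[U01]_w (\1_B (p w))%:E <= (C * rho ^+ 2)%:E)%E.
  rewrite (p_law (fun v => (\1_B v)%:E))//; last by apply/measurable_EFinP; exact: measurable_indic.
  rewrite (integral_indic U01 measurableT mB) setIT; apply: (@le_trans _ _ (1 - (1 - C * rho ^+ 2 - 0))%:E).
    rewrite le_eqVlt; apply/orP; left; apply/eqP; apply: U01_Icc => //; first by lra.
    by rewrite gerBl mulr_ge0 ?ltW.
  by rewrite subr0 opprB addrC subrK.
pose J (w : R) : \bar R := ((\1_A (rgt w))%:E + (\1_B (p w))%:E)%E.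
have mjA : measurable_fun [set: mR] (fun w => (\1_A (rgt w))%:E : \bar R).
  by apply/measurable_EFinP; apply: (measurableT_comp (measurable_indic mA)); exact: measurable_rgt.
have mjB : measurable_fun [set: mR] (fun w => (\1_B (p w))%:E : \bar R).
  by apply/measurable_EFinP; apply: (measurableT_comp (measurable_indic mB)).
have mJ : measurable_fun [set: mR] J by exact: emeasurable_funD.
have J0 w : (0 <= J w)%E by rewrite adde_ge0.
have iJ : (\int[U01]_w J w <= (2 * rho ^+ 4 + C * rho ^+ 2)%:E)%E.
  by rewrite ge0_integralD// EFinD; exact: leeD.
have a0 : 0 <= rho / 4 by rewrite divr_ge0// ltW.
have b0 : 0 <= (2 * rho)^-1 by rewrite invr_ge0 mulr_ge0// ltW.
have maI : measurable_fun [set: mR] (fun w => (rho / 4)%:E * I w)%E by exact: (emeasurable_funM (measurable_cst _) mI).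
have mbJ : measurable_fun [set: mR] (fun w => (2 * rho)^-1%:E * J w)%E by exact: (emeasurable_funM (measurable_cst _) mJ).
have aI0 w : (0 <= (rho / 4)%:E * I w)%E by rewrite mule_ge0.
have bJ0 w : (0 <= (2 * rho)^-1%:E * J w)%E by rewrite mule_ge0.
apply: (@le_trans _ _ (\int[U01]_w ((expR (c * rho))%:E + ((rho / 4)%:E * I w + (2 * rho)^-1%:E * J w)))%E).
  apply: ge0_le_integral => //; first exact: measurable_expM.
    by apply: emeasurable_funD => //; exact: emeasurable_funD.
  by move=> w _; have := H n rho (lft w) (rgt w) l l0 r01 rn Cr => /= h; have := h; rewrite -lee_fin; exact.
rewrite ge0_integralD//; last 2 first.
- by move=> w _; rewrite adde_ge0.
- exact: emeasurable_funD.
rewrite ge0_integralD// integral_cst_prob !ge0_integralZl//.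
have := @leeD _ _ _ _ _ (lexx (expR (c * rho))%:E) (leeD (lee_wpmul2l (_ : (0 <= (rho / 4)%:E)%E) iI) (lee_wpmul2l (_ : (0 <= (2 * rho)^-1%:E)%E) iJ)).
move=> /(_ a0 b0) /le_trans; apply; rewrite -!EFinM -!EFinD lee_fin.
have e1 := @expR_le_lin c rho c0; rewrite (ltW r0) r1 in e1.
have -> : (2 * rho)^-1 * (2 * rho ^+ 4 + C * rho ^+ 2) = rho ^+ 2 * rho + C * rho / 2.
  by have r0' : rho != 0 by [rewrite gt_eqF]; field.
have r2 : rho ^+ 2 * rho <= rho by rewrite ler_piMl ?(ltW r0)// exprn_ile1// ltW.
have h1 : 0 <= (2 * C * (Kq + Kv)) * rho by rewrite !mulr_ge0 ?addr_ge0// ltW.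
have h2 : 0 <= (Kq + Kv) * rho by rewrite mulr_ge0 ?addr_ge0// ltW.
have h3 : 0 <= C * rho by rewrite mulr_ge0 ?ltW.
move: (e1 isT) h1 h2 h3 r2; move: (expR _) (Kq + Kv) (rho ^+ 2) => ? ? ? {}e1 h1 h2 h3 r2; lra.
Qed.

End exponential_moments.

(** * Exponential moments of the statistics of a block *)

Section block_moments.
Context {R : realType}.
Local Notation mR := (measurableTypeR R).
Local Notation U01 := (@U01 R).
Local Notation gam := (@gam R).
Local Notation plane := (mR * mR)%type.

(** The coupling rate n^(-1/64); the maximum with 1 gives an empty block the value 1. *)
Definition rho_ (n : nat) : R := (maxn n 1)%:R `^ (- 64^-1).

Lemma rho_bound n : 0 < rho_ n <= 1.
Proof.
have n1 : (1 : R) <= (maxn n 1)%:R by rewrite ler1n leq_maxr.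
rewrite powR_gt0 ?(lt_le_trans ltr01)//= -(powRr0 (maxn n 1)%:R) /rho_.
by apply: ler_powR => //; rewrite oppr_le0 invr_ge0.
Qed.

Lemma rho_gt0 n : 0 < rho_ n. Proof. by case/andP: (rho_bound n). Qed.

Lemma rhoX n : (0 < n)%N -> rho_ n ^+ 64 = n%:R^-1.
Proof.
move=> n0; rewrite /rho_ (maxn_idPl n0) -powR_mulrn ?powR_ge0// -powRrM mulNr mulVf ?pnatr_eq0//.
by rewrite powRN powRr1.
Qed.

(* The uniform source [w] of a block is split into the angles [useq i (useq 0 w)], the smoothing
   variable [useq 1 w], the direction [useq 2 w], and the sources of the two Gaussian splittings. *)
Definition block_theta (w : R) (i : nat) : R := useq i (useq 0 w).
Definition block_g1 (n : nat) (w : R) : R :=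
  bgauss1 n (rho_ n ^+ 8) (sumc n (useq 0 w), sums n (useq 0 w)) (useq 1 w) (useq 2 w).
Definition block_g2 (n : nat) (w : R) : R :=
  bgauss2 n (rho_ n ^+ 8) (sumc n (useq 0 w), sums n (useq 0 w)) (useq 1 w) (useq 2 w).
Definition block_w1 (n : nat) (w : R) (i : nat) : R := wsplit n (block_g1 n w) (useq 3 w) i.
Definition block_w2 (n : nat) (w : R) (i : nat) : R := wsplit n (block_g2 n w) (iter 4 rgt w) i.

Lemma measurable_block_g n : measurable_fun [set: mR] (fun w => (block_g1 n w, block_g2 n w) : plane).
Proof.
apply: measurable_bgauss; rewrite ?exprn_gt0 ?rho_gt0//; try exact: measurable_useq.
  by apply: (measurable_comp1 (measurable_sumc n)); exact: measurable_useq.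
by apply: (measurable_comp1 (measurable_sums n)); exact: measurable_useq.
Qed.

Lemma measurable_block_theta i : measurable_fun [set: mR] (fun w => block_theta w i : mR).
Proof. by apply: measurable_useq; exact: measurable_useq. Qed.

Lemma measurable_block_w1 n i : measurable_fun [set: mR] (fun w => block_w1 n w i : mR).
Proof.
apply: measurable_wsplit; last exact: measurable_useq.
exact: (measurableT_comp measurable_fst (measurable_block_g n)).
Qed.

Lemma measurable_block_w2 n i : measurable_fun [set: mR] (fun w => block_w2 n w i : mR).
Proof.
apply: measurable_wsplit; last exact: measurable_iter_rgt.
exact: (measurableT_comp measurable_snd (measurable_block_g n)).
Qed.

(** The source beyond the first three draws stays uniform and independent of the Gaussian pair; its
    two halves feed the two splittings. *)
Lemma block_law n (F : plane * mR -> \bar R) : measurable_fun setT F -> (forall z, 0 <= F z)%E ->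
  (\int[U01]_w F ((block_g1 n w, block_g2 n w), iter 3 rgt w) =
   \int[gam]_x \int[gam]_y \int[U01]_r F ((x, y), r))%E.
Proof.
move=> mF F0; have eps0 : 0 < rho_ n ^+ 8 by rewrite exprn_gt0// rho_gt0.
pose g (t V U : R) : plane := (bgauss1 n (rho_ n ^+ 8) (sumc n t, sums n t) V U, bgauss2 n (rho_ n ^+ 8) (sumc n t, sums n t) V U).
have mg d (T : measurableType d) (t V U : T -> R) : measurable_fun [set: T] (t : T -> mR) ->
    measurable_fun [set: T] (V : T -> mR) -> measurable_fun [set: T] (U : T -> mR) ->
    measurable_fun [set: T] (fun x => g (t x) (V x) (U x)).
  move=> mt mV mU; apply: measurable_bgauss => //.
    exact: (measurable_comp1 (measurable_sumc n)).
  exact: (measurable_comp1 (measurable_sums n)).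
have mFg d (T : measurableType d) (t V U r : T -> R) : measurable_fun [set: T] (t : T -> mR) ->
    measurable_fun [set: T] (V : T -> mR) -> measurable_fun [set: T] (U : T -> mR) ->
    measurable_fun [set: T] (r : T -> mR) -> measurable_fun [set: T] (fun x => F (g (t x) (V x) (U x), r x)).
  move=> mt mV mU mr'; apply: (measurableT_comp mF); apply: measurable_fun_pair => //; exact: mg.
pose G (z : plane) : \bar R := (\int[U01]_r F (z, r))%E.
have mG : mp G by exact: (measurable_fun_fubini_tonelli_F F).
have G0 : nn G by move=> z; exact: integral_ge0.
rewrite -[RHS](bgauss_law n eps0 mG G0).
transitivity (\int[U01]_t \int[U01]_z F (g t (useq 0 z) (useq 1 z), iter 2 rgt z))%E.
  apply: (split_integral (f := fun t => F (g t.1 (useq 0 t.2) (useq 1 t.2), iter 2 rgt t.2))) => //.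
  apply: mFg; [exact: measurable_fst|exact: measurable_useq|exact: measurable_useq|exact: measurable_iter_rgt].
apply: eq_integral => t _.
transitivity (\int[U01]_V \int[U01]_z F (g t V (useq 0 z), iter 1 rgt z))%E.
  apply: (split_integral (f := fun s => F (g t s.1 (useq 0 s.2), iter 1 rgt s.2))) => //.
  apply: mFg; [exact: measurable_cst|exact: measurable_fst|exact: measurable_useq|exact: measurable_iter_rgt].
apply: eq_integral => V _.
apply: (split_integral (f := fun s => F (g t V s.1, s.2))) => //.
by apply: mFg; [exact: measurable_cst|exact: measurable_cst|exact: measurable_fst|exact: measurable_snd].
Qed.

Lemma block_w1_integral n (F : mR * mR -> \bar R) : measurable_fun setT F -> (forall z, 0 <= F z)%E ->
  (\int[U01]_w F (block_g1 n w, useq 3 w) = \int[gam]_x \int[U01]_r F (x, r))%E.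
Proof.
move=> mF F0; have mF' : measurable_fun [set: (plane * mR)%type] (fun z : plane * mR => F (z.1.1, lft z.2)).
  apply: (measurableT_comp mF); apply: measurable_fun_pair; first exact: (measurableT_comp measurable_fst measurable_fst).
  exact: (measurable_comp1 measurable_lft).
apply: etrans (block_law n mF' (fun _ => F0 _)) _.
apply: eq_integral => x _ /=; rewrite integral_cst_prob.
by rewrite (lft_integral (f := fun r => F (x, r)))//; exact: (measurable_fun_pair2 x mF).
Qed.

Lemma block_w2_integral n (F : mR * mR -> \bar R) : measurable_fun setT F -> (forall z, 0 <= F z)%E ->
  (\int[U01]_w F (block_g2 n w, iter 4 rgt w) = \int[gam]_x \int[U01]_r F (x, r))%E.
Proof.
move=> mF F0; have mF' : measurable_fun [set: (plane * mR)%type] (fun z : plane * mR => F (z.1.2, rgt z.2)).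
  apply: (measurableT_comp mF); apply: measurable_fun_pair; first exact: (measurableT_comp measurable_snd measurable_fst).
  exact: (measurable_comp1 measurable_rgt).
apply: etrans (block_law n mF' (fun _ => F0 _)) _.
rewrite [LHS]/= integral_cst_prob; apply: eq_integral => x _ /=.
by rewrite (rgt_integral (f := fun r => F (x, r)))//; exact: (measurable_fun_pair2 x mF).
Qed.

(** A partial sum is the linear combination with coefficients 0 and 1 of i.i.d. standard Gaussians,
    hence of variance m <= n. *)
Lemma wsplit_mgf n m (t : R) : (m <= n)%N ->
  (\int[gam]_x \int[U01]_r (expR (t * \sum_(i < m) wsplit n x r i))%:E <= (expR (2 * t ^+ 2 * n%:R))%:E)%E.
Proof.
move=> mn; pose c (k : nat) : R := (k < m)%N%:R.
have mf : measurable_fun [set: mR] (fun s : mR => (expR (t * s))%:E) by apply: measurable_expM.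
have f0 (s : mR) : (0 <= (expR (t * s))%:E)%E by rewrite lee_fin expR_ge0.
have := @wsplit_law R n c (fun _ => cst 1%E) (fun s => (expR (t * s))%:E) 0 (fun _ => measurable_cst _) mf (fun _ _ => lee01) f0.
rewrite gfun1// => h.
have sm (F : nat -> R) : \sum_(k < n) c k * F k = \sum_(i < m) F i.
  rewrite [RHS](big_ord_widen n F mn) [RHS]big_mkcond/=; apply: eq_bigr => k _.
  by rewrite /c; case: ifP => _; rewrite ?mul1r ?mul0r.
apply: (@le_trans _ _ (\int[gam]_x (expR (t * (0 + Num.sqrt (\sum_(k < n) c k ^+ 2) * x)))%:E)%E).
  rewrite -h le_eqVlt; apply/orP; left; apply/eqP; apply: eq_integral => x _; apply: eq_integral => r _.
  by rewrite eprod_cst expr1n mul1e add0r (sm (wsplit n x r)).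
have -> : \sum_(k < n) c k ^+ 2 = m%:R.
  transitivity (\sum_(k < n) c k * 1); last by rewrite (sm (fun=> 1)) sumr_const card_ord.
  by apply: eq_bigr => k _; rewrite mulr1 /c; case: (k < m)%N; rewrite ?expr1n ?expr0n.
under eq_integral do rewrite add0r mulrA.
rewrite gam_mgf lee_fin ler_expR exprMn sqr_sqrtr//.
have t2 := sqr_ge0 t; have mn' : m%:R <= n%:R :> R by rewrite ler_nat.
have a := ler_wpM2l t2 mn'; have b : 0 <= t ^+ 2 * m%:R by rewrite mulr_ge0.
lra.
Qed.

(** The six sequences whose partial sums over a block must be controlled: cosine and sine of the
    first two harmonics, and both Gaussian families. *)
Definition xs (th w1 w2 : nat -> R) (s i : nat) : R :=
  match s with
  | 0 => ecos (th i) | 1 => esin (th i)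
  | 2 => ecos (2 * th i) | 3 => esin (2 * th i)
  | 4 => w1 i | _ => w2 i
  end.

Definition bmax (n : nat) (th w1 w2 : nat -> R) : R :=
  \big[Num.max/0]_(s < 6) \big[Num.max/0]_(m < n.+1) `|\sum_(i < m) xs th w1 w2 s i|.

(** The division by sqrt 2 reflects the weight 1/sqrt(2p) of the Gaussian term against p^(-1/2) for
    the first harmonic. *)
Definition bdiff (n : nat) (th w1 w2 : nat -> R) : R :=
  `|\sum_(i < n) (ecos (th i) - w1 i / Num.sqrt 2)| + `|\sum_(i < n) (esin (th i) - w2 i / Num.sqrt 2)|.

Lemma bmax_ge n th w1 w2 s m : (s < 6)%N -> (m <= n)%N -> `|\sum_(i < m) xs th w1 w2 s i| <= bmax n th w1 w2.
Proof.
move=> s6 mn; rewrite /bmax.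
apply: le_trans (le_bigmax_cond _ (fun s : 'I_6 => \big[Num.max/0]_(m < n.+1) `|\sum_(i < m) xs th w1 w2 s i|) (isT : xpredT (Ordinal s6))).
by have m1 : (m < n.+1)%N by []; apply: (le_bigmax_cond _ (fun m : 'I_n.+1 => `|\sum_(i < m) xs th w1 w2 s i|) (isT : xpredT (Ordinal m1))).
Qed.

Lemma bmax_ge0 n th w1 w2 : 0 <= bmax n th w1 w2.
Proof. by apply: le_trans (@bmax_ge n th w1 w2 0 0 _ _); rewrite ?normr_ge0. Qed.

(** The exponential of a maximum is one of the exponentials in the sum, or 1 when the maximum is its
    initial value 0. *)
Lemma exp_bigmax (t : R) n (f : nat -> R) :
  expR (t * \big[Num.max/0]_(i < n) f i) <= 1 + \sum_(i < n) expR (t * f i).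
Proof.
elim: n f => [|n IH] f; first by rewrite !big_ord0 mulr0 expR0 addr0.
rewrite !big_ord_recl/=; have {IH} := IH (fun i => f i.+1); set b := \big[_/_]_(_ < _) _.
set c := \big[_/_]_(_ < n) _ in b *; set S := \sum_(_ < n) _.
have S0 : 0 <= S by apply: sumr_ge0 => i _; exact: expR_ge0.
move=> IH; have [h|h] := leP (f 0%N) b; first by apply: le_trans IH _; rewrite lerD2l lerDr expR_ge0.
by rewrite addrCA lerDl addr_ge0.
Qed.

Lemma dir_le1 (z : plane) (U : R) : `|dir1 z U| <= 1 /\ `|dir2 z U| <= 1.
Proof.
have [v /(_ 0 U)] := dir_unit z.
have -> : rot 0 z = z.
  by case: z => x y; rewrite /rot /= /ecos /esin mulr0 cos0 sin0 !mulr0 !mulr1 subr0 add0r.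
by case: ifP => _ [-> ->]; rewrite ecos_le1 esin_le1.
Qed.

(** The sum of the unit vectors and its Gaussian counterpart share their direction, so each
    coordinate of the difference is sqrt n |sqrt u - sqrt v| times a coordinate of a unit vector.
    The splitting preserves the Gaussian total exactly. *)
Lemma bdiff_le n (w : R) :
  bdiff n (block_theta w) (block_w1 n w) (block_w2 n w)
  <= 2 * (Num.sqrt n%:R * berr n (rho_ n) (useq 0 w) (useq 1 w)).
Proof.
rewrite /bdiff !sumrB -!mulr_suml !wsplit_sum.
set S := (sumc n (useq 0 w), sums n (useq 0 w)).
rewrite -[\sum_(i < n) ecos _]/(S.1) -[\sum_(i < n) esin _]/(S.2).
rewrite /block_g1 /block_g2 /bgauss1 /bgauss2 -/S -[sqn S / _]/(bnorm n (useq 0 w)).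
set v := bexp _ _ _ _; set u := bnorm n (useq 0 w); set s := Num.sqrt n%:R.
have [d1 d2] := dir_le1 S (useq 2 w).
have e2 (x : R) : s * (Num.sqrt (2 * v) * x) / Num.sqrt 2 = s * Num.sqrt v * x.
  have s2 : Num.sqrt 2 != 0 :> R by rewrite sqrtr_eq0 -ltNge.
  by rewrite sqrtrM//; field.
have su : s * Num.sqrt u = Num.sqrt (sqn S).
  rewrite /u /bnorm -/S; have [n0|n0] := posnP n.
    by rewrite /s n0 sqrtr0 mul0r /S n0 /sumc /sums /sqn/= !big_ord0 expr0n/= addr0 sqrtr0.
  by rewrite /s -sqrtrM// mulrCA mulfV ?mulr1// pnatr_eq0 -lt0n.
have [S1 S2] : S.1 = s * Num.sqrt u * dir1 S (useq 2 w) /\ S.2 = s * Num.sqrt u * dir2 S (useq 2 w).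
  rewrite su /dir1 /dir2; have [S0|S0] := eqVneq (sqn S) 0.
    rewrite S0 sqrtr0 !mul0r; have := S0; move/eqP; rewrite paddr_eq0 ?sqr_ge0// !sqrf_eq0.
    by move=> /andP[/eqP -> /eqP ->].
  have s0 : Num.sqrt (sqn S) != 0 by rewrite sqrtr_eq0 -ltNge lt_neqAle sqn_ge0 eq_sym S0.
  by rewrite indicE memNset ?mulr0 ?addr0; [split; field|exact/eqP].
rewrite !e2 S1 S2 -!mulrBl -!mulrBr !normrM -[`|Num.sqrt u - _|]/(berr n (rho_ n) (useq 0 w) (useq 1 w)).
rewrite (ger0_norm (sqrtr_ge0 _)) -mulrDr mulrC; apply: ler_wpM2r; last by lra.
by rewrite mulr_ge0 ?sqrtr_ge0 ?normr_ge0.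
Qed.

(** Convexity of the exponential between 0 and y; it brings a small weight [g] down from the
    exponent. *)
Lemma expR_conv (g y : R) : 0 <= g <= 1 -> expR (g * y) <= (1 - g) + g * expR y.
Proof.
move=> /andP[g0 g1].
have h1 := expR_ge1Dx ((1 - g) * y); have h2 := expR_ge1Dx (- (g * y)).
have e1 : expR y = expR ((1 - g) * y) * expR (g * y) by rewrite -expRD; congr expR; ring.
have e2 := expRxMexpNx_1 (g * y).
have z0 := expR_gt0 (g * y); move: e1 e2 h1 h2 z0.
move: (expR _) (expR ((1 - g) * y)) (expR (g * y)) (expR (- (g * y))) => E p z q -> zq h1 h2 z0.
have g1' : 0 <= 1 - g by lra.
have a1 := ler_wpM2l g0 h1; have a2 := ler_wpM2l g1' h2.
have a : 1 <= g * p + (1 - g) * q by apply: le_trans (lerD a1 a2); rewrite le_eqVlt; apply/orP; left; apply/eqP; ring.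
have := ler_wpM2r (ltW z0) a; rewrite mul1r => h; apply: le_trans h _.
have -> : (g * p + (1 - g) * q) * z = (1 - g) * (z * q) + g * (p * z) by ring.
by rewrite zq mulr1.
Qed.

Lemma integral_sum_le k (f : nat -> R -> R) (c : R) : (forall i, (i < k)%N -> measurable_fun [set: mR] (f i : mR -> mR)) ->
  (forall i w, 0 <= f i w) -> (forall i, (i < k)%N -> (\int[U01]_w (f i w)%:E <= c%:E)%E) ->
  (\int[U01]_w (\sum_(i < k) f i w)%:E <= (k%:R * c)%:E)%E.
Proof.
move=> mf f0; elim: k mf => [|k IH] mf fc.
  by under eq_integral do rewrite big_ord0; rewrite integral_cst_prob mul0r.
under eq_integral do rewrite big_ord_recr/= EFinD.
have ms : measurable_fun [set: mR] (fun w => \sum_(i < k) f i w : mR).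
  by apply: measurable_sum => i; apply: mf; rewrite (ltn_trans (ltn_ord i)).
rewrite ge0_integralD//; last 4 first.
- by move=> w _; rewrite lee_fin sumr_ge0.
- exact/measurable_EFinP.
- by move=> w _; rewrite lee_fin.
- by apply/measurable_EFinP; exact: mf.
rewrite -natr1 mulrDl mul1r EFinD; apply: leeD; last exact: fc.
by apply: IH => i ik; [apply: mf|apply: fc]; rewrite (ltn_trans ik).
Qed.

Let measurable_xs n s i : measurable_fun [set: mR] (fun w => xs (block_theta w) (block_w1 n w) (block_w2 n w) s i : mR).
Proof.
have m2 : measurable_fun [set: mR] (fun w => 2 * block_theta w i : mR).
  by apply: measurable_funM => //; exact: measurable_block_theta.
move: s => [|[|[|[|[|s]]]]] /=.
- exact: (measurable_comp1 measurable_ecos (measurable_block_theta i)).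
- exact: (measurable_comp1 measurable_esin (measurable_block_theta i)).
- exact: (measurable_comp1 measurable_ecos m2).
- exact: (measurable_comp1 measurable_esin m2).
- exact: measurable_block_w1.
- exact: measurable_block_w2.
Qed.

Lemma xs_mgf n s m (t : R) : (m <= n)%N ->
  (\int[U01]_w (expR (t * \sum_(i < m) xs (block_theta w) (block_w1 n w) (block_w2 n w) s i))%:E
    <= (expR (2 * t ^+ 2 * n%:R))%:E)%E.
Proof.
move=> mn; have t2 := sqr_ge0 t.
have th (a : R -> R) : subgauss 2 a ->
    (\int[U01]_w (expR (t * \sum_(i < m) a (block_theta w i)))%:E <= (expR (2 * t ^+ 2 * n%:R))%:E)%E.
  move=> sa; rewrite (useq_integral 0 (f := fun u => (expR (t * \sum_(i < m) a (useq i u)))%:E)); last 2 first.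
  - have [ma _] := sa; apply: measurable_expM; apply: measurable_sum => i.
    by apply: (measurable_comp1 ma); exact: measurable_useq.
  - by move=> z; rewrite lee_fin expR_ge0.
  apply: le_trans (sum_mgf m t sa) _; rewrite lee_fin ler_expR ler_wpM2l ?ler_nat//.
  exact: mulr_ge0.
have mw : measurable_fun [set: mR * mR] (fun z : mR * mR => (expR (t * \sum_(i < m) wsplit n z.1 z.2 i))%:E).
  by apply: measurable_expM; apply: measurable_sum => i; exact: measurable_wsplit.
have w0 (z : mR * mR) : (0 <= (expR (t * \sum_(i < m) wsplit n z.1 z.2 i))%:E)%E by rewrite lee_fin expR_ge0.
move: s => [|[|[|[|[|s]]]]] /=.
- exact: (th _ subgauss_ecos).
- exact: (th _ subgauss_esin).
- exact: (th _ subgauss_ecos2).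
- exact: (th _ subgauss_esin2).
- by apply: le_trans (wsplit_mgf t mn); rewrite le_eqVlt; apply/orP; left; apply/eqP; exact: (block_w1_integral n mw w0).
- by apply: le_trans (wsplit_mgf t mn); rewrite le_eqVlt; apply/orP; left; apply/eqP; exact: (block_w2_integral n mw w0).
Qed.

Lemma measurable_bigmax d (T : measurableType d) k (f : nat -> T -> R) : (forall i, measurable_fun [set: T] (f i : T -> mR)) ->
  measurable_fun [set: T] (fun w => \big[Num.max/0]_(i < k) f i w : mR).
Proof.
elim: k f => [|k IH] f mf; first by under eq_fun do rewrite big_ord0; exact: measurable_cst.
under eq_fun do rewrite big_ord_recl; apply: measurable_maxr; first exact: (mf 0%N).
exact: (IH (fun i => f i.+1) (fun i => mf i.+1)).
Qed.

Lemma measurable_block_bmax n : measurable_fun [set: mR] (fun w => bmax n (block_theta w) (block_w1 n w) (block_w2 n w) : mR).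
Proof.
apply: (@measurable_bigmax _ mR 6 (fun s w => \big[Num.max/0]_(m < n.+1) `|\sum_(i < m) xs (block_theta w) (block_w1 n w) (block_w2 n w) s i|)) => s.
apply: (@measurable_bigmax _ mR n.+1 (fun m w => `|\sum_(i < m) xs (block_theta w) (block_w1 n w) (block_w2 n w) s i|)) => m.
by apply: (measurable_comp1 measurable_abs); apply: measurable_sum => i; exact: measurable_xs.
Qed.

Lemma measurable_block_bdiff n : measurable_fun [set: mR] (fun w => bdiff n (block_theta w) (block_w1 n w) (block_w2 n w) : mR).
Proof.
apply: measurable_funD; apply: (measurable_comp1 measurable_abs); apply: measurable_sum => i; apply: measurable_funB.
- exact: (measurable_comp1 measurable_ecos (measurable_block_theta i)).
- by apply: measurable_funM => //; exact: measurable_block_w1.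
- exact: (measurable_comp1 measurable_esin (measurable_block_theta i)).
- by apply: measurable_funM => //; exact: measurable_block_w2.
Qed.

(** Union bound over six sequences, n + 1 lengths and two signs; the total 7 + 12 (n+1) E is at most
    20 (n+1) E. *)
Lemma bmax_mgf n (c : R) : 
  (\int[U01]_w (expR (c * bmax n (block_theta w) (block_w1 n w) (block_w2 n w)))%:E
    <= (20 * n.+1%:R * expR (2 * c ^+ 2 * n%:R))%:E)%E.
Proof.
set E := expR (2 * c ^+ 2 * n%:R).
have E1 : 1 <= E by rewrite -expR0 ler_expR mulr_ge0// mulr_ge0// sqr_ge0.
pose P (s m : nat) (w : R) : R := \sum_(i < m) xs (block_theta w) (block_w1 n w) (block_w2 n w) s i.
have mP s m : measurable_fun [set: mR] (P s m : mR -> mR) by apply: measurable_sum => i; exact: measurable_xs.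
have me (a : R) s m : measurable_fun [set: mR] (fun w => expR (a * P s m w) : mR).
  by apply: (measurableT_comp (@measurable_expR R)); apply: measurable_funM => //; exact: mP.
pose F1 (s m : nat) (w : R) : R := expR (c * P s m w) + expR (- c * P s m w).
pose F2 (s : nat) (w : R) : R := 1 + \sum_(m < n.+1) F1 s m w.
have mF1 s m : measurable_fun [set: mR] (F1 s m : mR -> mR) by apply: measurable_funD; exact: me.
have mF2 s : measurable_fun [set: mR] (F2 s : mR -> mR).
  by apply: measurable_funD => //; apply: measurable_sum => m; exact: mF1.
have F10 s m w : 0 <= F1 s m w by rewrite addr_ge0 ?expR_ge0.
have F20 s w : 0 <= F2 s w by rewrite addr_ge0 ?sumr_ge0.
have i1 s m : (m < n.+1)%N -> (\int[U01]_w (F1 s m w)%:E <= (2 * E)%:E)%E.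
  move=> mn; under eq_integral do rewrite EFinD.
  rewrite ge0_integralD//; [|apply/measurable_EFinP; exact: me..].
  have -> : 2 * E = E + E by ring.
  have mn' : (m <= n)%N by [].
  rewrite EFinD; apply: leeD; first exact: (xs_mgf s c mn').
  by have := xs_mgf s (- c) mn'; rewrite sqrrN.
have i2 s : (s < 6)%N -> (\int[U01]_w (F2 s w)%:E <= (1 + n.+1%:R * (2 * E))%:E)%E.
  move=> _; under eq_integral do rewrite EFinD.
  rewrite ge0_integralD//; [|by move=> w _; rewrite lee_fin sumr_ge0|by apply/measurable_EFinP; apply: measurable_sum => ?; exact: mF1].
  by rewrite integral_cst_prob EFinD leeD2l//; apply: integral_sum_le => // m; exact: i1.
apply: (@le_trans _ _ (\int[U01]_w (1 + \sum_(s < 6) F2 s w)%:E)%E).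
  apply: ge0_le_integral => //.
  - by apply: measurable_expM; exact: measurable_block_bmax.
  - by apply/measurable_EFinP; apply: measurable_funD => //; apply: measurable_sum => ?; exact: mF2.
  move=> w _; rewrite lee_fin /bmax.
  apply: le_trans (exp_bigmax c 6 (fun s => \big[Num.max/0]_(m < n.+1) `|\sum_(i < m) xs (block_theta w) (block_w1 n w) (block_w2 n w) s i|)) _.
  rewrite lerD2l; apply: ler_sum => s _.
  apply: le_trans (exp_bigmax c n.+1 (fun m => `|\sum_(i < m) xs (block_theta w) (block_w1 n w) (block_w2 n w) s i|)) _.
  by rewrite lerD2l; apply: ler_sum => m _; exact: expM_abs.
under eq_integral do rewrite EFinD.
rewrite ge0_integralD//; [|by move=> w _; rewrite lee_fin sumr_ge0|by apply/measurable_EFinP; apply: measurable_sum => ?; exact: mF2].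
rewrite integral_cst_prob.
apply: le_trans (leeD (lexx _) (integral_sum_le (k := 6) _ F20 i2)) _; first by move=> s _.
rewrite -EFinD lee_fin; have n1 : 1 <= n.+1%:R :> R by rewrite ler1n.
have : 1 <= n.+1%:R * E by rewrite -[leLHS]mulr1 ler_pM.
by move=> h; lra.
Qed.

Lemma useq01_integral (F : mR * mR -> \bar R) : measurable_fun setT F -> (forall z, 0 <= F z)%E ->
  (\int[U01]_w F (useq 0 w, useq 1 w) = \int[U01]_w F (lft w, rgt w))%E.
Proof.
move=> mF F0; rewrite (split_integral mF F0).
transitivity (\int[U01]_x \int[U01]_y F (x, lft y))%E.
  apply: (split_integral (f := fun z => F (z.1, lft z.2))) => //.
  apply: (measurableT_comp mF); apply: measurable_fun_pair; first exact: measurable_fst.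
  exact: (measurable_comp1 measurable_lft).
apply: eq_integral => x _; apply: (lft_integral (f := fun y => F (x, y))) => //.
exact: (measurable_fun_pair2 x mF).
Qed.

Lemma measurable_berr n d (T : measurableType d) (x y : T -> R) : measurable_fun [set: T] (x : T -> mR) ->
  measurable_fun [set: T] (y : T -> mR) -> measurable_fun [set: T] (fun z => berr n (rho_ n) (x z) (y z) : mR).
Proof.
move=> mx my; have mb : measurable_fun [set: T] (fun z => bnorm n (x z) : mR) by exact: (measurable_comp1 (measurable_bnorm n)).
apply: (measurable_comp1 measurable_abs); apply: measurable_funB; apply: (measurable_comp1 measurable_sqrt) => //.
by apply: measurable_bexp => //; rewrite ?exprn_gt0 ?rho_gt0.
Qed.

(** The two parts of the exponent are separated by [expD_le]. For the first, e^(2 l max(0, y)) <= 1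
    + e^(t y) for every t >= 2 l, and a large t lets e^(-t) beat the union bound. For the second,
    convexity with weight b sqrt n <= 1 keeps this weight as a factor of the excess K rho. *)
Lemma block_exp (l : R) : 0 <= l -> exists2 K : R, 0 <= K & forall (n : nat) (tau b t : R),
  0 <= b -> 2 * l <= t -> 0 <= tau -> b * Num.sqrt n%:R <= 1 ->
  (\int[U01]_w (expR (l * (Num.max 0 (tau * bmax n (block_theta w) (block_w1 n w) (block_w2 n w) - 1)
      + b * bdiff n (block_theta w) (block_w1 n w) (block_w2 n w))))%:E <=
   (1 + (20 * n.+1%:R * expR (2 * (t * tau) ^+ 2 * n%:R - t) + K * (b * Num.sqrt n%:R * rho_ n)))%:E)%E.
Proof.
move=> l0; have [K K0 HK] := berr_exp (mulr_ge0 (ler0n R 4) l0).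
exists K => // n tau b t b0 lt tau0 bn.
set g := b * Num.sqrt n%:R in bn *; have g0 : 0 <= g by rewrite mulr_ge0 ?sqrtr_ge0.
have t0 : 0 <= t by apply: le_trans lt; rewrite mulr_ge0.
pose M (w : R) : R := bmax n (block_theta w) (block_w1 n w) (block_w2 n w).
pose e (w : R) : R := berr n (rho_ n) (useq 0 w) (useq 1 w).
have e0 w : 0 <= e w by exact: normr_ge0.
have mM : measurable_fun [set: mR] (M : mR -> mR) by exact: measurable_block_bmax.
have me : measurable_fun [set: mR] (e : mR -> mR) by apply: measurable_berr; exact: measurable_useq.
have mb2 : measurable_fun [set: mR * mR] (fun z : mR * mR => berr n (rho_ n) z.1 z.2 : mR) by exact: measurable_berr.
have ie : (\int[U01]_w ((1 - g) + g * expR (4 * l * e w))%:E <= (1 + K * (g * rho_ n))%:E)%E.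
  have g1 : 0 <= 1 - g by rewrite subr_ge0.
  have mE := measurable_expM (4 * l) me.
  under eq_integral do rewrite EFinD EFinM.
  rewrite ge0_integralD//; [|by move=> w _; rewrite mule_ge0// lee_fin expR_ge0|exact: (emeasurable_funM (measurable_cst _) mE)].
  rewrite integral_cst_prob ge0_integralZl//.
  have [n0|n0] := posnP n; first by rewrite /g n0 sqrtr0 mulr0 mul0e adde0 subr0 mul0r mulr0 addr0.
  have iE : (\int[U01]_w (expR (4 * l * e w))%:E <= (1 + K * rho_ n)%:E)%E.
    apply: le_trans (HK n (rho_ n) (rho_bound n) (rhoX n0)); rewrite le_eqVlt; apply/orP; left; apply/eqP.
    have mE2 := measurable_expM (4 * l) mb2.
    have E20 (z : mR * mR) : (0 <= (expR (4 * l * berr n (rho_ n) z.1 z.2))%:E)%E by rewrite lee_fin expR_ge0.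
    exact: (useq01_integral mE2 E20).
  apply: le_trans (leeD (lexx _) (lee_wpmul2l (_ : (0 <= g%:E)%E) iE)) _ => //.
  rewrite -EFinM -EFinD lee_fin; lra.
have iM : (\int[U01]_w (expR (- t) * expR (t * tau * M w))%:E <= (20 * n.+1%:R * expR (2 * (t * tau) ^+ 2 * n%:R - t))%:E)%E.
  under eq_integral do rewrite EFinM.
  have mE := measurable_expM (t * tau) mM.
  rewrite ge0_integralZl//.
  apply: le_trans (lee_wpmul2l _ (bmax_mgf n (t * tau))) _; first by rewrite lee_fin expR_ge0.
  by rewrite -EFinM lee_fin mulrCA -expRD addrC.
have mA : measurable_fun [set: mR] (fun w => (expR (- t) * expR (t * tau * M w))%:E : \bar R).
  apply/measurable_EFinP; apply: measurable_funM => //; apply: (measurableT_comp (@measurable_expR R)).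
  exact: measurable_funM.
have mB : measurable_fun [set: mR] (fun w => ((1 - g) + g * expR (4 * l * e w))%:E : \bar R).
  apply/measurable_EFinP; apply: measurable_funD => //; apply: measurable_funM => //.
  by have /measurable_EFinP := measurable_expM (4 * l) me.
have A0 w : (0 <= (expR (- t) * expR (t * tau * M w))%:E)%E by rewrite lee_fin mulr_ge0 ?expR_ge0.
have B0 w : (0 <= ((1 - g) + g * expR (4 * l * e w))%:E)%E.
  by rewrite lee_fin addr_ge0 ?subr_ge0// mulr_ge0 ?expR_ge0.
apply: (@le_trans _ _ (\int[U01]_w (2^-1%:E * (1%:E + (expR (- t) * expR (t * tau * M w))%:E + ((1 - g) + g * expR (4 * l * e w))%:E))%E)%E).
  apply: ge0_le_integral => //.
  - apply: (measurable_expM l); apply: measurable_funD.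
      by apply: measurable_maxr => //; apply: measurable_funB => //; exact: measurable_funM.
    by apply: measurable_funM => //; exact: measurable_block_bdiff.
  - by apply: (emeasurable_funM (measurable_cst _)); apply: emeasurable_funD => //; exact: emeasurable_funD.
  move=> w _; rewrite -!EFinD -EFinM lee_fin mulrDr.
  apply: le_trans (expD_le _ _) _; rewrite mulrC ler_wpM2l// lerD//.
    rewrite -/(M w) mulrA; have [h|h] := leP 0 (tau * M w - 1); last by rewrite mulr0 expR0 lerDl mulr_ge0 ?expR_ge0.
    rewrite -expRD (_ : - t + t * tau * M w = t * (tau * M w - 1)); last by ring.
    have : expR (2 * l * (tau * M w - 1)) <= expR (t * (tau * M w - 1)) by rewrite ler_expR ler_wpM2r.
    lra.
  have g01 : 0 <= g <= 1 by rewrite g0.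
  apply: le_trans (expR_conv _ g01); rewrite ler_expR.
  have := ler_wpM2l b0 (bdiff_le n w); rewrite -/(e w) => h.
  have := ler_wpM2l (mulr_ge0 (ler0n R 2) l0) h; rewrite /g; lra.
rewrite ge0_integralZl//; last 2 first.
- by apply: emeasurable_funD => //; exact: emeasurable_funD.
- by move=> w _; rewrite adde_ge0// adde_ge0.
rewrite ge0_integralD//; last 2 first.
- by move=> w _; rewrite adde_ge0.
- exact: emeasurable_funD.
rewrite ge0_integralD// integral_cst_prob.
apply: le_trans (lee_wpmul2l _ (leeD (leeD (lexx _) iM) ie)) _ => //.
rewrite -!EFinD -EFinM lee_fin.
have r0 := ltW (rho_gt0 n).
have h1 : 0 <= K * (g * rho_ n) by rewrite !mulr_ge0.
have h2 : 0 <= 20 * n.+1%:R * expR (2 * (t * tau) ^+ 2 * n%:R - t) by rewrite mulr_ge0 ?expR_ge0// mulr_ge0.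
lra.
Qed.

End block_moments.

(** * Blocks of primes and Abel summation *)

Section prime_blocks.

Lemma next_prime_gt m : (m < next_prime m)%N.
Proof. by rewrite /next_prime; case: ex_minnP => p /andP[]. Qed.

Lemma nth_prime_lt k : (nth_prime k < nth_prime k.+1)%N.
Proof. exact: next_prime_gt. Qed.

(** Consecutive primes are distinct integers. Nothing is used about their density, so block sizes
    are bounded from above only. *)
Lemma nth_prime_shift k i : (nth_prime k + i <= nth_prime (k + i))%N.
Proof.
elim: i => [|i IH]; first by rewrite !addn0.
by rewrite !addnS; apply: leq_ltn_trans IH (nth_prime_lt _).
Qed.

Lemma nth_prime_ge k : (k.+2 <= nth_prime k)%N.
Proof. by have := nth_prime_shift 0 k; rewrite add0n. Qed.

Lemma nth_prime_mono k k' : (k <= k')%N -> (nth_prime k <= nth_prime k')%N.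
Proof. by move=> kk; rewrite -(subnKC kk); apply: leq_trans (nth_prime_shift _ _); rewrite leq_addr. Qed.

Variable a : nat.
Hypothesis a0 : (0 < a)%N.

Lemma exists_block_start J : exists k, (J ^ a <= nth_prime k)%N.
Proof. by exists (J ^ a)%N; apply: leq_trans (nth_prime_ge _); rewrite leqW// leqW. Qed.

(* The [J]-th block consists of the primes in [J^a, (J+1)^a). *)
Definition bstart J := ex_minn (exists_block_start J).
Definition bsize J := (bstart J.+1 - bstart J)%N.

Lemma bstart_le J k : (bstart J <= k)%N = (J ^ a <= nth_prime k)%N.
Proof.
rewrite /bstart; case: ex_minnP => m h hm; apply/idP/idP => [mk|]; last exact: hm.
exact: leq_trans h (nth_prime_mono mk).
Qed.

Lemma bstart_mono J J' : (J <= J')%N -> (bstart J <= bstart J')%N.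
Proof.
move=> JJ; rewrite bstart_le (leq_trans (_ : _ <= J' ^ a)%N)//; first by rewrite leq_exp2r.
by rewrite -bstart_le.
Qed.

Lemma bstart0 : bstart 0 = 0%N.
Proof. by apply/eqP; rewrite -leqn0 bstart_le exp0n. Qed.

(** Block 0 is therefore empty, and the default values that the scales take at J = 0 weigh on no
    prime. *)
Lemma bstart1 : bstart 1 = 0%N.
Proof. by apply/eqP; rewrite -leqn0 bstart_le exp1n. Qed.

Lemma block_prime_bounds J i : (i < bsize J)%N ->
  (J ^ a <= nth_prime (bstart J + i) < J.+1 ^ a)%N.
Proof.
move=> i_lt; rewrite -bstart_le leq_addr/= ltnNge -bstart_le -ltnNge -ltn_subRL//.
Qed.

Lemma bsize_le J : (bsize J <= J.+1 ^ a - J ^ a)%N.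
Proof.
case E : (bsize J) => [|n] //; rewrite ltn_subRL.
have /andP[_] := @block_prime_bounds J n (ltac:(by rewrite E)).
apply: leq_ltn_trans; rewrite -/(nth_prime _); apply: leq_trans (nth_prime_shift _ _).
by rewrite leq_add2r -bstart_le.
Qed.

Lemma exists_block k : exists J, (nth_prime k < J.+1 ^ a)%N.
Proof.
exists (nth_prime k); apply: leq_trans (_ : (nth_prime k).+1 ^ 1 <= _)%N; first by rewrite expn1.
by rewrite leq_pexp2l//.
Qed.

Definition blk k := ex_minn (exists_block k).

Lemma blkP k : (bstart (blk k) <= k < bstart (blk k).+1)%N.
Proof.
rewrite bstart_le [X in _ && X]ltnNge bstart_le -ltnNge /blk.
case: ex_minnP => J -> hm; rewrite andbT; case: J hm => [|J] hm; first by rewrite exp0n.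
by rewrite leqNgt; apply/negP => /hm; rewrite ltnn.
Qed.

Lemma blk_uniq k J : (bstart J <= k < bstart J.+1)%N -> blk k = J.
Proof.
have := blkP k => /andP[h1 h2] /andP[h3 h4].
apply/eqP; rewrite eqn_leq; apply/andP; split; rewrite leqNgt; apply/negP => /bstart_mono h.
  by have := leq_ltn_trans h1 (leq_trans h4 h); rewrite ltnn.
by have := leq_ltn_trans h3 (leq_trans h2 h); rewrite ltnn.
Qed.

Lemma blk_bstart J i : (i < bsize J)%N -> blk (bstart J + i) = J.
Proof. by move=> h; apply: blk_uniq; rewrite leq_addr/= -ltn_subRL. Qed.

Lemma blk_mono k k' : (k <= k')%N -> (blk k <= blk k')%N.
Proof.
move=> kk; rewrite leqNgt; apply/negP => /bstart_mono h.
have /andP[_ h2] := blkP k'; have /andP[h3 _] := blkP k.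
by have := leq_ltn_trans kk (leq_trans h2 (leq_trans h h3)); rewrite ltnn.
Qed.

(** Not stated as an equality: if block [J] is empty, its starting index belongs to a later
    block. *)
Lemma blk_ge J : (J <= blk (bstart J))%N.
Proof.
rewrite leqNgt; apply/negP => /bstart_mono h; have /andP[_ h2] := blkP (bstart J).
by have := leq_trans h2 h; rewrite ltnn.
Qed.

Lemma blk_gt0 k : (0 < blk k)%N.
Proof.
by apply: leq_trans (blk_ge 1) (blk_mono _); rewrite bstart1.
Qed.

Lemma sum_blocks (V : nmodType) (F : nat -> V) J :
  \sum_(k < bstart J) F k = \sum_(i < J) \sum_(m < bsize i) F (bstart i + m)%N.
Proof.
elim: J => [|J IH]; first by rewrite bstart0 !big_ord0.
rewrite big_ord_recr/= -IH -(big_mkord xpredT F) (big_cat_nat (n := bstart J))//=; last exact: bstart_mono.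
rewrite big_mkord; congr (_ + _); rewrite -{1}[bstart J]add0n big_addn big_mkord.
by apply: eq_bigr => i _; rewrite addnC.
Qed.

Lemma sum_blk (V : nmodType) (F : nat -> V) N (J := blk N) :
  \sum_(k < N) F k = \sum_(i < J) \sum_(m < bsize i) F (bstart i + m)%N + \sum_(m < N - bstart J) F (bstart J + m)%N.
Proof.
have /andP[h _] := blkP N; rewrite -sum_blocks -(big_mkord xpredT F) (big_cat_nat (n := bstart J))//=.
rewrite big_mkord; congr (_ + _); rewrite -{1}[bstart J]add0n big_addn big_mkord.
by apply: eq_bigr => i _; rewrite addnC.
Qed.

End prime_blocks.

(** * Scales attached to the blocks *)

Section block_scales.
Context {R : realType}.

(** [yy J] is J^(1/8), the margin that pays for powers of logarithms and for tails; [vv J] is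
    J^(-9/8), the summable scale of all errors. *)
Definition yy (J : nat) : R := Num.sqrt (Num.sqrt (Num.sqrt J%:R)).
Definition vv (J : nat) : R := (J%:R * yy J)^-1.

Lemma yyX J : yy J ^+ 8 = J%:R.
Proof. by rewrite -[8%N]/(2 * 2 * 2)%N !exprM !sqr_sqrtr ?sqrtr_ge0. Qed.

Lemma yy_ge0 J : 0 <= yy J. Proof. exact: sqrtr_ge0. Qed.

Lemma yy_mono J J' : (J <= J')%N -> yy J <= yy J'.
Proof. by move=> h; do !apply: ler_wsqrtr; rewrite ler_nat. Qed.

Lemma yy1 : yy 1 = 1. Proof. by rewrite /yy !sqrtr1. Qed.

Lemma yy_ge1 J : (0 < J)%N -> 1 <= yy J. Proof. by move=> J0; rewrite -yy1 yy_mono. Qed.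

Lemma yy_gt0 J : (0 < J)%N -> 0 < yy J. Proof. by move=> J0; rewrite (lt_le_trans ltr01) ?yy_ge1. Qed.

Lemma vv_ge0 J : 0 <= vv J. Proof. by rewrite invr_ge0 mulr_ge0 ?yy_ge0. Qed.

Lemma vv0 : vv 0 = 0. Proof. by rewrite /vv mul0r invr0. Qed.

(** For consecutive eighth roots y <= z one has 1 = z^8 - y^8 <= 8 z^7 (z - y), so J^(-9/8) is
    dominated by a telescoping difference of J^(-1/8). *)
Lemma yy_step J : (0 < J)%N -> vv J.+1 <= 8 * ((yy J)^-1 - (yy J.+1)^-1).
Proof.
move=> J0; have y0 := yy_gt0 J0; have z0 := yy_gt0 (ltn0Sn J).
have yz := yy_mono (leqnSn J).
have e : yy J.+1 ^+ 8 - yy J ^+ 8 = 1 by rewrite !yyX -natr1 addrAC subrr add0r.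
have h : 1 <= (yy J.+1 - yy J) * (8 * yy J.+1 ^+ 7).
  rewrite -[leLHS]e subrXX ler_wpM2l ?subr_ge0//.
  apply: (@le_trans _ _ (\sum_(i < 8) yy J.+1 ^+ 7)); last by rewrite sumr_const card_ord -[_ *+ 8]mulr_natl.
  apply: ler_sum => i _; rewrite -[X in _ <= _ ^+ X](subnK (_ : i <= 7)%N) ?exprD//; last by have := ltn_ord i; lia.
  rewrite ler_wpM2l ?exprn_ge0 ?yy_ge0// lerXn2r ?nnegrE ?yy_ge0//.
rewrite /vv -yyX -[8%N]/(7 + 1)%N exprD expr1.
move: h e y0 z0 yz; move: (yy J.+1) (yy J) => z y h e y0 z0 yz.
have -> : 8 * (y^-1 - z^-1) = 8 * (z - y) / (y * z).
  by field; rewrite !gt_eqF.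
rewrite ler_pdivlMr ?mulr_gt0//.
have z7 : 0 < z ^+ 7 by rewrite exprn_gt0.
rewrite (_ : (z ^+ 7 * z * z)^-1 * (y * z) = (y / z) / z ^+ 7); last first.
  by field; rewrite gt_eqF.
rewrite ler_pdivrMr//; apply: (@le_trans _ _ 1); first by rewrite ler_pdivrMr// mul1r.
by rewrite mulrAC mulrC mulrA [X in _ <= X]mulrC; move: h; rewrite mulrA [(z - y) * 8]mulrC; lra.
Qed.

(** The term at J = 1, plus eight times a telescoping sum. *)
Lemma sum_vv m : \sum_(J < m) vv J <= 9.
Proof.
case: m => [|m]; first by rewrite big_ord0.
rewrite big_ord_recl/= vv0 add0r; case: m => [|m]; first by rewrite big_ord0.
rewrite big_ord_recl/= {1}/vv yy1 mulr1 invr1.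
suff : \sum_(i < m) vv i.+2 <= 8 * (1 - (yy m.+1)^-1).
  by have := yy_ge0 m.+1; rewrite -invr_ge0 => ? ?; rewrite (eq_bigr (fun i : 'I_m => vv i.+2))//; lra.
elim: m => [|m IH]; first by rewrite big_ord0 yy1 invr1 subrr mulr0.
rewrite big_ord_recr/=; apply: le_trans (lerD IH (yy_step (ltn0Sn m))) _; lra.
Qed.

Variable a : nat.
Hypothesis a0 : (0 < a)%N.

(** By z^l / l! <= e^z with z proportional to the logarithm; the factor b = 8 a makes e^z at most a
    multiple of J^(1/8). *)
Lemma polylog_le l : exists2 C : R, 1 <= C & forall J, (0 < J)%N -> (1 + a%:R * ln J.+1%:R) ^+ l <= C * yy J.
Proof.
have [l0|l0] := posnP l.
  by exists 1 => // J J0; rewrite l0 expr0 mul1r yy_ge1.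
pose b : R := 8 * a%:R; have b1 : 1 <= b by rewrite /b -natrM ler1n muln_gt0.
pose C := b ^+ l * l`!%:R * (expR 1 * 2).
have e1 : 1 <= expR (1 : R) by rewrite -expR0 ler_expR.
have C1 : 1 <= C.
  have f1 : 1 <= l`!%:R :> R by rewrite ler1n fact_gt0.
  rewrite /C -[leLHS]mulr1 ler_pM//; first by rewrite -[leLHS]mulr1 ler_pM// exprn_ege1.
  by lra.
exists C => // J J0; pose z := (1 + a%:R * ln J.+1%:R) / b.
have b0 : 0 < b by exact: lt_le_trans b1.
have ln0 : 0 <= ln J.+1%:R :> R by rewrite ln_ge0// ler1n.
have z0 : 0 <= z by rewrite divr_ge0 ?(ltW b0)// addr_ge0// mulr_ge0.
have -> : 1 + a%:R * ln J.+1%:R = b * z by rewrite /z [RHS]mulrC divfK// gt_eqF.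
have hz : z ^+ l / l`!%:R <= expR z.
  by have := expR_ge1Dxn l.-1 z0; rewrite prednK//; apply: le_trans; rewrite lerDr.
have ez : expR z <= expR 1 * (2 * yy J).
  have -> : z = b^-1 + 8^-1 * ln J.+1%:R.
    rewrite /z /b; field; rewrite !pnatr_eq0 -?lt0n//.
  rewrite expRD ler_pM ?expR_ge0// ?ler_expR ?invf_le1//.
  have y20 : 0 < 2 * yy J by rewrite mulr_gt0 ?yy_gt0.
  rewrite -[leRHS](lnK (y20 : _ \is Num.pos)) ler_expR mulrC ler_pdivrMr// mulr_natr -lnXn//.
  rewrite ler_ln ?posrE ?ltr0n ?exprn_gt0// exprMn yyX -natr1.
  have J1 : 1 <= J%:R :> R by rewrite ler1n.
  have : 2 <= 2 ^+ 8 :> R by rewrite -[leLHS]expr1 ler_eXn2l// ltr1n.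
  move: (2 ^+ 8) => q q2; nra.
rewrite exprMn /C -!mulrA ler_wpM2l ?exprn_ge0 ?(ltW b0)//.
rewrite -ler_pdivrMl ?ltr0n ?fact_gt0// mulrC; exact: le_trans hz ez.
Qed.

End block_scales.

(** * Abel summation with oscillating weights *)

Section abel_summation.
Context {R : realType}.

Lemma taylor2_le (f f' f'' : R -> R) (B x y : R) :
  (forall z : R, is_derive z 1 f (f' z)) -> (forall z : R, is_derive z 1 f' (f'' z)) ->
  (forall z, `|z - x| <= `|y - x| -> `|f'' z| <= B) ->
  `|f y - f x - f' x * (y - x)| <= B * (y - x) ^+ 2.
Proof.
move=> df df' fB; pose h (z : R) : R := f z - f' x * (z - x).
have dh (z : R) : is_derive z 1 h (f' z - f' x).
  have ? := df z; rewrite /h; apply: is_derive_eq; rewrite /GRing.scale/=; ring.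
have B0 : 0 <= B by apply: le_trans (fB x _); rewrite ?subrr ?normr0.
have -> : f y - f x - f' x * (y - x) = h y - h x by rewrite /h subrr mulr0; ring.
rewrite -real_normK ?num_real// expr2 mulrA.
apply: mvt_le dh _ => z zy; apply: le_trans (_ : B * `|z - x| <= _); last by rewrite ler_wpM2l.
by apply: mvt_le df' _ => t zeta_harm; apply: fB; exact: le_trans zy.
Qed.

Lemma cos_shift_lip (u p x y : R) : `|cos (u * y + p) - cos (u * x + p)| <= `|u| * `|y - x|.
Proof.
have d (z : R) : is_derive z 1 (fun z : R => cos (u * z + p)) (- (u * sin (u * z + p))).
  by apply: is_derive_eq; rewrite /GRing.scale/=; ring.
apply: mvt_le d _ => z _; rewrite normrN normrM ler_piMr// ler_norml.
by rewrite sin_geN1 sin_le1.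
Qed.

Lemma expX_lip (c M x y : R) (l : nat) : 0 <= c -> 0 <= x -> x <= y -> y <= M -> 1 <= M ->
  `|expR (- (c * y)) * y ^+ l - expR (- (c * x)) * x ^+ l| <= expR (- (c * x)) * ((c + l%:R) * M ^+ l) * (y - x).
Proof.
move=> c0 x0 xy yM M1.
have e1 : `|expR (- (c * y)) - expR (- (c * x))| <= expR (- (c * x)) * c * (y - x).
  have h : expR (- (c * y)) <= expR (- (c * x)) by rewrite ler_expR lerN2 ler_wpM2l.
  rewrite ler0_norm ?subr_le0// opprB.
  have -> : expR (- (c * y)) = expR (- (c * x)) * expR (- (c * (y - x))) by rewrite -expRD; congr expR; ring.
  have := expR_ge1Dx (- (c * (y - x))); have := expR_ge0 (- (c * x)).
  move: (expR _) => E E0; move: (expR _) => F; nra.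
have M0 : 0 <= M by lra.
have y0 := le_trans x0 xy.
have p1 : `|y ^+ l - x ^+ l| <= l%:R * M ^+ l * (y - x).
  rewrite subrXX normrM (ger0_norm (x := y - x)) ?subr_ge0// mulrC ler_wpM2r ?subr_ge0//.
  apply: le_trans (ler_norm_sum _ _ _) _.
  apply: (@le_trans _ _ (\sum_(i < l) M ^+ l)); last by rewrite sumr_const card_ord -[_ *+ l]mulr_natl.
  apply: ler_sum => i _; rewrite normrM !normrX !ger0_norm//.
  apply: (@le_trans _ _ (M ^+ (l.-1 - i) * M ^+ i)).
    by apply: ler_pM; rewrite ?exprn_ge0// lerXn2r ?nnegrE// (le_trans xy).
  rewrite -exprD ler_weXn2l//; have := ltn_ord i; lia.
have yl : y ^+ l <= M ^+ l by rewrite lerXn2r ?nnegrE.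
have yl0 : 0 <= y ^+ l by rewrite exprn_ge0.
have -> : expR (- (c * y)) * y ^+ l - expR (- (c * x)) * x ^+ l =
  (expR (- (c * y)) - expR (- (c * x))) * y ^+ l + expR (- (c * x)) * (y ^+ l - x ^+ l) by ring.
apply: le_trans (ler_normD _ _) _; rewrite !normrM (ger0_norm yl0) (ger0_norm (expR_ge0 _)).
have -> : expR (- (c * x)) * ((c + l%:R) * M ^+ l) * (y - x) =
   expR (- (c * x)) * c * (y - x) * M ^+ l + expR (- (c * x)) * (l%:R * M ^+ l * (y - x)) by ring.
by apply: lerD; [apply: ler_pM|rewrite ler_wpM2l ?expR_ge0].
Qed.

(** At L = ln q this is q^(-c) (ln q)^l cos(u ln q + p). With u = - x it yields the real and
    imaginary parts of q^(-c-ix) and of its x-derivatives, each derivative raising [l] and shifting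
    the phase [p]. *)
Definition kern (c : R) (l : nat) (u p L : R) : R := expR (- (c * L)) * L ^+ l * cos (u * L + p).

Lemma kern_le (c M : R) l (u p x L : R) : 0 <= c -> 0 <= x -> x <= L -> L <= M ->
  `|kern c l u p L| <= expR (- (c * x)) * M ^+ l.
Proof.
move=> c0 x0 xL LM; have L0 := le_trans x0 xL; have M0 := le_trans L0 LM.
rewrite /kern normrM normrM normrX (ger0_norm (expR_ge0 _)) (ger0_norm L0).
rewrite -[leRHS]mulr1; apply: ler_pM => //; first by rewrite mulr_ge0 ?expR_ge0 ?exprn_ge0.
  apply: ler_pM; rewrite ?expR_ge0 ?exprn_ge0//; first by rewrite ler_expR lerN2 ler_wpM2l.
  by rewrite lerXn2r ?nnegrE.
by rewrite ler_norml cos_geN1 cos_le1.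
Qed.

Lemma kern_lip (c M : R) l (u p x0 x y : R) : 0 <= c -> 0 <= x0 -> x0 <= x -> x <= y -> y <= M -> 1 <= M ->
  `|kern c l u p y - kern c l u p x| <= expR (- (c * x0)) * ((c + l%:R + `|u|) * M ^+ l) * (y - x).
Proof.
move=> c0 x00 x0x xy yM M1; have x0' := le_trans x00 x0x.
have := @expX_lip c M x y l c0 x0' xy yM M1; have := cos_shift_lip u p x y.
rewrite /kern (ger0_norm (x := y - x)) ?subr_ge0//.
have ex : expR (- (c * x)) <= expR (- (c * x0)) by rewrite ler_expR lerN2 ler_wpM2l.
have b : `|expR (- (c * x)) * x ^+ l| <= expR (- (c * x0)) * M ^+ l.
  rewrite normrM normrX (ger0_norm (expR_ge0 _)) (ger0_norm x0').
  by apply: ler_pM; rewrite ?expR_ge0 ?exprn_ge0// lerXn2r ?nnegrE//; lra.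
have c1 : `|cos (u * y + p)| <= 1 by rewrite ler_norml cos_geN1 cos_le1.
set F := expR (- (c * y)) * _; set E := expR (- (c * x)) * _ in b *.
move: (cos _) c1 => cy c1; move: (cos _) => cx h1 h2.
have -> : F * cy - E * cx = (F - E) * cy + E * (cy - cx) by ring.
apply: le_trans (ler_normD _ _) _; rewrite (normrM (F - E)) (normrM E).
have -> : expR (- (c * x0)) * ((c + l%:R + `|u|) * M ^+ l) * (y - x) =
  expR (- (c * x0)) * ((c + l%:R) * M ^+ l) * (y - x) * 1 + expR (- (c * x0)) * M ^+ l * (`|u| * (y - x)) by ring.
apply: lerD; last exact: ler_pM.
apply: ler_pM => //; apply: le_trans h2 _.
rewrite ler_wpM2r ?subr_ge0// ler_wpM2r// mulr_ge0 ?addr_ge0 ?exprn_ge0//; lra.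
Qed.

(** Summation by parts: the last weight multiplies the full sum, and the variation of the weights,
    at most D times that of L, multiplies the largest partial sum. *)
Lemma abel (h X L : nat -> R) (D M H d : R) n : 0 <= D -> 0 <= d ->
  (forall i, (i < n)%N -> `|h i| <= H) ->
  (forall i, (i.+1 < n)%N -> `|h i.+1 - h i| <= D * (L i.+1 - L i)) ->
  (forall i, (i < n)%N -> L i - L 0%N <= d) ->
  (forall i, (i <= n)%N -> `|\sum_(k < i) X k| <= M) ->
  `|\sum_(i < n) h i * X i| <= H * `|\sum_(i < n) X i| + D * d * M.
Proof.
case: n => [|n] D0 d0 hH hD hL hM.
  have M0 : 0 <= M by have := hM 0%N isT; rewrite big_ord0 normr0.
  by rewrite !big_ord0 normr0 mulr0 add0r !mulr_ge0.
have M0 : 0 <= M by have := hM 0%N isT; rewrite big_ord0 normr0.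
suff h1 : `|\sum_(i < n.+1) h i * X i - h n * \sum_(i < n.+1) X i| <= D * (L n - L 0%N) * M.
  apply: le_trans (_ : `|h n * \sum_(i < n.+1) X i| + `|\sum_(i < n.+1) h i * X i - h n * \sum_(i < n.+1) X i| <= _).
    by apply: le_trans (ler_normD _ _); rewrite addrC subrK.
  rewrite normrM; apply: lerD; first by rewrite ler_wpM2r ?hH.
  by apply: le_trans h1 _; rewrite ler_wpM2r// ler_wpM2l// hL.
elim: n {hH hL} hD hM => [|n IH] hD hM; first by rewrite !big_ord1 subrr normr0 subrr mulr0 mul0r.
rewrite big_ord_recr/= [\sum_(i < n.+2) X i]big_ord_recr/=.
have -> : \sum_(i < n.+1) h i * X i + h n.+1 * X n.+1 - h n.+1 * (\sum_(i < n.+1) X i + X n.+1) =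
  (\sum_(i < n.+1) h i * X i - h n * \sum_(i < n.+1) X i) - (h n.+1 - h n) * \sum_(i < n.+1) X i by ring.
apply: le_trans (ler_normB _ _) _.
have -> : D * (L n.+1 - L 0%N) * M = D * (L n - L 0%N) * M + D * (L n.+1 - L n) * M by ring.
apply: lerD; first by apply: IH => i ni; [apply: hD; exact: ltnW|apply: hM; exact: ltnW].
rewrite normrM; apply: ler_pM => //; first exact: hD.
exact: hM.
Qed.

End abel_summation.

Lemma eq_ler (R : numDomainType) (x y : R) : x = y -> x <= y. Proof. by move->. Qed.

(** * Sums over a block of primes *)

Section block_sums.
Context {R : realType}.
Variable h : nat.
Hypothesis h0 : (0 < h)%N.
Local Notation a := (h + h)%N.

Definition lp (k : nat) : R := ln (nth_prime k)%:R.
(* [J^h] is the order of [sqrt p] on the block, whose size is of order [J^(2h - 1)]; hence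
   [tauJ^2] times the size stays small, while [bet] times its square root tends to [0]. *)
Definition bet (J : nat) : R := yy J / J%:R ^+ h.
Definition tauJ (J : nat) : R := yy J * bet J.

Lemma bet_ge0 J : 0 <= bet J. Proof. by rewrite divr_ge0 ?yy_ge0 ?exprn_ge0. Qed.
Lemma tauJ_ge0 J : 0 <= tauJ J. Proof. by rewrite mulr_ge0 ?yy_ge0 ?bet_ge0. Qed.

Lemma lp_ge0 k : 0 <= lp k.
Proof. by rewrite ln_ge0// ler1n (leq_trans _ (nth_prime_ge k)). Qed.

Lemma lp_mono k k' : (k <= k')%N -> lp k <= lp k'.
Proof.
move=> kk; rewrite ler_ln ?posrE ?ltr0n ?ler_nat ?nth_prime_mono//.
all: exact: leq_trans (nth_prime_ge _).
Qed.

Lemma a_gt0 : (0 < a)%N. Proof. by rewrite addn_gt0 h0. Qed.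

Lemma lp_block J i : (0 < J)%N -> (i < bsize a J)%N ->
  a%:R * ln J%:R <= lp (bstart a J + i) <= a%:R * ln J.+1%:R.
Proof.
move=> J0 /block_prime_bounds/andP[p1 p2].
have p0 : (0 < nth_prime (bstart a J + i))%N by exact: leq_trans (nth_prime_ge _).
rewrite !mulr_natl -!lnXn ?ltr0n// /lp -!natrX !ler_ln ?posrE ?ltr0n ?expn_gt0 ?J0//.
by rewrite !ler_nat p1 ltnW.
Qed.

Lemma ln_step J : (0 < J)%N -> ln J.+1%:R - ln J%:R <= J%:R^-1 :> R.
Proof.
move=> J0; have J0' : 0 < J%:R :> R by rewrite ltr0n.
rewrite -ln_div ?posrE ?ltr0n//.
have -> : J.+1%:R / J%:R = 1 + J%:R^-1 :> R by rewrite -natr1; field; rewrite gt_eqF.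
by rewrite -ler_expR lnK ?posrE ?addr_gt0 ?invr_gt0// expR_ge1Dx.
Qed.

Lemma exp_half J : (0 < J)%N -> expR (- (2^-1 * (a%:R * ln J%:R))) = J%:R ^- h :> R.
Proof.
move=> J0; have J0' : 0 < J%:R :> R by rewrite ltr0n.
have -> : - (2^-1 * (a%:R * ln J%:R)) = - (h%:R * ln J%:R) :> R.
  by rewrite natrD; field.
by rewrite expRN expRM_natl lnK ?posrE.
Qed.

(** The second harmonic has weight 1/p <= J^(-2h); beyond J^-h, a single factor 1/J of the surplus
    is kept. *)
Lemma exp_one J : (0 < J)%N -> expR (- (1 * (a%:R * ln J%:R))) <= J%:R ^- h / J%:R :> R.
Proof.
move=> J0; have J0' : 0 < J%:R :> R by rewrite ltr0n.
have J1 : 1 <= J%:R :> R by rewrite ler1n.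
have -> : - (1 * (a%:R * ln J%:R)) = - (2^-1 * (a%:R * ln J%:R)) + - (2^-1 * (a%:R * ln J%:R)) :> R by field.
rewrite expRD exp_half// ler_wpM2l ?invr_ge0 ?exprn_ge0// lef_pV2 ?posrE ?exprn_gt0//.
by rewrite -[leLHS]expr1 ler_weXn2l.
Qed.

(** On the block ln p varies by at most a/J, so the largest partial sum enters with an extra factor
    1/J. *)
Lemma kern_sum (c : R) l (u p : R) (X : nat -> R) J n (M : R) : 0 <= c -> (0 < J)%N -> (n <= bsize a J)%N ->
  (forall i, (i <= n)%N -> `|\sum_(k < i) X k| <= M) ->
  `|\sum_(i < n) kern c l u p (lp (bstart a J + i)) * X i| <=
  expR (- (c * (a%:R * ln J%:R))) * (1 + a%:R * ln J.+1%:R) ^+ l * (`|\sum_(i < n) X i| + (c + l%:R + `|u|) * (a%:R / J%:R) * M).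
Proof.
move=> c0 J0 nb hM; set E := expR _; set Q := 1 + _.
have lJ : 0 <= a%:R * ln J%:R :> R by rewrite mulr_ge0// ln_ge0// ler1n.
have lJ1 : 0 <= a%:R * ln J.+1%:R :> R by rewrite mulr_ge0// ln_ge0// ler1n.
have Q1 : 1 <= Q by rewrite lerDl.
have Q0 : 0 <= Q by lra.
have -> : E * Q ^+ l * (`|\sum_(i < n) X i| + (c + l%:R + `|u|) * (a%:R / J%:R) * M) =
  E * Q ^+ l * `|\sum_(i < n) X i| + E * ((c + l%:R + `|u|) * Q ^+ l) * (a%:R / J%:R) * M by ring.
have bl i : (i < n)%N -> a%:R * ln J%:R <= lp (bstart a J + i) /\ lp (bstart a J + i) <= Q.
  move=> ni; have /andP[h1 h2] := lp_block J0 (leq_trans ni nb).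
  by split => //; apply: le_trans h2 _; rewrite lerDr.
apply: (@abel R (fun i => kern c l u p (lp (bstart a J + i))) X (fun i => lp (bstart a J + i))) => //.
- by rewrite mulr_ge0 ?expR_ge0// mulr_ge0 ?exprn_ge0// !addr_ge0.
- by move=> i ni; have [h1 h2] := bl i ni; exact: kern_le.
- move=> i ni; have [h1 h2] := bl i (ltnW ni); have [h3 h4] := bl i.+1 ni.
  by apply: kern_lip => //; rewrite lp_mono// leq_add2l.
- move=> i ni; have /andP[h1 h2] := lp_block J0 (leq_trans ni nb).
  have n0 : (0 < n)%N by case: (n) ni.
  have /andP[h3 h4] := lp_block J0 (leq_trans n0 nb).
  apply: le_trans (lerB h2 h3) _.
  by rewrite -mulrBr ler_wpM2l// ln_step.
Qed.

(** The power of the logarithm is absorbed by the factor [yy J] contained in [bet J]. *)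
Lemma kern_half_sum l (U : R) : 0 <= U -> exists2 C : R, 0 <= C &
  forall (u p : R) (X : nat -> R) J n (M : R), `|u| <= U -> (0 < J)%N -> (n <= bsize a J)%N ->
  (forall i, (i <= n)%N -> `|\sum_(k < i) X k| <= M) ->
  `|\sum_(i < n) kern 2^-1 l u p (lp (bstart a J + i)) * X i| <= C * bet J * (`|\sum_(i < n) X i| + M / J%:R).
Proof.
move=> U0; have [C C1 hC] := @polylog_le R a a_gt0 l.
pose D : R := 1 + (2^-1 + l%:R + U) * a%:R.
have x0 : 0 <= (2^-1 + l%:R + U) * a%:R :> R by rewrite mulr_ge0// !addr_ge0.
have D1 : 1 <= D by rewrite /D lerDl.
exists (C * D); first by rewrite mulr_ge0//; lra.
move=> u p X J n M uU J0 nb hM.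
have M0 : 0 <= M by have := hM 0%N isT; rewrite big_ord0 normr0.
apply: le_trans (kern_sum _ _ _ _ J0 nb hM) _ => //.
rewrite exp_half//.
have -> : C * D * bet J = J%:R ^- h * (C * yy J) * D by rewrite /bet; ring.
have Jh : 0 <= J%:R ^- h :> R by rewrite invr_ge0 exprn_ge0.
rewrite -[leRHS]mulrA; apply: ler_pM.
- by rewrite mulr_ge0// exprn_ge0// addr_ge0// mulr_ge0// ln_ge0// ler1n.
- by rewrite addr_ge0// mulr_ge0// mulr_ge0 ?divr_ge0// !addr_ge0.
- by rewrite ler_wpM2l// hC.
rewrite mulrDr; apply: lerD; first by rewrite ler_peMl.
have -> : (2^-1 + l%:R + `|u|) * (a%:R / J%:R) * M = (2^-1 + l%:R + `|u|) * a%:R * (M / J%:R) by ring.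
rewrite ler_wpM2r ?divr_ge0//; apply: (@le_trans _ _ ((2^-1 + l%:R + U) * a%:R)); last by rewrite /D; lra.
by rewrite ler_wpM2r// lerD2l.
Qed.

(** Here even the total sum may be estimated by M: the factor 1/J is supplied by the weight 1/p
    itself. *)
Lemma kern_one_sum l (U : R) : 0 <= U -> exists2 C : R, 0 <= C &
  forall (u p : R) (X : nat -> R) J n (M : R), `|u| <= U -> (0 < J)%N -> (n <= bsize a J)%N ->
  (forall i, (i <= n)%N -> `|\sum_(k < i) X k| <= M) ->
  `|\sum_(i < n) kern 1 l u p (lp (bstart a J + i)) * X i| <= C * bet J * (M / J%:R).
Proof.
move=> U0; have [C C1 hC] := @polylog_le R a a_gt0 l.
pose D : R := 1 + (1 + l%:R + U) * a%:R.
have x0 : 0 <= (1 + l%:R + U) * a%:R :> R by rewrite mulr_ge0// !addr_ge0.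
have D1 : 1 <= D by rewrite /D lerDl.
exists (C * D); first by rewrite mulr_ge0//; lra.
move=> u p X J n M uU J0 nb hM.
have M0 : 0 <= M by have := hM 0%N isT; rewrite big_ord0 normr0.
apply: le_trans (kern_sum _ _ _ _ J0 nb hM) _ => //.
have -> : C * D * bet J * (M / J%:R) = J%:R ^- h / J%:R * (C * yy J) * (D * M) by rewrite /bet; ring.
have Jh : 0 <= J%:R ^- h :> R by rewrite invr_ge0 exprn_ge0.
apply: ler_pM.
- by rewrite mulr_ge0 ?expR_ge0// exprn_ge0// addr_ge0// mulr_ge0// ln_ge0// ler1n.
- by rewrite addr_ge0// mulr_ge0// mulr_ge0 ?divr_ge0// !addr_ge0.
- apply: ler_pM; rewrite ?expR_ge0 ?exp_one ?hC//.
  by rewrite exprn_ge0// addr_ge0// mulr_ge0// ln_ge0// ler1n.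
rewrite [D * M]mulrDl [1 * M]mul1r; apply: lerD; first exact: hM.
rewrite ler_wpM2r//; apply: ler_pM; rewrite ?divr_ge0//; last first.
  by rewrite ler_piMr// invf_le1 ?ltr0n// ler1n.
by rewrite lerD2l.
Qed.

Section terms.
Variables th w1 w2 : nat -> R.

Definition bM J := bmax (bsize a J) (fun i => th (bstart a J + i)) (fun i => w1 (bstart a J + i)) (fun i => w2 (bstart a J + i)).
Definition bB J := bdiff (bsize a J) (fun i => th (bstart a J + i)) (fun i => w1 (bstart a J + i)) (fun i => w2 (bstart a J + i)).
Definition xi J := Num.max 0 (tauJ J * bM J - 1) + bet J * bB J.

(* The terms j = 1, 2 of the logarithm minus the Gaussian term; [l] counts derivatives in [x],
   each of which also shifts the phase [p] by [- pi / 2]. *)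
Definition term12 (l : nat) (p x : R) (k : nat) : R :=
  kern 2^-1 l (- x) p (lp k) * (ecos (th k) - w1 k / Num.sqrt 2)
  + kern 2^-1 l (- x) (p + pi / 2) (lp k) * (esin (th k) - w2 k / Num.sqrt 2)
  + 2 ^+ l / 2 * (kern 1 l (- (2 * x)) p (lp k) * ecos (2 * th k) + kern 1 l (- (2 * x)) (p + pi / 2) (lp k) * esin (2 * th k)).

Lemma xi_ge0 J : 0 <= xi J.
Proof. by apply: addr_ge0; [rewrite le_max lexx|rewrite mulr_ge0 ?bet_ge0 ?addr_ge0]. Qed.

Lemma tauM_le J : tauJ J * bM J <= 1 + xi J.
Proof.
rewrite /xi addrA; apply: (@le_trans _ _ (1 + Num.max 0 (tauJ J * bM J - 1))).
  have : tauJ J * bM J - 1 <= Num.max 0 (tauJ J * bM J - 1) by rewrite le_max lexx orbT.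
  lra.
by rewrite lerDl mulr_ge0 ?bet_ge0 ?addr_ge0.
Qed.

Lemma betB_le J : bet J * bB J <= xi J.
Proof. by rewrite /xi lerDr le_max lexx. Qed.

End terms.

(** The first harmonic is summed together with the Gaussian term, so that their difference plays the
    role of the total sum; the second harmonic is small by itself. *)
Lemma term12_sum l (U : R) : 0 <= U -> exists2 C : R, 0 <= C &
  forall (p x : R) (th w1 w2 : nat -> R) J n, `|x| <= U -> (0 < J)%N -> (n <= bsize a J)%N ->
  `|\sum_(i < n) term12 th w1 w2 l p x (bstart a J + i)| <=
  C * bet J * (bdiff n (fun i => th (bstart a J + i)) (fun i => w1 (bstart a J + i)) (fun i => w2 (bstart a J + i)) + bM th w1 w2 J / J%:R).
Proof.
move=> U0; have [C1 C10 h1] := @kern_half_sum l U U0.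
have U20 : 0 <= 2 * U by lra.
have [C2 C20 h2] := @kern_one_sum l (2 * U) U20.
pose t : R := 2 ^+ l; have t0 : 0 <= t by rewrite exprn_ge0.
exists (4 * C1 + t * C2); first by rewrite addr_ge0// mulr_ge0.
move=> p x th w1 w2 J n xU J0 nb.
set th' := fun i => th (bstart a J + i); set w1' := fun i => w1 _; set w2' := fun i => w2 _.
set M := bM th w1 w2 J; have M0 : 0 <= M by exact: bmax_ge0.
have hM s i : (s < 6)%N -> (i <= n)%N -> `|\sum_(k < i) xs th' w1' w2' s k| <= M.
  by move=> s6 ni; apply: bmax_ge => //; exact: leq_trans ni nb.
have s21 : 1 <= Num.sqrt 2 :> R by rewrite -[leLHS]sqrtr1 ler_wsqrtr// ler1n.
have hX (s s' : nat) (X Y : nat -> R) i : (i <= n)%N -> (s < 6)%N -> (s' < 6)%N ->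
    (forall k, X k = xs th' w1' w2' s k - xs th' w1' w2' s' k / Num.sqrt 2) -> `|\sum_(k < i) X k| <= 2 * M.
  move=> ni s6 s6' XE; rewrite (eq_bigr _ (fun (k : 'I_i) _ => XE k)) sumrB -mulr_suml.
  apply: le_trans (ler_normB _ _) _; rewrite [2]/(1 + 1) mulrDl mul1r; apply: lerD; first exact: hM.
  rewrite normrM; apply: le_trans (_ : `|\sum_(k < i) xs th' w1' w2' s' k| * 1 <= _); last by rewrite mulr1 hM.
  by rewrite ler_wpM2l// ger0_norm ?invr_ge0// ?invf_le1//; lra.
have nx : `|- x| <= U by rewrite normrN.
have nx2 : `|- (2 * x)| <= 2 * U by rewrite normrN normrM ger0_norm// ler_wpM2l.
have b1 := @h1 (- x) p (fun i => ecos (th' i) - w1' i / Num.sqrt 2) J n (2 * M) nx J0 nb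
  (fun i ni => hX 0%N 4%N _ (fun=> 0) i ni isT isT (fun k => erefl)).
have b2 := @h1 (- x) (p + pi / 2) (fun i => esin (th' i) - w2' i / Num.sqrt 2) J n (2 * M) nx J0 nb
  (fun i ni => hX 1%N 5%N _ (fun=> 0) i ni isT isT (fun k => erefl)).
have b3 := @h2 (- (2 * x)) p (fun i => ecos (2 * th' i)) J n M nx2 J0 nb (fun i ni => hM 2%N i isT ni).
have b4 := @h2 (- (2 * x)) (p + pi / 2) (fun i => esin (2 * th' i)) J n M nx2 J0 nb (fun i ni => hM 3%N i isT ni).
rewrite /term12 big_split/= big_split/= -mulr_sumr big_split/=.
apply: le_trans (ler_normD _ _) _.
apply: (@le_trans _ _ (C1 * bet J * (bdiff n th' w1' w2' + 4 * (M / J%:R)) + t / 2 * (2 * (C2 * bet J * (M / J%:R))))).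
  apply: lerD.
    apply: le_trans (ler_normD _ _) (le_trans (lerD b1 b2) _).
    by rewrite /bdiff; apply: eq_ler; ring.
  rewrite normrM (ger0_norm (x := t / 2)) ?divr_ge0// ler_wpM2l ?divr_ge0//.
  by apply: le_trans (ler_normD _ _) (le_trans (lerD b3 b4) _); apply: eq_ler; ring.
have q0 : 0 <= M / J%:R by rewrite divr_ge0.
have d0 : 0 <= bdiff n th' w1' w2' by rewrite addr_ge0.
have := bet_ge0 J; move: (bet J) (M / J%:R) (bdiff _ _ _ _) q0 d0 => b q d q0 d0 b0.
have -> : C1 * b * (d + 4 * q) + t / 2 * (2 * (C2 * b * q)) = C1 * b * (d + 4 * q) + t * (C2 * b * q) by field.
have := mulr_ge0 (mulr_ge0 C10 b0) d0; have := mulr_ge0 (mulr_ge0 (mulr_ge0 t0 C20) b0) d0; lra.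
Qed.

(* On a full block the main parts compare through [bdiff]; on an initial segment both are bounded by [bmax]. *)
Lemma term12_bounds l (U : R) : 0 <= U -> exists2 C : R, 0 <= C &
  forall (p x : R) (th w1 w2 : nat -> R) J, `|x| <= U -> (0 < J)%N ->
  `|\sum_(i < bsize a J) term12 th w1 w2 l p x (bstart a J + i)| <= C * (2 * xi th w1 w2 J + vv J) /\
  forall n, (n <= bsize a J)%N ->
  `|\sum_(i < n) term12 th w1 w2 l p x (bstart a J + i)| <= C * ((1 + xi th w1 w2 J) / yy J).
Proof.
move=> U0; have [C C0 hC] := @term12_sum l U U0.
exists (5 * C) => [|p x th w1 w2 J xU J0]; first by rewrite mulr_ge0.
have y1 : 1 <= yy J :> R by exact: yy_ge1.
have y0 : 0 < yy J :> R by exact: yy_gt0.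
have J1 : 1 <= J%:R :> R by rewrite ler1n.
have J0' : 0 < J%:R :> R by rewrite ltr0n.
have x0 := xi_ge0 th w1 w2 J.
have bm : bet J * bM th w1 w2 J <= (1 + xi th w1 w2 J) / yy J.
  by rewrite ler_pdivlMr// mulrC mulrA; exact: tauM_le.
have vle : vv J * yy J <= 1 :> R.
  by rewrite /vv invfM -mulrA mulVf ?gt_eqF// mulr1 invf_le1.
have vv1 : vv J <= 1 :> R.
  by rewrite /vv invf_le1 ?mulr_gt0//; nra.
have v0 := vv_ge0 J : (0 : R) <= vv J.
split=> [|n nb].
  apply: le_trans (hC p x th w1 w2 J _ xU J0 (leqnn _)) _.
  have h1 := betB_le th w1 w2 J.
  have h2 : bet J * (bM th w1 w2 J / J%:R) <= (1 + xi th w1 w2 J) * vv J.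
    rewrite mulrA ler_pdivrMr// /vv; apply: le_trans bm _.
    by apply: eq_ler; field; rewrite !gt_eqF.
  rewrite -/(bB th w1 w2 J).
  have h3 : (1 + xi th w1 w2 J) * vv J <= vv J + xi th w1 w2 J by nra.
  have h4 : bet J * (bB th w1 w2 J + bM th w1 w2 J / J%:R) <= 5 * (2 * xi th w1 w2 J + vv J).
    by rewrite mulrDr; lra.
  rewrite -[leLHS]mulrA [5 * C]mulrC -[leRHS]mulrA.
  by apply: ler_wpM2l.
apply: le_trans (hC p x th w1 w2 J _ xU J0 nb) _.
set M := bM th w1 w2 J in bm *; have M0 : 0 <= M by exact: bmax_ge0.
have hd : bdiff n (fun i => th (bstart a J + i)) (fun i => w1 (bstart a J + i)) (fun i => w2 (bstart a J + i)) <= 4 * M.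
  have s21 : 1 <= Num.sqrt 2 :> R by rewrite -[leLHS]sqrtr1 ler_wsqrtr// ler1n.
  have sv : (Num.sqrt 2)^-1 <= 1 :> R by rewrite invf_le1//; lra.
  have sv0 : 0 <= (Num.sqrt 2)^-1 :> R by rewrite invr_ge0 sqrtr_ge0.
  have hM s : (s < 6)%N -> `|\sum_(k < n) xs (fun i => th (bstart a J + i)) (fun i => w1 (bstart a J + i)) (fun i => w2 (bstart a J + i)) s k| <= M.
    by move=> s6; apply: bmax_ge.
  have m0 := hM 0%N isT; have m1 := hM 1%N isT; have m4 := hM 4%N isT; have m5 := hM 5%N isT.
  rewrite /bdiff !sumrB -!mulr_suml.
  have e : 4 * M = M + M + (M + M) by ring.
  rewrite e; apply: lerD; apply: le_trans (ler_normB _ _) _; apply: lerD => //.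
    by rewrite normrM (ger0_norm sv0); apply: le_trans m4; rewrite ler_piMr.
  by rewrite normrM (ger0_norm sv0); apply: le_trans m5; rewrite ler_piMr.
have MJ : M / J%:R <= M by rewrite ler_piMr// invf_le1.
rewrite -[leLHS]mulrA [5 * C]mulrC -[leRHS]mulrA; apply: ler_wpM2l => //.
apply: le_trans (_ : bet J * (5 * M) <= _); first by rewrite ler_wpM2l ?bet_ge0//; lra.
by rewrite mulrCA ler_wpM2l.
Qed.

End block_sums.

(** * Terms of the logarithm and their derivatives *)

Section quadratic_bounds.
Context {R : realType}.

(** A quadratic remainder bound, unlike mere differentiability, passes to sums of series and to
    limits in N; this is why all derivatives of the error and of its limit are obtained from such
    bounds. *)
Lemma quad_is_derive (f : R -> R) (x d C : R) : (forall y, `|f y - f x - d * (y - x)| <= C * (y - x) ^+ 2) -> is_derive x 1 f d.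
Proof.
move=> fC; have C0 : 0 <= C.
  by have := fC (x + 1); rewrite [x + 1]addrC addrK expr1n !mulr1 => /(le_trans (normr_ge0 _)).
have h : h^-1 *: ((f \o shift x) (h *: (1 : R)) - f x) @[h --> 0^'] --> d.
  apply/cvgrPdist_le => /= e e0; near=> t.
  have t0 : t != 0 by near: t; exact: nbhs_dnbhs_neq.
  have tn : 0 < `|t| by rewrite normr_gt0.
  have te : `|t| <= e / (C + 1).
    near: t; apply: dnbhs0_le; by rewrite divr_gt0//; lra.
  rewrite /GRing.scale/= mulr1 distrC.
  have -> : t^-1 * (f (t + x) - f x) - d = t^-1 * (f (t + x) - f x - d * (t + x - x)).
    by field.
  rewrite normrM normfV mulrC ler_pdivrMr//; apply: le_trans (fC (t + x)) _.
  rewrite addrK -real_normK ?num_real// expr2 mulrA ler_wpM2r//.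
  move: te; rewrite ler_pdivlMr; last by lra.
  by move: (`|t|) tn => s s0; nra.
by apply: DeriveDef; [exact: (cvgP _ h)|exact: (cvg_lim _ h)].
Unshelve. all: by end_near.
Qed.

Variable A : R.
Hypothesis A0 : 0 < A.
Local Notation S := (`[- A, A]%classic : set R).

(** Since A > 0, every point of the segment, endpoints included, is a limit of other points of it;
    so limits along this filter are unique. *)
Lemma within_dnbhs_proper (x : R) : S x -> ProperFilter (within S x^').
Proof.
rewrite /= in_itv/= => /andP[x1 x2]; split; last exact: within_filter.
rewrite /within/= => /nbhs_ballP[e /= e0 he].
pose m : R := Num.min (e / 2) A; have m0 : 0 < m by rewrite lt_min A0 divr_gt0.
have mA : m <= A by rewrite ge_min lexx orbT.
have me : m < e by apply: (@le_lt_trans _ _ (e / 2)); [rewrite ge_min lexx|lra].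
have [x0|x0] := leP x 0.
  apply: (he (x + m)); rewrite /ball/= ?in_itv/=.
  - by rewrite opprD addrA subrr add0r normrN gtr0_norm.
  - by rewrite -subr_eq0 addrC addKr gt_eqF.
  - by apply/andP; split; lra.
apply: (he (x - m)); rewrite /ball/= ?in_itv/=.
- by rewrite opprB addrCA subrr addr0 gtr0_norm.
- by rewrite -subr_eq0 addrC addKr oppr_eq0 gt_eqF.
- by apply/andP; split; lra.
Qed.

Lemma quad_diff_quot (f : R -> R) (x d C : R) : 
  (forall y, S y -> `|f y - f x - d * (y - x)| <= C * (y - x) ^+ 2) -> diff_quot f x @ within S x^' --> d.
Proof.
move=> fC; apply/cvgrPdist_le => /= e e0.
suff h : \forall t \near x^', S t -> `|d - diff_quot f x t| <= e by exact: h.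
have r0 : 0 < e / (`|C| + 1) by rewrite divr_gt0// ltr_wpDl.
near=> t => St.
have tx : t - x != 0 by rewrite subr_eq0; near: t; exact: nbhs_dnbhs_neq.
have tn : 0 < `|t - x| by rewrite normr_gt0.
have te : `|t - x| <= e / (`|C| + 1).
  by rewrite distrC; near: t; apply: filterS (dnbhs_ball x r0) => t [/ltW].
have -> : d - diff_quot f x t = - ((f t - f x - d * (t - x)) / (t - x)) by rewrite /diff_quot; field.
rewrite normrN normrM normfV ler_pdivrMr//; apply: le_trans (fC _ St) _.
rewrite -real_normK ?num_real// expr2 mulrA ler_wpM2r//.
have C1 : C <= `|C| by exact: ler_norm.
move: te; rewrite ler_pdivlMr ?ltr_wpDl//.
by move: (`|t - x|) tn (`|C|) C1 (normr_ge0 C) => s s0 c; nra.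
Unshelve. all: try by end_near.
Qed.

Lemma quad_derive_within (f : R -> R) (x d C : R) : S x ->
  (forall y, S y -> `|f y - f x - d * (y - x)| <= C * (y - x) ^+ 2) ->
  diff_quot f x @ within S x^' --> d /\ derive_within S f x = d.
Proof.
move=> Sx /quad_diff_quot h; split => //.
by have P := within_dnbhs_proper Sx; apply: cvg_lim.
Qed.

Lemma derive_within_congr (f g : R -> R) (x : R) : S x -> {in S, f =1 g} ->
  diff_quot f x @ within S x^' = diff_quot g x @ within S x^'.
Proof.
move=> Sx fg; apply/seteqP; split => P; rewrite /nbhs/=/within/=; apply: filterS => y h Sy; move: (h Sy);
  by rewrite /diff_quot !fg ?inE.
Qed.

(** Candidates for all derivatives are given in advance, each within a quadratic term of its
    first-order expansion; the iterated derivatives relative to the segment are identified with them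
    by induction. *)
Lemma quad_smooth (g : nat -> R -> R) (C : nat -> R) :
  (forall n x y, S x -> S y -> `|g n y - g n x - g n.+1 x * (y - x)| <= C n * (y - x) ^+ 2) ->
  smooth_within S (g 0%N) /\ forall n, {in S, derive_within_n S n (g 0%N) =1 g n}.
Proof.
move=> gC.
have h n : {in S, derive_within_n S n (g 0%N) =1 g n}.
  elim: n => [//|n IH] x xS; rewrite /derive_within_n iterS -/(derive_within_n S n (g 0%N)).
  rewrite /derive_within (derive_within_congr (set_mem xS) IH).
  by have [_ <-] := quad_derive_within (set_mem xS) (fun y => gC n x y (set_mem xS)).
split => // n x Sx; rewrite (derive_within_congr Sx (h n)).
by have [/cvgP] := quad_derive_within Sx (fun y => gC n x y Sx).
Qed.

Lemma smooth_within0 : smooth_within S (cst 0).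
Proof.
have [] // := @quad_smooth (fun=> cst 0) (fun=> 0).
by move=> n x y _ _; rewrite /cst subrr mul0r subr0 normr0 mul0r.
Qed.

End quadratic_bounds.

Section series_bounds.
Context {R : realType}.

Lemma geo_series_le (u : nat -> R) (c q : R) : 0 <= c -> 0 < q -> q < 1 -> (forall j, `|u j| <= c * q ^+ j) ->
  cvgn (series u) /\ `|limn (series u)| <= c / (1 - q).
Proof.
move=> c0 q0 q1 uc; have qn : `|q| < 1 by rewrite gtr0_norm.
have cg : cvgn (series (geometric c q)) by exact: is_cvg_geometric_series.
have cn : cvgn [normed series u].
  apply: (@series_le_cvg R (fun n => `|u n|) (geometric c q)) => // n.
  by rewrite mulr_ge0// exprn_ge0// ltW.
split; first exact: normed_cvg.
apply: le_trans (lim_series_norm cn) _.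
rewrite -(cvg_lim _ (cvg_geometric_series (a := c) qn)) //.
exact: lim_series_le.
Qed.

End series_bounds.

(** * The harmonics of the logarithm at one prime *)

Section zeta_terms.
Context {R : realType}.

Lemma kern_derive (c : R) l (p L x : R) :
  is_derive x 1 (fun x => kern c l (- x) p L) (kern c l.+1 (- x) (p - pi / 2) L).
Proof.
have d : is_derive x 1 (fun x : R => cos (- x * L + p)) (L * sin (- x * L + p)).
  by apply: is_derive_eq; rewrite /GRing.scale/=; ring.
have -> : kern c l.+1 (- x) (p - pi / 2) L = (expR (- (c * L)) * L ^+ l) * (L * sin (- x * L + p)).
  rewrite /kern addrA cosB cos_pihalf sin_pihalf exprS; ring.
by rewrite /kern; apply: is_derive_eq; rewrite /GRing.scale/=; ring.
Qed.

(** One eighth of the exponent 1/2 is spent on the powers of L, which leaves 3/8. From the third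
    harmonic on, the decay is then at least p^(-9/8), hence summable. *)
Lemma kern_decay l : exists2 C : R, 0 <= C & forall u p L : R, 0 <= L -> `|kern 2^-1 l u p L| <= C * expR (- (3 / 8 * L)).
Proof.
exists (8 ^+ l * l`!%:R) => [|u p L L0]; first by rewrite mulr_ge0// exprn_ge0.
rewrite /kern normrM; apply: (@le_trans _ _ (expR (- (2^-1 * L)) * L ^+ l * 1)).
  by rewrite ger0_norm ?mulr_ge0 ?expR_ge0 ?exprn_ge0// ler_wpM2l ?mulr_ge0 ?expR_ge0 ?exprn_ge0// ler_norml cos_geN1 cos_le1.
have h : (L / 8) ^+ l / l`!%:R <= expR (L / 8).
  have z0 : 0 <= L / 8 by rewrite divr_ge0.
  case: l => [|l]; first by apply: le_trans (expR_ge1Dx _); rewrite expr0 fact0; lra.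
  by apply: le_trans (expR_ge1Dxn l z0); rewrite lerDr.
have -> : - (3 / 8 * L) = - (2^-1 * L) + L / 8 by field.
rewrite expRD mulr1 mulrCA ler_wpM2l ?expR_ge0//.
move: h; rewrite ler_pdivrMr ?ltr0n ?fact_gt0// expr_div_n ler_pdivrMr ?exprn_gt0//.
by move/le_trans; apply; apply: eq_ler; ring.
Qed.

(** 2^(-3/8): a geometric ratio in j valid for every prime. *)
Definition qz : R := expR (- (3 / 8 * ln 2)).

Lemma qz_gt0 : 0 < qz. Proof. exact: expR_gt0. Qed.

Lemma qz_lt1 : qz < 1.
Proof. by rewrite -expR0 ltr_expR oppr_lt0 mulr_gt0// ln_gt0// ltr1n. Qed.

Lemma lp_ge_ln2 k : ln 2 <= lp k :> R.
Proof. by rewrite ler_ln ?posrE ?ltr0n ?ler_nat ?(leq_trans _ (nth_prime_ge k)). Qed.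

Lemma lp_vv k : expR (- (9 / 8 * lp k)) <= vv k.+1 :> R.
Proof.
have k0 : 0 < k.+1%:R :> R by rewrite ltr0n.
have y0 : 0 < yy k.+1 :> R by rewrite yy_gt0.
have yE : yy k.+1 = expR (8^-1 * ln k.+1%:R) :> R.
  rewrite -[LHS](lnK (y0 : _ \is Num.pos)); congr expR.
  by rewrite -yyX lnXn// -[_ *+ 8]mulr_natl; field.
have -> : vv k.+1 = expR (- (9 / 8 * ln k.+1%:R)) :> R.
  have -> : 9 / 8 * ln k.+1%:R = ln k.+1%:R + 8^-1 * ln k.+1%:R :> R by field.
  by rewrite expRN expRD lnK ?posrE// /vv yE.
rewrite ler_expR lerN2.
have : ln k.+1%:R <= lp k :> R.
  by rewrite ler_ln ?posrE ?ltr0n ?ler_nat ?(leq_trans _ (nth_prime_ge k)).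
lra.
Qed.

(** The summand of index j + 1 in the logarithm. The phase p = 0 gives its real part, p = - pi / 2
    its imaginary part; the powers of j + 1 coming from derivatives sit inside [kern]. *)
Definition zeta_harm (th : nat -> R) (j l : nat) (p x : R) (k : nat) : R :=
  j.+1%:R^-1 * kern 2^-1 l (- x) (2 * pi * j.+1%:R * th k + p) (j.+1%:R * lp k).

Definition zeta_wave (th : nat -> R) (l : nat) (p x : R) (k : nat) : R := limn (series (fun j => zeta_harm th j l p x k)).

Definition gauss_wave (w1 w2 : nat -> R) (l : nat) (p x : R) (k : nat) : R :=
  kern 2^-1 l (- x) p (lp k) * (w1 k / Num.sqrt 2) + kern 2^-1 l (- x) (p + pi / 2) (lp k) * (w2 k / Num.sqrt 2).

Definition err_term (th w1 w2 : nat -> R) (l : nat) (p x : R) (k : nat) : R := zeta_wave th l p x k - gauss_wave w1 w2 l p x k.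

Lemma zeta_harm_derive (th : nat -> R) j l (p x : R) k : is_derive x 1 (fun x => zeta_harm th j l p x k) (zeta_harm th j l.+1 (p - pi / 2) x k).
Proof.
rewrite /zeta_harm; have := @kern_derive 2^-1 l (2 * pi * j.+1%:R * th k + p) (j.+1%:R * lp k) x; rewrite -addrA => ?.
by apply: is_derive_eq; rewrite /GRing.scale/=; ring.
Qed.

Lemma gauss_wave_derive (w1 w2 : nat -> R) l (p x : R) k : is_derive x 1 (fun x => gauss_wave w1 w2 l p x k) (gauss_wave w1 w2 l.+1 (p - pi / 2) x k).
Proof.
rewrite /gauss_wave; have ? := @kern_derive 2^-1 l p (lp k) x; have ? := @kern_derive 2^-1 l (p + pi / 2) (lp k) x.
by rewrite [p - _ + _]addrAC; apply: is_derive_eq; rewrite /GRing.scale/=; ring.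
Qed.

(** In the second bound the index shift by 2 means harmonics 3 and above: three factors p^(-3/8)
    make p^(-9/8), the remaining j give the geometric decay. *)
Lemma zeta_harm_le l : exists2 C : R, 0 <= C & forall (th : nat -> R) j p x k,
  `|zeta_harm th j l p x k| <= C * qz ^+ j /\ `|zeta_harm th j.+2 l p x k| <= C * vv k.+1 * qz ^+ j.
Proof.
have [C C0 hC] := kern_decay l; exists C => // th j p x k.
have h i : `|zeta_harm th i l p x k| <= C * expR (- (3 / 8 * (i.+1%:R * lp k))).
  rewrite /zeta_harm normrM; apply: (@le_trans _ _ (1 * `|kern 2^-1 l (- x) (2 * pi * i.+1%:R * th k + p) (i.+1%:R * lp k)|)).
    by rewrite ler_wpM2r// ger0_norm ?invr_ge0// invf_le1 ?ltr0n// ler1n.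
  by rewrite mul1r hC// mulr_ge0// lp_ge0.
have hq i : expR (- (3 / 8 * (i%:R * lp k))) <= qz ^+ i.
  rewrite -expRM_natl ler_expR mulrN lerN2 mulrCA ler_wpM2l//.
  by rewrite ler_wpM2l// lp_ge_ln2.
split.
  apply: le_trans (h j) _; rewrite ler_wpM2l//; apply: le_trans (hq j); rewrite ler_expR lerN2 ler_wpM2l//.
  by rewrite ler_wpM2r ?lp_ge0// ler_nat.
apply: le_trans (h j.+2) _; rewrite -[leRHS]mulrA ler_wpM2l//.
have -> : - (3 / 8 * (j.+3%:R * lp k)) = - (9 / 8 * lp k) + - (3 / 8 * (j%:R * lp k)) :> R.
  by rewrite -[j.+3]addn3 natrD; field.
by rewrite expRD; apply: ler_pM; [exact: expR_ge0|exact: expR_ge0|exact: lp_vv|exact: hq].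
Qed.

Lemma zeta_harm_cvg (th : nat -> R) l p x k : cvgn (series (fun j => zeta_harm th j l p x k)).
Proof.
have [C C0 hC] := zeta_harm_le l.
by have [] := @geo_series_le R _ C qz C0 qz_gt0 qz_lt1 (fun j => (hC th j p x k).1).
Qed.

Lemma zeta_wave_tail l : exists2 C : R, 0 <= C & forall (th : nat -> R) p x k, `|zeta_wave th l p x k - zeta_harm th 0 l p x k - zeta_harm th 1 l p x k| <= C * vv k.+1.
Proof.
have [C C0 hC] := zeta_harm_le l; exists (C / (1 - qz)).
  by rewrite divr_ge0// subr_ge0 ltW// qz_lt1.
move=> th p x k; have cv0 : 0 <= C * vv k.+1 by rewrite mulr_ge0 ?vv_ge0.
have [cu hu] := @geo_series_le R _ _ qz cv0 qz_gt0 qz_lt1 (fun j => (hC th j p x k).2).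
rewrite [C / _ * _]mulrAC; suff -> : zeta_wave th l p x k - zeta_harm th 0 l p x k - zeta_harm th 1 l p x k = limn (series (fun j => zeta_harm th j.+2 l p x k)) by [].
rewrite -addrA -opprD; apply/eqP; rewrite subr_eq; apply/eqP.
have h1 := @zeta_harm_cvg th l p x k; apply: cvg_lim => //.
rewrite -(cvg_shiftn 2)/=.
have -> : (fun n => series (fun j => zeta_harm th j l p x k) (n + 2)%N) = (fun n => series (fun j => zeta_harm th j.+2 l p x k) n + (zeta_harm th 0 l p x k + zeta_harm th 1 l p x k)).
  apply/funext => n; rewrite /series/= addn2 !big_nat_recl// addrA addrC.
  by rewrite addrC.
by apply: cvgD; [|exact: cvg_cst].
Qed.

(** The second-order Taylor bounds of the harmonics are summable in j, so the series can be
    differentiated term by term. *)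
Lemma zeta_wave_quad (th : nat -> R) l : exists C : R, forall p k x y, `|zeta_wave th l p y k - zeta_wave th l p x k - zeta_wave th l.+1 (p - pi / 2) x k * (y - x)| <= C * (y - x) ^+ 2.
Proof.
have [C C0 hC] := zeta_harm_le l.+2; exists (C / (1 - qz)) => p k x y.
pose u j : R := zeta_harm th j l p y k - zeta_harm th j l p x k - zeta_harm th j l.+1 (p - pi / 2) x k * (y - x).
have c0 : 0 <= C * (y - x) ^+ 2 by rewrite mulr_ge0 ?sqr_ge0.
have hu j : `|u j| <= C * (y - x) ^+ 2 * qz ^+ j.
  rewrite mulrAC; apply: taylor2_le (fun z => zeta_harm_derive th j l p z k) (fun z => zeta_harm_derive th j l.+1 _ z k) _ => z _.
  exact: (hC th j _ z k).1.
have [cu] := @geo_series_le R u _ qz c0 qz_gt0 qz_lt1 hu.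
rewrite [C / _ * _]mulrAC; suff -> : limn (series u) = zeta_wave th l p y k - zeta_wave th l p x k - zeta_wave th l.+1 (p - pi / 2) x k * (y - x) by [].
apply: cvg_lim => //.
have -> : series u = (fun n => series (fun j => zeta_harm th j l p y k) n - series (fun j => zeta_harm th j l p x k) n - series (fun j => zeta_harm th j l.+1 (p - pi / 2) x k) n * (y - x)).
  by apply/funext => n; rewrite /series/= mulr_suml -!sumrB.
apply: cvgB; first by apply: cvgB; exact: zeta_harm_cvg.
by apply: cvgMl; exact: zeta_harm_cvg.
Qed.

Lemma zeta_wave_derive (th : nat -> R) l (p x : R) k : is_derive x 1 (fun x => zeta_wave th l p x k) (zeta_wave th l.+1 (p - pi / 2) x k).
Proof. by have [C hC] := zeta_wave_quad th l; apply: (quad_is_derive (C := C)) => y; exact: hC. Qed.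

Lemma err_term_derive (th w1 w2 : nat -> R) l (p x : R) k : is_derive x 1 (fun x => err_term th w1 w2 l p x k) (err_term th w1 w2 l.+1 (p - pi / 2) x k).
Proof.
have ? := zeta_wave_derive th l p x k; have ? := gauss_wave_derive w1 w2 l p x k.
by rewrite /err_term; apply: is_derive_eq.
Qed.

Lemma cos_pihalfD (v : R) : cos (v + pi / 2) = - sin v.
Proof. by rewrite cosD cos_pihalf sin_pihalf; ring. Qed.

(** Expanding the cosine of a sum of angles turns the first two harmonics minus the Gaussian term
    into [term12]; only the tail of the series remains. *)
Lemma err_term_tail l : exists2 C : R, 0 <= C & forall (th w1 w2 : nat -> R) p x k, `|err_term th w1 w2 l p x k - term12 th w1 w2 l p x k| <= C * vv k.+1.
Proof.
have [C C0 hC] := zeta_wave_tail l; exists C => // th w1 w2 p x k.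
suff -> : err_term th w1 w2 l p x k - term12 th w1 w2 l p x k = zeta_wave th l p x k - zeta_harm th 0 l p x k - zeta_harm th 1 l p x k by exact: hC.
have e0 : zeta_harm th 0 l p x k = kern 2^-1 l (- x) p (lp k) * ecos (th k) + kern 2^-1 l (- x) (p + pi / 2) (lp k) * esin (th k).
  rewrite /zeta_harm /kern !addrA cos_pihalfD /ecos /esin invr1 !mul1r.
  have -> : - x * lp k + 2 * pi * 1 * th k + p = (- x * lp k + p) + 2 * pi * th k by ring.
  by rewrite cosD; ring.
have e1 : zeta_harm th 1 l p x k = 2 ^+ l / 2 * (kern 1 l (- (2 * x)) p (lp k) * ecos (2 * th k) + kern 1 l (- (2 * x)) (p + pi / 2) (lp k) * esin (2 * th k)).
  rewrite /zeta_harm /kern !addrA cos_pihalfD /ecos /esin mul1r exprMn.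
  have -> : 2^-1 * (2 * lp k) = lp k :> R by field.
  have -> : - x * (2 * lp k) + 2 * pi * 2 * th k + p = (- (2 * x) * lp k + p) + 2 * pi * (2 * th k) by ring.
  by rewrite cosD; ring.
rewrite /err_term /term12 e0 e1 /gauss_wave; ring.
Qed.

End zeta_terms.

(** * Bounds and convergence of the error sums *)

Section error_sums.
Context {R : realType}.
Variable h : nat.
Hypothesis h0 : (0 < h)%N.
Local Notation a := (h + h)%N.
Let a0 : (0 < a)%N := a_gt0 h0.

Lemma sum_vvS m : \sum_(k < m) vv k.+1 <= 9 :> R.
Proof. by apply: le_trans (sum_vv m.+1); rewrite big_ord_recl/= vv0 add0r. Qed.

(** Scale of the contribution of the harmonics j >= 3 over block [J]. *)
Definition kap (J : nat) : R := \sum_(m < bsize a J) vv (bstart a J + m).+1.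

Lemma kap_ge0 J : 0 <= kap J. Proof. by apply: sumr_ge0 => i _; exact: vv_ge0. Qed.

Lemma sum_kap J : \sum_(i < J) kap i <= 9.
Proof. by rewrite /kap -(sum_blocks a0 (fun k => vv k.+1)); exact: sum_vvS. Qed.

Lemma bsize0 : bsize a 0 = 0%N. Proof. by rewrite /bsize bstart1 bstart0 ?subnn. Qed.

Lemma yy_large (M : R) : exists J0, forall J, (J0 <= J)%N -> M <= yy J.
Proof.
exists ((Num.truncn `|M|).+1 ^ 8)%N => J hJ.
apply: le_trans (ler_norm M) _; apply: ltW; apply: lt_le_trans (truncnS_gt _) _.
rewrite -(ler_pXn2r (ltn0Sn 7)) ?nnegrE ?yy_ge0//.
by rewrite yyX -natrX ler_nat.
Qed.

Lemma err_term_blocks l (U : R) : 0 <= U -> exists2 C : R, 0 <= C &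
  forall (p x : R) (th w1 w2 : nat -> R) J, `|x| <= U ->
  `|\sum_(i < bsize a J) err_term th w1 w2 l p x (bstart a J + i)| <= C * (2 * xi h th w1 w2 J + vv J + kap J) /\
  forall n, (n <= bsize a J)%N ->
  `|\sum_(i < n) err_term th w1 w2 l p x (bstart a J + i)| <= C * ((1 + xi h th w1 w2 J) / yy J + kap J).
Proof.
move=> U0; have [C C0 hC] := term12_bounds h0 l U0.
have [D D0 hD] := @err_term_tail R l.
exists (C + D) => [|p x th w1 w2 J xU]; first exact: addr_ge0.
have x0 := xi_ge0 h th w1 w2 J; have v0 := vv_ge0 J : 0 <= (vv J : R); have k0 := kap_ge0 J.
have y0 := yy_ge0 J : 0 <= (yy J : R).
have key n : (n <= bsize a J)%N -> `|\sum_(i < n) err_term th w1 w2 l p x (bstart a J + i)| <=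
    `|\sum_(i < n) term12 th w1 w2 l p x (bstart a J + i)| + D * kap J.
  move=> nb; rewrite -[X in `|X| <= _](subrK (\sum_(i < n) term12 th w1 w2 l p x (bstart a J + i))) addrC.
  apply: le_trans (ler_normD _ _) _; rewrite lerD2l -sumrB.
  apply: le_trans (ler_norm_sum _ _ _) _.
  apply: le_trans (_ : \sum_(i < n) D * vv (bstart a J + i).+1 <= _).
    by apply: ler_sum => i _; exact: hD.
  rewrite -mulr_sumr ler_wpM2l// /kap -(subnKC nb) big_split_ord/= lerDl.
  by apply: sumr_ge0 => i _; exact: vv_ge0.
have [J0|J0] := posnP J.
  have c1 : 0 <= (C + D) * (2 * xi h th w1 w2 J + vv J + kap J) by rewrite mulr_ge0// !addr_ge0// mulr_ge0.
  have c2 : 0 <= (C + D) * ((1 + xi h th w1 w2 J) / yy J + kap J) by rewrite mulr_ge0// !addr_ge0// divr_ge0// addr_ge0.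
  move: c1 c2; rewrite J0 bsize0 big_ord0 normr0 => c1 c2; split => // n.
  by rewrite leqn0 => /eqP ->; rewrite big_ord0 normr0.
have [h1 h2] := hC p x th w1 w2 J xU J0.
split.
  apply: le_trans (key _ (leqnn _)) (le_trans (lerD h1 (lexx _)) _).
  by nra.
move=> n nb; apply: le_trans (key _ nb) (le_trans (lerD (h2 n nb) (lexx _)) _).
have q0 : 0 <= (1 + xi h th w1 w2 J) / yy J by rewrite divr_ge0// addr_ge0.
by move: (_ / _) q0 => q q0; nra.
Qed.

Definition err_sum (th w1 w2 : nat -> R) (N l : nat) (p x : R) : R := \sum_(k < N) err_term th w1 w2 l p x k.
Definition xisum (th w1 w2 : nat -> R) (m : nat) : R := \sum_(J < m) xi h th w1 w2 J.

Lemma xisum_ge0 th w1 w2 m : 0 <= xisum th w1 w2 m.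
Proof. by apply: sumr_ge0 => i _; exact: xi_ge0. Qed.

(** Whole blocks contribute the sums of 2 xi, [vv] and [kap], the incomplete last one 1 + xi + kap;
    the constants 9 + 9 + 1 are within 28. *)
Lemma err_sum_le l (U : R) : 0 <= U -> exists2 C : R, 0 <= C &
  forall (p x : R) (th w1 w2 : nat -> R) N, `|x| <= U ->
  `|err_sum th w1 w2 N l p x| <= C * (1 + xisum th w1 w2 (blk a0 N).+1).
Proof.
move=> U0; have [C C0 hC] := err_term_blocks l U0.
exists (28 * C) => [|p x th w1 w2 N xU]; first by rewrite mulr_ge0.
have J0 := blk_gt0 a0 N; have /andP[N1 N2] := blkP a0 N.
rewrite /err_sum (sum_blk a0); move: (blk a0 N) J0 N1 N2 => J J0 N1 N2.
have y1 : 1 <= yy J :> R by exact: yy_ge1.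
have x0 := xi_ge0 h th w1 w2 J.
have s1 : `|\sum_(i < J) \sum_(m < bsize a i) err_term th w1 w2 l p x (bstart a i + m)| <= C * (2 * xisum th w1 w2 J + 9 + \sum_(i < J) kap i).
  apply: le_trans (ler_norm_sum _ _ _) _.
  apply: le_trans (_ : \sum_(i < J) C * (2 * xi h th w1 w2 i + vv i + kap i) <= _).
    by apply: ler_sum => i _; have [] := hC p x th w1 w2 i xU.
  rewrite -mulr_sumr ler_wpM2l// !big_split/= -mulr_sumr lerD2r lerD2l; exact: sum_vv.
have s2 : `|\sum_(m < N - bstart a J) err_term th w1 w2 l p x (bstart a J + m)| <= C * (1 + xi h th w1 w2 J + kap J).
  have [_ hn] := hC p x th w1 w2 J xU; apply: le_trans (hn _ _) _; first by rewrite leq_sub2r// ltnW.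
  rewrite ler_wpM2l// lerD2r ler_pdivrMr; last exact: lt_le_trans y1.
  by rewrite ler_peMr// addr_ge0.
apply: le_trans (ler_normD _ _) (le_trans (lerD s1 s2) _).
have sk := sum_kap J.+1; rewrite big_ord_recr/= in sk.
rewrite /xisum big_ord_recr/= -/(xisum th w1 w2 J).
have z0 := xisum_ge0 th w1 w2 J; rewrite -mulrDr [28 * C]mulrC -mulrA ler_wpM2l//.
lra.
Qed.

Fixpoint phase (p : R) (n : nat) : R := if n is n'.+1 then phase p n' - pi / 2 else p.

Lemma err_sum_derive th w1 w2 N l (p x : R) :
  is_derive x 1 (fun x => err_sum th w1 w2 N l p x) (err_sum th w1 w2 N l.+1 (p - pi / 2) x).
Proof.
have := @is_derive_sum R R R N (fun k x => err_term th w1 w2 l p x k) x 1 (fun k => err_term th w1 w2 l.+1 (p - pi / 2) x k)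
  (fun k => err_term_derive th w1 w2 l p x k).
by congr is_derive; apply/funext => y; rewrite fct_sumE.
Qed.

Lemma err_sum_quad l (A : R) : 0 < A -> exists2 C : R, 0 <= C & forall p th w1 w2 N x y, `|x| <= A -> `|y| <= A ->
  `|err_sum th w1 w2 N l p y - err_sum th w1 w2 N l p x - err_sum th w1 w2 N l.+1 (p - pi / 2) x * (y - x)| <=
  C * (1 + xisum th w1 w2 (blk a0 N).+1) * (y - x) ^+ 2.
Proof.
(* The Taylor bound asks for all points within |y - x| <= 2 A of x, hence the radius 3 A. *)
move=> A0; have A3 : 0 <= 3 * A by lra.
have [C C0 hC] := err_sum_le l.+2 A3; exists C => // p th w1 w2 N x y xA yA.
apply: taylor2_le (fun z => err_sum_derive th w1 w2 N l p z) (fun z => err_sum_derive th w1 w2 N l.+1 _ z) _ => z zx.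
apply: hC; rewrite -[z](subrK x).
apply: le_trans (ler_normD _ _) _; apply: le_trans (lerD zx xA) _.
have := ler_normB y x; lra.
Qed.

Section limits.
Variables th w1 w2 : nat -> R.
Hypothesis cxi : cvgn (series (xi h th w1 w2)).

Definition err_lim (l : nat) (p x : R) : R := limn (fun N => err_sum th w1 w2 N l p x).

(** The majorants [mu] of whole blocks are summable as soon as the xi are, and the bound [nu] for an
    incomplete block tends to 0. The resulting rate depends neither on the point nor on the
    phase. *)
Lemma err_sum_unif l (U : R) : 0 <= U -> exists2 r : nat -> R, r @ \oo --> 0 &
  forall p x N, `|x| <= U -> `|err_lim l p x - err_sum th w1 w2 N l p x| <= r N.
Proof.
move=> U0; have [C C0 hC] := err_term_blocks l U0.
pose mu J := C * (2 * xi h th w1 w2 J + vv J + kap J).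
pose nu J := C * ((1 + xi h th w1 w2 J) / yy J + kap J).
have mu0 J : 0 <= mu J.
  by rewrite mulr_ge0// !addr_ge0 ?vv_ge0 ?kap_ge0// mulr_ge0 ?xi_ge0.
have bnd_cvg (u : nat -> R) (B : R) : (forall J, 0 <= u J) -> (forall m, \sum_(J < m) u J <= B) -> cvgn (series u).
  move=> u0 uB; apply: nondecreasing_is_cvgn.
    by apply: nondecreasing_series => n *; exact: u0.
  by exists B => _ [m _ <-]; rewrite /series/= big_mkord.
have ck : cvgn (series kap) by apply: bnd_cvg kap_ge0 sum_kap.
have cv : cvgn (series (vv : nat -> R)) by apply: bnd_cvg (@vv_ge0 R) (@sum_vv R).
have cmu : cvgn (series mu).
  have -> : mu = C *: (2 *: xi h th w1 w2 + vv + kap) by apply/funext.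
  by apply: is_cvg_seriesZ; apply: is_cvg_seriesD => //; apply: is_cvg_seriesD => //; exact: is_cvg_seriesZ.
have nu0 : nu @ \oo --> 0.
  have -> : 0 = C * (0 + 0) :> R by rewrite addr0 mulr0.
  apply: cvgMr; apply: cvgD; last exact: cvg_series_cvg_0.
  have cx0 : (1 + xi h th w1 w2 J) @[J --> \oo] --> 1 + (0 : R).
    by apply: cvgD; [exact: cvg_cst|exact: cvg_series_cvg_0].
  have cy0 : (yy J)^-1 @[J --> \oo] --> (0 : R).
    apply/cvgrPdist_le => e e0; have [J1 hJ] := yy_large e^-1.
    exists J1 => // J /= JJ; rewrite sub0r normrN ger0_norm ?invr_ge0 ?yy_ge0//.
    have := hJ J JJ; have e1 : 0 < e^-1 by rewrite invr_gt0.
    by move=> ye; rewrite -[leRHS]invrK lef_pV2 ?posrE// (lt_le_trans e1).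
  rewrite -[X in _ --> X](mulr0 (1 + 0)); exact: (cvgM cx0 cy0).
pose r J := limn (series mu) - series mu J + nu J.
have r0 : r @ \oo --> 0.
  have -> : 0 = limn (series mu) - limn (series mu) + 0 :> R by rewrite subrr addr0.
  by apply: cvgD => //; apply: cvgB => //; exact: cvg_cst.
have rb : (r \o blk a0) @ \oo --> 0.
  apply: cvg_comp r0; move=> P [J0 _ hJ]; exists (bstart a J0) => // N /= JN.
  by apply: hJ => /=; apply: leq_trans (blk_ge a0 J0) (blk_mono a0 JN).
have key p x : `|x| <= U -> exists F, forall N, `|F - err_sum th w1 w2 N l p x| <= r (blk a0 N).
  move=> xU; pose A J := \sum_(i < bsize a J) err_term th w1 w2 l p x (bstart a J + i).
  have hA J : `|A J| <= mu J by have [] := hC p x th w1 w2 J xU.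
  have cA : cvgn (series A).
    by apply: normed_cvg; apply: (@series_le_cvg R (fun J => `|A J|) mu).
  exists (limn (series A)) => N.
  have h1 J : `|limn (series A) - series A J| <= limn (series mu) - series mu J.
    have cn : `|series A n - series A J| @[n --> \oo] --> `|limn (series A) - series A J|.
      by apply: cvg_norm; apply: cvgB => //; exact: cvg_cst.
    rewrite -(cvg_lim _ cn)//; apply: limr_le; first exact: cvgP cn.
    exists J => // n /= Jn; rewrite sub_series_geq//; apply: le_trans (ler_norm_sum _ _ _) _.
    apply: (@le_trans _ _ (series mu n - series mu J)).
      by rewrite sub_series_geq//; apply: ler_sum.
    rewrite lerD2r; apply: nondecreasing_cvgn_le => //.
    by apply: nondecreasing_series => m *; exact: mu0.
  have /andP[N1 N2] := blkP a0 N.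
  rewrite /err_sum (sum_blk a0); set J := blk a0 N in N1 N2 *.
  rewrite -(big_mkord xpredT A) opprD addrA; apply: le_trans (ler_normB _ _) _.
  rewrite /r; apply: lerD; first exact: h1.
  have [_ hn] := hC p x th w1 w2 J xU; apply: hn; rewrite leq_sub2r//; exact: ltnW.
exists (r \o blk a0) => // p x N xU; have [F hF] := key p x xU.
suff -> : err_lim l p x = F by exact: hF.
apply: cvg_lim => //; apply/cvgrPdist_le => e e0.
move/cvgrPdist_le : rb => /(_ e e0); apply: filterS => n /=; rewrite sub0r normrN => hr.
by apply: le_trans (hF n) (le_trans (ler_norm _) hr).
Qed.

Lemma err_sum_cvg l p x : err_sum th w1 w2 N l p x @[N --> \oo] --> err_lim l p x.
Proof.
have [r r0 hr] := err_sum_unif l (normr_ge0 x); apply/cvgrPdist_le => e e0.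
move/cvgrPdist_le : r0 => /(_ e e0); apply: filterS => n /=; rewrite sub0r normrN => h1.
by apply: le_trans (hr p x n (lexx _)) (le_trans (ler_norm _) h1).
Qed.

(** The quadratic bounds of the partial sums are uniform in N once the sum of the xi is finite, so
    they survive in the limit. *)
Lemma err_lim_quad l (A : R) : 0 < A -> exists C : R, forall p x y, `|x| <= A -> `|y| <= A ->
  `|err_lim l p y - err_lim l p x - err_lim l.+1 (p - pi / 2) x * (y - x)| <= C * (y - x) ^+ 2.
Proof.
move=> A0; have [C C0 hC] := err_sum_quad l A0.
exists (C * (1 + limn (series (xi h th w1 w2)))) => p x y xA yA.
have cn : `|err_sum th w1 w2 N l p y - err_sum th w1 w2 N l p x - err_sum th w1 w2 N l.+1 (p - pi / 2) x * (y - x)| @[N --> \oo]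
    --> `|err_lim l p y - err_lim l p x - err_lim l.+1 (p - pi / 2) x * (y - x)|.
  apply: cvg_norm; apply: cvgB; first by apply: cvgB; exact: err_sum_cvg.
  by apply: cvgMl; exact: err_sum_cvg.
rewrite -(cvg_lim _ cn)//; apply: limr_le; first exact: cvgP cn.
apply: nearW => N; apply: le_trans (hC p th w1 w2 N x y xA yA) _.
rewrite ler_wpM2r ?sqr_ge0// ler_wpM2l// lerD2l /xisum -(big_mkord xpredT).
apply: nondecreasing_cvgn_le => //.
by apply: nondecreasing_series => m *; exact: xi_ge0.
Qed.

End limits.

End error_sums.

(** * Essential suprema of continuous functions *)

Section linfty.
Context {R : realType}.
Variable A : R.
Hypothesis A0 : 0 < A.
Local Notation S := (`[- A, A]%classic : set R).

(* An enumeration of the rational points of the segment (with repetitions of 0). *)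
Definition rpt (n : nat) : R := let q := ratr (odflt 0 (unpickle n : option rat)) in if `|q| <= A then q else 0.

Lemma rptS n : S (rpt n).
Proof.
rewrite /= in_itv/= -ler_norml /rpt; case: ifP => //= _; by rewrite normr0 ltW.
Qed.

Lemma itv_near (x e : R) : S x -> 0 < e -> exists c d : R, [/\ c < d, `]c, d[ `<=` S & `]c, d[ `<=` ball x e].
Proof.
rewrite /= in_itv/= => /andP[x1 x2] e0; pose m : R := Num.min e A; have m0 : 0 < m by rewrite lt_min A0 e0.
have mA : m <= A by rewrite ge_min lexx orbT.
have me : m <= e by rewrite ge_min lexx.
have [x0|x0] := leP x 0.
  exists x, (x + m); split; first by rewrite ltrDl.
    by move=> t /=; rewrite !in_itv/= => /andP[? ?]; apply/andP; split; lra.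
  by move=> t /=; rewrite in_itv/= /ball/= => /andP[? ?]; rewrite ltr_norml; apply/andP; split; lra.
exists (x - m), x; split; first by rewrite gtrDl oppr_lt0.
  by move=> t /=; rewrite !in_itv/= => /andP[? ?]; apply/andP; split; lra.
by move=> t /=; rewrite in_itv/= /ball/= => /andP[? ?]; rewrite ltr_norml; apply/andP; split; lra.
Qed.

(** A countable supremum makes the norm measurable in the random parameter. By continuity a value
    exceeding the essential supremum at one point would persist on an interval of positive length
    inside the segment. *)
Lemma Linfty_norm_sup (f : R -> R[i]) (g : R -> R) : continuous g -> (forall x, 0 <= g x) ->
  (forall x, S x -> Normc.normc (f x) = g x) ->
  Linfty_norm S f = ereal_sup (range (fun n => (g (rpt n))%:E)).
Proof.
move=> cg g0 fg; pose F := abse \o ((fun x => (Normc.normc (f x))%:E) \_ S).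
have FS x : S x -> F x = (g x)%:E.
  by move=> Sx; rewrite /F/= patchE mem_set// fg//= ger0_norm.
have Fn x : ~ S x -> F x = 0%E by move=> Sx; rewrite /F/= patchE memNset// abse0.
have mT : (0 < @lebesgue_measure R [set: R])%E.
  apply: (@lt_le_trans _ _ (@lebesgue_measure R `[0, 1]%classic)).
    by rewrite lebesgue_measure_itv/= lte_fin ltr01 sube0 lte_fin.
  by apply: le_measure; rewrite ?inE.
rewrite /Linfty_norm unlock mT -/F; apply/eqP; rewrite eq_le; apply/andP; split.
  apply/ess_sup_inf.ess_supP; apply: aeW => x.
  have [Sx|Sx] := pselect (S x); last first.
    rewrite Fn//; apply: le_trans (_ : (g (rpt 0))%:E <= _)%E; first by rewrite lee_fin.
    by apply: ereal_sup_ubound; exists 0%N.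
  rewrite FS//; apply/lee_addgt0Pr => e e0.
  have /nbhs_ballP[d /= d0 hd] : nbhs x (fun y => `|g x - g y| < e).
    by have /cvgrPdist_lt /(_ e e0) := cg x.
  have [c [c' [cc cS cb]]] := itv_near Sx d0.
  have [q qc] := rat_in_itvoo cc.
  have qS := cS _ qc; have qb := cb _ qc.
  have qE : rpt (pickle q) = ratr q.
    by rewrite /rpt pickleK/= ler_norml; move: qS; rewrite /= in_itv/= => ->.
  apply: le_trans (_ : (g (ratr q) + e)%:E <= _)%E; first by rewrite lee_fin; have := hd _ qb; rewrite ltr_norml => /andP[_ ?]; lra.
  by rewrite EFinD leeD2r//; apply: ereal_sup_ubound; exists (pickle q) => //; rewrite qE.
apply: ge_ereal_sup => _ [n _ <-]; rewrite leNgt; apply/negP => lt.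
have [r [lr rg]] : exists r : R, (ess_sup_inf.ess_sup (@lebesgue_measure R) F <= r%:E)%E /\ r < g (rpt n).
  have := ess_sup_inf.ess_sup_ge (@lebesgue_measure R) F.
  move: lt; case: (ess_sup_inf.ess_sup (@lebesgue_measure R) F) => [r| |]//.
    by rewrite lte_fin => lt _; exists r.
  by move=> _ _; exists (g (rpt n) - 1); rewrite leNye; split => //; rewrite gtrDl ltrN10.
have e0 : 0 < g (rpt n) - r by rewrite subr_gt0.
have /nbhs_ballP[d /= d0 hd] : nbhs (rpt n) (fun y => `|g (rpt n) - g y| < g (rpt n) - r).
  by have /cvgrPdist_lt /(_ _ e0) := cg (rpt n).
have [c [c' [cc cS cb]]] := itv_near (rptS n) d0.
have /ess_sup_inf.ess_supP := lr; move=> [N [mN N0 hN]].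
have : (@lebesgue_measure R `]c, c'[%classic <= @lebesgue_measure R N)%E.
  apply: le_measure; rewrite ?inE//= => t tc; apply: hN => /=.
  rewrite FS; last exact: cS.
  rewrite lee_fin; have := hd _ (cb _ tc); rewrite ltr_norml => /andP[_]; rewrite ltrD2l ltrN2 => rg'.
  by rewrite leNgt rg'.
by rewrite N0 lebesgue_measure_itv/= lte_fin cc leNgt -EFinB lte_fin subr_gt0 cc.
Qed.

End linfty.

(** * Real and imaginary parts *)

Section complex_parts.
Context {R : realType}.

Lemma Re_sum (N : nat) (F : 'I_N -> R[i]) : complex.Re (\sum_(k < N) F k) = \sum_(k < N) complex.Re (F k).
Proof.
by apply: (big_morph (@complex.Re R)) => // -[? ?] [? ?].
Qed.

Lemma Im_sum (N : nat) (F : 'I_N -> R[i]) : complex.Im (\sum_(k < N) F k) = \sum_(k < N) complex.Im (F k).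
Proof.
by apply: (big_morph (@complex.Im R)) => // -[? ?] [? ?].
Qed.

Lemma mulCE (x y z t : R) : (Complex x y * Complex z t : R[i]) = Complex (x * z - y * t) (x * t + y * z).
Proof. by []. Qed.

Lemma natC (n : nat) : n%:R = (Complex n%:R 0) :> R[i].
Proof. by rewrite -[LHS](rmorph_nat (real_complex R)). Qed.

Lemma invnC (n : nat) : n%:R^-1 = (Complex n%:R^-1 0) :> R[i].
Proof. by rewrite -(rmorph_nat (real_complex R)) -fmorphV. Qed.

Lemma npowcE (n : nat) (u v : R) : npowc n (Complex u v) = cexp (Complex (u * ln n%:R) (v * ln n%:R)).
Proof. by rewrite /npowc mulCE !mulr0 subr0 add0r. Qed.

Lemma cexp_mul (u v z t : R) : cexp (Complex u v) * cexp (Complex z t) = cexp (Complex (u + z) (v + t)).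
Proof. by rewrite /cexp mulCE/= expRD cosD sinD; congr Complex; ring. Qed.

(** The imaginary part is the real one with its phase shifted by - pi / 2, so one real family covers
    both. *)
Lemma zeta_term (t : R) (p j : nat) (x : R) :
  (j.+1)%:R^-1 * cexp (Complex 0 (2 * pi * j.+1%:R * t)) * npowc p (- (j.+1%:R * Complex 2^-1 x))
  = Complex (j.+1%:R^-1 * kern 2^-1 0 (- x) (2 * pi * j.+1%:R * t + 0) (j.+1%:R * ln p%:R))
            (j.+1%:R^-1 * kern 2^-1 0 (- x) (2 * pi * j.+1%:R * t + - (pi / 2)) (j.+1%:R * ln p%:R)).
Proof.
rewrite invnC (natC j.+1) [X in npowc _ (- X)]mulCE mul0r subr0 mul0r addr0.
have -> : - Complex (j.+1%:R * 2^-1) (j.+1%:R * x) = Complex (- (j.+1%:R * 2^-1)) (- (j.+1%:R * x)) :> R[i] by [].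
rewrite npowcE -mulrA cexp_mul /cexp/= mulCE /kern expr0 !mulr1 !addr0 add0r !mul0r subr0 addr0 addrA cosB cos_pihalf sin_pihalf mulr0 add0r mulr1.
have -> : - (j.+1%:R / 2) * ln p%:R = - (2^-1 * (j.+1%:R * ln p%:R)) :> R by ring.
have -> : 2 * pi * j.+1%:R * t + - (j.+1%:R * x) * ln p%:R = - x * (j.+1%:R * ln p%:R) + 2 * pi * j.+1%:R * t :> R by ring.
by [].
Qed.

Lemma cseriesE (u : nat -> R[i]) (f g : nat -> R) : (forall j, u j = Complex (f j) (g j)) ->
  cseries u = Complex (limn (series f)) (limn (series g)).
Proof. by move=> uE; rewrite /cseries; congr (Complex (limn (series _)) (limn (series _))); apply/funext => j; rewrite uE. Qed.

Lemma Re_log_zeta (t : nat -> R) N x : complex.Re (log_zeta_rand t N x) = \sum_(k < N) zeta_wave t 0 0 x k.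
Proof.
rewrite /log_zeta_rand /gauss_sum Re_sum; apply: eq_bigr => k _; rewrite (cseriesE (fun j => zeta_term _ _ _ _))//.
Qed.

Lemma Im_log_zeta (t : nat -> R) N x : complex.Im (log_zeta_rand t N x) = \sum_(k < N) zeta_wave t 0 (- (pi / 2)) x k.
Proof.
rewrite /log_zeta_rand /gauss_sum Im_sum; apply: eq_bigr => k _; rewrite (cseriesE (fun j => zeta_term _ _ _ _))//.
Qed.

Lemma gauss_term (p : nat) (x u v : R) : (0 < p)%N ->
  ((Num.sqrt (2 * p%:R))^-1)%:C%C * npowc p (Complex 0 (- x)) * Complex u v =
  Complex (kern 2^-1 0 (- x) 0 (ln p%:R) * (u / Num.sqrt 2) + kern 2^-1 0 (- x) (0 + pi / 2) (ln p%:R) * (v / Num.sqrt 2))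
   (kern 2^-1 0 (- x) (- (pi / 2)) (ln p%:R) * (u / Num.sqrt 2) + kern 2^-1 0 (- x) (- (pi / 2) + pi / 2) (ln p%:R) * (v / Num.sqrt 2)).
Proof.
move=> p0; have p0' : 0 < p%:R :> R by rewrite ltr0n.
have pE : (Num.sqrt (2 * p%:R))^-1 = expR (- (2^-1 * ln p%:R)) / Num.sqrt 2 :> R.
  rewrite sqrtrM// invfM mulrC; congr (_ / _).
  have -> : Num.sqrt p%:R = expR (2^-1 * ln p%:R) :> R.
    have -> : p%:R = expR (2^-1 * ln p%:R) ^+ 2 :> R.
      by rewrite -expRM_natl mulVKf ?lnK// posrE.
    by rewrite sqrtr_sqr ger0_norm ?expR_ge0// -expRM_natl mulVKf ?expRK// .
  by rewrite expRN.
rewrite npowcE /cexp/= mul0r expR0 !mul1r pE /real_complex_def !mulCE /kern expr0 !mulr1 add0r cos_pihalfD cosB cos_pihalf sin_pihalf.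
rewrite addNr !addr0; congr Complex; ring.
Qed.

Lemma Re_gauss (W : nat * 'I_2 -> R) N x :
  complex.Re (gauss_sum W N x) = \sum_(k < N) gauss_wave (fun k => W (k, ord0)) (fun k => W (k, ord_max)) 0 0 x k.
Proof.
rewrite /log_zeta_rand /gauss_sum Re_sum; apply: eq_bigr => k _; rewrite gauss_term//.
by rewrite (leq_trans _ (nth_prime_ge k)).
Qed.

Lemma Im_gauss (W : nat * 'I_2 -> R) N x :
  complex.Im (gauss_sum W N x) = \sum_(k < N) gauss_wave (fun k => W (k, ord0)) (fun k => W (k, ord_max)) 0 (- (pi / 2)) x k.
Proof.
rewrite /log_zeta_rand /gauss_sum Im_sum; apply: eq_bigr => k _; rewrite gauss_term//.
by rewrite (leq_trans _ (nth_prime_ge k)).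
Qed.

End complex_parts.

(** * Smoothness, norms and measurability of the error *)

Section smooth_errors.
Context {R : realType}.
Variables (h : nat) (A : R).
Hypotheses (h0 : (0 < h)%N) (A0 : 0 < A).
Local Notation a := (h + h)%N.
Local Notation S := (`[- A, A]%classic : set R).
Let a0 : (0 < a)%N := a_gt0 h0.

Definition zeta_err (th : nat -> R) (W : nat * 'I_2 -> R) (N : nat) (x : R) : R[i] :=
  log_zeta_rand th N x - gauss_sum W N x.

Definition wl (W : nat * 'I_2 -> R) (k : nat) : R := W (k, ord0).
Definition wr (W : nat * 'I_2 -> R) (k : nat) : R := W (k, ord_max).

Lemma Re_err th W N x : complex.Re (zeta_err th W N x) = err_sum th (wl W) (wr W) N 0 0 x.
Proof.
rewrite /zeta_err; have -> (u v : R[i]) : complex.Re (u - v) = complex.Re u - complex.Re v by case: u; case: v.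
by rewrite Re_log_zeta Re_gauss -sumrB.
Qed.

Lemma Im_err th W N x : complex.Im (zeta_err th W N x) = err_sum th (wl W) (wr W) N 0 (- (pi / 2)) x.
Proof.
rewrite /zeta_err; have -> (u v : R[i]) : complex.Im (u - v) = complex.Im u - complex.Im v by case: u; case: v.
by rewrite Im_log_zeta Im_gauss -sumrB.
Qed.

Lemma csmooth_quad (f : R -> R[i]) (g k : nat -> R -> R) :
  (forall y, complex.Re (f y) = g 0%N y) -> (forall y, complex.Im (f y) = k 0%N y) ->
  (forall n, exists C : R, forall x y, S x -> S y -> `|g n y - g n x - g n.+1 x * (y - x)| <= C * (y - x) ^+ 2) ->
  (forall n, exists C : R, forall x y, S x -> S y -> `|k n y - k n x - k n.+1 x * (y - x)| <= C * (y - x) ^+ 2) ->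
  csmooth_within S f /\ forall n x, S x -> cderive_within_n S n f x = Complex (g n x) (k n x).
Proof.
move=> /funext fg /funext fk /choice[C hC] /choice[D hD].
have [s1 d1] := quad_smooth A0 hC; have [s2 d2] := quad_smooth A0 hD.
rewrite /csmooth_within /cderive_within_n fg fk; split => // n x Sx.
by rewrite d1 ?d2 ?inE.
Qed.

Lemma S_le x : S x -> `|x| <= A.
Proof. by rewrite /= in_itv/= -ler_norml. Qed.

Lemma err_smooth th W N : csmooth_within S (zeta_err th W N) /\
  forall n x, S x -> cderive_within_n S n (zeta_err th W N) x =
    Complex (err_sum th (wl W) (wr W) N n (phase 0 n) x) (err_sum th (wl W) (wr W) N n (phase (- (pi / 2)) n) x).
Proof.
apply: csmooth_quad => [y|y|n|n]; [exact: Re_err|exact: Im_err| |].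
all: have [C C0 hC] := err_sum_quad h0 n A0; exists (C * (1 + xisum h th (wl W) (wr W) (blk a0 N).+1)) => x y /S_le xA /S_le yA.
all: exact: hC.
Qed.

Definition err_norm th W N (n : nat) (x : R) : R :=
  Num.sqrt (err_sum th (wl W) (wr W) N n (phase 0 n) x ^+ 2 + err_sum th (wl W) (wr W) N n (phase (- (pi / 2)) n) x ^+ 2).

Lemma err_sum_continuous th w1 w2 N l p : continuous (fun x => err_sum th w1 w2 N l p x : R).
Proof. by apply: derivable_continuous => x; have [] := err_sum_derive th w1 w2 N l p x. Qed.

Lemma err_norm_continuous th W N n : continuous (err_norm th W N n).
Proof.
move=> x; apply: continuous_comp; last exact: sqrt_continuous.
by apply: cvgD; apply: cvgM; exact: err_sum_continuous.
Qed.

Lemma C_norm_err th W N l : C_norm S l (zeta_err th W N) =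
  (\sum_(j < l.+1) ereal_sup (range (fun n => (err_norm th W N j (rpt A n))%:E)))%E.
Proof.
apply: eq_bigr => j _; apply: (Linfty_norm_sup A0 (@err_norm_continuous th W N j)).
  by move=> x; exact: sqrtr_ge0.
by move=> x Sx; have [_ ->] := err_smooth th W N.
Qed.

Lemma sqrt_sqrD_le (u v : R) : Num.sqrt (u ^+ 2 + v ^+ 2) <= `|u| + `|v|.
Proof.
rewrite -[leRHS]ger0_norm ?addr_ge0// -sqrtr_sqr ler_wsqrtr// sqrrD !real_normK ?num_real//.
by rewrite -addrA lerD2l lerDr mulrn_wge0// mulr_ge0.
Qed.

Lemma C_norm_err_le l : exists2 C : R, 0 <= C & forall th W N,
  (C_norm S l (zeta_err th W N) <= (C * (1 + xisum h th (wl W) (wr W) (blk a0 N).+1))%:E)%E.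
Proof.
have /choice[C hC] j : exists C : R, 0 <= C /\ forall (p x : R) (th w1 w2 : nat -> R) N, `|x| <= A ->
    `|err_sum th w1 w2 N j p x| <= C * (1 + xisum h th w1 w2 (blk a0 N).+1).
  by have [C C0 hC] := err_sum_le h0 j (ltW A0); exists C.
exists (\sum_(j < l.+1) (C j + C j)) => [|th W N].
  by apply: sumr_ge0 => j _; have [? _] := hC j; rewrite addr_ge0.
rewrite C_norm_err mulr_suml -sumEFin; apply: lee_sum => j _.
apply: ge_ereal_sup => _ [n _ <-]; rewrite lee_fin.
apply: le_trans (sqrt_sqrD_le _ _) _; have [_ hj] := hC j.
have rA := S_le (rptS A0 n).
by rewrite [leRHS]mulrDl; exact: (lerD (hj _ _ _ _ _ _ rA) (hj _ _ _ _ _ _ rA)).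
Qed.

(** An extended real, so that it is defined everywhere and measurable before being shown to be
    finite almost surely. *)
Definition Xi (th : nat -> R) (W : nat * 'I_2 -> R) : \bar R :=
  (\sum_(0 <= J <oo) (xi h th (wl W) (wr W) J)%:E)%E.

Lemma Xi_ge0 th W : (0 <= Xi th W)%E.
Proof. by apply: nneseries_ge0 => J _ _; rewrite lee_fin xi_ge0. Qed.

Lemma xisum_le_Xi th W m : ((xisum h th (wl W) (wr W) m)%:E <= Xi th W)%E.
Proof.
apply: le_trans (nneseries_lim_ge m _) => [|J _ _]; last by rewrite lee_fin xi_ge0.
by rewrite big_mkord sumEFin.
Qed.

Lemma C_norm_err_Xi l : exists2 C : R, 0 <= C & forall th W N,
  (C_norm S l (zeta_err th W N) <= C%:E * (1 + Xi th W))%E.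
Proof.
have [C C0 hC] := C_norm_err_le l; exists C => // th W N.
by apply: le_trans (hC th W N) _; rewrite EFinM EFinD lee_wpmul2l ?lee_fin// leeD2l// xisum_le_Xi.
Qed.

Lemma Xi_cvg th W : (Xi th W < +oo)%E -> cvgn (series (xi h th (wl W) (wr W))).
Proof.
move=> fin; apply: nondecreasing_is_cvgn.
  by apply: nondecreasing_series => n *; exact: xi_ge0.
exists (fine (Xi th W)) => _ [m _ <-].
rewrite -lee_fin fineK; last by rewrite ge0_fin_numE ?Xi_ge0.
by rewrite /series/= big_mkord; exact: xisum_le_Xi.
Qed.

Definition zeta_lim (th : nat -> R) (W : nat * 'I_2 -> R) (x : R) : R[i] :=
  Complex (err_lim th (wl W) (wr W) 0 0 x) (err_lim th (wl W) (wr W) 0 (- (pi / 2)) x).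

Lemma lim_smooth th W : (Xi th W < +oo)%E -> csmooth_within S (zeta_lim th W).
Proof.
move=> /Xi_cvg cx.
have [||//] := @csmooth_quad (zeta_lim th W) (fun n => err_lim th (wl W) (wr W) n (phase 0 n)) (fun n => err_lim th (wl W) (wr W) n (phase (- (pi / 2)) n)) (fun=> erefl) (fun=> erefl).
all: move=> n; have [C hC] := err_lim_quad h0 cx n A0; exists C => x y /S_le xA /S_le yA; exact: hC.
Qed.

Lemma uniform_of_bound (f : nat -> R -> R) (g : R -> R) (r : nat -> R) : r @ \oo --> 0 ->
  (forall N x, S x -> `|g x - f N x| <= r N) -> {uniform S, f @ \oo --> g}.
Proof.
move=> r0 fg P /uniform_nbhs[E [entE EP]].
have [e /= e0 eE] := entE.
have [N0 _ hN] : \forall N \near \oo, `|0 - r N| < e by move/cvgrPdist_lt : r0; apply.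
exists N0 => // N /= NN; apply: EP => y Sy; apply: eE => /=.
have := hN N NN; rewrite sub0r normrN => /(le_lt_trans (ler_norm _)); exact: le_lt_trans (fg N y Sy).
Qed.

Lemma err_uniform th W : (Xi th W < +oo)%E -> cuniform_cvg S (fun N => zeta_err th W N) (zeta_lim th W).
Proof.
move=> /Xi_cvg cx; have [r r0 hr] := err_sum_unif h0 cx 0 (ltW A0).
by split; apply: uniform_of_bound r0 _ => N x /S_le xA; rewrite ?Re_err ?Im_err; exact: hr.
Qed.

Lemma csmooth0 : csmooth_within S (fun=> (0 : R[i])).
Proof. by split; exact: smooth_within0. Qed.

Section measurability.
Context d (T : measurableType d) (th : nat -> T -> R) (W : nat * 'I_2 -> T -> R).
Hypothesis mth : forall k, measurable_fun [set: T] (th k).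
Hypothesis mW : forall k, measurable_fun [set: T] (W k).

Lemma measurable_kern c l u (f : T -> R) L : measurable_fun [set: T] f -> measurable_fun [set: T] (fun w => kern c l u (f w) L).
Proof.
move=> mf; rewrite /kern; apply: measurable_funM => //.
apply: measurableT_comp; last by apply: measurable_funD.
by apply: continuous_measurable_fun; exact: continuous_cos.
Qed.

Lemma measurable_zeta_wave l p x k : measurable_fun [set: T] (fun w => zeta_wave (th ^~ w) l p x k).
Proof.
apply: (@measurable_fun_cvg _ _ _ _ (fun n w => series (fun j => zeta_harm (th ^~ w) j l p x k) n)) => [n|w _]; last exact: zeta_harm_cvg.
rewrite /series/=; apply: measurable_sum => j; apply: measurable_funM => //.
by apply: measurable_kern; apply: measurable_funD => //; exact: measurable_funM.
Qed.

Lemma measurable_err_sum N l p x : measurable_fun [set: T] (fun w => err_sum (th ^~ w) (wl (W ^~ w)) (wr (W ^~ w)) N l p x).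
Proof.
apply: measurable_sum => k; apply: measurable_funB; first exact: measurable_zeta_wave.
by apply: measurable_funD; apply: measurable_funM => //; apply: measurable_funM => //; exact: mW.
Qed.

Lemma measurable_C_norm N l : measurable_fun [set: T] (fun w => C_norm S l (zeta_err (th ^~ w) (W ^~ w) N)).
Proof.
have -> : (fun w => C_norm S l (zeta_err (th ^~ w) (W ^~ w) N)) =
    (fun w => \sum_(j < l.+1) esups (fun n => (err_norm (th ^~ w) (W ^~ w) N j (rpt A n))%:E) 0%N)%E.
  apply/funext => w; rewrite C_norm_err; apply: eq_bigr => j _.
  by congr ereal_sup; apply/seteqP; split => y [n _ <-]; exists n.
apply: emeasurable_sum => j; apply: measurable_fun_esups => n.
apply/measurable_EFinP; apply: measurableT_comp; first by apply: continuous_measurable_fun; exact: sqrt_continuous.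
by apply: measurable_funD; apply: measurable_funX; exact: measurable_err_sum.
Qed.

Lemma measurable_sup_norm l : measurable_fun [set: T] (fun w =>
  ereal_sup [set C_norm S l (zeta_err (th ^~ w) (W ^~ w) N) | N in [set N | (1 <= N)%N]]).
Proof. exact: (measurable_fun_esups (fun N => measurable_C_norm N l) 1%N). Qed.

Lemma measurable_err_lim l p x (B : set T) : measurable B ->
  (forall w, B w -> (Xi (th ^~ w) (W ^~ w) < +oo)%E) ->
  measurable_fun B (fun w => err_lim (th ^~ w) (wl (W ^~ w)) (wr (W ^~ w)) l p x).
Proof.
move=> mB hB; apply: (@measurable_fun_cvg _ _ _ _ (fun N w => err_sum (th ^~ w) (wl (W ^~ w)) (wr (W ^~ w)) N l p x)) => [n|w Bw].
  by apply: measurable_funTS; exact: measurable_err_sum.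
exact: (err_sum_cvg h0 (Xi_cvg (hB w Bw))).
Qed.

End measurability.

End smooth_errors.

(** * Moments and joint law *)

Section xi_moments.
Context {R : realType}.
Variable h : nat.
(** With this value the bound (J+1)^(2h) on the size of block J makes 1/rho at most (2 J)^2; as an
    equation it is invoked only where the number matters. *)
Hypothesis h64 : h = 64%N.
Local Notation mR := (measurableTypeR R).
Local Notation U01 := (@U01 R).
Local Notation a := (h + h)%N.
Let h0 : (0 < h)%N. Proof. by rewrite h64. Qed.
Let a0 : (0 < a)%N := a_gt0 h0.

(** The block lies in an interval of length (J+1)^a - J^a, a difference of powers bounded by a (2
    J)^(a-1). *)
Lemma bsize_growth : exists2 c : R, 1 <= c & forall J, (0 < J)%N -> (bsize a J)%:R <= c * J%:R ^+ a.-1.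
Proof.
exists (a%:R * 2 ^+ a.-1) => [|J J0].
  by rewrite -natrX -natrM ler1n muln_gt0 a0 expn_gt0.
have J1 : 1 <= J%:R :> R by rewrite ler1n.
apply: (@le_trans _ _ (J.+1%:R ^+ a - J%:R ^+ a)).
  rewrite -!natrX -natrB ?leq_exp2r// ler_nat; exact: bsize_le.
rewrite subrXX -natr1 addrAC subrr add0r mul1r.
apply: (@le_trans _ _ (\sum_(i < a) (2 * J%:R) ^+ a.-1)); last first.
  by rewrite sumr_const card_ord -[_ *+ a]mulr_natl exprMn mulrA.
apply: ler_sum => i _; have ia : (a.-1 = (a.-1 - i) + i)%N by have := ltn_ord i; lia.
rewrite [in leRHS]ia exprD; apply: ler_pM; rewrite ?exprn_ge0//.
  by rewrite lerXn2r ?nnegrE ?addr_ge0// ?mulr_ge0//; lra.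
by rewrite lerXn2r ?nnegrE// ?mulr_ge0//; lra.
Qed.

Lemma polyexp_le (M : nat) : exists2 C : R, 0 <= C & forall y : R, 0 <= y -> y ^+ M * expR (- y) <= C.
Proof.
exists M`!%:R => // y y0.
rewrite expRN ler_pdivrMr ?expR_gt0// mulrC -ler_pdivrMr ?ltr0n ?fact_gt0//.
case: M => [|M]; first by apply: le_trans (expR_ge1Dx _); rewrite expr0 fact0; lra.
by apply: le_trans (expR_ge1Dxn M y0); rewrite lerDr.
Qed.

Lemma rho_inv_le J : (0 < J)%N -> (0 < bsize a J)%N -> (rho_ (bsize a J))^-1 <= 4 * J%:R ^+ 2 :> R.
Proof.
move=> J0 n0; have r0 : 0 < rho_ (bsize a J) :> R by exact: rho_gt0.
have J1 : 1 <= J%:R :> R by rewrite ler1n.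
have q0 : 0 <= 4 * J%:R ^+ 2 :> R by rewrite mulr_ge0// sqr_ge0.
rewrite -(ler_pXn2r (ltn0Sn 63)) ?nnegrE ?invr_ge0 ?(ltW r0)//.
rewrite exprVn rhoX// invrK.
apply: (@le_trans _ _ (J.+1%:R ^+ a)).
  by rewrite -natrX ler_nat; apply: leq_trans (bsize_le _ _) (leq_subr _ _).
have -> : 4 * J%:R ^+ 2 = (2 * J%:R) ^+ 2 :> R by rewrite exprMn; congr (_ * _); rewrite expr2; ring.
rewrite -exprM (_ : (2 * 64)%N = a); last by rewrite h64.
by rewrite lerXn2r ?nnegrE ?mulr_ge0//; rewrite -natr1; lra.
Qed.

Definition xiw (J : nat) (w : R) : R :=
  Num.max 0 (tauJ h J * bmax (bsize a J) (block_theta w) (block_w1 (bsize a J) w) (block_w2 (bsize a J) w) - 1)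
  + bet h J * bdiff (bsize a J) (block_theta w) (block_w1 (bsize a J) w) (block_w2 (bsize a J) w).

Lemma xiw_ge0 J w : 0 <= xiw J w.
Proof.
apply: addr_ge0; first by rewrite le_max lexx.
by rewrite mulr_ge0 ?bet_ge0 ?addr_ge0.
Qed.

Lemma measurable_xiw_gen J (b : R) : measurable_fun [set: mR] (fun w : mR =>
  Num.max 0 (tauJ h J * bmax (bsize a J) (block_theta w) (block_w1 (bsize a J) w) (block_w2 (bsize a J) w) - 1)
  + b * bdiff (bsize a J) (block_theta w) (block_w1 (bsize a J) w) (block_w2 (bsize a J) w)).
Proof.
apply: measurable_funD; last by apply: measurable_funM => //; exact: measurable_block_bdiff.
apply: measurable_maxr => //; apply: measurable_funB => //; apply: measurable_funM => //; exact: measurable_block_bmax.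
Qed.

Lemma measurable_xiw J : measurable_fun [set: mR] (xiw J).
Proof. exact: measurable_xiw_gen. Qed.

Lemma xiw0 w : xiw 0 w = 0.
Proof.
by rewrite /xiw /tauJ /bet /yy mulr0n !sqrtr0 !mul0r addr0; apply/max_idPl; rewrite sub0r oppr_le0.
Qed.

Lemma yy2_le J : (0 < J)%N -> yy J ^+ 2 <= J%:R :> R.
Proof. by move=> J0; rewrite -yyX ler_weXn2l ?yy_ge1. Qed.

(** The free parameter of [block_exp] is t = yy J + 2 l c: then (t tau)^2 n stays bounded because
    (yy J)^6 <= J, while e^(-yy J) beats the polynomial size of the block. For the coupling, sqrt n
    rho = rho^-31 <= (4 J^2)^31, and yy J / J^64 times J^62 is at most J^(-9/8) because (yy J)^2 <=
    J. *)
Lemma xiw_exp (l : R) : 0 <= l -> exists2 K : R, 0 <= K &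
  forall J, (\int[U01]_w (expR (l * xiw J w))%:E <= (1 + K * vv J)%:E)%E.
Proof.
move=> l0; have [c c1 hc] := bsize_growth; have c0 : 0 < c by lra.
have lc0 : 0 <= l * c by rewrite mulr_ge0// ltW.
have [K K0 hK] := @block_exp R (l * c) lc0.
(* The exponent 8 a + 1 turns (yy J)^(8a+1) into J^a yy J, the block scale J^(a-1) divided by
   [vv J]. *)
have [M M0 hM] := polyexp_le (8 * a).+1.
pose C1 := (1 + 2 * (l * c)) ^+ 2 * c.
pose K4 : R := 4 ^+ 31; have K40 : 0 <= K4 by rewrite exprn_ge0.
pose K' := 20 * (2 * c) * expR (2 * C1) * M + K * K4.
have K'0 : 0 <= K' by rewrite addr_ge0 ?mulr_ge0 ?expR_ge0// ltW.
exists K' => // J.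
have [J0|J0] := posnP J.
  rewrite J0 vv0 mulr0 addr0; under eq_integral do rewrite xiw0 mulr0 expR0.
  by rewrite integral_cst_prob.
set n := bsize a J; set y : R := yy J; set x : R := J%:R; set X := x ^+ h.
have y1 : 1 <= y by exact: yy_ge1.
have y0 : 0 < y by lra.
have x1 : 1 <= x by rewrite ler1n.
have x0 : 0 < x by lra.
have X0 : 0 < X by rewrite exprn_gt0.
have nZ : n%:R <= c * x ^+ a.-1 := hc J J0.
set Z := x ^+ a.-1 in nZ; have Z1 : 1 <= Z by rewrite exprn_ege1.
have XZ : X ^+ 2 = x * Z by rewrite -exprM -exprS prednK// mulnC mul2n -addnn.
have yx : y ^+ 2 <= x := yy2_le J0.
have y6 : y ^+ 6 <= x by rewrite /x -yyX ler_weXn2l.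
have betE : bet h J = y / X by [].
have c1inv : 0 <= c^-1 by rewrite invr_ge0 ltW.
(* Dividing by [c] ensures b sqrt n <= 1; the exponent l c in place of l compensates. *)
pose b := c^-1 * bet h J; have b0 : 0 <= b by rewrite mulr_ge0 ?bet_ge0.
pose t := y + 2 * (l * c).
have ht : 2 * (l * c) <= t by rewrite /t lerDr ltW.
have t_le : t <= (1 + 2 * (l * c)) * y by rewrite /t; nra.
have t0 : 0 <= t by apply: le_trans ht; rewrite mulr_ge0.
have bn : b ^+ 2 * n%:R <= 1.
  apply: (@le_trans _ _ (b ^+ 2 * (c * Z))); first by rewrite ler_wpM2l ?sqr_ge0.
  rewrite /b betE [c^-1 * _]mulrA expr_div_n XZ.
  rewrite (_ : (c^-1 * y) ^+ 2 / (x * Z) * (c * Z) = (y ^+ 2 / x) * c^-1); last first.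
    by field; rewrite !gt_eqF//; lra.
  by rewrite mulr_ile1 ?invf_le1 ?ler_pdivrMr ?mul1r// divr_ge0 ?sqr_ge0// ltW.
have bsn : b * Num.sqrt n%:R <= 1.
  rewrite -[b]ger0_norm// -sqrtr_sqr -sqrtrM ?sqr_ge0// -[leRHS]sqrtr1.
  by rewrite ler_wsqrtr.
apply: (@le_trans _ _ (\int[U01]_w (expR ((l * c) * (Num.max 0 (tauJ h J * bmax n (block_theta w) (block_w1 n w) (block_w2 n w) - 1)
      + b * bdiff n (block_theta w) (block_w1 n w) (block_w2 n w))))%:E)%E).
  apply: ge0_le_integral => //.
  - exact: (measurable_expM l (measurable_xiw J)).
  - exact: (measurable_expM (l * c) (measurable_xiw_gen J b)).
  - move=> w _; rewrite lee_fin ler_expR /xiw -/n /b.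
    set m := Num.max _ _; have m0 : 0 <= m by rewrite le_max lexx.
    set B := bdiff _ _ _ _; have cn : c != 0 by rewrite gt_eqF.
    have -> : l * c * (m + c^-1 * bet h J * B) = l * c * m + l * (bet h J * B) by field.
    by rewrite mulrDr lerD2r ler_wpM2r// ler_peMr.
apply: le_trans (hK n (tauJ h J) b t b0 ht (tauJ_ge0 h J) bsn) _.
rewrite lee_fin lerD2l /K' [leRHS]mulrDl; apply: lerD.
  have e1 : (t * tauJ h J) ^+ 2 * n%:R <= C1.
    have tau0 := tauJ_ge0 h J : (0 : R) <= _.
    apply: (@le_trans _ _ (((1 + 2 * (l * c)) * y * tauJ h J) ^+ 2 * (c * Z))).
      apply: ler_pM => //; first by rewrite sqr_ge0.
      have q0 := le_trans t0 t_le; have q1 := mulr_ge0 t0 tau0; have q2 := mulr_ge0 q0 tau0.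
      by rewrite lerXn2r ?nnegrE// ler_wpM2r.
    have -> : ((1 + 2 * (l * c)) * y * tauJ h J) ^+ 2 = (1 + 2 * (l * c)) ^+ 2 * y ^+ 6 / X ^+ 2.
      by rewrite /tauJ betE -/y; field; rewrite gt_eqF.
    rewrite XZ (_ : (1 + 2 * (l * c)) ^+ 2 * y ^+ 6 / (x * Z) * (c * Z) = C1 * (y ^+ 6 / x)); last first.
      by rewrite /C1; field; rewrite !gt_eqF//; lra.
    rewrite ler_piMr//; last by rewrite ler_pdivrMr// mul1r.
    by rewrite mulr_ge0 ?sqr_ge0// ltW.
  have e2 : expR (2 * (t * tauJ h J) ^+ 2 * n%:R - t) <= expR (2 * C1) * expR (- y).
    rewrite -expRD ler_expR -mulrA; apply: lerD; first by rewrite ler_wpM2l.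
    by rewrite lerN2 /t lerDl mulr_ge0.
  have n1 : n.+1%:R <= 2 * c * Z by rewrite -natr1; nra.
  have e3 : Z * expR (- y) <= M * vv J.
    have xy0 : 0 < x * y by rewrite mulr_gt0.
    rewrite /vv -/x -/y ler_pdivlMr//; apply: le_trans (hM y (ltW y0)).
    rewrite exprSr exprM -[y ^+ 8]/(yy J ^+ 8) yyX -/x.
    have -> : x ^+ a = Z * x by rewrite -exprSr prednK.
    by apply: eq_ler; ring.
  apply: (@le_trans _ _ (20 * (2 * c * Z) * (expR (2 * C1) * expR (- y)))).
    by apply: ler_pM; rewrite ?mulr_ge0 ?expR_ge0// ler_wpM2l.
  have -> : 20 * (2 * c * Z) * (expR (2 * C1) * expR (- y)) = 20 * (2 * c) * expR (2 * C1) * (Z * expR (- y)) by ring.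
  have q0 : 0 <= 20 * (2 * c) * expR (2 * C1) by rewrite mulr_ge0 ?expR_ge0//; lra.
  by rewrite -[leRHS]mulrA ler_wpM2l.
have [n0|n0] := posnP n.
  by rewrite n0 sqrtr0 !(mulr0, mul0r) mulr_ge0 ?vv_ge0// mulr_ge0.
rewrite -[leRHS]mulrA; apply: ler_wpM2l => //.
have r0 : 0 < rho_ n :> R by exact: rho_gt0.
have ri0 : 0 <= (rho_ n)^-1 :> R by rewrite invr_ge0 ltW.
have sE : Num.sqrt n%:R * rho_ n = (rho_ n)^-1 ^+ 31 :> R.
  have -> : n%:R = ((rho_ n)^-1 ^+ 32) ^+ 2 :> R by rewrite -exprM exprVn rhoX// invrK.
  rewrite sqrtr_sqr ger0_norm ?exprn_ge0// exprSr -mulrA mulVf ?mulr1// gt_eqF//.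
rewrite -mulrA sE; apply: (@le_trans _ _ (y / X * (4 * x ^+ 2) ^+ 31)).
  apply: ler_pM => //; first by rewrite exprn_ge0.
    by rewrite /b betE ler_piMl ?invf_le1// divr_ge0// ltW.
  by rewrite lerXn2r ?nnegrE ?rho_inv_le// mulr_ge0 ?sqr_ge0.
have XE : X = x ^+ 62 * x ^+ 2 by rewrite /X h64 -exprD.
rewrite XE exprMn -/K4 -exprM /vv -/x -/y.
have E0 : 0 < x ^+ 62 by rewrite exprn_gt0.
move: (x ^+ 62) E0 => E E0.
rewrite (_ : y / (E * x ^+ 2) * (K4 * E) = K4 * (y / x ^+ 2)); last first.
  by field; rewrite !gt_eqF.
rewrite ler_wpM2l// ler_pdivrMr ?exprn_gt0// mulrC ler_pdivlMr ?mulr_gt0//.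
have -> : y * (x * y) = x * y ^+ 2 by ring.
by rewrite [leRHS]expr2 ler_wpM2l// ltW.
Qed.

Lemma bmax_congr n (th th' w1 w1' w2 w2' : nat -> R) :
  (forall i, (i < n)%N -> [/\ th i = th' i, w1 i = w1' i & w2 i = w2' i]) -> bmax n th w1 w2 = bmax n th' w1' w2'.
Proof.
move=> e; rewrite /bmax; apply: eq_bigr => s _; apply: eq_bigr => m _; congr `|_|; apply: eq_bigr => i _.
have [] := e i; first by have := ltn_ord m; have := ltn_ord i; lia.
by move=> e1 e2 e3; case: (s : nat) => [|[|[|[|[|?]]]]] /=; rewrite ?e1 ?e2 ?e3.
Qed.

Lemma bdiff_congr n (th th' w1 w1' w2 w2' : nat -> R) :
  (forall i, (i < n)%N -> [/\ th i = th' i, w1 i = w1' i & w2 i = w2' i]) -> bdiff n th w1 w2 = bdiff n th' w1' w2'.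
Proof.
move=> e; rewrite /bdiff (eq_bigr (fun i : 'I_n => ecos (th' i) - w1' i / Num.sqrt 2)); last first.
  by move=> i _; have [|-> -> _] := e i.
rewrite [X in _ + `|X|](eq_bigr (fun i : 'I_n => esin (th' i) - w2' i / Num.sqrt 2))//.
by move=> i _; have [|-> _ ->] := e i.
Qed.

(** Block J reads the J-th draw of the global source, so that different blocks are independent;
    inside it a prime is located by its offset. *)
Definition prime_theta (k : nat) (w : R) : R := block_theta (useq (blk a0 k) w) (k - bstart a (blk a0 k))%N.
Definition prime_gauss (kj : nat * 'I_2) (w : R) : R :=
  let J := blk a0 kj.1 in
  (if kj.2 == ord0 then block_w1 else block_w2) (bsize a J) (useq J w) (kj.1 - bstart a J)%N.

Lemma xi_xiw w J : xi h (prime_theta ^~ w) (wl (prime_gauss ^~ w)) (wr (prime_gauss ^~ w)) J = xiw J (useq J w).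
Proof.
have e i : (i < bsize a J)%N -> [/\ prime_theta (bstart a J + i) w = block_theta (useq J w) i,
    wl (prime_gauss ^~ w) (bstart a J + i) = block_w1 (bsize a J) (useq J w) i &
    wr (prime_gauss ^~ w) (bstart a J + i) = block_w2 (bsize a J) (useq J w) i].
  by move=> ib; rewrite /prime_theta /wl /wr /prime_gauss/= blk_bstart// addKn.
by rewrite /xi /xiw /bM /bB (bmax_congr e) (bdiff_congr e).
Qed.

Lemma measurable_prime_theta k : measurable_fun [set: mR] (prime_theta k).
Proof. exact: (measurable_comp1 (measurable_block_theta _) (measurable_useq _ (@measurable_id _ mR setT))). Qed.

Lemma measurable_prime_gauss kj : measurable_fun [set: mR] (prime_gauss kj).
Proof.
rewrite /prime_gauss; case: ifP => _.
  exact: (measurable_comp1 (measurable_block_w1 _ _) (measurable_useq _ (@measurable_id _ mR setT))).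
exact: (measurable_comp1 (measurable_block_w2 _ _) (measurable_useq _ (@measurable_id _ mR setT))).
Qed.

Local Notation Xiw w := (Xi h (prime_theta ^~ w) (prime_gauss ^~ w)).

Lemma measurable_Xi : measurable_fun [set: mR] (fun w => Xiw w).
Proof.
rewrite /Xi; under eq_fun do under eq_eseriesr do rewrite xi_xiw.
apply: ge0_emeasurable_sum => [k w _ _|k _]; first by rewrite lee_fin xiw_ge0.
by apply/measurable_EFinP; apply: (measurable_comp1 (measurable_xiw k)); exact: measurable_useq.
Qed.

(** Independence multiplies the bounds of the blocks, and the product of the 1 + K vv(J) is at most
    e^(9 K), whatever the number of blocks. *)
Lemma expR_partial_sum (l : R) : 0 <= l -> exists C : R, forall m,
  (\int[U01]_w (expR (l * \sum_(J < m) xiw J (useq J w)))%:E <= C%:E)%E.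
Proof.
move=> l0; have [K K0 hK] := xiw_exp l0; exists (expR (K * 9)) => m.
have mf k : measurable_fun [set: mR] (fun z => (expR (l * xiw k z))%:E).
  exact: (measurable_expM l (measurable_xiw k)).
have f0 k z : (0 <= (expR (l * xiw k z))%:E)%E by rewrite lee_fin expR_ge0.
have -> : (\int[U01]_w (expR (l * \sum_(J < m) xiw J (useq J w)))%:E =
    eprod m (fun k => \int[U01]_x (expR (l * xiw k x))%:E))%E.
  rewrite -useq_prod1//; apply: eq_integral => w _.
  by elim: m => [|m IH] /=; rewrite ?big_ord0 ?mulr0 ?expR0// big_ord_recr/= mulrDr expRD EFinM muleC IH.
apply: (@le_trans _ _ (eprod m (fun k => (1 + K * vv k)%:E))).
  by apply: eprod_le => k //; exact: integral_ge0.
apply: (@le_trans _ _ (expR (K * \sum_(k < m) vv k))%:E); last first.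
  by rewrite lee_fin ler_expR ler_wpM2l// sum_vv.
elim: m => [|m IH] /=; first by rewrite big_ord0 mulr0 expR0.
rewrite big_ord_recr/= mulrDr expRD EFinM muleC; apply: lee_pmul => //.
- by apply: eprod_ge0 => k; rewrite lee_fin addr_ge0// mulr_ge0 ?vv_ge0.
- by rewrite lee_fin addr_ge0// mulr_ge0 ?vv_ge0.
- by rewrite lee_fin expR_ge1Dx.
Qed.

Lemma measurable_expeR d (T : measurableType d) (f : T -> \bar R) : measurable_fun [set: T] f ->
  measurable_fun [set: T] (fun w => expeR (f w)).
Proof.
move=> mf mD; apply: (measurability _ (ErealGenCInfty.measurableE R)) => //.
move=> _ [_ [x ->] <-]; have [x0|x0] := leP x 0.
  rewrite [X in measurable X](_ : _ = setT); first exact: measurableT.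
  apply/seteqP; split => // t _; split => //=; rewrite in_itv/= andbT.
  by apply: le_trans (expeR_ge0 _); rewrite lee_fin.
rewrite [X in measurable X](_ : _ = [set: T] `&` f @^-1` `[(ln x)%:E, +oo[%classic); first exact/mf/emeasurable_itv.
congr (_ `&` _); apply/funext => t /=; rewrite !in_itv/= !andbT.
by rewrite -[x in LHS]lnK ?posrE// -[(expR _)%:E]/(expeR (ln x)%:E) lee_expeR.
Qed.

(** Monotone convergence in the number of blocks. That the limit of the exponentials dominates the
    exponential of the limit is read through the extended logarithm, since [Xi] may be infinite. *)
Lemma Xi_exp (l : R) : 0 < l -> (\int[U01]_w expeR (l%:E * Xiw w) < +oo)%E.
Proof.
move=> l0; have [C hC] := expR_partial_sum (ltW l0).
pose g m (w : mR) : \bar R := (expR (l * \sum_(J < m) xiw J (useq J w)))%:E.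
have mg m : measurable_fun [set: mR] (g m).
  apply: measurable_expM; apply: measurable_sum => J.
  by apply: (measurable_comp1 (measurable_xiw J)); exact: measurable_useq.
have g0 m w : (0 <= g m w)%E by rewrite lee_fin expR_ge0.
have ndg w : {homo g ^~ w : n m / (n <= m)%N >-> (n <= m)%E}.
  move=> n m nm; rewrite lee_fin ler_expR ler_wpM2l ?(ltW l0)//.
  by rewrite -(subnKC nm) big_split_ord/= lerDl sumr_ge0// => i _; exact: xiw_ge0.
apply: (@le_lt_trans _ _ C%:E); last exact: ltry.
apply: (@le_trans _ _ (\int[U01]_w limn (g ^~ w))%E); last first.
  rewrite monotone_convergence//; apply: lime_le; last by apply: nearW => m; exact: hC.
  apply: ereal_nondecreasing_is_cvgn => n m nm; apply: ge0_le_integral => // w _; exact: ndg.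
apply: ge0_le_integral => //.
- by move=> w _; exact: expeR_ge0.
- by apply: measurable_expeR; apply: measurable_funeM; exact: measurable_Xi.
- apply: (@emeasurable_fun_cvg _ _ _ _ g) => // w _.
  by apply: ereal_nondecreasing_is_cvgn; exact: ndg.
move=> w _; set L := limn _.
have gL m : (g m w <= L)%E.
  rewrite /L (cvg_lim _ (ereal_nondecreasing_cvgn (ndg w)))//.
  by apply: ereal_sup_ubound; exists m.
have L0 : (0 <= L)%E by apply: le_trans (gL 0%N); exact: g0.
rewrite -[leRHS]lneK; last by rewrite in_itv/= L0 leey.
rewrite lee_expeR muleC -lee_pdivlMr//.
rewrite /Xi; apply: lime_le; first by apply: is_cvg_nneseries => J _ _; rewrite lee_fin xi_ge0.
apply: nearW => m; rewrite lee_pdivlMr// big_mkord sumEFin -EFinM -lee_expeR lneK; last by rewrite in_itv/= L0 leey.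
rewrite /=; apply: le_trans (gL m); rewrite lee_fin mulrC.
by under eq_bigr do rewrite xi_xiw.
Qed.

Lemma Xi_ae_fin : \forall w \ae U01, (Xiw w < +oo)%E.
Proof.
have l1 := @Xi_exp 1 ltr01.
have int : U01.-integrable setT (fun w => expeR (1%:E * Xiw w)).
  apply/integrableP; split; first by apply: measurable_expeR; apply: measurable_funeM; exact: measurable_Xi.
  by under eq_integral do rewrite gee0_abs ?expeR_ge0//.
have := integrable_ae measurableT int; apply: filterS => w /(_ I).
rewrite mul1e; by case: (Xi _ _ _) => //= r _; exact: ltry.
Qed.

End xi_moments.

(** * Independence from product formulas *)

Section independence.
Context {R : realType}.
Local Notation mR := (measurableTypeR R).
Local Notation U01 := (@U01 R).
Local Notation gam := (@gam R).

Definition mkRV (f : mR -> R) (mf : measurable_fun [set: mR] f) : {RV U01 >-> R} := mfun_Sub (mem_set mf).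

Lemma mkRVE f mf w : @mkRV f mf w = f w.
Proof. by []. Qed.

Lemma prod_sub_seq (I : eqType) (r s : seq I) (g : I -> \bar R) : uniq r -> uniq s -> {subset s <= r} ->
  (\prod_(i <- r) (if i \in s then g i else 1) = \prod_(i <- s) g i)%E.
Proof.
move=> ur us sr; rewrite -big_mkcond -big_filter; apply: perm_big; apply: uniq_perm => //.
  by rewrite filter_uniq.
by move=> i; rewrite mem_filter; case: (boolP (i \in s)) => // /sr ->.
Qed.

Lemma measurable_indic_comp (B : set R) : measurable B -> measurable_fun [set: mR] (fun y : mR => (\1_B y)%:E : \bar R).
Proof. by move=> mB; apply/measurable_EFinP; exact: measurable_indic. Qed.

Lemma measurable_comp2 d (T : measurableType d) (F : mR -> mR -> \bar R) (f g : T -> R) :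
  measurable_fun [set: (mR * mR)%type] (fun z : mR * mR => F z.1 z.2) ->
  measurable_fun [set: T] (f : T -> mR) -> measurable_fun [set: T] (g : T -> mR) ->
  measurable_fun [set: T] (fun t => F (f t) (g t)).
Proof.
move=> mF mf mg.
exact: (measurableT_comp mF (measurable_fun_pair mf mg)).
Qed.

Lemma indep_of_prod (I : choiceType) (X : I -> {RV U01 >-> R}) (law : probability mR R) :
  (forall s : seq I, exists r : seq I, [/\ uniq r, {subset s <= r} &
     forall q : I -> mR -> \bar R, (forall i, measurable_fun setT (q i)) -> (forall i z, 0 <= q i z)%E ->
     (\int[U01]_w \prod_(i <- r) q i (X i w) = \prod_(i <- r) \int[law]_x q i x)%E]) ->
  mutually_independent X /\ forall i, has_law (X i) law.
Proof.
move=> hr.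
have key (s : seq I) (B : I -> set R) : uniq s -> (forall i, i \in s -> measurable (B i)) ->
    (U01 (\bigcap_(i in [set` s]) (X i @^-1` B i)) = \prod_(i <- s) law (B i))%E.
  move=> us mB; have [r [ur sr h]] := hr s.
  pose q i (y : mR) : \bar R := if i \in s then (\1_(B i) y)%:E else 1%E.
  have mq i : measurable_fun setT (q i).
    rewrite /q; have [si|_] := boolP (i \in s); last exact: measurable_cst.
    exact: measurable_indic_comp (mB i si).
  have q0 i z : (0 <= q i z)%E by rewrite /q; case: ifP => _; rewrite ?lee01// lee_fin.
  have mI : measurable (\bigcap_(i in [set` s]) (X i @^-1` B i)).
    apply: fin_bigcap_measurable => [|i si]; first exact: finite_seq.
    by rewrite -[X in measurable X]setTI; apply: measurable_funPT => //; exact: mB.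
  transitivity (\int[U01]_w \prod_(i <- r) q i (X i w))%E.
    transitivity (\int[U01]_w (\1_(\bigcap_(i in [set` s]) (X i @^-1` B i)) w)%:E)%E.
      by rewrite integral_indic// setIT.
    apply: eq_integral => w _; rewrite prod_sub_seq//.
    rewrite indicE; case: (boolP (w \in _)) => [/set_mem wI|wI].
      rewrite big_seq big1// => i si; rewrite indicE mem_set//; exact: wI.
    have [i si Bi] : exists2 i, i \in s & ~ B i (X i w).
      apply: contrapT => hn; move/negP: wI; apply; apply/mem_set => i /= si.
      by apply: contrapT => Bi; apply: hn; exists i.
    by rewrite (big_rem i)//= indicE memNset// mul0e.
  rewrite h//; transitivity (\prod_(i <- r) (if i \in s then law (B i) else 1))%E; last exact: prod_sub_seq.
  apply: eq_bigr => i _; rewrite /q; have [si|_] := boolP (i \in s).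
    by rewrite integral_indic ?setIT//; exact: mB.
  exact: integral_cst_prob.
have law1 i B : measurable B -> (U01 (X i @^-1` B) = law B)%E.
  move=> mB; have := @key [:: i] (fun=> B) isT (fun _ _ => mB); rewrite big_seq1 => <-.
  congr (U01 _); apply/seteqP; split=> [w Bw j /=|w Bw]; first by rewrite inE => /eqP ->.
  by apply: (Bw i); rewrite /= mem_head.
split=> [s B us mB|i B mB]; last exact: law1.
rewrite key// big_seq [RHS]big_seq; apply: eq_bigr => i si; rewrite law1//; exact: mB.
Qed.

End independence.

(** * The angles and the Gaussians are i.i.d *)

Section process_laws.
Context {R : realType}.
Variable h : nat.
Hypothesis h64 : h = 64%N.
Local Notation mR := (measurableTypeR R).
Local Notation U01 := (@U01 R).
Local Notation gam := (@gam R).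
Local Notation plane := (mR * mR)%type.
Local Notation a := (h + h)%N.
Let h0 : (0 < h)%N. Proof. by rewrite h64. Qed.
Let a0 : (0 < a)%N := a_gt0 h0.

Lemma eprod_blocks (F : nat -> \bar R) J :
  eprod (bstart a J) F = eprod J (fun j => eprod (bsize a j) (fun i => F (bstart a j + i)%N)).
Proof.
elim: J => [|J IH] /=; first by rewrite bstart0.
rewrite -IH !eprodE -(big_mkord xpredT F) (big_cat_nat (n := bstart a J))//=; last exact: bstart_mono.
rewrite muleC !big_mkord; congr (_ * _)%E; rewrite -{1}[bstart a J]add0n big_addn big_mkord.
by apply: eq_bigr => i _; rewrite addnC.
Qed.

Lemma gfun_cst m (c : nat -> R) (p : nat -> mR -> \bar R) s : (forall k, measurable_fun setT (p k)) -> (forall k z, 0 <= p k z)%E ->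
  gfun m c p (cst 1%E) s = eprod m (fun k => \int[gam]_x p k x)%E.
Proof.
move=> mp p0; elim: m s => [//|m IH] s /=.
under eq_integral do rewrite IH.
by rewrite ge0_integralZr//; apply: eprod_ge0 => k; exact: integral_ge0.
Qed.

Lemma wsplit_prod n (p : nat -> mR -> \bar R) : (forall k, measurable_fun setT (p k)) -> (forall k z, 0 <= p k z)%E ->
  (\int[gam]_x \int[U01]_r eprod n (fun k => p k (wsplit n x r k)) = eprod n (fun k => \int[gam]_x p k x))%E.
Proof.
move=> mp p0; rewrite -(@gfun_cst n (fun=> 0) p 0 mp p0) -(@wsplit_law R n (fun=> 0) p (cst 1%E) 0 mp (measurable_cst _) p0 (fun=> lee01)).
by apply: eq_integral => x _; apply: eq_integral => r _; rewrite mule1.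
Qed.

Lemma block_theta_prod n (p : nat -> mR -> \bar R) : (forall k, measurable_fun setT (p k)) -> (forall k z, 0 <= p k z)%E ->
  (\int[U01]_w eprod n (fun k => p k (block_theta w k)) = eprod n (fun k => \int[U01]_x p k x))%E.
Proof.
move=> mp p0; rewrite -(useq_prod1 n mp p0) /block_theta.
apply: (@useq_integral R 0 (fun z => eprod n (fun k => p k (useq k z)))) => [|z]; last exact: eprod_ge0.
by apply: measurable_eprod => k; apply: (measurableT_comp (mp k)); exact: measurable_useq.
Qed.

(** The two splittings read disjoint parts of the source, and the Gaussian pair that they split has
    independent coordinates. *)
Lemma block_gauss_split n (F G : mR -> mR -> \bar R) :
  measurable_fun [set: plane] (fun z : plane => F z.1 z.2) -> measurable_fun [set: plane] (fun z : plane => G z.1 z.2) ->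
  (forall x r, 0 <= F x r)%E -> (forall x r, 0 <= G x r)%E ->
  (\int[U01]_w (F (block_g1 n w) (useq 3 w) * G (block_g2 n w) (iter 4 rgt w)) =
   (\int[gam]_x \int[U01]_r F x r) * (\int[gam]_y \int[U01]_r G y r))%E.
Proof.
move=> mF mG F0 G0.
pose H (z : plane * mR) : \bar R := (F z.1.1 (lft z.2) * G z.1.2 (rgt z.2))%E.
have mH : measurable_fun setT H.
  apply: emeasurable_funM.
    apply: (measurable_comp2 mF); first exact: (measurableT_comp measurable_fst measurable_fst).
    exact: (measurable_comp1 measurable_lft).
  apply: (measurable_comp2 mG); first exact: (measurableT_comp measurable_snd measurable_fst).
  exact: (measurable_comp1 measurable_rgt).
have mFx x : measurable_fun setT (F x) by exact: (measurable_fun_pair2 x mF).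
have mGx x : measurable_fun setT (G x) by exact: (measurable_fun_pair2 x mG).
have mIF : measurable_fun [set: mR] (fun x => \int[U01]_r F x r)%E.
  exact: (measurable_fun_fubini_tonelli_F (fun z : plane => F z.1 z.2)).
have mIG : measurable_fun [set: mR] (fun x => \int[U01]_r G x r)%E.
  exact: (measurable_fun_fubini_tonelli_F (fun z : plane => G z.1 z.2)).
have IF0 x : (0 <= \int[U01]_r F x r)%E by exact: integral_ge0.
have IG0 x : (0 <= \int[U01]_r G x r)%E by exact: integral_ge0.
apply: etrans (block_law n mH (fun z => mule_ge0 (F0 _ _) (G0 _ _))) _.
transitivity (\int[gam]_x \int[gam]_y ((\int[U01]_r F x r) * (\int[U01]_r G y r)))%E.
  apply: eq_integral => x _; apply: eq_integral => y _; rewrite /H/=.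
  rewrite (split_integral (f := fun z : plane => F x z.1 * G y z.2)%E)//=; last 2 first.
  - apply: emeasurable_funM; first exact: (measurableT_comp (mFx x) measurable_fst).
    exact: (measurableT_comp (mGx y) measurable_snd).
  - by move=> z; exact: mule_ge0.
  under eq_integral do rewrite ge0_integralZl//.
  by rewrite ge0_integralZr.
under eq_integral do rewrite ge0_integralZl//.
by rewrite ge0_integralZr//; exact: integral_ge0.
Qed.

Lemma theta_prod J (q : nat -> mR -> \bar R) : (forall k, measurable_fun setT (q k)) -> (forall k z, 0 <= q k z)%E ->
  (\int[U01]_w eprod (bstart a J) (fun k => q k (prime_theta h64 k w)) = eprod (bstart a J) (fun k => \int[U01]_x q k x))%E.
Proof.
move=> mq q0; rewrite eprod_blocks.
pose f j (z : mR) := eprod (bsize a j) (fun i => q (bstart a j + i)%N (block_theta z i)).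
transitivity (\int[U01]_w eprod J (fun j => f j (useq j w)))%E.
  apply: eq_integral => w _; rewrite eprod_blocks; apply: eq_eprod => j _; apply: eq_eprod => i ib.
  by rewrite /prime_theta blk_bstart// addKn.
rewrite useq_prod1 => [|j|j z]; last exact: eprod_ge0.
  by apply: eq_eprod => j _; exact: (block_theta_prod (bsize a j) (fun i => mq _) (fun i => q0 _)).
by apply: measurable_eprod => k; apply: (measurableT_comp (mq _)); exact: measurable_block_theta.
Qed.

Lemma gauss_prod J (q : nat * 'I_2 -> mR -> \bar R) : (forall k, measurable_fun setT (q k)) -> (forall k z, 0 <= q k z)%E ->
  (\int[U01]_w eprod (bstart a J) (fun k => q (k, ord0) (prime_gauss h64 (k, ord0) w) * q (k, ord_max) (prime_gauss h64 (k, ord_max) w)) =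
   eprod (bstart a J) (fun k => (\int[gam]_x q (k, ord0) x) * (\int[gam]_x q (k, ord_max) x)))%E.
Proof.
move=> mq q0; rewrite eprod_blocks.
have eprodM m (u v : nat -> \bar R) : (eprod m (fun k => u k * v k) = eprod m u * eprod m v)%E.
  by elim: m => [|m IH] /=; rewrite ?mule1// IH muleACA.
pose P (e : 'I_2) j (x r : mR) := eprod (bsize a j) (fun i => q (bstart a j + i, e)%N (wsplit (bsize a j) x r i)).
have mP e j : measurable_fun [set: plane] (fun z : plane => P e j z.1 z.2).
  apply: measurable_eprod => k; apply: (measurableT_comp (mq _)).
  by apply: measurable_wsplit.
have P0 e j x r : (0 <= P e j x r)%E by exact: eprod_ge0.
pose f j (z : mR) := (P ord0 j (block_g1 (bsize a j) z) (useq 3 z) * P ord_max j (block_g2 (bsize a j) z) (iter 4 rgt z))%E.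
transitivity (\int[U01]_w eprod J (fun j => f j (useq j w)))%E.
  apply: eq_integral => w _; rewrite eprod_blocks; apply: eq_eprod => j _; rewrite eprodM; congr (_ * _)%E.
    by apply: eq_eprod => i ib; rewrite /prime_gauss/= blk_bstart// addKn.
  by apply: eq_eprod => i ib; rewrite /prime_gauss/= blk_bstart// addKn.
rewrite useq_prod1 => [|j|j z]; last exact: mule_ge0.
  apply: eq_eprod => j _; rewrite eprodM /f block_gauss_split//.
  by congr (_ * _)%E; apply: wsplit_prod.
apply: emeasurable_funM.
  apply: (measurable_comp2 (mP _ _)); last exact: measurable_useq.
  exact: (measurableT_comp measurable_fst (measurable_block_g _)).
apply: (measurable_comp2 (mP _ _)); last exact: measurable_iter_rgt.
exact: (measurableT_comp measurable_snd (measurable_block_g _)).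
Qed.

Definition theta_rv (k : nat) : {RV U01 >-> R} := mkRV (measurable_prime_theta h64 k).
Definition gauss_rv (kj : nat * 'I_2) : {RV U01 >-> R} := mkRV (measurable_prime_gauss h64 kj).

Lemma lt_bstart k (s : seq nat) : k \in s -> (k < bstart a (\max_(i <- s) blk a0 i).+1)%N.
Proof.
move=> ks; have /andP[_ h1] := blkP a0 k; apply: leq_trans h1 _; apply: bstart_mono => //.
by rewrite ltnS; exact: (leq_bigmax_seq _ ks isT).
Qed.

Lemma eprod_iota m (F : nat -> \bar R) : eprod m F = (\prod_(i <- iota 0 m) F i)%E.
Proof. by rewrite eprodE -(big_mkord xpredT F) /index_iota subn0. Qed.

Lemma iid_theta : iid theta_rv (@uniform_prob R 0 1 ltr01).
Proof.
have [ind hl] : mutually_independent theta_rv /\ forall i, has_law (theta_rv i) U01.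
  apply: indep_of_prod => s; set J := (\max_(i <- s) blk a0 i).+1.
  exists (iota 0 (bstart a J)); split; first exact: iota_uniq.
    by move=> k ks; rewrite mem_iota add0n/=; exact: lt_bstart.
  move=> q mq q0; rewrite -(eprod_iota _ (fun i => \int[U01]_x q i x)%E) -theta_prod//.
  by apply: eq_integral => w _; rewrite eprod_iota.
by split=> // k B mB; rewrite hl// U01_uniform.
Qed.

Lemma iid_gauss : iid gauss_rv (normal_prob 0 1).
Proof.
have [ind hl] : mutually_independent gauss_rv /\ forall i, has_law (gauss_rv i) gam.
  apply: indep_of_prod => s; set J := (\max_(i <- map fst s) blk a0 i).+1.
  exists [seq (k, e) | k <- iota 0 (bstart a J), e <- [:: ord0; ord_max]]; split.
  - by apply: allpairs_uniq; [exact: iota_uniq|by []|move=> [? ?] [? ?] _ _ /= [-> ->]].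
  - move=> [k e] ks; apply/allpairsP; exists (k, e); split => //=.
      by rewrite mem_iota add0n/=; apply: lt_bstart; apply/mapP; exists (k, e).
    by case: e ks => -[|[|//]] i _; rewrite !inE -!val_eqE.
  move=> q mq q0; rewrite big_allpairs_dep.
  under [RHS]eq_bigr do rewrite !big_cons big_nil Monoid.mulm1.
  rewrite -(eprod_iota _ (fun k => (\int[gam]_x q (k, ord0) x) * (\int[gam]_x q (k, ord_max) x))%E) -gauss_prod//.
  by apply: eq_integral => w _; rewrite eprod_iota big_allpairs_dep; apply: eq_bigr => k _; rewrite !big_cons big_nil Monoid.mulm1.
by split=> // k B mB; rewrite hl// gamE.
Qed.

End process_laws.

(** * Linear combinations of the Gaussians *)

Section gaussian_combinations.
Context {R : realType}.
Local Notation mR := (measurableTypeR R).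
Local Notation U01 := (@U01 R).
Local Notation gam := (@gam R).
Local Notation plane := (mR * mR)%type.

Lemma wsplit_comb n (c : nat -> R) (f : mR -> \bar R) s : measurable_fun setT f -> (forall z, 0 <= f z)%E ->
  (\int[gam]_x \int[U01]_r f (s + \sum_(k < n) c k * wsplit n x r k)%R =
   \int[gam]_x f (s + Num.sqrt (\sum_(k < n) c k ^+ 2) * x)%R)%E.
Proof.
move=> mf f0; rewrite -(@gfun1 R n c f s mf f0) -(@wsplit_law R n c (fun _ => cst 1%E) f s (fun _ => measurable_cst _) mf (fun _ _ => lee01) f0).
by apply: eq_integral => x _; apply: eq_integral => r _; rewrite eprod_cst expr1n mul1e.
Qed.

(** With the first splitting held fixed, the second family integrates to one Gaussian by
    [wsplit_comb]; then the first does, and [gam_comb] adds the variances. *)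
Lemma block_comb n (c d : nat -> R) :
  isN (fun w => \sum_(i < n) c i * block_w1 n w i + \sum_(i < n) d i * block_w2 n w i)
    (\sum_(i < n) c i ^+ 2 + \sum_(i < n) d i ^+ 2).
Proof.
move=> f mf f0; set vc := \sum_(_ < n) _ ^+ 2; set vd := \sum_(_ < n) _ ^+ 2.
have vc0 : 0 <= vc by apply: sumr_ge0 => i _; exact: sqr_ge0.
have vd0 : 0 <= vd by apply: sumr_ge0 => i _; exact: sqr_ge0.
pose S1 (x r : R) : R := \sum_(i < n) c i * wsplit n x r i.
pose S2 (x r : R) : R := \sum_(i < n) d i * wsplit n x r i.
have mS e (T : measurableType e) (u v u' v' : T -> R) : measurable_fun [set: T] (u : T -> mR) -> measurable_fun [set: T] (v : T -> mR) ->
    measurable_fun [set: T] (u' : T -> mR) -> measurable_fun [set: T] (v' : T -> mR) ->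
    measurable_fun [set: T] (fun t => f (S1 (u t) (v t) + S2 (u' t) (v' t))).
  move=> mu mv mu' mv'; apply: (measurableT_comp mf); apply: measurable_funD; apply: measurable_sum => i;
  by apply: measurable_funM => //; exact: measurable_wsplit.
pose H (z : plane * mR) : \bar R := f (S1 z.1.1 (lft z.2) + S2 z.1.2 (rgt z.2)).
have mH : measurable_fun setT H.
  apply: mS.
  - exact: (measurableT_comp measurable_fst measurable_fst).
  - exact: (measurable_comp1 measurable_lft).
  - exact: (measurableT_comp measurable_snd measurable_fst).
  - exact: (measurable_comp1 measurable_rgt).
apply: etrans (block_law n mH (fun z => f0 _)) _.
pose g (s : mR) : \bar R := (\int[gam]_y f (s + Num.sqrt vd * y)%R)%E.
have mg : measurable_fun setT g.
  apply: (measurable_fun_fubini_tonelli_F (fun z : plane => f (z.1 + Num.sqrt vd * z.2))) => //.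
  by apply: (measurableT_comp mf); apply: measurable_funD => //; exact: measurable_funM.
have g0 s : (0 <= g s)%E by exact: integral_ge0.
transitivity (\int[gam]_x \int[U01]_r g (S1 x r))%E; last first.
  have := @wsplit_comb n c g 0 mg g0; under eq_integral do under eq_integral do rewrite add0r.
  move=> ->; under eq_integral do rewrite add0r.
  transitivity (\int[gam]_x f (0 + Num.sqrt (vc + vd) * x)%R)%E; last by under eq_integral do rewrite add0r.
  have := @gam_comb R f (Num.sqrt vc) (Num.sqrt vd) 0 mf f0; rewrite (sqr_sqrtr vc0) (sqr_sqrtr vd0) => <-.
  by apply: eq_integral => x _; apply: eq_integral => y _; rewrite add0r.
apply: eq_integral => x _.
transitivity (\int[gam]_y \int[U01]_r1 \int[U01]_r2 f (S1 x r1 + S2 y r2)%R)%E.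
  apply: eq_integral => y _.
  apply: (split_integral (f := fun z : plane => f (S1 x z.1 + S2 y z.2)%R)) => //.
  by apply: mS; [exact: measurable_cst|exact: measurable_fst|exact: measurable_cst|exact: measurable_snd].
pose K (z : plane) : \bar R := (\int[U01]_r2 f (S1 x z.2 + S2 z.1 r2)%R)%E.
have mK : measurable_fun setT K.
  apply: (measurable_fun_fubini_tonelli_F (fun z : plane * mR => f (S1 x z.1.2 + S2 z.1.1 z.2))) => //.
  apply: mS; [exact: measurable_cst| | |exact: measurable_snd].
    exact: (measurableT_comp measurable_snd measurable_fst).
  exact: (measurableT_comp measurable_fst measurable_fst).
have K0 z : (0 <= K z)%E by exact: integral_ge0.
apply: etrans (fubini_tonelli _ mK K0) _.
by apply: eq_integral => r _; exact: (wsplit_comb n d (S1 x r) mf f0).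
Qed.

Lemma isN_blocks m (X : nat -> R -> R) (v : nat -> R) : (forall j, measurable_fun [set: mR] (X j : mR -> mR)) ->
  (forall j, 0 <= v j) -> (forall j, isN (X j) (v j)) ->
  isN (fun w => \sum_(j < m) X j (useq j w)) (\sum_(j < m) v j).
Proof.
elim: m X v => [|m IH] X v mX v0 NX.
  move=> f mf f0; rewrite big_ord0 sqrtr0.
  under eq_integral do rewrite big_ord0; under [RHS]eq_integral do rewrite mul0r.
  by rewrite !integral_cst_prob.
have NS := @IH (fun j => X j.+1) (fun j => v j.+1) (fun j => mX _) (fun j => v0 _) (fun j => NX _).
have mY : measurable_fun [set: mR] ((fun w => \sum_(j < m) X j.+1 (useq j w)) : mR -> mR).
  by apply: measurable_sum => j; apply: (measurable_comp1 (mX _)); exact: measurable_useq.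
have v0' : 0 <= \sum_(j < m) v j.+1 by exact: sumr_ge0.
have := isN_add (mX 0%N) mY (v0 0%N) v0' (NX 0%N) NS.
have -> : (fun w => \sum_(j < m.+1) X j (useq j w)) = (fun w => X 0%N (lft w) + \sum_(j < m) X j.+1 (useq j (rgt w))).
  by apply/funext => w; rewrite big_ord_recl/= /useq; congr (_ + _); apply: eq_bigr => j _; rewrite iterSr.
by rewrite big_ord_recl.
Qed.

Variable h : nat.
Hypothesis h64 : h = 64%N.
Local Notation a := (h + h)%N.
Let h0 : (0 < h)%N. Proof. by rewrite h64. Qed.
Let a0 : (0 < a)%N := a_gt0 h0.

(** The coefficients are extended by 0 up to the end of a block, which turns the sum into
    independent sums over whole blocks. *)
Lemma gauss_comb N (c d : nat -> R) : exists2 v : R, 0 <= v &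
  isN (fun w => \sum_(k < N) (c k * prime_gauss h64 (k : nat, ord0) w + d k * prime_gauss h64 (k : nat, ord_max) w)) v.
Proof.
pose J := (blk a0 N).+1; have NJ : (N <= bstart a J)%N by have /andP[_ /ltnW] := blkP a0 N.
pose c' k : R := if (k < N)%N then c k else 0; pose d' k : R := if (k < N)%N then d k else 0.
pose X j (w : R) : R := \sum_(i < bsize a j) c' (bstart a j + i)%N * block_w1 (bsize a j) w i
   + \sum_(i < bsize a j) d' (bstart a j + i)%N * block_w2 (bsize a j) w i.
pose v j : R := \sum_(i < bsize a j) c' (bstart a j + i)%N ^+ 2 + \sum_(i < bsize a j) d' (bstart a j + i)%N ^+ 2.
have v0 j : 0 <= v j by apply: addr_ge0; apply: sumr_ge0 => i _; exact: sqr_ge0.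
exists (\sum_(j < J) v j); first exact: sumr_ge0.
have mX j : measurable_fun [set: mR] (X j : mR -> mR).
  apply: measurable_funD; apply: measurable_sum => i; apply: measurable_funM => //.
    exact: measurable_block_w1.
  exact: measurable_block_w2.
have := isN_blocks J mX v0 (fun j => @block_comb (bsize a j) (fun i => c' (bstart a j + i)%N) (fun i => d' (bstart a j + i)%N)).
suff <- : (fun w => \sum_(k < N) (c k * prime_gauss h64 (k : nat, ord0) w + d k * prime_gauss h64 (k : nat, ord_max) w)) =
  (fun w => \sum_(j < J) X j (useq j w)) by [].
apply/funext => w.
rewrite (big_ord_widen (bstart a J) (fun k => c k * prime_gauss h64 (k, ord0) w + d k * prime_gauss h64 (k, ord_max) w) NJ) big_mkcond/=.
rewrite (sum_blocks a0 (fun k => if (k < N)%N then c k * prime_gauss h64 (k, ord0) w + d k * prime_gauss h64 (k, ord_max) w else 0)).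
apply: eq_bigr => j _; rewrite /X -big_split/=; apply: eq_bigr => i _.
rewrite /prime_gauss/= blk_bstart// addKn /c' /d'; case: ifP => // _; by rewrite !mul0r addr0.
Qed.

Lemma isN_gaussian (X : {RV U01 >-> R}) (v : R) : 0 <= v -> isN X v -> gaussian_rv X.
Proof.
move=> v0 NX; exists 0, (Num.sqrt v); split; first exact: sqrtr_ge0.
move=> B mB; have mi := measurable_indic_comp mB.
have -> : distribution U01 X B = (\int[gam]_x (\1_B (Num.sqrt v * x))%:E)%E.
  rewrite -(NX (fun y => (\1_B y)%:E))//.
  rewrite -[LHS]/(U01 (X @^-1` B)) -[X in U01 X]setIT -integral_indic//.
  by rewrite -[X in measurable X]setTI; exact: measurable_funPT.
have [s0|s0] := eqVneq (Num.sqrt v) 0.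
  by rewrite s0; under eq_integral do rewrite mul0r; rewrite integral_cst_prob diracE indicE.
by rewrite gam_law// lt_def s0 sqrtr_ge0.
Qed.

Lemma gauss_sum_process (S : set R) N :
  gaussian_process U01 S (fun w => gauss_sum (fun kj => gauss_rv h64 kj w) N).
Proof.
move=> n x al be _.
pose c k : R := \sum_(i < n) (al i * kern 2^-1 0 (- x i) 0 (lp k) + be i * kern 2^-1 0 (- x i) (- (pi / 2)) (lp k)) / Num.sqrt 2.
pose d k : R := \sum_(i < n) (al i * kern 2^-1 0 (- x i) (0 + pi / 2) (lp k) + be i * kern 2^-1 0 (- x i) (- (pi / 2) + pi / 2) (lp k)) / Num.sqrt 2.
have [v v0 NX] := gauss_comb N c d.
pose X (w : mR) : R := \sum_(k < N) (c k * prime_gauss h64 (k : nat, ord0) w + d k * prime_gauss h64 (k : nat, ord_max) w).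
have mX : measurable_fun [set: mR] X.
  apply: measurable_sum => k; apply: measurable_funD; apply: measurable_funM => //; exact: measurable_prime_gauss.
exists (mkRV mX); last by apply: isN_gaussian v0 _.
move=> w; rewrite mkRVE /X.
under [RHS]eq_bigr do rewrite Re_gauss Im_gauss !mulr_sumr -big_split/=.
rewrite exchange_big/=; apply: eq_bigr => k _.
rewrite /c /d !mulr_suml -big_split/=; apply: eq_bigr => i _.
by rewrite /gauss_wave/=; ring.
Qed.

End gaussian_combinations.

(** * The error process and its limit *)

Section main_theorem.
Context {R : realType}.
Variables (h : nat) (A : R).
Hypotheses (h64 : h = 64%N) (A0 : 0 < A).
Local Notation mR := (measurableTypeR R).
Local Notation U01 := (@U01 R).
Local Notation S := (`[- A, A]%classic : set R).
Let h0 : (0 < h)%N. Proof. by rewrite h64. Qed.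
Local Notation Xiw w := (Xi h (prime_theta h64 ^~ w) (prime_gauss h64 ^~ w)).

Definition error_fun (N : nat) (w : mR) : R -> R[i] := zeta_err (prime_theta h64 ^~ w) (prime_gauss h64 ^~ w) N.

(** Set to 0 on the null event where [Xi] is infinite, so that smoothness holds at every sample
    point. *)
Definition error_lim (w : mR) : R -> R[i] :=
  if (Xiw w < +oo)%E then zeta_lim (prime_theta h64 ^~ w) (prime_gauss h64 ^~ w) else fun=> 0.

Let mth k : measurable_fun [set: mR] (prime_theta h64 k). Proof. exact: measurable_prime_theta. Qed.
Let mW k : measurable_fun [set: mR] (prime_gauss h64 k). Proof. exact: measurable_prime_gauss. Qed.

Lemma error_smooth N : random_smooth S (error_fun N).
Proof.
split=> [w|x _]; first by have [] := err_smooth h0 A0 (prime_theta h64 ^~ w) (prime_gauss h64 ^~ w) N.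
split; [under eq_fun do rewrite Re_err|under eq_fun do rewrite Im_err]; exact: measurable_err_sum.
Qed.

Lemma measurable_Xi_fin : measurable [set w : mR | (Xiw w < +oo)%E].
Proof.
rewrite -[X in measurable X]setTI.
exact: (emeasurable_fun_infty_o measurableT (measurable_Xi h64)).
Qed.

Lemma error_lim_smooth : random_smooth S error_lim.
Proof.
split=> [w|x _].
  rewrite /error_lim; case: ifP => [fin|_]; last exact: csmooth0.
  exact: (lim_smooth h0 A0 fin).
set B := [set w : mR | (Xiw w < +oo)%E].
have mB : measurable B := measurable_Xi_fin.
have mE p : measurable_fun [set: mR] ((fun w => err_lim (prime_theta h64 ^~ w) (wl (prime_gauss h64 ^~ w)) (wr (prime_gauss h64 ^~ w)) 0 p x) \_ B).
  by apply/(measurable_restrictT _ mB); apply: (measurable_err_lim h0).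
split.
  have -> : (fun w => complex.Re (error_lim w x)) =
     ((fun w => err_lim (prime_theta h64 ^~ w) (wl (prime_gauss h64 ^~ w)) (wr (prime_gauss h64 ^~ w)) 0 0 x) \_ B); last exact: mE.
  apply/funext => w; rewrite patchE /error_lim; case: ifP => fin; first by rewrite mem_set.
  by rewrite memNset// /B/= fin.
have -> : (fun w => complex.Im (error_lim w x)) =
   ((fun w => err_lim (prime_theta h64 ^~ w) (wl (prime_gauss h64 ^~ w)) (wr (prime_gauss h64 ^~ w)) 0 (- (pi / 2)) x) \_ B); last exact: mE.
apply/funext => w; rewrite patchE /error_lim; case: ifP => fin; first by rewrite mem_set.
by rewrite memNset// /B/= fin.
Qed.

Lemma error_cvg : {ae U01, forall w, cuniform_cvg S (fun N => error_fun N w) (error_lim w)}.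
Proof.
apply: negligibleS (Xi_ae_fin h64) => w; apply: contra_not => /= fin; rewrite /error_lim fin.
exact: (err_uniform h0 A0 fin).
Qed.

Lemma error_sup (lambda : R) (l : nat) (supE := fun w => ereal_sup [set C_norm S l (error_fun N w) | N in [set N | (1 <= N)%N]]) :
  0 < lambda -> measurable_fun [set: mR] supE /\ (\int[U01]_w expeR (lambda%:E * supE w) < +oo)%E.
Proof.
move=> l0; have mS : measurable_fun [set: mR] supE := measurable_sup_norm h0 A0 mth mW l.
split => //; have [C C0 hC] := C_norm_err_Xi h0 A0 l.
(* C may vanish; C + 1 makes [c] positive, as the exponential moment of [Xi] requires. *)
pose c := lambda * (C + 1); have c0 : 0 < c by rewrite mulr_gt0// ltr_wpDl.
have mX := measurable_Xi h64.
have sX w : (lambda%:E * supE w <= c%:E + c%:E * Xiw w)%E.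
  have X0 := Xi_ge0 h (prime_theta h64 ^~ w) (prime_gauss h64 ^~ w).
  have -> : (c%:E + c%:E * Xiw w = lambda%:E * ((C + 1)%:E * (1 + Xiw w)))%E.
    by rewrite muleA -EFinM -/c ge0_muleDr// mule1.
  apply: lee_wpmul2l; first by rewrite lee_fin ltW.
  apply: ge_ereal_sup => _ [N _ <-]; apply: le_trans (hC _ _ N) _.
  by apply: lee_wpmul2r; [exact: adde_ge0|rewrite lee_fin lerDl].
apply: (@le_lt_trans _ _ (\int[U01]_w ((expR c)%:E * expeR (c%:E * Xiw w)))%E).
  apply: ge0_le_integral => //.
  - by move=> w _; exact: expeR_ge0.
  - by apply: measurable_expeR; exact: measurable_funeM.
  - by apply: emeasurable_funM => //; apply: measurable_expeR; exact: measurable_funeM.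
  - move=> w _; rewrite -[(expR c)%:E]/(expeR c%:E) -expeRD lee_expeR; exact: sX.
rewrite ge0_integralZl//; last 2 first.
- by apply: measurable_expeR; exact: measurable_funeM.
- by move=> w _; exact: expeR_ge0.
by rewrite lte_mul_pinfty ?lee_fin ?expR_ge0//; exact: Xi_exp.
Qed.

End main_theorem.

Local Open Scope complex_scope.

Theorem theorem1p7 (R : realType) (A : R) (A_gt0 : 0 < A) :
  exists (d : measure_display) (T : measurableType d) (P : probability T R)
         (theta : nat -> {RV P >-> R}) (W : nat * 'I_2 -> {RV P >-> R})
         (G E : nat -> T -> R -> R[i]) (Einf : T -> R -> R[i]),
    [/\ iid theta (@uniform_prob R 0 1 ltr01),
        iid W (normal_prob 0 1),
        (forall N : nat, (1 <= N)%N ->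
          [/\ forall w x, x \in `[- A, A] ->
                log_zeta_rand (fun k => theta k w) N x = G N w x + E N w x,
              gaussian_process P `[- A, A] (G N),
              forall w x, x \in `[- A, A] ->
                G N w x = gauss_sum (fun kj => W kj w) N x &
              random_smooth `[- A, A] (E N)]),
        random_smooth `[- A, A] Einf /\
        {ae P, forall w,
          cuniform_cvg `[- A, A] (fun N => E N w) (Einf w)} &
        forall (lambda : R) (l : nat), 0 < lambda ->
          let supE := fun w => ereal_sup
            [set C_norm `[- A, A] l (E N w) | N in [set N | (1 <= N)%N]] in
          measurable_fun [set: T] supE /\
          (\int[P]_w expeR (lambda%:E * supE w) < +oo)%E].
Proof.
(* The exponent is hidden behind an equation, so that powers with exponents 64 and 128 stay
   folded. *)
have [h h64] : exists h, h = 64%N by exists 64%N.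
exists _, (measurableTypeR R), U01, (theta_rv h64), (gauss_rv h64).
exists (fun N w => gauss_sum (fun kj => gauss_rv h64 kj w) N), (error_fun h64), (error_lim h64).
split.
- exact: iid_theta.
- exact: iid_gauss.
- move=> N _; split => //.
  + by move=> w x _; rewrite /error_fun /zeta_err addrC subrK.
  + exact: gauss_sum_process.
  + exact: error_smooth.
- by split; [exact: error_lim_smooth|exact: error_cvg].
- move=> lambda l l0 /=; exact: error_sup.
Qed.
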